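(* Let $d$ be a positive square-free integer such that $K=\mathbb{Q}(\sqrt d)$ is a real quadratic number field, with totally positive fundamental unit $\varepsilon=\frac{a+b\sqrt d}{2}\in\mathcal{O}_{K,+}^\times$, $a,b\in\mathbb{N}$, such that $\mathbb{Z}+\mathbb{Z}\varepsilon=\mathcal{O}_K$. Let $\mathfrak{f}=(u+v\sqrt d)$ be a non-zero principal integral ideal of $\mathcal{O}_K$ and let $g=g(\mathfrak{f})$. Then for all $k\in\{0,\dots,g-1\}$, with $n$ running through the integers, $$X(\mathfrak{f})=\lim_{n\to\infty}\left|\frac{(x_k,y_k;\tau_n)_\infty\,(x_k,y_k;\tau_{-n})_\infty}{(x_k,y_k;\tau_{n+2g})_\infty\,(x_k,y_k;\tau_{-n+2g})_\infty}\right|=\lim_{n\to\infty}\left|\frac{(x_k,y_k;\tau_{n-g})_\infty\,(x_k,y_k;\tau_{-n-g})_\infty}{(x_k,y_k;\tau_{n+g})_\infty\,(x_k,y_k;\tau_{-n+g})_\infty}\right|.$$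
   Context: Notation. $\mathcal{O}_K$ is the ring of integers of $K$, and $\mathcal{O}_{K,+}^\times$ is the group of totally positive units; the totally positive fundamental unit $\varepsilon$ is its generator with $a,b\in\mathbb{N}$ (so $\varepsilon>1$). $\varepsilon'=\varepsilon^{-1}$ denotes the Galois conjugate of $\varepsilon$. The polynomials $T_n$ ($n\in\mathbb{Z}$) are the normalized Chebyshev polynomials of the first kind, defined by $T_n(X+X^{-1})=X^n+X^{-n}$; thus $T_n(a)=\varepsilon^n+\varepsilon^{-n}$. For $n\in\mathbb{Z}$, $\tau_n=\frac{T_{n+1}(a)+i\,b\sqrt d}{T_n(a)}$. For $x,y\in\mathbb{R}$ and $\mathrm{Im}(\tau)>0$, $(x,y;\tau)_\infty=\prod_{k\ge0}\left(1-e^{2\pi i(k\tau+x\tau+y)}\right)$. $g(\mathfrak{f})$ is the smallest positive integer such that $\varepsilon^{g(\mathfrak{f})}$ generates the group $\mathcal{O}_{K,+}^\times\cap(1+\mathfrak{f})$. Double sine function: for $\omega>0$ and $0<z<1+\omega$, $$\mathcal{S}(\omega,z)=\exp\left(\zeta_2'(0,1+\omega-z,\omega)-\zeta_2'(0,z,\omega)\right),$$ where $\zeta_2(s,z,\omega)=\sum_{n_1,n_2=0}^\infty(n_1+n_2\omega+z)^{-s}$ (analytically continued in $s$), and $'$ means the derivative with respect to $s$. Decomposition data and Shintani's invariant (for the trivial ray class of conductor $\mathfrak{f}$): put $\mu=\frac{1}{u+v\sqrt d}\in K^\times$. For each $k\in\mathbb{Z}$, $(x_k,y_k)\in\mathbb{Q}^2$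 is the unique pair with $0<x_k\le 1$, $0\le y_k<1$ and $x_k\varepsilon^{1-k}+y_k\varepsilon^{-k}\in\mu+\mathcal{O}_K$. Then $$X(\mathfrak{f})=X_1(\mathfrak{f})X_2(\mathfrak{f}),\quad X_1(\mathfrak{f})=\prod_{k=1}^{g(\mathfrak{f})}\mathcal{S}(\varepsilon,x_k\varepsilon+y_k),\quad X_2(\mathfrak{f})=\prod_{k=1}^{g(\mathfrak{f})}\mathcal{S}(\varepsilon',x_k\varepsilon'+y_k).$$ *)

(* Defs.v *)
From Stdlib Require Export Reals ZArith QArith Qreals ClassicalEpsilon.
From Stdlib Require Import Lra Lia.
From Coquelicot Require Export Coquelicot.
Open Scope R_scope.

(** * The real quadratic field *)

Definition squarefree (d : Z) : Prop :=
  forall m : Z, (m * m | d)%Z -> m = 1%Z \/ m = (-1)%Z.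

(** [K = Q(sqrt d)] is realised as a subset of [R], through the embedding that
    sends [sqrt d] to the positive square root. *)
Definition inK (d : Z) (x : R) : Prop :=
  exists p q : Q, x = Q2R p + Q2R q * sqrt (IZR d).

Definition integral_over_Z (x : R) : Prop :=
  exists (n : nat) (c : nat -> Z),
    x ^ S n + sum_f_R0 (fun i => IZR (c i) * x ^ i) n = 0.

Definition OK (d : Z) (x : R) : Prop := inK d x /\ integral_over_Z x.

(** For irrational [sqrt d] the rationals [p], [q] are determined by [x], and
    [p - q sqrt d] is the Galois conjugate of [x]. *)
Definition totally_positive (d : Z) (x : R) : Prop :=
  exists p q : Q, x = Q2R p + Q2R q * sqrt (IZR d) /\
    0 < Q2R p + Q2R q * sqrt (IZR d) /\ 0 < Q2R p - Q2R q * sqrt (IZR d).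

Definition tot_pos_unit (d : Z) (x : R) : Prop :=
  x <> 0 /\ OK d x /\ OK d (/ x) /\ totally_positive d x.

(** The set [H] is the multiplicative group generated by [e]. *)
Definition generates (e : R) (H : R -> Prop) : Prop :=
  forall x : R, H x <-> exists n : Z, x = powerRZ e n.

Definition ideal (d : Z) (phi : R) (x : R) : Prop :=
  exists w : R, OK d w /\ x = phi * w.

Definition ray_units (d : Z) (phi : R) (x : R) : Prop :=
  tot_pos_unit d x /\ ideal d phi (x - 1).

(** [g = g(f)] for the ideal [f = (phi)]. *)
Definition is_g (d : Z) (eps phi : R) (g : nat) : Prop :=
  (0 < g)%nat /\ generates (eps ^ g) (ray_units d phi) /\
  forall m : nat, (0 < m)%nat -> generates (eps ^ m) (ray_units d phi) ->
    (g <= m)%nat.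

Definition is_decomposition (d : Z) (eps mu : R) (k : Z) (x y : Q) : Prop :=
  (0 < x /\ x <= 1)%Q /\ (0 <= y /\ y < 1)%Q /\
  OK d (Q2R x * powerRZ eps (1 - k) + Q2R y * powerRZ eps (- k) - mu).

(** * Chebyshev polynomials *)

Fixpoint chebT_nat (n : nat) (x : R) : R :=
  match n with
  | O => 2
  | S m => match m with
           | O => x
           | S p => x * chebT_nat m x - chebT_nat p x
           end
  end.

Definition chebT (n : Z) (x : R) : R := chebT_nat (Z.abs_nat n) x.

Lemma chebT_nat_spec (x : R) (n : nat) : x <> 0 ->
  chebT_nat n (x + / x) = x ^ n + (/ x) ^ n /\
  chebT_nat (S n) (x + / x) = x ^ S n + (/ x) ^ S n.
Proof.
intros Hx; induction n as [|n [IH1 IH2]]; [simpl; lra|].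
split; [exact IH2|].
change (chebT_nat (S (S n)) (x + / x))
  with ((x + / x) * chebT_nat (S n) (x + / x) - chebT_nat n (x + / x)).
rewrite IH1, IH2; simpl.
replace ((x + / x) * (x * x ^ n + / x * (/ x) ^ n) - (x ^ n + (/ x) ^ n))
  with (x * (x * x ^ n) + / x * (/ x * (/ x) ^ n)
        + (x * / x - 1) * (x ^ n + (/ x) ^ n)) by ring.
rewrite Rinv_r by exact Hx; ring.
Qed.

(** The identity that characterises the polynomials [T_n]. *)
Lemma chebT_spec (n : Z) (x : R) : x <> 0 ->
  chebT n (x + / x) = powerRZ x n + powerRZ x (- n).
Proof.
intros Hx; unfold chebT.
destruct (chebT_nat_spec x (Z.abs_nat n) Hx) as [-> _].
rewrite pow_inv.
destruct n as [|p|p]; simpl; [field| |]; try reflexivity.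
apply Rplus_comm.
Qed.

(** * Complex exponential and infinite products *)

Definition Cexp (z : C) : C := (exp (Re z) * cos (Im z), exp (Re z) * sin (Im z)).

(** [Cprod f n] is the product of [f k] over [0 <= k < n]. *)
Fixpoint Cprod (f : nat -> C) (n : nat) : C :=
  match n with
  | O => RtoC 1
  | S m => (Cprod f m * f m)%C
  end.

(** Coquelicot's [C_lim] takes functions of a complex variable; this is its
    componentwise analogue for sequences. *)
Definition C_lim_seq (u : nat -> C) : C :=
  (real (Lim_seq (fun n => Re (u n))), real (Lim_seq (fun n => Im (u n)))).

Definition qpoch (x y : R) (tau : C) : C :=
  C_lim_seq (Cprod (fun k =>
    (1 - Cexp (RtoC (2 * PI) * Ci * (RtoC (INR k) * tau + RtoC x * tau + RtoC y)))%C)).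

Definition tau (d : Z) (a b : nat) (n : Z) : C :=
  ((RtoC (chebT (n + 1) (INR a)) + Ci * RtoC (INR b * sqrt (IZR d)))
     / RtoC (chebT n (INR a)))%C.

(** * The double sine function *)

(** [r ^ s] for a positive real [r] and a complex [s]. *)
Definition Rcpow (r : R) (s : C) : C := Cexp (s * RtoC (ln r))%C.

Definition analytic_at (f : C -> C) (s0 : C) : Prop :=
  exists (c : nat -> C) (r : R), 0 < r /\
    forall s : C, Cmod (s - s0)%C < r ->
      is_pseries (K := C_AbsRing) (V := C_NormedModule) c (s - s0)%C (f s).

Definition double_series (s : C) (z w : R) (l : C) : Prop :=
  exists row : nat -> C,
    (forall n1 : nat,
       is_series (K := C_AbsRing) (V := C_NormedModule)
         (fun n2 : nat => Rcpow (INR n1 + INR n2 * w + z) (- s)%C) (row n1)) /\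
    is_series (K := C_AbsRing) (V := C_NormedModule) row l.

(** For [w, z > 0] the series converges absolutely when [Re s > 2], and its
    analytic continuation has at most poles at [1] and [2].  The domain
    [C \ {1, 2}] is connected, so the continuation is unique on it. *)
Definition is_double_zeta (z w : R) (F : C -> C) : Prop :=
  (forall s : C, s <> RtoC 1 -> s <> RtoC 2 -> analytic_at F s) /\
  (forall s : C, 2 < Re s -> double_series s z w (F s)).

Definition double_zeta (s : C) (z w : R) : C :=
  epsilon (inhabits (fun _ : C => RtoC 0)) (is_double_zeta z w) s.

Definition double_zeta' (s : C) (z w : R) : C :=
  C_derive (fun t : C => double_zeta t z w) s.

(** Meaningful for [0 < w] and [0 < z < 1 + w]. *)
Definition double_sine (w z : R) : C :=
  Cexp (double_zeta' (RtoC 0) (1 + w - z) w - double_zeta' (RtoC 0) z w)%C.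

(** * Shintani's invariant *)

(** The index [j] of [Cprod] starts at [0], whence the shift [k = j + 1].  The
    factors [X_1] and [X_2] are obtained for [e = eps] and [e = / eps]. *)
Definition shintani_factor (e : R) (g : nat) (x y : Z -> Q) : C :=
  Cprod (fun j : nat =>
    let k := Z.of_nat (S j) in double_sine e (Q2R (x k) * e + Q2R (y k))) g.

Definition shintani_X (eps : R) (g : nat) (x y : Z -> Q) : C :=
  (shintani_factor eps g x y * shintani_factor (/ eps) g x y)%C.

(* Main.v *)
Require Import Defs.
From Stdlib Require Import Lra Lia Psatz.

(** Since [eps^2 = a eps - 1], the points [tau_n] satisfy [tau_(n+2) = a - 1/tau_n], and the
    decomposition data satisfy [x_(k-1) = 1 - y_k] and [y_(k-1) = x_k - a (1 - y_k)] modulo 1.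
    Hence [(x_(k-1), y_(k-1); tau_(n+2))] is the q-Pochhammer symbol at [- 1/tau_n] that the
    modular relation compares with [(x_k, y_k; tau_n)]: the quotient of the two is
    [exp (G(tau, z) - G(tau, 1 + tau - z) - pi i B_{2,2}(z) / 2)] with [z = x_k tau + y_k]
    and [G] the logarithm of a double gamma function.  When [tau] tends to a positive real
    [om], the Bernoulli term becomes a phase, and the rest tends to the double sine
    function.  As [tau_n] tends to [eps] for [n -> +oo] and to [/ eps] for [n -> -oo], and
    as the data are periodic of period [g], telescoping over [g] steps gives the products
    [X_1] and [X_2].

    The function [G] is the convergent lattice sum of [log (z + n + m tau)] corrected by
    Euler-Maclaurin terms; the modular relation follows from cutting the half-plane lattice
    into two cones, row by row from the product formula for the sine.  The same
    Euler-Maclaurin scheme applied to [w ^ (- s)] continues the double zeta function. *)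

(** * Complex sequences and sums *)

(** The modular relation is set up for the finite box sums [Lam], where rescaling and the exchange
    of the two directions are exact identities; limits are taken afterwards, and only of
    combinations known to converge. This is why logarithms are summed instead of multiplying
    factors: rescaling by [tau] or [- / tau] adds one constant to every term, without a [2 PI i]
    correction because all points involved stay in the closed upper half-plane, and the boundary of
    the box reduces the accumulated constants to a Bernoulli polynomial. That polynomial is real at
    real parameters, so multiplied by [PI i] it drops out of the modulus. The double zeta function
    is a choice among all functions with the required series and analyticity. Its derivative at 0 is
    therefore reached from two sides: an explicit continuation shows that such a function exists,
    and an identity theorem that all of them agree near 0. On the arithmetic side the norm of [eps]
    is not given; it is deduced from the integrality of [eps ^ 2] and [/ eps]. *)

Fixpoint Csum (f : nat -> C) (n : nat) : C :=
  match n with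
  | O => RtoC 0
  | S m => (Csum f m + f m)%C
  end.

Fixpoint Rsum (f : nat -> R) (n : nat) : R :=
  match n with
  | O => 0
  | S m => Rsum f m + f m
  end.

(** Convergence is encoded as a real limit, so that squeezing, shifts and subsequences come from the
    real theory; [filterlim_Clim] identifies it with convergence in the uniform space of complex
    numbers. *)
Definition Clim (u : nat -> C) (l : C) : Prop :=
  is_lim_seq (fun n => Cmod (u n - l)%C) 0.

Lemma is_lim_seq_eq (u : nat -> R) (l l' : R) :
  is_lim_seq u l -> l = l' -> is_lim_seq u l'.
Proof. intros H <-; exact H. Qed.

Lemma Cmod_le_Re_Im (z : C) : Cmod z <= Rabs (Re z) + Rabs (Im z).
Proof.
unfold Cmod.
rewrite <- (sqrt_pow2 (Rabs (Re z) + Rabs (Im z))).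
2: generalize (Rabs_pos (Re z)) (Rabs_pos (Im z)); lra.
apply sqrt_le_1_alt. unfold Re, Im.
rewrite <- (pow2_abs (fst z)), <- (pow2_abs (snd z)).
generalize (Rabs_pos (fst z)) (Rabs_pos (snd z)); nra.
Qed.

Lemma im_le_Cmod (z : C) : Rabs (Im z) <= Cmod z.
Proof.
eapply Rle_trans; [|apply Rmax_Cmod]; apply Rmax_r.
Qed.

Lemma Clim_components (u : nat -> C) (l : C) :
  Clim u l <-> is_lim_seq (fun n => Re (u n)) (Re l) /\
               is_lim_seq (fun n => Im (u n)) (Im l).
Proof.
unfold Clim; split.
- intros H; split.
  + apply is_lim_seq_ext with (fun n => Re (u n - l)%C + Re l).
    { intros n; unfold Cminus; rewrite re_plus, re_opp; ring. }
    apply is_lim_seq_eq with (0 + Re l); [|ring].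
    apply is_lim_seq_plus'; [|apply is_lim_seq_const].
    apply is_lim_seq_abs_0.
    apply is_lim_seq_le_le with (fun _ => 0) (fun n => Cmod (u n - l)%C);
      [|apply is_lim_seq_const|exact H].
    intros n; split; [apply Rabs_pos|apply re_le_Cmod].
  + apply is_lim_seq_ext with (fun n => Im (u n - l)%C + Im l).
    { intros n; unfold Cminus; rewrite im_plus, im_opp; ring. }
    apply is_lim_seq_eq with (0 + Im l); [|ring].
    apply is_lim_seq_plus'; [|apply is_lim_seq_const].
    apply is_lim_seq_abs_0.
    apply is_lim_seq_le_le with (fun _ => 0) (fun n => Cmod (u n - l)%C);
      [|apply is_lim_seq_const|exact H].
    intros n; split; [apply Rabs_pos|apply im_le_Cmod].
- intros [H1 H2].
  apply is_lim_seq_le_le with (fun _ => 0)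
    (fun n => Rabs (Re (u n) - Re l) + Rabs (Im (u n) - Im l)).
  + intros n; split; [apply Cmod_ge_0|].
    eapply Rle_trans; [apply Cmod_le_Re_Im|].
    unfold Cminus; rewrite re_plus, re_opp, im_plus, im_opp.
    apply Rle_refl.
  + apply is_lim_seq_const.
  + apply is_lim_seq_eq with (0 + 0); [|ring].
    apply is_lim_seq_plus'.
    * apply (proj1 (is_lim_seq_abs_0 _)).
      apply is_lim_seq_eq with (Re l - Re l); [|ring].
      apply is_lim_seq_minus'; [exact H1|apply is_lim_seq_const].
    * apply (proj1 (is_lim_seq_abs_0 _)).
      apply is_lim_seq_eq with (Im l - Im l); [|ring].
      apply is_lim_seq_minus'; [exact H2|apply is_lim_seq_const].
Qed.

Lemma Clim_C_lim_seq (u : nat -> C) (l : C) : Clim u l -> C_lim_seq u = l.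
Proof.
intros H; apply Clim_components in H; destruct H as [H1 H2].
unfold C_lim_seq.
rewrite (is_lim_seq_unique _ _ H1), (is_lim_seq_unique _ _ H2).
destruct l; reflexivity.
Qed.

Lemma Clim_unique (u : nat -> C) (l l' : C) : Clim u l -> Clim u l' -> l = l'.
Proof.
intros H1 H2; rewrite <- (Clim_C_lim_seq _ _ H1); apply Clim_C_lim_seq, H2.
Qed.

Lemma Clim_squeeze (u : nat -> C) (l : C) (e : nat -> R) :
  (forall n, Cmod (u n - l)%C <= e n) -> is_lim_seq e 0 -> Clim u l.
Proof.
intros H He; unfold Clim.
apply is_lim_seq_le_le with (fun _ => 0) e; [|apply is_lim_seq_const|exact He].
intros n; split; [apply Cmod_ge_0|apply H].
Qed.

Lemma Clim_ext_loc (u v : nat -> C) (l : C) :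
  eventually (fun n => u n = v n) -> Clim u l -> Clim v l.
Proof.
intros H; apply is_lim_seq_ext_loc.
revert H; apply filter_imp; intros n ->; reflexivity.
Qed.

Lemma Clim_ext (u v : nat -> C) (l : C) :
  (forall n, u n = v n) -> Clim u l -> Clim v l.
Proof.
intros H; apply is_lim_seq_ext; intros n; rewrite H; reflexivity.
Qed.

Lemma Clim_const (l : C) : Clim (fun _ => l) l.
Proof.
apply Clim_components; split; apply is_lim_seq_const.
Qed.

Lemma Clim_plus (u v : nat -> C) (l m : C) :
  Clim u l -> Clim v m -> Clim (fun n => (u n + v n)%C) (l + m)%C.
Proof.
intros [Hu1 Hu2]%Clim_components [Hv1 Hv2]%Clim_components.
apply Clim_components; split.
- apply is_lim_seq_plus' with (1 := Hu1) (2 := Hv1).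
- apply is_lim_seq_plus' with (1 := Hu2) (2 := Hv2).
Qed.

Lemma Clim_mult (u v : nat -> C) (l m : C) :
  Clim u l -> Clim v m -> Clim (fun n => (u n * v n)%C) (l * m)%C.
Proof.
intros [Hu1 Hu2]%Clim_components [Hv1 Hv2]%Clim_components.
apply Clim_components; split.
- apply is_lim_seq_minus'; apply is_lim_seq_mult'; assumption.
- apply is_lim_seq_plus'; apply is_lim_seq_mult'; assumption.
Qed.

Lemma Clim_scal (c : C) (u : nat -> C) (l : C) :
  Clim u l -> Clim (fun n => (c * u n)%C) (c * l)%C.
Proof. intros H; apply Clim_mult; [apply Clim_const|exact H]. Qed.

Lemma Clim_opp (u : nat -> C) (l : C) :
  Clim u l -> Clim (fun n => (- u n)%C) (- l)%C.
Proof.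
intros H; apply Clim_ext with (fun n => (- (1) * u n)%C); [intros; ring|].
replace (- l)%C with (- (1) * l)%C by ring; apply Clim_scal, H.
Qed.

Lemma Clim_minus (u v : nat -> C) (l m : C) :
  Clim u l -> Clim v m -> Clim (fun n => (u n - v n)%C) (l - m)%C.
Proof. intros Hu Hv; apply Clim_plus; [exact Hu|apply Clim_opp, Hv]. Qed.

Lemma Clim_subseq (u : nat -> C) (l : C) (phi : nat -> nat) :
  filterlim phi eventually eventually -> Clim u l -> Clim (fun n => u (phi n)) l.
Proof. intros H; apply (is_lim_seq_subseq (fun n => Cmod (u n - l)%C) 0 phi H). Qed.

Lemma Clim_incr_n (u : nat -> C) (N : nat) (l : C) :
  Clim u l <-> Clim (fun n => u (n + N)%nat) l.
Proof. apply (is_lim_seq_incr_n (fun n => Cmod (u n - l)%C) N 0). Qed.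

Lemma Cmod_triangle' (z w : C) : Rabs (Cmod z - Cmod w) <= Cmod (z - w)%C.
Proof.
apply Rabs_le; split.
- generalize (Cmod_triangle z (- (z - w))%C); rewrite Cmod_opp.
  replace (z + - (z - w))%C with w by ring; lra.
- generalize (Cmod_triangle w (z - w)%C).
  replace (w + (z - w))%C with z by ring; lra.
Qed.

Lemma Clim_Cmod (u : nat -> C) (l : C) :
  Clim u l -> is_lim_seq (fun n => Cmod (u n)) (Cmod l).
Proof.
intros H.
apply is_lim_seq_ext with (fun n => (Cmod (u n) - Cmod l) + Cmod l);
  [intros; ring|].
apply is_lim_seq_eq with (0 + Cmod l); [|ring].
apply is_lim_seq_plus'; [|apply is_lim_seq_const].
apply is_lim_seq_abs_0.
apply is_lim_seq_le_le with (fun _ => 0) (fun n => Cmod (u n - l)%C);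
  [|apply is_lim_seq_const|exact H].
intros n; split; [apply Rabs_pos|apply Cmod_triangle'].
Qed.

Lemma Clim_bound (u : nat -> C) (l : C) (M : R) :
  Clim u l -> (forall n, Cmod (u n) <= M) -> Cmod l <= M.
Proof.
intros H HM; apply Clim_Cmod in H.
apply (is_lim_seq_le _ (fun _ => M) _ _ HM H (is_lim_seq_const M)).
Qed.

Lemma Clim_RtoC (u : nat -> R) (l : R) :
  is_lim_seq u l -> Clim (fun n => RtoC (u n)) (RtoC l).
Proof.
intros H; apply Clim_components; split; [exact H|apply is_lim_seq_const].
Qed.

Lemma Clim_inv (u : nat -> C) (l : C) :
  l <> RtoC 0 -> Clim u l -> Clim (fun n => (/ u n)%C) (/ l)%C.
Proof.
intros Hl [H1 H2]%Clim_components.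
assert (Hd : Re l ^ 2 + Im l ^ 2 <> 0).
{ rewrite <- Cmod2_alt; apply pow_nonzero; intros H; apply Hl, Cmod_eq_0, H. }
assert (Hlim : is_lim_seq (fun n => Re (u n) ^ 2 + Im (u n) ^ 2)
                 (Re l ^ 2 + Im l ^ 2)).
{ apply is_lim_seq_ext with
    (fun n => Re (u n) * Re (u n) + Im (u n) * Im (u n)); [intros; ring|].
  replace (Re l ^ 2 + Im l ^ 2) with (Re l * Re l + Im l * Im l) by ring.
  apply is_lim_seq_plus'; apply is_lim_seq_mult'; assumption. }
apply Clim_components; split.
- apply is_lim_seq_div'; assumption.
- apply is_lim_seq_div'; try assumption.
  apply (is_lim_seq_opp (fun n => Im (u n)) (Im l)); assumption.
Qed.

Lemma Clim_div (u v : nat -> C) (l m : C) :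
  m <> RtoC 0 -> Clim u l -> Clim v m -> Clim (fun n => (u n / v n)%C) (l / m)%C.
Proof. intros Hm Hu Hv; apply Clim_mult; [exact Hu|apply Clim_inv; assumption]. Qed.

Lemma Csum_S (f : nat -> C) (n : nat) : Csum f (S n) = (Csum f n + f n)%C.
Proof. reflexivity. Qed.

Lemma Csum_ext (f g : nat -> C) (n : nat) :
  (forall k, (k < n)%nat -> f k = g k) -> Csum f n = Csum g n.
Proof.
induction n as [|n IH]; intros H; simpl; [reflexivity|].
rewrite IH, (H n) by (intros; try apply H; lia); reflexivity.
Qed.

Lemma Csum_plus (f g : nat -> C) (n : nat) :
  Csum (fun k => (f k + g k)%C) n = (Csum f n + Csum g n)%C.
Proof. induction n as [|n IH]; simpl; [|rewrite IH]; ring. Qed.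

Lemma Csum_scal (c : C) (f : nat -> C) (n : nat) :
  Csum (fun k => (c * f k)%C) n = (c * Csum f n)%C.
Proof. induction n as [|n IH]; simpl; [|rewrite IH]; ring. Qed.

Lemma Csum_opp (f : nat -> C) (n : nat) :
  Csum (fun k => (- f k)%C) n = (- Csum f n)%C.
Proof. induction n as [|n IH]; simpl; [|rewrite IH]; ring. Qed.

Lemma Csum_minus (f g : nat -> C) (n : nat) :
  Csum (fun k => (f k - g k)%C) n = (Csum f n - Csum g n)%C.
Proof. induction n as [|n IH]; simpl; [|rewrite IH]; ring. Qed.

Lemma Csum_const (c : C) (n : nat) : Csum (fun _ => c) n = (RtoC (INR n) * c)%C.
Proof.
induction n as [|n IH]; [simpl; ring|].
rewrite S_INR, RtoC_plus; simpl Csum; rewrite IH; ring.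
Qed.

Lemma Csum_zero (f : nat -> C) (n : nat) :
  (forall k, (k < n)%nat -> f k = RtoC 0) -> Csum f n = RtoC 0.
Proof.
intros H; rewrite (Csum_ext f (fun _ => RtoC 0)) by exact H.
rewrite Csum_const; ring.
Qed.

Lemma Csum_swap (a : nat -> nat -> C) (n m : nat) :
  Csum (fun i => Csum (fun j => a i j) m) n =
  Csum (fun j => Csum (fun i => a i j) n) m.
Proof.
induction n as [|n IH]; simpl.
- symmetry; apply Csum_zero; reflexivity.
- rewrite IH, <- Csum_plus; reflexivity.
Qed.

Lemma Csum_telescope (f : nat -> C) (n : nat) :
  Csum (fun k => (f k - f (S k))%C) n = (f O - f n)%C.
Proof. induction n as [|n IH]; simpl; [|rewrite IH]; ring. Qed.

Lemma Csum_shift (f : nat -> C) (n : nat) :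
  Csum f (S n) = (f O + Csum (fun k => f (S k)) n)%C.
Proof.
induction n as [|n IH]; [simpl; ring|].
change (Csum f (S (S n))) with (Csum f (S n) + f (S n))%C.
rewrite IH; simpl; ring.
Qed.

Lemma Csum_split (f : nat -> C) (n m : nat) :
  Csum f (n + m) = (Csum f n + Csum (fun k => f (n + k)%nat) m)%C.
Proof.
induction m as [|m IH]; [rewrite Nat.add_0_r; simpl; ring|].
rewrite Nat.add_succ_r; simpl; rewrite IH; ring.
Qed.

Lemma Csum_single (f : nat -> C) (n i : nat) :
  (i < n)%nat -> (forall k, (k < n)%nat -> k <> i -> f k = RtoC 0) ->
  Csum f n = f i.
Proof.
induction n as [|n IH]; intros Hi Hf; [lia|]; simpl.
destruct (Nat.eq_dec i n) as [->|Hin].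
- rewrite Csum_zero; [ring|]; intros k Hk; apply Hf; lia.
- rewrite IH, (Hf n) by (try lia; intros; apply Hf; lia); ring.
Qed.

Lemma Cmod_Csum (f : nat -> C) (n : nat) :
  Cmod (Csum f n) <= Rsum (fun k => Cmod (f k)) n.
Proof.
induction n as [|n IH]; simpl; [rewrite Cmod_0; lra|].
generalize (Cmod_triangle (Csum f n) (f n)); lra.
Qed.

Lemma Rsum_le (f g : nat -> R) (n : nat) :
  (forall k, (k < n)%nat -> f k <= g k) -> Rsum f n <= Rsum g n.
Proof.
induction n as [|n IH]; intros H; simpl; [lra|].
generalize (IH (fun k Hk => H k (Nat.lt_lt_succ_r _ _ Hk))) (H n (Nat.lt_succ_diag_r n)); lra.
Qed.

Lemma Rsum_scal (c : R) (f : nat -> R) (n : nat) :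
  Rsum (fun k => c * f k) n = c * Rsum f n.
Proof. induction n as [|n IH]; simpl; [|rewrite IH]; ring. Qed.

Lemma Rsum_const (c : R) (n : nat) : Rsum (fun _ => c) n = INR n * c.
Proof. induction n as [|n IH]; [simpl; ring|]; rewrite S_INR; simpl; rewrite IH; ring. Qed.

Lemma Rsum_pos (f : nat -> R) (n : nat) : (forall k, 0 <= f k) -> 0 <= Rsum f n.
Proof. intros H; induction n as [|n IH]; simpl; [lra|]; generalize (H n); lra. Qed.

Lemma Cmod_Csum_le (f : nat -> C) (b : nat -> R) (n : nat) :
  (forall k, (k < n)%nat -> Cmod (f k) <= b k) -> Cmod (Csum f n) <= Rsum b n.
Proof.
intros H; eapply Rle_trans; [apply Cmod_Csum|]; apply Rsum_le, H.
Qed.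

(** A majorant together with its sum: keeping [B] explicit gives the tail bound [B - Rsum b n]
    directly. *)
Definition summable (b : nat -> R) (B : R) : Prop :=
  (forall n, 0 <= b n) /\ is_lim_seq (Rsum b) B.

Lemma summable_le (b : nat -> R) (B : R) (n : nat) : summable b B -> Rsum b n <= B.
Proof.
intros [H1 H2]; apply (is_lim_seq_incr_compare _ _ H2).
intros k; simpl; generalize (H1 k); lra.
Qed.

Lemma summable_pos (b : nat -> R) (B : R) : summable b B -> 0 <= B.
Proof. intros H; apply (summable_le b B 0 H). Qed.

Lemma summable_scal (c : R) (b : nat -> R) (B : R) :
  0 <= c -> summable b B -> summable (fun n => c * b n) (c * B).
Proof.
intros Hc [H1 H2]; split; [intros n; apply Rmult_le_pos; auto|].
apply is_lim_seq_ext with (fun n => c * Rsum b n).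
- intros n; rewrite Rsum_scal; reflexivity.
- apply (is_lim_seq_scal_l (Rsum b) c B H2).
Qed.

Lemma summable_tail (b : nat -> R) (B : R) : summable b B ->
  is_lim_seq (fun n => B - Rsum b n) 0.
Proof.
intros [_ H]; apply is_lim_seq_eq with (B - B); [|ring].
apply is_lim_seq_minus'; [apply is_lim_seq_const|exact H].
Qed.

Lemma Rsum_abs_conv (r b : nat -> R) (B : R) :
  (forall n, Rabs (r n) <= b n) -> summable b B -> exists l : R, is_lim_seq (Rsum r) l.
Proof.
intros Hr Hb.
assert (E : forall n, Rsum (fun k => b k + r k) n = Rsum b n + Rsum r n).
{ induction n as [|n IH]; simpl; [|rewrite IH]; ring. }
(* Adding the majorant makes the terms nonnegative, so the partial sums increase and stay below
   [2 * B]. *)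
destruct (ex_finite_lim_seq_incr (Rsum (fun k => b k + r k)) (2 * B)) as [l Hl].
- intros n; simpl; generalize (Hr n); intros H; apply Rabs_le_between in H; lra.
- intros n; rewrite E.
  assert (Rsum r n <= Rsum b n).
  { apply Rsum_le; intros k _; generalize (Hr k); intros H; apply Rabs_le_between in H; lra. }
  generalize (summable_le b B n Hb); lra.
- exists (l - B).
  apply is_lim_seq_ext with (fun n => Rsum (fun k => b k + r k) n - Rsum b n).
  { intros n; rewrite E; ring. }
  apply is_lim_seq_minus'; [exact Hl|apply Hb].
Qed.

Lemma Re_Csum (a : nat -> C) (n : nat) : Re (Csum a n) = Rsum (fun k => Re (a k)) n.
Proof. induction n as [|n IH]; simpl Csum; [reflexivity|rewrite re_plus, IH; reflexivity]. Qed.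

Lemma Im_Csum (a : nat -> C) (n : nat) : Im (Csum a n) = Rsum (fun k => Im (a k)) n.
Proof. induction n as [|n IH]; simpl Csum; [reflexivity|rewrite im_plus, IH; reflexivity]. Qed.

(** A total function: for a divergent series it only returns what [Lim_seq] gives in each
    component. *)
Definition CSer (a : nat -> C) : C := C_lim_seq (Csum a).

Lemma Csum_tail_le (a : nat -> C) (b : nat -> R) (N n : nat) :
  (forall k, Cmod (a k) <= b k) -> (N <= n)%nat ->
  Cmod (Csum a n - Csum a N)%C <= Rsum b n - Rsum b N.
Proof.
intros Ha HN; induction HN as [|n HN IH]; simpl.
- replace (Csum a N - Csum a N)%C with (RtoC 0) by ring; rewrite Cmod_0; lra.
- replace (Csum a n + a n - Csum a N)%C with ((Csum a n - Csum a N) + a n)%C by ring.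
  generalize (Cmod_triangle (Csum a n - Csum a N)%C (a n)) (Ha n); lra.
Qed.

Lemma CSer_correct (a : nat -> C) (b : nat -> R) (B : R) :
  (forall n, Cmod (a n) <= b n) -> summable b B -> Clim (Csum a) (CSer a).
Proof.
intros Ha Hb.
destruct (Rsum_abs_conv (fun k => Re (a k)) b B) as [x Hx]; auto.
{ intros n; eapply Rle_trans; [apply re_le_Cmod|apply Ha]. }
destruct (Rsum_abs_conv (fun k => Im (a k)) b B) as [y Hy]; auto.
{ intros n; eapply Rle_trans; [apply im_le_Cmod|apply Ha]. }
assert (H : Clim (Csum a) (x, y)).
{ apply Clim_components; split.
  - apply is_lim_seq_ext with (2 := Hx); intros n; rewrite Re_Csum; reflexivity.
  - apply is_lim_seq_ext with (2 := Hy); intros n; rewrite Im_Csum; reflexivity. }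
unfold CSer; rewrite (Clim_C_lim_seq _ _ H); exact H.
Qed.

Lemma CSer_tail (a : nat -> C) (b : nat -> R) (B : R) (N : nat) :
  (forall n, Cmod (a n) <= b n) -> summable b B ->
  Cmod (CSer a - Csum a N)%C <= B - Rsum b N.
Proof.
intros Ha Hb.
generalize (CSer_correct a b B Ha Hb); intros H.
apply (Clim_bound (fun n => (Csum a (n + N) - Csum a N)%C)).
- apply Clim_minus; [|apply Clim_const].
  apply -> Clim_incr_n; exact H.
- intros n; eapply Rle_trans; [apply (Csum_tail_le a b); [exact Ha|lia]|].
  generalize (summable_le b B (n + N) Hb); lra.
Qed.

Lemma CSer_bound (a : nat -> C) (b : nat -> R) (B : R) :
  (forall n, Cmod (a n) <= b n) -> summable b B -> Cmod (CSer a) <= B.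
Proof.
intros Ha Hb; generalize (CSer_tail a b B 0 Ha Hb); simpl.
replace (CSer a - 0)%C with (CSer a) by ring; lra.
Qed.

Lemma CSer_ext (a a' : nat -> C) : (forall n, a n = a' n) -> CSer a = CSer a'.
Proof.
intros H; unfold CSer, C_lim_seq.
f_equal; f_equal; apply Lim_seq_ext; intros n;
  rewrite (Csum_ext a a') by auto; reflexivity.
Qed.

(** Tannery's theorem: the tails are small uniformly in [i], and what precedes them is a finite
    sum. *)
Lemma CSer_dominated (a : nat -> nat -> C) (l : nat -> C) (b : nat -> R) (B : R) :
  (forall i n, Cmod (a i n) <= b n) -> summable b B ->
  (forall n, Clim (fun i => a i n) (l n)) ->
  Clim (fun i => CSer (a i)) (CSer l).
Proof.
intros Ha Hb Hl.
assert (Hlb : forall n, Cmod (l n) <= b n).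
{ intros n; apply (Clim_bound _ _ _ (Hl n)); intros i; apply Ha. }
unfold Clim; apply is_lim_seq_spec; intros eps; simpl.
assert (Hpos : 0 < eps / 3) by (generalize (cond_pos eps); lra).
assert (Htail := summable_tail b B Hb).
apply is_lim_seq_spec in Htail.
destruct (Htail (mkposreal _ Hpos)) as [N HN]; simpl in HN.
specialize (HN N (Nat.le_refl N)); rewrite Rminus_0_r in HN.
apply Rabs_lt_between in HN.
assert (Hfin : Clim (fun i => Csum (a i) N) (Csum l N)).
{ clear -Hl; induction N as [|N IH]; simpl; [apply Clim_const|].
  apply Clim_plus; auto. }
unfold Clim in Hfin; apply is_lim_seq_spec in Hfin.
destruct (Hfin (mkposreal _ Hpos)) as [I HI]; simpl in HI.
exists I; intros i Hi; specialize (HI i Hi).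
rewrite Rminus_0_r in HI |- *.
rewrite Rabs_pos_eq in HI |- * by apply Cmod_ge_0.
generalize (CSer_tail (a i) b B N (Ha i) Hb) (CSer_tail l b B N Hlb Hb).
intros H1 H2.
replace (CSer (a i) - CSer l)%C with
  ((CSer (a i) - Csum (a i) N) + ((Csum (a i) N - Csum l N) + - (CSer l - Csum l N)))%C
  by ring.
eapply Rle_lt_trans; [apply Cmod_triangle|].
generalize (Cmod_triangle (Csum (a i) N - Csum l N)%C (- (CSer l - Csum l N))%C).
rewrite Cmod_opp; lra.
Qed.

(** * Double series *)

(** The bridge between iterated sums and finite squares, where telescoping and symmetry are exact. A
    product majorant bounds the part outside the square by the two one-dimensional tails. *)
Lemma CSer_box (a : nat -> nat -> C) (u v : nat -> R) (U V : R) :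
  summable u U -> summable v V ->
  (forall n m, Cmod (a n m) <= u n * v m) ->
  Clim (fun N => Csum (fun n => Csum (fun m => a n m) N) N)
       (CSer (fun n => CSer (a n))).
Proof.
intros Hu Hv Ha.
assert (Hsv : forall n, summable (fun m => u n * v m) (u n * V)).
{ intros n; apply summable_scal; [apply Hu|exact Hv]. }
assert (Hrow : forall n, Cmod (CSer (a n)) <= V * u n).
{ intros n; rewrite Rmult_comm; apply (CSer_bound (a n) (fun m => u n * v m)); auto. }
assert (Hsu : summable (fun n => V * u n) (V * U)).
{ apply summable_scal; [apply (summable_pos v)|]; assumption. }
apply Clim_squeeze with (fun N => U * (V - Rsum v N) + V * (U - Rsum u N)).
- intros N.
  replace (Csum (fun n => Csum (fun m => a n m) N) N - CSer (fun n => CSer (a n)))%C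
    with (- (Csum (fun n => CSer (a n) - Csum (fun m => a n m) N)%C N)
          + - (CSer (fun n => CSer (a n)) - Csum (fun n => CSer (a n)) N))%C
    by (rewrite Csum_minus; ring).
  eapply Rle_trans; [apply Cmod_triangle|]; rewrite !Cmod_opp.
  apply Rplus_le_compat.
  + eapply Rle_trans with (Rsum (fun n => (V - Rsum v N) * u n) N).
    * apply Cmod_Csum_le; intros n _.
      generalize (CSer_tail (a n) (fun m => u n * v m) _ N (Ha n) (Hsv n)).
      rewrite (Rsum_scal (u n) v); 
      change (fun m => a n m) with (a n); lra.
    * rewrite (Rsum_scal _ u), Rmult_comm; apply Rmult_le_compat_r.
      -- generalize (summable_le v V N Hv); lra.
      -- apply summable_le, Hu.
  + generalize (CSer_tail (fun n => CSer (a n)) _ _ N Hrow Hsu).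
    rewrite (Rsum_scal V u); lra.
- apply is_lim_seq_eq with (U * 0 + V * 0); [|ring].
  apply is_lim_seq_plus'; apply (is_lim_seq_scal_l _ _ 0); apply summable_tail; assumption.
Qed.

(** Both iterated sums are limits of the same square sums. *)
Lemma CSer_swap (a : nat -> nat -> C) (u v : nat -> R) (U V : R) :
  summable u U -> summable v V ->
  (forall n m, Cmod (a n m) <= u n * v m) ->
  CSer (fun n => CSer (fun m => a n m)) = CSer (fun m => CSer (fun n => a n m)).
Proof.
intros Hu Hv Ha.
apply (Clim_unique (fun N => Csum (fun n => Csum (fun m => a n m) N) N)).
- apply (CSer_box a u v U V); assumption.
- apply Clim_ext with (fun N => Csum (fun m => Csum (fun n => a n m) N) N).
  { intros N; apply Csum_swap. }
  apply (CSer_box (fun m n => a n m) v u V U); try assumption.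
  intros n m; rewrite Rmult_comm; apply Ha.
Qed.

Lemma CSer_double_dominated (a : nat -> nat -> nat -> C) (l : nat -> nat -> C)
  (u v : nat -> R) (U V : R) :
  summable u U -> summable v V ->
  (forall i n m, Cmod (a i n m) <= u n * v m) ->
  (forall n m, Clim (fun i => a i n m) (l n m)) ->
  Clim (fun i => CSer (fun n => CSer (a i n))) (CSer (fun n => CSer (l n))).
Proof.
intros Hu Hv Ha Hl.
assert (Hsv : forall n, summable (fun m => u n * v m) (u n * V)).
{ intros n; apply summable_scal; [apply Hu|exact Hv]. }
apply (CSer_dominated (fun i n => CSer (a i n)) (fun n => CSer (l n))
         (fun n => V * u n) (V * U)).
- intros i n; rewrite Rmult_comm; apply (CSer_bound _ (fun m => u n * v m)); auto.
- apply summable_scal; [apply (summable_pos v)|]; assumption.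
- intros n; apply (CSer_dominated _ _ (fun m => u n * v m) (u n * V)); auto.
Qed.

(** [pw n * pw m] dominates a multiple of [|z + n al + m be| ^ (-3)] over a lattice cone. *)
Definition pw (n : nat) : R := / (sqrt (INR (S n))) ^ 3.

Lemma sqrt_S_pos (n : nat) : 0 < sqrt (INR (S n)).
Proof. apply sqrt_lt_R0, lt_0_INR; lia. Qed.

Lemma sqrt_S_sq (n : nat) : sqrt (INR (S n)) ^ 2 = INR (S n).
Proof. apply pow2_sqrt, pos_INR. Qed.

Lemma pw_summable : exists U, summable pw U.
Proof.
assert (Hpos : forall n, 0 <= pw n).
{ intros n; apply Rlt_le, Rinv_0_lt_compat, pow_lt, sqrt_S_pos. }
(* Comparison with the integral of [t ^ (- 3 / 2)], whose primitive is [- 2 / sqrt t]. With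
   [y ^ 2 = x ^ 2 + 1] the induction step is [/ y ^ 3 <= 2 / x - 2 / y]. *)
assert (Hb : forall n, Rsum pw (S n) <= 3 - 2 / sqrt (INR (S n))).
{ induction n as [|n IH].
  - unfold Rsum, pw; simpl INR; rewrite sqrt_1; lra.
  - change (Rsum pw (S (S n))) with (Rsum pw (S n) + pw (S n)).
    unfold pw at 2.
    assert (Hx := sqrt_S_pos n); assert (Hy := sqrt_S_pos (S n)).
    assert (Hx2 := sqrt_S_sq n); assert (Hy2 := sqrt_S_sq (S n)).
    assert (Hyx : sqrt (INR (S (S n))) ^ 2 = sqrt (INR (S n)) ^ 2 + 1).
    { rewrite Hx2, Hy2; apply S_INR. }
    clear Hx2 Hy2.
    set (x := sqrt (INR (S n))) in *.
    set (y := sqrt (INR (S (S n)))) in *.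
    cut (/ y ^ 3 <= 2 / x - 2 / y); [intros; lra|].
    apply Rmult_le_reg_r with (x * y ^ 3).
    { apply Rmult_lt_0_compat; [|apply pow_lt]; assumption. }
    replace (/ y ^ 3 * (x * y ^ 3)) with x by (field; lra).
    replace ((2 / x - 2 / y) * (x * y ^ 3)) with (2 * y ^ 2 * (y - x)) by (field; lra).
    assert (Hxy : x < y).
    { destruct (Rlt_or_le x y) as [H|H]; [exact H|].
      assert (y * y <= x * x) by (apply Rmult_le_compat; lra); nra. }
    assert (H1 : (y - x) * (y + x) = 1) by nra.
    apply Rmult_le_reg_r with (y + x); [lra|].
    replace (2 * y ^ 2 * (y - x) * (y + x)) with (2 * y ^ 2 * ((y - x) * (y + x))) by ring.
    rewrite H1; nra. }
destruct (ex_finite_lim_seq_incr (Rsum pw) 3) as [U HU].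
- intros n; simpl; generalize (Hpos n); lra.
- intros [|n]; [simpl; lra|]; eapply Rle_trans; [apply Hb|].
  assert (0 < 2 / sqrt (INR (S n))).
  { apply Rmult_lt_0_compat; [lra|apply Rinv_0_lt_compat, sqrt_S_pos]. }
  lra.
- exists U; split; assumption.
Qed.

(** * Exponential, derivatives along a real parameter, Taylor's formula *)

Lemma Cexp_plus (z w : C) : Cexp (z + w)%C = (Cexp z * Cexp w)%C.
Proof.
unfold Cexp; rewrite re_plus, im_plus, exp_plus, cos_plus, sin_plus.
apply injective_projections; simpl; ring.
Qed.

Lemma Cexp_RtoC (x : R) : Cexp (RtoC x) = RtoC (exp x).
Proof.
unfold Cexp; simpl; rewrite cos_0, sin_0.
apply injective_projections; simpl; ring.
Qed.

Lemma Cexp_0 : Cexp (RtoC 0) = RtoC 1.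
Proof. rewrite Cexp_RtoC, exp_0; reflexivity. Qed.

Lemma Cmod_Cexp (z : C) : Cmod (Cexp z) = exp (Re z).
Proof.
unfold Cmod, Cexp; simpl.
replace (_ + _) with (exp (Re z) ^ 2 * (Rsqr (sin (Im z)) + Rsqr (cos (Im z))))
  by (unfold Rsqr; ring).
rewrite sin2_cos2, Rmult_1_r, sqrt_pow2; [reflexivity|].
apply Rlt_le, exp_pos.
Qed.

Lemma Cexp_neq0 (z : C) : Cexp z <> RtoC 0.
Proof.
apply Cmod_gt_0; rewrite Cmod_Cexp; apply exp_pos.
Qed.

Lemma Cexp_opp (z : C) : Cexp (- z)%C = (/ Cexp z)%C.
Proof.
assert (H : (Cexp z * Cexp (- z))%C = RtoC 1).
{ rewrite <- Cexp_plus; replace (z + - z)%C with (RtoC 0) by ring; apply Cexp_0. }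
replace (Cexp (- z)) with (/ Cexp z * (Cexp z * Cexp (- z)))%C.
- rewrite H; ring.
- field; apply Cexp_neq0.
Qed.

Lemma Cexp_minus (z w : C) : Cexp (z - w)%C = (Cexp z / Cexp w)%C.
Proof. unfold Cminus; rewrite Cexp_plus, Cexp_opp; reflexivity. Qed.

Lemma Cexp_Csum (f : nat -> C) (n : nat) :
  Cexp (Csum f n) = Cprod (fun k => Cexp (f k)) n.
Proof.
induction n as [|n IH]; simpl; [apply Cexp_0|rewrite Cexp_plus, IH; reflexivity].
Qed.

Lemma Cexp_pow (z : C) (n : nat) : (Cexp z ^ n)%C = Cexp (RtoC (INR n) * z)%C.
Proof.
induction n as [|n IH].
- simpl INR; replace (RtoC 0 * z)%C with (RtoC 0) by ring; rewrite Cexp_0; reflexivity.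
- rewrite Cpow_S, IH, <- Cexp_plus, S_INR, RtoC_plus; f_equal; ring.
Qed.

Lemma Cexp_2PI_nat (n : nat) : Cexp (RtoC (2 * PI) * Ci * RtoC (INR n))%C = RtoC 1.
Proof.
unfold Cexp; simpl.
replace (_ - _) with 0 by ring.
replace (_ + _) with (0 + 2 * INR n * PI) by ring.
rewrite cos_period, sin_period, cos_0, sin_0, exp_0.
apply injective_projections; simpl; ring.
Qed.

Lemma Cexp_2PI (n : Z) : Cexp (RtoC (2 * PI) * Ci * RtoC (IZR n))%C = RtoC 1.
Proof.
destruct (Z_le_gt_dec 0 n) as [H|H].
- rewrite <- (Z2Nat.id n H), <- INR_IZR_INZ; apply Cexp_2PI_nat.
- replace (RtoC (2 * PI) * Ci * RtoC (IZR n))%C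
    with (- (RtoC (2 * PI) * Ci * RtoC (INR (Z.to_nat (- n)))))%C.
  + rewrite Cexp_opp, Cexp_2PI_nat; field; apply C1_nz.
  + rewrite INR_IZR_INZ, Z2Nat.id, opp_IZR, RtoC_opp by lia; ring.
Qed.

Lemma Clim_Cexp (u : nat -> C) (l : C) :
  Clim u l -> Clim (fun n => Cexp (u n)) (Cexp l).
Proof.
intros [H1 H2]%Clim_components.
assert (He : is_lim_seq (fun n => exp (Re (u n))) (exp (Re l))).
{ apply is_lim_seq_continuous; [|exact H1].
  apply derivable_continuous_pt, derivable_pt_exp. }
apply Clim_components; split; apply is_lim_seq_mult'; try exact He.
- apply (is_lim_seq_continuous cos); [apply continuity_cos|exact H2].
- apply (is_lim_seq_continuous sin); [apply continuity_sin|exact H2].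
Qed.

(** Taylor's formula is only applied along segments, so componentwise differentiation in a real
    parameter replaces complex differentiation there. *)
Definition Cder (f : R -> C) (t : R) (l : C) : Prop :=
  is_derive (fun s => Re (f s)) t (Re l) /\ is_derive (fun s => Im (f s)) t (Im l).

Lemma is_derive_eq (f : R -> R) (t l l' : R) :
  is_derive f t l -> l = l' -> is_derive f t l'.
Proof. intros H <-; exact H. Qed.

Lemma Cder_eq (f : R -> C) (t : R) (l l' : C) : Cder f t l -> l = l' -> Cder f t l'.
Proof. intros H <-; exact H. Qed.

Lemma Cder_ext (f g : R -> C) (t : R) (l : C) :
  (forall s, f s = g s) -> Cder f t l -> Cder g t l.
Proof.
intros H [H1 H2]; split.
- apply is_derive_ext with (2 := H1); intros s; rewrite H; reflexivity.
- apply is_derive_ext with (2 := H2); intros s; rewrite H; reflexivity.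
Qed.

Lemma Cder_const (c : C) (t : R) : Cder (fun _ => c) t (RtoC 0).
Proof. split; apply (is_derive_const (V := R_NormedModule)). Qed.

Lemma Cder_id (t : R) : Cder (fun s => RtoC s) t (RtoC 1).
Proof.
split; simpl; [apply (is_derive_id (K := R_AbsRing))|].
apply (is_derive_const (K := R_AbsRing) (V := R_NormedModule) 0).
Qed.

Lemma Cder_plus (f g : R -> C) (t : R) (l m : C) :
  Cder f t l -> Cder g t m -> Cder (fun s => (f s + g s)%C) t (l + m)%C.
Proof. intros [H1 H2] [H3 H4]; split; apply (is_derive_plus (V := R_NormedModule)); assumption. Qed.

Lemma Cder_opp (f : R -> C) (t : R) (l : C) :
  Cder f t l -> Cder (fun s => (- f s)%C) t (- l)%C.
Proof. intros [H1 H2]; split; apply (is_derive_opp (V := R_NormedModule)); assumption. Qed.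

Lemma Cder_minus (f g : R -> C) (t : R) (l m : C) :
  Cder f t l -> Cder g t m -> Cder (fun s => (f s - g s)%C) t (l - m)%C.
Proof. intros H1 H2; apply Cder_plus; [|apply Cder_opp]; assumption. Qed.

Lemma is_derive_mult_R (f g : R -> R) (t l m : R) :
  is_derive f t l -> is_derive g t m ->
  is_derive (fun s => f s * g s) t (l * g t + f t * m).
Proof.
intros H1 H2; apply (is_derive_mult f g t l m H1 H2); intros; apply Rmult_comm.
Qed.

Lemma is_derive_plus_R (f g : R -> R) (t l m : R) :
  is_derive f t l -> is_derive g t m -> is_derive (fun s => f s + g s) t (l + m).
Proof. apply (is_derive_plus (K := R_AbsRing) (V := R_NormedModule)). Qed.

Lemma is_derive_comp_R (f g : R -> R) (t l m : R) :
  is_derive f (g t) m -> is_derive g t l -> is_derive (fun s => f (g s)) t (l * m).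
Proof. apply (is_derive_comp (K := R_AbsRing) (V := R_NormedModule)). Qed.

Lemma Cder_mult (f g : R -> C) (t : R) (l m : C) :
  Cder f t l -> Cder g t m ->
  Cder (fun s => (f s * g s)%C) t (l * g t + f t * m)%C.
Proof.
intros [H1 H2] [H3 H4]; split.
- eapply is_derive_eq.
  + apply (is_derive_minus (V := R_NormedModule)); apply is_derive_mult_R; eassumption.
  + unfold minus, plus, opp; simpl; unfold Re, Im; ring.
- eapply is_derive_eq.
  + apply (is_derive_plus (V := R_NormedModule)); apply is_derive_mult_R; eassumption.
  + unfold plus; simpl; unfold Re, Im; ring.
Qed.

Lemma Cder_scal (c : C) (f : R -> C) (t : R) (l : C) :
  Cder f t l -> Cder (fun s => (c * f s)%C) t (c * l)%C.
Proof.
intros H; eapply Cder_eq; [apply Cder_mult; [apply Cder_const|exact H]|cbv beta; ring].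
Qed.

Lemma Cder_line (w a : C) (t : R) : Cder (fun s => (w + RtoC s * a)%C) t a.
Proof.
eapply Cder_eq.
- apply Cder_plus; [apply Cder_const|apply Cder_mult; [apply Cder_id|apply Cder_const]].
- cbv beta; ring.
Qed.

Lemma Cder_pow (f : R -> C) (t : R) (l : C) (n : nat) :
  Cder f t l -> Cder (fun s => (f s ^ S n)%C) t (RtoC (INR (S n)) * (f t ^ n * l))%C.
Proof.
intros H; induction n as [|n IH].
- apply Cder_ext with f; [intros s; rewrite Cpow_1_r; reflexivity|].
  eapply Cder_eq; [exact H|simpl; ring].
- eapply Cder_eq; [apply (Cder_mult f (fun s => (f s ^ S n)%C) t l _ H IH)|].
  rewrite (S_INR (S n)), RtoC_plus, !Cpow_S; ring.
Qed.

Lemma Cder_Cexp (f : R -> C) (t : R) (l : C) :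
  Cder f t l -> Cder (fun s => Cexp (f s)) t (l * Cexp (f t))%C.
Proof.
intros [H1 H2]; split; unfold Cexp; simpl.
- eapply is_derive_eq.
  + apply is_derive_mult_R.
    * apply (is_derive_comp (V := R_NormedModule) exp); [apply is_derive_exp|exact H1].
    * apply (is_derive_comp (V := R_NormedModule) cos); [apply is_derive_cos|exact H2].
  + unfold scal; simpl; unfold mult; simpl; unfold Re, Im; ring.
- eapply is_derive_eq.
  + apply is_derive_mult_R.
    * apply (is_derive_comp (V := R_NormedModule) exp); [apply is_derive_exp|exact H1].
    * apply (is_derive_comp (V := R_NormedModule) sin); [apply is_derive_sin|exact H2].
  + unfold scal; simpl; unfold mult; simpl; unfold Re, Im; ring.
Qed.

(** The difference of the two sides has a nonnegative derivative. Iterated, this bounds Taylor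
    remainders without any integral. *)
Lemma is_derive_growth (g dg : R -> R) (B : R) (K : nat) :
  (forall t, 0 <= t <= 1 -> is_derive g t (dg t)) ->
  (forall t, 0 <= t <= 1 -> dg t <= B * t ^ K) -> g 0 = 0 ->
  forall t, 0 <= t <= 1 -> g t <= B * t ^ S K / INR (S K).
Proof.
intros Hg Hdg Hg0 t Ht.
assert (HK : 0 < INR (S K)) by (apply lt_0_INR; lia).
assert (Hd : forall s, 0 <= s <= t ->
  is_derive (fun s => B * s ^ S K / INR (S K) - g s) s (B * s ^ K - dg s)).
{ intros s Hs; eapply is_derive_eq.
  - apply (is_derive_minus (K := R_AbsRing) (V := R_NormedModule)
      (fun s => B * s ^ S K / INR (S K)) g).
    + auto_derive; [exact I|reflexivity].
    + apply Hg; lra.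
  - unfold minus, plus, opp; simpl Init.Nat.pred; cbn [AbelianGroup.sort]; simpl.
    change (match K with O => 1 | S _ => INR K + 1 end) with (INR (S K)).
    field; lra. }
destruct (MVT_gen (fun s => B * s ^ S K / INR (S K) - g s) 0 t
            (fun s => B * s ^ K - dg s)) as [c [Hc E]].
- rewrite Rmin_left, Rmax_right by lra; intros s Hs; apply Hd; lra.
- rewrite Rmin_left, Rmax_right by lra; intros s Hs.
  apply continuity_pt_filterlim.
  apply (ex_derive_continuous (K := R_AbsRing) (V := R_NormedModule)
           (fun s => B * s ^ S K / INR (S K) - g s)).
  exists (B * s ^ K - dg s); apply Hd, Hs.
- rewrite Rmin_left, Rmax_right in Hc by lra.
  rewrite Hg0 in E.
  replace (B * 0 ^ S K / INR (S K) - 0) with 0 in E by (simpl (0 ^ S K); field; lra).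
  assert (0 <= (B * c ^ K - dg c) * (t - 0)).
  { apply Rmult_le_pos; [|lra]; generalize (Hdg c); lra. }
  lra.
Qed.

Lemma Cder_growth (f df : R -> C) (B : R) (K : nat) :
  (forall t, 0 <= t <= 1 -> Cder f t (df t)) ->
  (forall t, 0 <= t <= 1 -> Cmod (df t) <= B * t ^ K) -> f 0 = RtoC 0 ->
  forall t, 0 <= t <= 1 -> Cmod (f t) <= 2 * B * t ^ S K / INR (S K).
Proof.
intros Hf Hdf Hf0 t Ht.
assert (Hre : forall s, 0 <= s <= 1 -> Rabs (Re (df s)) <= B * s ^ K).
{ intros s Hs; eapply Rle_trans; [apply re_le_Cmod|apply Hdf, Hs]. }
assert (Him : forall s, 0 <= s <= 1 -> Rabs (Im (df s)) <= B * s ^ K).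
{ intros s Hs; eapply Rle_trans; [apply im_le_Cmod|apply Hdf, Hs]. }
eapply Rle_trans; [apply Cmod_le_Re_Im|].
assert (HA : forall (g dg : R -> R), (forall s, 0 <= s <= 1 -> is_derive g s (dg s)) ->
  (forall s, 0 <= s <= 1 -> Rabs (dg s) <= B * s ^ K) -> g 0 = 0 ->
  Rabs (g t) <= B * t ^ S K / INR (S K)).
{ intros g dg Hg Hdg Hg0; apply Rabs_le; split.
  - cut (- g t <= B * t ^ S K / INR (S K)); [intros; lra|].
    apply (is_derive_growth (fun s => - g s) (fun s => - dg s)); [| |lra|exact Ht].
    + intros s Hs; apply (is_derive_opp (V := R_NormedModule)), Hg, Hs.
    + intros s Hs; generalize (Hdg s Hs); intros H; apply Rabs_le_between in H; lra.
  - apply (is_derive_growth g dg); [exact Hg| |exact Hg0|exact Ht].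
    intros s Hs; generalize (Hdg s Hs); intros H; apply Rabs_le_between in H; lra. }
assert (H1 : Rabs (Re (f t)) <= B * t ^ S K / INR (S K)).
{ apply (HA (fun s => Re (f s)) (fun s => Re (df s))); auto.
  - intros s Hs; apply Hf, Hs.
  - rewrite Hf0; reflexivity. }
assert (H2 : Rabs (Im (f t)) <= B * t ^ S K / INR (S K)).
{ apply (HA (fun s => Im (f s)) (fun s => Im (df s))); auto.
  - intros s Hs; apply Hf, Hs.
  - rewrite Hf0; reflexivity. }
unfold Rdiv in *; lra.
Qed.

Definition taylor (a : C) (e : nat -> C) (K : nat) : C :=
  Csum (fun i => (a ^ i / RtoC (INR (fact i)) * e i)%C) K.

Lemma INR_fact_neq0 (i : nat) : RtoC (INR (fact i)) <> RtoC 0.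
Proof. intros H; apply RtoC_inj in H; exact (INR_fact_neq_0 i H). Qed.

Lemma RtoC_neq0 (x : R) : x <> 0 -> RtoC x <> RtoC 0.
Proof. intros H E; apply H, RtoC_inj, E. Qed.

Lemma Cder_taylor (a : C) (e : nat -> C) (K : nat) (t : R) :
  Cder (fun s => taylor (RtoC s * a) e (S K)) t (a * taylor (RtoC t * a) (fun i => e (S i)) K)%C.
Proof.
induction K as [|K IH].
- apply Cder_ext with (fun _ => e O).
  + intros s; unfold taylor; simpl; field; apply C1_nz.
  + eapply Cder_eq; [apply Cder_const|unfold taylor; cbn [Csum]; ring].
- apply Cder_ext with (fun s => taylor (RtoC s * a) e (S K)
      + (e (S K) / RtoC (INR (fact (S K)))) * (RtoC s * a) ^ S K)%C.
  { intros s; unfold taylor; rewrite (Csum_S _ (S K)); unfold Cdiv; ring. }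
  eapply Cder_eq.
  + apply Cder_plus; [exact IH|apply Cder_scal, Cder_pow, Cder_mult; [apply Cder_id|apply Cder_const]].
  + unfold taylor; rewrite (Csum_S _ K).
    rewrite fact_simpl, mult_INR, RtoC_mult.
    field; split; [apply INR_fact_neq0|].
    apply RtoC_neq0, not_0_INR; lia.
Qed.

(** Taylor's formula for a family [E] with [E_j' = a E_{j+1}]; the factor [2 ^ K]
    comes from estimating real and imaginary parts separately. *)
Lemma taylor_remainder (E : nat -> R -> C) (a : C) (B : R) (K : nat) : forall j : nat,
  (forall i t, 0 <= t <= 1 -> Cder (E i) t (a * E (S i) t)%C) ->
  (forall t, 0 <= t <= 1 -> Cmod (E (j + K)%nat t) <= B) ->
  forall t, 0 <= t <= 1 ->
  Cmod (E j t - taylor (RtoC t * a) (fun i => E (j + i)%nat 0) K)%C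
    <= (2 * Cmod a) ^ K * B * t ^ K / INR (fact K).
Proof.
induction K as [|K IH]; intros j HE HB t Ht.
- unfold taylor; simpl; replace (E j t - 0)%C with (E j t) by ring.
  generalize (HB t Ht); rewrite Nat.add_0_r; lra.
- eapply Rle_trans.
  + apply (Cder_growth
      (fun s => (E j s - taylor (RtoC s * a) (fun i => E (j + i)%nat 0) (S K))%C)
      (fun s => (a * (E (S j) s - taylor (RtoC s * a) (fun i => E (S j + i)%nat 0) K))%C)
      (Cmod a * ((2 * Cmod a) ^ K * B / INR (fact K))) K); [| | |exact Ht].
    * intros s Hs; eapply Cder_eq.
      -- apply Cder_minus; [apply HE, Hs|].
         apply Cder_taylor.
      -- unfold taylor; rewrite (Csum_ext _
           (fun i => ((RtoC s * a) ^ i / RtoC (INR (fact i)) * E (S j + i)%nat 0)%C)).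
         ++ ring.
         ++ intros k _; do 2 f_equal; lia.
    * intros s Hs; rewrite Cmod_mult, Rmult_assoc.
      apply Rmult_le_compat_l; [apply Cmod_ge_0|].
      eapply Rle_trans; [apply IH; [exact HE| |exact Hs]|].
      -- intros r Hr; replace (S j + K)%nat with (j + S K)%nat by lia; apply HB, Hr.
      -- unfold Rdiv; apply Req_le; ring.
    * unfold taylor; rewrite Csum_shift, Csum_zero.
      -- rewrite Nat.add_0_r; simpl; field; apply C1_nz.
      -- intros k _; rewrite Cpow_S; unfold Cdiv; ring.
  + rewrite fact_simpl, mult_INR; apply Req_le.
    simpl ((2 * Cmod a) ^ S K).
    field; split; [apply INR_fact_neq_0|apply not_0_INR; lia].
Qed.

Lemma taylor_remainder_1 (E : nat -> R -> C) (a : C) (B : R) (K j : nat) :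
  (forall i t, 0 <= t <= 1 -> Cder (E i) t (a * E (S i) t)%C) ->
  (forall t, 0 <= t <= 1 -> Cmod (E (j + K)%nat t) <= B) ->
  Cmod (E j 1 - taylor a (fun i => E (j + i)%nat 0) K)%C
    <= (2 * Cmod a) ^ K * B / INR (fact K).
Proof.
intros HE HB.
generalize (taylor_remainder E a B K j HE HB 1 ltac:(lra)).
rewrite pow1, Rmult_1_r; replace (RtoC 1 * a)%C with a by ring; auto.
Qed.

Lemma Cexp_taylor (z : C) (K : nat) :
  Cmod (Cexp z - taylor z (fun _ => RtoC 1) K)%C
    <= (2 * Cmod z) ^ K * exp (Cmod z) / INR (fact K).
Proof.
generalize (taylor_remainder_1 (fun _ t => Cexp (RtoC t * z)) z (exp (Cmod z)) K 0).
replace (RtoC 1 * z)%C with z by ring.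
replace (RtoC 0 * z)%C with (RtoC 0) by ring; rewrite Cexp_0.
intros H; apply H; clear H.
- intros _ t _; eapply Cder_eq; [apply Cder_Cexp, Cder_mult; [apply Cder_id|apply Cder_const]|cbv beta; ring].
- intros t Ht; rewrite Cmod_Cexp.
  assert (Re (RtoC t * z)%C <= Cmod z) as [H| ->]; [|left; apply exp_increasing, H|right; reflexivity].
  rewrite re_scal_l.
  generalize (re_le_Cmod z); intros H; apply Rabs_le_between in H.
  generalize (Cmod_ge_0 z); nra.
Qed.

Lemma Cexp_series (z : C) :
  Clim (Csum (fun k => (/ RtoC (INR (fact k)) * z ^ k)%C)) (Cexp z).
Proof.
apply Clim_squeeze with (fun K => exp (Cmod z) * ((2 * Cmod z) ^ K / INR (fact K))).
- intros K.
  replace (Csum _ K) with (taylor z (fun _ => RtoC 1) K).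
  + rewrite <- Cmod_opp.
    replace (- (taylor z (fun _ => RtoC 1) K - Cexp z))%C
      with (Cexp z - taylor z (fun _ => RtoC 1) K)%C by ring.
    eapply Rle_trans; [apply Cexp_taylor|apply Req_le; unfold Rdiv; ring].
  + apply Csum_ext; intros k _; unfold Cdiv; ring.
- apply is_lim_seq_eq with (exp (Cmod z) * 0); [|ring].
  apply (is_lim_seq_scal_l _ _ 0), is_lim_seq_Reals, cv_speed_pow_fact.
Qed.

(** * The principal logarithm *)

(** The complement of the closed negative real axis. *)
Definition slit (w : C) : Prop := 0 < Cmod w + Re w.

(** On [slit] the half-angle formula [arg w = 2 atan (Im w / (|w| + Re w))]
    gives the principal argument without a case distinction. *)
Definition Clog (w : C) : C :=
  (ln (Cmod w), 2 * atan (Im w / (Cmod w + Re w))).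

Lemma Cmod_sq (w : C) : Cmod w * Cmod w = Re w * Re w + Im w * Im w.
Proof. generalize (Cmod2_alt w); simpl; lra. Qed.

Lemma slit_pos (w : C) : slit w -> 0 < Cmod w.
Proof.
unfold slit; intros H; generalize (re_le_Cmod w); intros H1.
apply Rabs_le_between in H1; lra.
Qed.

Lemma slit_neq0 (w : C) : slit w -> w <> RtoC 0.
Proof. intros H; apply Cmod_gt_0, slit_pos, H. Qed.

Lemma slit_Im (w : C) : Im w <> 0 -> slit w.
Proof.
unfold slit; intros H.
assert (Hm := Cmod_sq w); assert (Hp := Cmod_ge_0 w).
assert (0 < Im w * Im w) by nra.
destruct (Rlt_or_le 0 (Cmod w + Re w)) as [H1|H1]; [exact H1|nra].
Qed.

Lemma slit_Re (w : C) : 0 < Re w -> slit w.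
Proof. unfold slit; generalize (Cmod_ge_0 w); lra. Qed.

Lemma cos_2atan (t : R) : cos (2 * atan t) = (1 - t * t) / (1 + t * t).
Proof.
assert (H : 0 < 1 + t * t) by nra.
rewrite cos_2a_sin, sin_atan; unfold Rsqr.
assert (Hs := sqrt_sqrt (1 + t * t) (Rlt_le _ _ H)).
assert (Hp := sqrt_lt_R0 _ H).
replace (1 - 2 * (t / sqrt (1 + t * t)) * (t / sqrt (1 + t * t)))
  with (1 - 2 * t * t / (sqrt (1 + t * t) * sqrt (1 + t * t))) by (field; lra).
rewrite Hs; field; lra.
Qed.

Lemma sin_2atan (t : R) : sin (2 * atan t) = 2 * t / (1 + t * t).
Proof.
assert (H : 0 < 1 + t * t) by nra.
rewrite sin_2a, sin_atan, cos_atan; unfold Rsqr.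
assert (Hs := sqrt_sqrt (1 + t * t) (Rlt_le _ _ H)).
assert (Hp := sqrt_lt_R0 _ H).
replace (2 * (t / sqrt (1 + t * t)) * (1 / sqrt (1 + t * t)))
  with (2 * t / (sqrt (1 + t * t) * sqrt (1 + t * t))) by (field; lra).
rewrite Hs; field; lra.
Qed.

Lemma Cexp_Clog (w : C) : slit w -> Cexp (Clog w) = w.
Proof.
intros H; assert (Hp := slit_pos w H); assert (Hm := Cmod_sq w); unfold slit in H.
unfold Cexp, Clog; simpl; rewrite cos_2atan, sin_2atan, exp_ln by exact Hp.
set (r := Cmod w) in *; set (p := Re w) in *; set (q := Im w) in *.
(* Both identities follow from [r ^ 2 = p ^ 2 + q ^ 2]; they turn the double-angle formulas into
   [p / r] and [q / r]. *)
assert (E : (r + p) * (r + p) + q * q = 2 * r * (r + p)) by nra.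
assert (E' : (r + p) * (r + p) - q * q = 2 * p * (r + p)) by nra.
apply injective_projections; cbn [fst snd].
- replace ((1 - q / (r + p) * (q / (r + p))) / (1 + q / (r + p) * (q / (r + p))))
    with (((r + p) * (r + p) - q * q) / ((r + p) * (r + p) + q * q)).
  2:{ field; repeat split; try (apply Rgt_not_eq; nra); lra. }
  rewrite E, E'; change (fst w) with p; field; lra.
- replace (2 * (q / (r + p)) / (1 + q / (r + p) * (q / (r + p))))
    with (2 * q * (r + p) / ((r + p) * (r + p) + q * q)).
  2:{ field; repeat split; try (apply Rgt_not_eq; nra); lra. }
  rewrite E; change (snd w) with q; field; lra.
Qed.

Lemma Clog_RtoC (x : R) : 0 < x -> Clog (RtoC x) = RtoC (ln x).
Proof.
intros H; unfold Clog; rewrite Cmod_R, Rabs_pos_eq by lra; simpl.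
unfold Rdiv; rewrite Rmult_0_l, atan_0.
apply injective_projections; simpl; ring.
Qed.

Lemma Clog_Im_bounds (w : C) : - PI < Im (Clog w) < PI.
Proof.
unfold Clog; simpl; generalize (atan_bound (Im w / (Cmod w + Re w))); lra.
Qed.

Lemma Clog_Im_nonneg (w : C) : slit w -> 0 <= Im w -> 0 <= Im (Clog w).
Proof.
unfold slit, Clog; intros H Hi; simpl.
assert (0 <= Im w / (Cmod w + Re w)) as [H1|<-].
{ apply Rmult_le_pos; [exact Hi|apply Rlt_le, Rinv_0_lt_compat, H]. }
- generalize (atan_increasing _ _ H1); rewrite atan_0; lra.
- rewrite atan_0; lra.
Qed.

Lemma Clog_Im_pos (w : C) : 0 < Im w -> 0 < Im (Clog w).
Proof.
intros Hi; assert (H : slit w) by (apply slit_Im; lra).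
unfold slit, Clog in *; simpl.
assert (H1 : 0 < Im w / (Cmod w + Re w)).
{ apply Rmult_lt_0_compat; [exact Hi|apply Rinv_0_lt_compat, H]. }
generalize (atan_increasing _ _ H1); rewrite atan_0; lra.
Qed.

Lemma Cexp_eq_1 (z : C) : Cexp z = RtoC 1 -> - (2 * PI) < Im z < 2 * PI -> z = RtoC 0.
Proof.
intros H Hi.
assert (Hre : Re z = 0).
{ apply (f_equal Cmod) in H; rewrite Cmod_Cexp, Cmod_1 in H.
  apply exp_inv; rewrite H, exp_0; reflexivity. }
assert (Hc : cos (Im z) = 1).
{ apply (f_equal fst) in H; unfold Cexp in H; simpl in H.
  rewrite Hre, exp_0 in H; lra. }
(* Passing to the half angle brings the argument into the interval from [- PI] to [PI], where 0 is
   the only zero of the sine. *)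
assert (Hs : sin (Im z / 2) = 0).
{ replace (Im z) with (2 * (Im z / 2)) in Hc by field.
  rewrite cos_2a_sin in Hc; nra. }
assert (Him : Im z = 0).
{ destruct (Rtotal_order (Im z) 0) as [Hn|[E|Hp]]; [|exact E|].
  - assert (0 < sin (- (Im z / 2))) by (apply sin_gt_0; lra).
    rewrite sin_neg in H0; lra.
  - assert (0 < sin (Im z / 2)) by (apply sin_gt_0; lra); lra. }
apply injective_projections; simpl; assumption.
Qed.

Lemma Clog_unique (w z : C) : slit w -> Cexp z = w -> - PI <= Im z <= PI -> Clog w = z.
Proof.
intros Hw Hz Hi.
assert (H : (Clog w - z)%C = RtoC 0).
{ apply Cexp_eq_1.
  - rewrite Cexp_minus, Cexp_Clog, Hz by exact Hw.
    field; apply slit_neq0, Hw.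
  - unfold Cminus; rewrite im_plus, im_opp; generalize (Clog_Im_bounds w); lra. }
replace (Clog w) with ((Clog w - z) + z)%C by ring; rewrite H; ring.
Qed.

(** The arguments add up without wrapping when all three points lie in the closed
    upper half-plane. *)
Lemma Clog_mult (l w : C) : slit l -> slit w -> slit (l * w)%C ->
  0 <= Im l -> 0 <= Im w -> 0 <= Im (l * w)%C ->
  Clog (l * w)%C = (Clog l + Clog w)%C.
Proof.
intros Hl Hw Hlw Il Iw Ilw.
assert (H : (Clog (l * w)%C - (Clog l + Clog w))%C = RtoC 0).
{ apply Cexp_eq_1.
  - rewrite Cexp_minus, Cexp_plus, !Cexp_Clog by assumption.
    field; split; apply slit_neq0; assumption.
  - unfold Cminus; rewrite im_plus, im_opp, im_plus.
    generalize (Clog_Im_nonneg _ Hl Il) (Clog_Im_nonneg _ Hw Iw)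
      (Clog_Im_nonneg _ Hlw Ilw) (Clog_Im_bounds l) (Clog_Im_bounds w)
      (Clog_Im_bounds (l * w)%C); lra. }
replace (Clog (l * w)%C) with ((Clog (l * w)%C - (Clog l + Clog w)) + (Clog l + Clog w))%C
  by ring.
rewrite H; ring.
Qed.

Lemma Cder_Clog (f : R -> C) (t : R) (l : C) :
  slit (f t) -> Cder f t l -> Cder (fun s => Clog (f s)) t (l / f t)%C.
Proof.
intros Hs [Hp Hq].
assert (Hpos := slit_pos _ Hs); assert (Hm := Cmod_sq (f t)).
unfold slit in Hs.
assert (Hn : 0 < Re (f t) * Re (f t) + Im (f t) * Im (f t)) by nra.
assert (Hr : is_derive (fun s => Cmod (f s)) t
  ((Re (f t) * Re l + Im (f t) * Im l) / Cmod (f t))).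
{ unfold Cmod.
  apply is_derive_ext with
    (fun s => sqrt (Re (f s) * Re (f s) + Im (f s) * Im (f s))).
  { intros s; f_equal; unfold Re, Im; simpl; ring. }
  eapply is_derive_eq.
  - apply (is_derive_comp_R sqrt); [|apply is_derive_plus_R; apply is_derive_mult_R; eassumption].
    apply is_derive_Reals, derivable_pt_lim_sqrt, Hn.
  - replace (fst (f t) ^ 2 + snd (f t) ^ 2)
      with (Re (f t) * Re (f t) + Im (f t) * Im (f t)) by (unfold Re, Im; ring).
    field; apply Rgt_not_eq, sqrt_lt_R0, Hn. }
(* The derivative of [2 atan (q / (r + p))], with [dr = (p dp + q dq) / r], reduces to that of the
   polar angle. *)
assert (Hf : forall r p q dp dq : R, 0 < r -> 0 < r + p -> r * r = p * p + q * q ->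
  2 * (((dq * (r + p) - q * ((p * dp + q * dq) / r + dp)) / ((r + p) * (r + p)))
       / (1 + q / (r + p) * (q / (r + p)))) = (p * dq - q * dp) / (p * p + q * q)).
{ intros r p q dp dq H1 H2 H3.
  replace (1 + q / (r + p) * (q / (r + p)))
    with (((r + p) * (r + p) + q * q) / ((r + p) * (r + p))) by (field; lra).
  replace ((r + p) * (r + p) + q * q) with (2 * r * (r + p)) by nra.
  rewrite <- H3.
  replace (dq * (r + p) - q * ((p * dp + q * dq) / r + dp))
    with ((dq * (r * r - q * q) + dq * p * r - q * p * dp - q * r * dp) / r) by (field; lra).
  replace (r * r - q * q) with (p * p) by lra.
  field; lra. }
split.
- eapply is_derive_eq.
  + apply (is_derive_comp_R ln); [|exact Hr].
    apply is_derive_ln, Hpos.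
  + simpl.
    change (fst (f t)) with (Re (f t)); change (snd (f t)) with (Im (f t)).
    change (fst l) with (Re l); change (snd l) with (Im l).
    replace (Re (f t) * (Re (f t) * 1) + Im (f t) * (Im (f t) * 1))
      with (Cmod (f t) * Cmod (f t)) by (rewrite Hm; ring).
    field; lra.
- eapply is_derive_eq.
  + apply (is_derive_scal (fun s => atan (Im (f s) / (Cmod (f s) + Re (f s))))).
    apply (is_derive_comp_R atan); [apply is_derive_atan|].
    * apply (is_derive_div (fun s => Im (f s)) (fun s => Cmod (f s) + Re (f s))).
      -- exact Hq.
      -- apply is_derive_plus_R; [exact Hr|exact Hp].
      -- lra.
  + simpl; unfold Rsqr.
    change (fst (f t)) with (Re (f t)); change (snd (f t)) with (Im (f t)).
    change (fst l) with (Re l); change (snd l) with (Im l).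
    transitivity ((Re (f t) * Im l - Im (f t) * Re l)
                    / (Re (f t) * Re (f t) + Im (f t) * Im (f t))).
    * rewrite <- (Hf (Cmod (f t)) (Re (f t)) (Im (f t)) (Re l) (Im l) Hpos Hs Hm).
      field; repeat split; apply Rgt_not_eq; nra.
    * field; repeat split; apply Rgt_not_eq; nra.
Qed.

Lemma Clim_Clog (u : nat -> C) (l : C) :
  slit l -> Clim u l -> Clim (fun n => Clog (u n)) (Clog l).
Proof.
intros Hs H.
assert (HC := Clim_Cmod u l H); apply Clim_components in H; destruct H as [H1 H2].
apply Clim_components; split.
- apply (is_lim_seq_continuous ln); [|exact HC].
  apply derivable_continuous_pt; exists (/ Cmod l); apply derivable_pt_lim_ln, slit_pos, Hs.
- apply (is_lim_seq_scal_l _ 2 (atan (Im l / (Cmod l + Re l)))).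
  apply (is_lim_seq_continuous atan).
  + apply derivable_continuous_pt, derivable_pt_atan.
  + apply is_lim_seq_div'; [exact H2|apply is_lim_seq_plus'; assumption|].
    unfold slit in Hs; lra.
Qed.

(** * Two-dimensional Euler-Maclaurin estimate *)

(** The mixed second difference, formally [(e ^ (al D) - 1) (e ^ (be D) - 1) f] with [D] the
    derivation. Summed over a box it telescopes to the four corners. *)
Definition DD (f : C -> C) (al be w : C) : C :=
  (f w - f (w + al) - f (w + be) + f (w + al + be))%C.

(** Taylor coefficients of [(e ^ (al t) - 1) (e ^ (be t) - 1)]. *)
Definition dcoef (al be : C) (i : nat) : C :=
  (((al + be) ^ i - al ^ i - be ^ i + RtoC 0 ^ i) / RtoC (INR (fact i)))%C.

(** The constants [(2 |ga|) ^ K] of [chain_taylor], added over the three segments that [DD]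
    involves. *)
Definition dbound (al be : C) (K : nat) : R :=
  (2 * Cmod al) ^ K + (2 * Cmod be) ^ K + (2 * Cmod (al + be)%C) ^ K.

Lemma dbound_pos (al be : C) (K : nat) : 0 <= dbound al be K.
Proof.
unfold dbound.
assert (H : forall z, 0 <= (2 * Cmod z) ^ K).
{ intros z; apply pow_le; generalize (Cmod_ge_0 z); lra. }
generalize (H al) (H be) (H (al + be)%C); lra.
Qed.

Lemma Csum_triangle (f : nat -> nat -> C) (n : nat) :
  Csum (fun j => Csum (f j) (n - j)) n =
  Csum (fun l => Csum (fun j => f j (l - j)%nat) (S l)) n.
Proof.
induction n as [|n IH]; [reflexivity|].
rewrite (Csum_S (fun j => Csum (f j) (S n - j)%nat) n),
  (Csum_S (fun l => Csum (fun j => f j (l - j)%nat) (S l)) n), <- IH.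
rewrite (Csum_ext _ (fun j => (Csum (f j) (n - j) + f j (n - j)%nat)%C) n).
- rewrite Csum_plus, (Csum_S _ n), Nat.sub_succ_l, Nat.sub_diag by lia; simpl Csum; ring.
- intros k Hk; rewrite Nat.sub_succ_l by lia; reflexivity.
Qed.

Lemma INR_fact_ge_1 (K : nat) : 1 <= INR (fact K).
Proof. apply (le_INR 1); generalize (lt_O_fact K); lia. Qed.

Section EulerMaclaurin.

Variables (E : nat -> C -> C) (al be w : C) (B : R).

(** Each member of the family is the derivative of the preceding one. The abstraction serves both
    the logarithmic chain [LE] and the power chain [ZE s]. *)
Definition chain_on (ga : C) : Prop :=
  forall i t, 0 <= t <= 1 ->
    Cder (fun s => E i (w + RtoC s * ga)%C) t (ga * E (S i) (w + RtoC t * ga))%C.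

Definition bounded_on (n : nat) (ga : C) : Prop :=
  forall t, 0 <= t <= 1 -> Cmod (E n (w + RtoC t * ga)%C) <= B.

Lemma chain_taylor (ga : C) (j K : nat) : chain_on ga -> bounded_on (j + K) ga ->
  Cmod (E j (w + ga) - taylor ga (fun i => E (j + i)%nat w) K)%C <= (2 * Cmod ga) ^ K * B.
Proof.
intros H1 H2.
assert (HB : 0 <= B) by (eapply Rle_trans; [apply Cmod_ge_0|apply (H2 0); lra]).
generalize (taylor_remainder_1 (fun i t => E i (w + RtoC t * ga)%C) ga B K j H1 H2).
replace (w + RtoC 1 * ga)%C with (w + ga)%C by ring.
replace (w + RtoC 0 * ga)%C with w by ring.
intros H; eapply Rle_trans; [exact H|].
apply Rle_div_l; [apply Rlt_gt, (Rlt_le_trans _ 1); [lra|apply INR_fact_ge_1]|].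
rewrite <- (Rmult_1_r ((2 * Cmod ga) ^ K * B)) at 1.
apply Rmult_le_compat_l; [|apply INR_fact_ge_1].
apply Rmult_le_pos; [apply pow_le; generalize (Cmod_ge_0 ga); lra|exact HB].
Qed.

Hypotheses (chain_al : chain_on al) (chain_be : chain_on be) (chain_albe : chain_on (al + be)%C).

Lemma DD_taylor (j K : nat) : (0 < K)%nat ->
  bounded_on (j + K) al -> bounded_on (j + K) be -> bounded_on (j + K) (al + be)%C ->
  Cmod (DD (E j) al be w - Csum (fun i => dcoef al be i * E (j + i)%nat w)%C K)%C
    <= dbound al be K * B.
Proof.
intros HK H1 H2 H3.
set (e := fun i => E (j + i)%nat w).
assert (Hs : Csum (fun i => (dcoef al be i * e i)%C) K =
  (taylor (al + be)%C e K - taylor al e K - taylor be e K + e O)%C).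
{ unfold taylor; transitivity (Csum (fun i => ((al + be) ^ i / RtoC (INR (fact i)) * e i
      - al ^ i / RtoC (INR (fact i)) * e i - be ^ i / RtoC (INR (fact i)) * e i)
      + RtoC 0 ^ i / RtoC (INR (fact i)) * e i)%C K).
  - apply Csum_ext; intros k _; unfold dcoef, Cdiv; ring.
  - rewrite Csum_plus, !Csum_minus; f_equal.
    rewrite (Csum_single _ K 0 HK).
    + simpl; field; apply C1_nz.
    + intros [|k] _ Hk; [congruence|]; rewrite Cpow_S; unfold Cdiv; ring. }
change (fun i => (dcoef al be i * E (j + i)%nat w)%C) with (fun i => (dcoef al be i * e i)%C).
rewrite Hs; unfold DD.
replace (w + al + be)%C with (w + (al + be))%C by ring.
assert (He : e O = E j w) by (unfold e; rewrite Nat.add_0_r; reflexivity).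
rewrite He.
replace (E j w - E j (w + al) - E j (w + be) + E j (w + (al + be))
    - (taylor (al + be) e K - taylor al e K - taylor be e K + E j w))%C
  with ((E j (w + (al + be)) - taylor (al + be) e K)
     + (- (E j (w + al) - taylor al e K) + - (E j (w + be) - taylor be e K)))%C by ring.
eapply Rle_trans; [apply Cmod_triangle|].
generalize (Cmod_triangle (- (E j (w + al) - taylor al e K)) (- (E j (w + be) - taylor be e K))).
rewrite !Cmod_opp.
generalize (chain_taylor _ j K chain_al H1) (chain_taylor _ j K chain_be H2)
  (chain_taylor _ j K chain_albe H3).
fold e; unfold dbound; nra.
Qed.

(** The hypothesis on [a] says that it inverts, up to order [N], the power series of the operator
    [DD], which starts in degree 2. Hence the combination of the [DD (E j)] reproduces [E 2] up to
    terms in [E (N + 3)]. *)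
Lemma euler_maclaurin (a : nat -> C) (N : nat) :
  (forall l, (l <= N)%nat ->
     Csum (fun j => (a j * dcoef al be (S (S (l - j))))%C) (S l) =
     if Nat.eqb l 0 then RtoC 1 else RtoC 0) ->
  bounded_on (N + 3) al -> bounded_on (N + 3) be -> bounded_on (N + 3) (al + be)%C ->
  Cmod (E 2 w - Csum (fun j => a j * DD (E j) al be w)%C (S N))%C
    <= Rsum (fun j => Cmod (a j) * dbound al be (N + 3 - j)) (S N) * B.
Proof.
intros Ha H1 H2 H3.
(* The [j]-th expansion is cut at [N + 3 - j], so that every remainder involves the same
   [E (N + 3)]. *)
assert (HE2 : E 2 w = Csum (fun j =>
  (a j * Csum (fun i => dcoef al be i * E (j + i)%nat w)%C (N + 3 - j))%C) (S N)).
{ transitivity (Csum (fun j => Csum (fun i =>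
      (a j * dcoef al be (S (S i)) * E (S (S (j + i))) w)%C) (S N - j)) (S N)).
  - rewrite (Csum_triangle (fun j i => (a j * dcoef al be (S (S i)) * E (S (S (j + i))) w)%C)).
    rewrite (Csum_single _ (S N) 0); [|lia|].
    + replace (E 2 w) with (RtoC 1 * E 2 w)%C by ring.
      generalize (Ha 0%nat ltac:(lia)); simpl; intros <-; ring.
    + intros k Hk Hk0.
      rewrite (Csum_ext _ (fun j => (E (S (S k)) w * (a j * dcoef al be (S (S (k - j)))))%C)).
      * rewrite Csum_scal, Ha by lia; destruct k; [lia|simpl; ring].
      * intros j Hj; replace (j + (k - j))%nat with k by lia; ring.
  - apply Csum_ext; intros j Hj.
    replace (N + 3 - j)%nat with (S (S (S N - j))) by lia.
    rewrite !Csum_shift.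
    rewrite (Csum_ext _ (fun i => (a j * (dcoef al be (S (S i)) * E (j + S (S i))%nat w))%C)).
    + rewrite Csum_scal.
      replace (dcoef al be 0) with (RtoC 0) by (unfold dcoef; simpl; field; apply C1_nz).
      replace (dcoef al be 1) with (RtoC 0) by (unfold dcoef; simpl; field; apply C1_nz).
      ring.
    + intros i _; replace (j + S (S i))%nat with (S (S (j + i))) by lia; ring. }
rewrite HE2, <- Csum_minus, Rmult_comm, <- Rsum_scal.
apply Cmod_Csum_le; intros j Hj.
replace (_ - _)%C with (- (a j * (DD (E j) al be w
   - Csum (fun i => dcoef al be i * E (j + i)%nat w) (N + 3 - j))))%C by ring.
rewrite Cmod_opp, Cmod_mult.
replace (B * (Cmod (a j) * dbound al be (N + 3 - j)))
  with (Cmod (a j) * (dbound al be (N + 3 - j) * B)) by ring.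
apply Rmult_le_compat_l; [apply Cmod_ge_0|].
apply DD_taylor; [lia| | |]; replace (j + (N + 3 - j))%nat with (N + 3)%nat by lia; assumption.
Qed.

End EulerMaclaurin.

(** * The Euler-Maclaurin correction of the logarithm *)

(** The chain [LE (S j) = (LE j)'] through [LE 2 = Clog]. *)
Definition LE (j : nat) (w : C) : C :=
  match j with
  | 0%nat => (w * w / RtoC 2 * Clog w - RtoC (3 / 4) * (w * w))%C
  | 1%nat => (w * Clog w - w)%C
  | 2%nat => Clog w
  | S (S (S k)) => (RtoC ((-1) ^ k * INR (fact k)) * (/ w) ^ S k)%C
  end.

Lemma Cder_inv (f : R -> C) (t : R) (l : C) :
  f t <> RtoC 0 -> Cder f t l -> Cder (fun s => (/ f s)%C) t (- (l * (/ f t) * (/ f t)))%C.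
Proof.
intros Hf [Hp Hq].
assert (Hn : Re (f t) ^ 2 + Im (f t) ^ 2 <> 0).
{ rewrite <- Cmod2_alt; apply pow_nonzero; intros H; apply Hf, Cmod_eq_0, H. }
assert (Hd : is_derive (fun s => Re (f s) ^ 2 + Im (f s) ^ 2) t
  (2 * (Re (f t) * Re l + Im (f t) * Im l))).
{ apply is_derive_ext with (fun s => Re (f s) * Re (f s) + Im (f s) * Im (f s)).
  { intros s; simpl; ring. }
  eapply is_derive_eq.
  - apply is_derive_plus_R; apply is_derive_mult_R; eassumption.
  - simpl; ring. }
unfold Re, Im in *.
split; simpl.
- eapply is_derive_eq.
  + apply (is_derive_div (fun s => fst (f s))); [exact Hp|exact Hd|exact Hn].
  + simpl; field; simpl in Hn; rewrite !Rmult_1_r in Hn; exact Hn.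
- eapply is_derive_eq.
  + apply (is_derive_div (fun s => - snd (f s))).
    * apply (is_derive_opp (K := R_AbsRing) (V := R_NormedModule)); exact Hq.
    * exact Hd.
    * exact Hn.
  + unfold opp; simpl; field; simpl in Hn; rewrite !Rmult_1_r in Hn; exact Hn.
Qed.

Lemma Cder_LE (w ga : C) (t : R) (j : nat) : slit (w + RtoC t * ga)%C ->
  Cder (fun s => LE j (w + RtoC s * ga)%C) t (ga * LE (S j) (w + RtoC t * ga))%C.
Proof.
intros Hs; assert (Hz := slit_neq0 _ Hs).
assert (Hl := Cder_line w ga t).
assert (Hlog := Cder_Clog _ t ga Hs Hl).
destruct j as [|[|[|k]]]; unfold LE.
- eapply Cder_eq.
  + apply Cder_minus.
    * apply Cder_mult; [|exact Hlog].
      apply (Cder_ext (fun s => (/ RtoC 2 * ((w + RtoC s * ga) * (w + RtoC s * ga)))%C)).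
      { intros s; unfold Cdiv; ring. }
      apply Cder_scal, Cder_mult; exact Hl.
    * apply Cder_scal, Cder_mult; exact Hl.
  + cbv beta; rewrite RtoC_div by lra; field.
    repeat split; try exact Hz; apply RtoC_neq0; lra.
- eapply Cder_eq.
  + apply Cder_minus; [|exact Hl]; apply Cder_mult; [exact Hl|exact Hlog].
  + cbv beta; field; exact Hz.
- eapply Cder_eq; [exact Hlog|].
  replace (RtoC ((-1) ^ 0 * INR (fact 0))) with (RtoC 1) by (simpl; f_equal; ring).
  rewrite Cpow_1_r; field; exact Hz.
- eapply Cder_eq.
  + apply Cder_scal, Cder_pow, Cder_inv; [exact Hz|exact Hl].
  + cbv beta; rewrite (fact_simpl k), mult_INR.
    replace ((-1) ^ S k * (INR (S k) * INR (fact k)))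
      with ((-1) ^ k * INR (fact k) * - INR (S k)) by (simpl ((-1) ^ S k); ring).
    rewrite (RtoC_mult ((-1) ^ k * INR (fact k))), RtoC_opp, !Cpow_S; ring.
Qed.

(** Laurent coefficients of [1 / ((e ^ (al t) - 1) (e ^ (be t) - 1))], from [t ^ (-2)] on. *)
Definition acoef (al be : C) (j : nat) : C :=
  match j with
  | 0%nat => (/ (al * be))%C
  | 1%nat => (- (al + be) / (RtoC 2 * al * be))%C
  | 2%nat => ((al * al + be * be + RtoC 3 * al * be) / (RtoC 12 * al * be))%C
  | 3%nat => (- (al + be) / RtoC 24)%C
  | _ => RtoC 0
  end.

Lemma acoef_spec (al be : C) : al <> RtoC 0 -> be <> RtoC 0 ->
  forall l, (l <= 3)%nat ->
  Csum (fun j => (acoef al be j * dcoef al be (S (S (l - j))))%C) (S l) =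
  if Nat.eqb l 0 then RtoC 1 else RtoC 0.
Proof.
intros Ha Hb l Hl.
assert (H2 : RtoC 2 <> RtoC 0) by (apply RtoC_neq0; lra).
assert (H6 : RtoC 6 <> RtoC 0) by (apply RtoC_neq0; lra).
assert (H12 : RtoC 12 <> RtoC 0) by (apply RtoC_neq0; lra).
assert (H24 : RtoC 24 <> RtoC 0) by (apply RtoC_neq0; lra).
assert (H120 : RtoC 120 <> RtoC 0) by (apply RtoC_neq0; lra).
destruct l as [|[|[|[|l]]]]; [| | | |lia]; unfold dcoef; cbn [Csum acoef Nat.sub Nat.eqb];
  change (fact 2) with 2%nat; change (fact 3) with 6%nat; change (fact 4) with 24%nat;
  change (fact 5) with 120%nat; rewrite !INR_IZR_INZ; cbn [Z.of_nat Pos.of_succ_nat Pos.succ];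
  cbn [Cpow]; field; repeat split; assumption.
Qed.

(** The sign makes [DD] of [hh] cancel [Clog] to leading orders. Keeping four terms leaves a
    remainder governed by [LE 6], of modulus [6 |w| ^ (- 4)], more than a rank two lattice
    requires. *)
Definition hh (al be w : C) : C := (- Csum (fun j => acoef al be j * LE j w)%C 4)%C.

(** The Euler-Maclaurin term [hh] makes [cc] of size [O(|w| ^ (-4))], so that [cc] is
    summable over a lattice cone while the [DD] part telescopes. *)
Definition cc (al be w : C) : C := (Clog w + DD (hh al be) al be w)%C.

Definition ccst (al be : C) : R :=
  Rsum (fun j => Cmod (acoef al be j) * dbound al be (6 - j)) 4.

Lemma ccst_pos (al be : C) : 0 <= ccst al be.
Proof.
apply Rsum_pos; intros k; apply Rmult_le_pos; [apply Cmod_ge_0|apply dbound_pos].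
Qed.

Lemma cc_bound (al be w : C) (rho : R) : al <> RtoC 0 -> be <> RtoC 0 -> 0 < rho ->
  (forall ga t, ga = al \/ ga = be \/ ga = (al + be)%C -> 0 <= t <= 1 ->
     slit (w + RtoC t * ga)%C /\ rho <= Cmod (w + RtoC t * ga)%C) ->
  Cmod (cc al be w) <= ccst al be * (6 / rho ^ 4).
Proof.
intros Ha Hb Hr H.
replace (cc al be w) with (LE 2 w - Csum (fun j => acoef al be j * DD (LE j) al be w)%C 4)%C.
2:{ unfold cc, hh, DD; simpl Csum; change (LE 2 w) with (Clog w); ring. }
assert (HB : forall ga, ga = al \/ ga = be \/ ga = (al + be)%C ->
  bounded_on LE w (6 / rho ^ 4) (3 + 3) ga).
{ intros ga Hga t Ht; destruct (H ga t Hga Ht) as [Hs Hrho].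
  change (3 + 3)%nat with 6%nat; unfold LE.
  rewrite Cmod_mult, Cmod_R, Cmod_pow, Cmod_inv by (apply slit_neq0, Hs).
  replace (Rabs ((-1) ^ 3 * INR (fact 3))) with 6.
  2:{ simpl; rewrite Rabs_left; lra. }
  apply Rmult_le_compat_l; [lra|].
  rewrite <- pow_inv; apply pow_incr; split.
  - apply Rlt_le, Rinv_0_lt_compat; lra.
  - apply Rinv_le_contravar; assumption. }
assert (HC : forall ga, ga = al \/ ga = be \/ ga = (al + be)%C -> chain_on LE w ga).
{ intros ga Hga i t Ht; apply Cder_LE, (H ga t Hga Ht). }
apply (euler_maclaurin LE al be w (6 / rho ^ 4)) with (N := 3%nat); auto.
apply acoef_spec; assumption.
Qed.

(** * Finite products and the sine product *)

Lemma Cprod_S (f : nat -> C) (n : nat) : Cprod f (S n) = (Cprod f n * f n)%C.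
Proof. reflexivity. Qed.

Lemma Cprod_ext (f g : nat -> C) (n : nat) :
  (forall k, (k < n)%nat -> f k = g k) -> Cprod f n = Cprod g n.
Proof.
induction n as [|n IH]; intros H; simpl; [reflexivity|].
rewrite IH, (H n) by (intros; try apply H; lia); reflexivity.
Qed.

Lemma Cprod_mult (f g : nat -> C) (n : nat) :
  Cprod (fun k => (f k * g k)%C) n = (Cprod f n * Cprod g n)%C.
Proof. induction n as [|n IH]; simpl; [|rewrite IH]; ring. Qed.

Lemma Cprod_const (c : C) (n : nat) : Cprod (fun _ => c) n = (c ^ n)%C.
Proof. induction n as [|n IH]; [reflexivity|]; rewrite Cprod_S, IH, Cpow_S; ring. Qed.

Lemma Cprod_split (f : nat -> C) (n m : nat) :
  Cprod f (n + m) = (Cprod f n * Cprod (fun k => f (n + k)%nat) m)%C.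
Proof.
induction m as [|m IH]; [rewrite Nat.add_0_r; simpl; ring|].
rewrite Nat.add_succ_r; simpl; rewrite IH; ring.
Qed.

Lemma Cprod_shift (f : nat -> C) (n : nat) :
  Cprod f (S n) = (f O * Cprod (fun k => f (S k)) n)%C.
Proof.
change (S n) with (1 + n)%nat; rewrite Cprod_split; simpl Cprod at 1; ring_simplify.
reflexivity.
Qed.

Lemma Cprod_rev (f : nat -> C) (n : nat) :
  Cprod f n = Cprod (fun k => f (n - 1 - k)%nat) n.
Proof.
induction n as [|n IH]; [reflexivity|].
rewrite (Cprod_shift (fun k => f (S n - 1 - k)%nat)), Cprod_S, IH, Cmult_comm.
f_equal; [f_equal; lia|].
apply Cprod_ext; intros k Hk; f_equal; lia.
Qed.

Lemma Cprod_neq0 (f : nat -> C) (n : nat) :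
  (forall k, (k < n)%nat -> f k <> RtoC 0) -> Cprod f n <> RtoC 0.
Proof.
induction n as [|n IH]; intros H; simpl; [apply C1_nz|].
apply Cmult_neq_0; [apply IH; intros; apply H; lia|apply H; lia].
Qed.

Lemma Cprod_div (f g : nat -> C) (n : nat) :
  (forall k, (k < n)%nat -> g k <> RtoC 0) ->
  Cprod (fun k => (f k / g k)%C) n = (Cprod f n / Cprod g n)%C.
Proof.
induction n as [|n IH]; intros H; simpl; [field; apply C1_nz|].
rewrite IH by (intros; apply H; lia).
field; split; [apply H; lia|apply Cprod_neq0; intros; apply H; lia].
Qed.

Lemma Cprod_near_1 (f : nat -> C) (n : nat) (delta : R) :
  (forall k, (k < n)%nat -> Cmod (f k - 1)%C <= delta) -> 0 <= delta ->
  Cmod (Cprod f n - 1)%C <= exp (INR n * delta) - 1.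
Proof.
intros H Hd.
assert (H1 : Cmod (Cprod f n - 1)%C <= (1 + delta) ^ n - 1).
{ induction n as [|n IH].
  - simpl; replace (1 - 1)%C with (RtoC 0) by ring; rewrite Cmod_0; lra.
  - rewrite Cprod_S.
    replace (Cprod f n * f n - 1)%C
      with ((Cprod f n - 1) * (f n - 1) + ((Cprod f n - 1) + (f n - 1)))%C by ring.
    specialize (IH (fun k Hk => H k (Nat.lt_lt_succ_r _ _ Hk))).
    specialize (H n (Nat.lt_succ_diag_r n)).
    eapply Rle_trans; [apply Cmod_triangle|].
    generalize (Cmod_triangle (Cprod f n - 1)%C (f n - 1)%C); rewrite Cmod_mult.
    intros H2; simpl pow.
    assert (Cmod (Cprod f n - 1)%C * Cmod (f n - 1)%C <= ((1 + delta) ^ n - 1) * delta).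
    { apply Rmult_le_compat; try apply Cmod_ge_0; assumption. }
    lra. }
eapply Rle_trans; [exact H1|].
apply Rplus_le_compat_r.
replace (exp (INR n * delta)) with (exp delta ^ n).
- apply pow_incr; split; [lra|].
  generalize (exp_ineq1_le delta); lra.
- clear; induction n as [|n IH]; [simpl; rewrite Rmult_0_l, exp_0; reflexivity|].
  rewrite S_INR, Rmult_plus_distr_r, exp_plus, Rmult_1_l; simpl; rewrite IH; ring.
Qed.

(** * Factorisation of [1 - e2 w] over roots of unity *)

Definition e2 (w : C) : C := Cexp (RtoC (2 * PI) * Ci * w)%C.

Lemma e2_plus (w z : C) : e2 (w + z)%C = (e2 w * e2 z)%C.
Proof. unfold e2; rewrite <- Cexp_plus; f_equal; ring. Qed.

Lemma e2_nat (n : nat) : e2 (RtoC (INR n)) = RtoC 1.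
Proof. apply Cexp_2PI_nat. Qed.

Lemma e2_Z (n : Z) : e2 (RtoC (IZR n)) = RtoC 1.
Proof. apply Cexp_2PI. Qed.

Lemma e2_neq0 (w : C) : e2 w <> RtoC 0.
Proof. apply Cexp_neq0. Qed.

Lemma e2_half : e2 (RtoC (/ 2)) = (- (1))%C.
Proof.
unfold e2, Cexp; simpl.
replace (_ - _) with 0 by ring; replace (_ + _) with PI by field.
rewrite cos_PI, sin_PI, exp_0; apply injective_projections; simpl; ring.
Qed.

Lemma INR_pow2 (n : nat) : INR (2 ^ n) = 2 ^ n.
Proof. rewrite pow_INR; reflexivity. Qed.

Lemma pow2_pos (n : nat) : 0 < 2 ^ n.
Proof. apply pow_lt; lra. Qed.

(** Iterates [1 - X ^ 2 = (1 - X) (1 + X)] with [-1 = e2 (/ 2)]. Orders that are powers of two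
    suffice for the limit and make this one identity enough. *)
Lemma e2_product (w : C) (n : nat) :
  (1 - e2 w)%C = Cprod (fun j => (1 - e2 ((w + RtoC (INR j)) / RtoC (2 ^ n)))%C) (2 ^ n).
Proof.
induction n as [|n IH].
- simpl; replace ((w + 0) / 1)%C with w by (field; apply C1_nz); ring.
- assert (H2 : RtoC 2 <> RtoC 0) by (apply RtoC_neq0; lra).
  assert (Hn : RtoC (2 ^ n) <> RtoC 0) by (apply RtoC_neq0, Rgt_not_eq, pow2_pos).
  replace (2 ^ S n)%nat with (2 ^ n + 2 ^ n)%nat by (simpl; lia).
  rewrite Cprod_split, <- Cprod_mult, IH.
  apply Cprod_ext; intros j _.
  change (2 ^ S n) with (2 * 2 ^ n); rewrite RtoC_mult.
  rewrite plus_INR, INR_pow2, RtoC_plus.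
  replace ((w + (RtoC (2 ^ n) + RtoC (INR j))) / (RtoC 2 * RtoC (2 ^ n)))%C
    with ((w + RtoC (INR j)) / (RtoC 2 * RtoC (2 ^ n)) + RtoC (/ 2))%C.
  2:{ rewrite RtoC_inv by lra; field; repeat split; assumption. }
  replace ((w + RtoC (INR j)) / RtoC (2 ^ n))%C
    with ((w + RtoC (INR j)) / (RtoC 2 * RtoC (2 ^ n)) + (w + RtoC (INR j)) / (RtoC 2 * RtoC (2 ^ n)))%C
    by (field; repeat split; assumption).
  rewrite !e2_plus, e2_half; ring.
Qed.

(** Two conjugate roots of unity are combined and the value at [X = 1] is pulled out; the normalised
    factor that remains approximates a factor of Euler's sine product. *)
Lemma e2_conj_pair (x : R) (X : C) : X <> RtoC 0 -> sin (PI * x) <> 0 ->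
  ((1 - X * e2 (RtoC x)) * (1 - X * e2 (- RtoC x)))%C =
  (RtoC (4 * sin (PI * x) ^ 2) * X *
    (1 + (X + / X - RtoC 2) / RtoC 4 / RtoC (sin (PI * x) ^ 2)))%C.
Proof.
intros HX Hs.
assert (H1 : (e2 (RtoC x) * e2 (- RtoC x))%C = RtoC 1).
{ rewrite <- e2_plus; replace (RtoC x + - RtoC x)%C with (RtoC (INR 0)) by (simpl; ring).
  apply e2_nat. }
assert (H2 : (e2 (RtoC x) + e2 (- RtoC x))%C = (RtoC 2 - RtoC 4 * RtoC (sin (PI * x) ^ 2))%C).
{ unfold e2, Cexp; simpl.
  replace (2 * PI * 0 - 0 * 1) with 0 by ring.
  repeat match goal with |- context [exp ?t] =>
    lazymatch t with 0 => fail | _ => replace t with 0 by ring end end.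
  rewrite exp_0.
  repeat match goal with |- context [cos ?t] =>
    lazymatch t with
    | 2 * (PI * x) => fail
    | - (2 * (PI * x)) => fail
    | _ => first [replace t with (2 * (PI * x)) by ring | replace t with (- (2 * (PI * x))) by ring]
    end end.
  repeat match goal with |- context [sin ?t] =>
    lazymatch t with
    | 2 * (PI * x) => fail
    | PI * x => fail
    | - (2 * (PI * x)) => fail
    | _ => first [replace t with (2 * (PI * x)) by ring | replace t with (- (2 * (PI * x))) by ring]
    end end.
  rewrite cos_neg, sin_neg, cos_2a_sin; apply injective_projections; simpl; ring. }
assert (Hs' : RtoC (sin (PI * x) ^ 2) <> RtoC 0) by (apply RtoC_neq0, pow_nonzero, Hs).
assert (H4 : RtoC 4 <> RtoC 0) by (apply RtoC_neq0; lra).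
replace ((1 - X * e2 (RtoC x)) * (1 - X * e2 (- RtoC x)))%C
  with (1 - X * (e2 (RtoC x) + e2 (- RtoC x)) + X * X * (e2 (RtoC x) * e2 (- RtoC x)))%C by ring.
rewrite H1, H2, RtoC_mult; field; repeat split; assumption.
Qed.

Lemma sin_grid_pos (H j : nat) : (j < H)%nat -> 0 < sin (PI * (INR (S j) / (2 * INR (S H)))).
Proof.
intros Hj.
assert (0 < INR (S H)) by (apply lt_0_INR; lia).
assert (0 < INR (S j)) by (apply lt_0_INR; lia).
assert (INR (S j) < INR (S H)) by (apply lt_INR; lia).
assert (0 < INR (S j) / (2 * INR (S H)) < / 2).
{ split; [apply Rdiv_lt_0_compat; lra|].
  apply Rmult_lt_reg_r with (2 * INR (S H)); [lra|].
  replace (/ 2 * (2 * INR (S H))) with (INR (S H)) by field.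
  unfold Rdiv; rewrite Rmult_assoc, Rinv_l by lra; lra. }
assert (HP := PI_RGT_0).
apply sin_gt_0; nra.
Qed.

(** The product over all residues, folded by [j <-> - j]. *)
Lemma e2_product_folded (w : C) (n H : nat) : S H = (2 ^ n)%nat ->
  let M := (2 * INR (S H)) in
  let X := e2 (w / RtoC M) in
  (1 - e2 w)%C =
  ((1 - X * X) * X ^ H * Cprod (fun j => RtoC (4 * sin (PI * (INR (S j) / M)) ^ 2)) H *
   Cprod (fun j => 1 + (X + / X - RtoC 2) / RtoC 4 /
                        RtoC (sin (PI * (INR (S j) / M)) ^ 2)) H)%C.
Proof.
intros HH M X.
assert (HM : M = 2 ^ S n).
{ unfold M; rewrite HH, INR_pow2; reflexivity. }
assert (HM0 : 0 < M) by (rewrite HM; apply pow2_pos).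
assert (HMC : RtoC M <> RtoC 0) by (apply RtoC_neq0; lra).
rewrite (e2_product w (S n)), <- HM.
replace (2 ^ S n)%nat with (S H + S H)%nat by (simpl; lia).
rewrite Cprod_split.
assert (Hf : forall x, (1 - e2 ((w + RtoC x) / RtoC M))%C = (1 - X * e2 (RtoC (x / M)))%C).
{ intros x; unfold X; rewrite <- e2_plus; do 2 f_equal.
  rewrite RtoC_div by lra; field; exact HMC. }
rewrite (Cprod_ext _ (fun j => (1 - X * e2 (RtoC (INR j / M)))%C) (S H)) by (intros; apply Hf).
rewrite (Cprod_ext (fun k => (1 - e2 ((w + RtoC (INR (S H + k))) / RtoC M))%C)
  (fun k => (1 - X * e2 (RtoC (INR (S H + k) / M)))%C) (S H)) by (intros; apply Hf).
rewrite !Cprod_shift.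
rewrite (Cprod_rev (fun k => (1 - X * e2 (RtoC (INR (S H + S k) / M)))%C) H).
rewrite (Cprod_ext (fun k => (1 - X * e2 (RtoC (INR (S H + S (H - 1 - k)) / M)))%C)
  (fun j => (1 - X * e2 (- RtoC (INR (S j) / M)))%C) H).
2:{ intros k Hk; do 2 f_equal.
  replace (RtoC (INR (S H + S (H - 1 - k)) / M)) with (- RtoC (INR (S k) / M) + RtoC (INR 1))%C.
  - rewrite e2_plus, e2_nat; ring.
  - rewrite <- RtoC_opp, <- RtoC_plus; f_equal.
    replace (S H + S (H - 1 - k))%nat with (S H + S H - S k)%nat by lia.
    rewrite minus_INR, plus_INR by lia; unfold M; simpl (INR 1); field.
    unfold M in HM0; lra. }
replace (RtoC (INR 0 / M)) with (RtoC (INR 0)) by (f_equal; simpl; field; lra).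
rewrite e2_nat, Nat.add_0_r.
replace (INR (S H) / M) with (/ 2) by (unfold M; field; unfold M in HM0; lra).
rewrite e2_half.
transitivity ((1 - X * X) * Cprod (fun j => (1 - X * e2 (RtoC (INR (S j) / M))) *
   (1 - X * e2 (- RtoC (INR (S j) / M)))) H)%C.
- rewrite Cprod_mult; ring.
- rewrite (Cprod_ext _ (fun j => ((X * RtoC (4 * sin (PI * (INR (S j) / M)) ^ 2)) *
     (1 + (X + / X - RtoC 2) / RtoC 4 / RtoC (sin (PI * (INR (S j) / M)) ^ 2)))%C)).
  + rewrite !Cprod_mult, Cprod_const; ring.
  + intros k Hk; rewrite e2_conj_pair; [ring|apply e2_neq0|].
    apply Rgt_not_eq, sin_grid_pos, Hk.
Qed.

(** * Comparison of the finite products with Euler's product *)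

Lemma sin_cubic (t : R) : 0 <= t -> t - sin t <= t ^ 3 / 6.
Proof.
intros Ht.
assert (H : (fun u => t * u - sin (t * u)) 1 <= (t ^ 3 / 2) * 1 ^ 3 / INR 3).
(* The derivative in [u] is at most [t ^ 3 u ^ 2 / 2], by the half-angle formula and [|sin v| <= v]
   for [v >= 0]. *)
{ apply (is_derive_growth (fun u => t * u - sin (t * u)) (fun u => t * (1 - cos (t * u)))
           (t ^ 3 / 2) 2); [| | |lra].
  - intros u _; auto_derive; [exact I|ring].
  - intros u Hu.
    replace (t * u) with (2 * (t * u / 2)) by field; rewrite cos_2a_sin.
    assert (Hs : sin (t * u / 2) * sin (t * u / 2) <= (t * u / 2) * (t * u / 2)).
    { assert (Hx : 0 <= t * u / 2) by (apply Rmult_le_pos; [apply Rmult_le_pos|]; lra).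
      assert (H1 : Rabs (sin (t * u / 2)) <= t * u / 2).
      { apply Rabs_le; split.
        - destruct Hx as [Hx|<-]; [|rewrite sin_0; lra].
          generalize (sin_lt_x (t * u / 2) Hx) (SIN_bound (t * u / 2)); intros.
          destruct (Rle_or_lt (t * u / 2) PI) as [Hp|Hp].
          + generalize (sin_ge_0 (t * u / 2) (Rlt_le _ _ Hx) Hp); lra.
          + generalize PI2_1; lra.
        - destruct Hx as [Hx|<-]; [|rewrite sin_0; lra].
          generalize (sin_lt_x _ Hx); lra. }
      apply Rsqr_le_abs_1; rewrite (Rabs_pos_eq (t * u / 2)) by exact Hx; exact H1. }
    assert (t * (2 * (sin (t * u / 2) * sin (t * u / 2))) <= t * (2 * ((t * u / 2) * (t * u / 2)))).
    { apply Rmult_le_compat_l; lra. }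
    lra.
  - rewrite Rmult_0_r, sin_0; ring. }
simpl in H |- *; rewrite !Rmult_1_r in H; lra.
Qed.

(** Since [t <= 2], the cubic bound gives [sin t >= t / 3] as well as
    [t ^ 2 - sin t ^ 2 <= t ^ 4 / 3]; the quotient of [t ^ 4 / 3] by [t ^ 4 / 9] is 3. *)
Lemma inv_sin_sq_bound (t : R) : 0 < t <= PI / 2 -> Rabs (/ sin t ^ 2 - / t ^ 2) <= 3.
Proof.
intros Ht; assert (H4 := PI_4).
assert (H1 := sin_cubic t ltac:(lra)).
assert (H2 := sin_lt_x t ltac:(lra)).
assert (H3 : t / 3 <= sin t) by (simpl in H1; nra).
assert (Hs : 0 < sin t) by lra.
replace (/ sin t ^ 2 - / t ^ 2) with ((t - sin t) * (t + sin t) / (sin t ^ 2 * t ^ 2))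
  by (field; lra).
rewrite Rabs_pos_eq.
2:{ apply Rmult_le_pos; [apply Rmult_le_pos; lra|].
    apply Rlt_le, Rinv_0_lt_compat, Rmult_lt_0_compat; apply pow_lt; lra. }
apply Rle_div_l; [apply Rmult_lt_0_compat; apply pow_lt; lra|].
assert ((t - sin t) * (t + sin t) <= t ^ 3 / 6 * (2 * t)).
{ apply Rmult_le_compat; lra. }
assert (t / 3 * (t / 3) <= sin t * sin t) by (apply Rmult_le_compat; lra).
assert (t / 3 * (t / 3) * t ^ 2 <= sin t * sin t * t ^ 2).
{ apply Rmult_le_compat_r; [apply pow_le; lra|assumption]. }
simpl in *; lra.
Qed.

(** The odd terms cancel between the expansions at [xi] and [- xi], so the error is of order 4. *)
Lemma Cexp_even_taylor (xi : C) :
  Cmod ((Cexp xi + / Cexp xi - RtoC 2) / RtoC 4 - xi * xi / RtoC 4)%C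
    <= Cmod xi ^ 4 * exp (Cmod xi).
Proof.
assert (H1 := Cexp_taylor xi 4); assert (H2 := Cexp_taylor (- xi)%C 4).
rewrite Cmod_opp in H2.
assert (H4 : RtoC 4 <> RtoC 0) by (apply RtoC_neq0; lra).
replace ((Cexp xi + / Cexp xi - RtoC 2) / RtoC 4 - xi * xi / RtoC 4)%C
  with (RtoC (/ 4) * ((Cexp xi - taylor xi (fun _ => RtoC 1) 4) +
        (Cexp (- xi) - taylor (- xi)%C (fun _ => RtoC 1) 4)))%C.
- rewrite Cmod_mult, Cmod_R, Rabs_pos_eq by lra.
  generalize (Cmod_triangle (Cexp xi - taylor xi (fun _ => RtoC 1) 4)
    (Cexp (- xi) - taylor (- xi)%C (fun _ => RtoC 1) 4)).
  assert (E : (2 * Cmod xi) ^ 4 * exp (Cmod xi) / INR (fact 4) = 2 / 3 * (Cmod xi ^ 4 * exp (Cmod xi))).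
  { simpl; field. }
  rewrite E in H1, H2.
  assert (0 <= Cmod xi ^ 4 * exp (Cmod xi)).
  { apply Rmult_le_pos; [apply pow_le, Cmod_ge_0|apply Rlt_le, exp_pos]. }
  lra.
- rewrite Cexp_opp; unfold taylor; cbn [Csum Cpow].
  change (fact 0) with 1%nat; change (fact 1) with 1%nat; change (fact 2) with 2%nat;
  change (fact 3) with 6%nat; rewrite !INR_IZR_INZ; cbn [Z.of_nat Pos.of_succ_nat Pos.succ].
  rewrite RtoC_inv by lra; field.
  repeat split; try apply Cexp_neq0; apply RtoC_neq0; lra.
Qed.

(** The partial products of Euler's formula for [sin (PI w) / (PI w)]. *)
Definition sineB (w : C) (H : nat) : C :=
  Cprod (fun j => 1 - w * w / (RtoC (INR (S j)) * RtoC (INR (S j))))%C H.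

Lemma RtoC_S_neq0 (j : nat) : RtoC (INR (S j)) <> RtoC 0.
Proof. apply RtoC_neq0, not_0_INR; lia. Qed.

Lemma sine_factor_lower (w : C) : Im w <> 0 -> exists c, 0 < c /\
  forall j, c <= Cmod (1 - w * w / (RtoC (INR (S j)) * RtoC (INR (S j))))%C.
Proof.
intros Hw.
set (eta := Rabs (Im w)); assert (He : 0 < eta) by apply Rabs_pos_lt, Hw.
(* For [s = w] or [s = - w], the bounds [x <= |x + s| + |w|] and [eta <= |x + s|] give
   [x <= k |x + s|], so each factor has modulus at least [/ k ^ 2]. *)
set (k := 1 + Cmod w / eta).
assert (Hk : 1 <= k).
{ unfold k; assert (0 <= Cmod w / eta).
  { apply Rmult_le_pos; [apply Cmod_ge_0|apply Rlt_le, Rinv_0_lt_compat, He]. }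
  lra. }
exists (/ (k * k)); split; [apply Rinv_0_lt_compat; nra|].
intros j; set (x := INR (S j)).
assert (Hx : 0 < x) by (apply lt_0_INR; lia).
assert (H1 : forall s : C, (s = w \/ s = (- w)%C) -> x <= k * Cmod (RtoC x + s)%C).
{ intros s Hs.
  assert (Hm : Cmod s = Cmod w) by (destruct Hs as [->| ->]; [|rewrite Cmod_opp]; reflexivity).
  assert (Hi : eta <= Cmod (RtoC x + s)%C).
  { eapply Rle_trans; [|apply im_le_Cmod].
    unfold eta; destruct Hs as [->| ->]; rewrite im_plus, im_RtoC, Rplus_0_l;
      [|rewrite im_opp, Rabs_Ropp]; apply Rle_refl. }
  assert (Ht : x <= Cmod (RtoC x + s)%C + Cmod w).
  { generalize (Cmod_triangle (RtoC x + s)%C (- s)%C).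
    replace (RtoC x + s + - s)%C with (RtoC x) by ring.
    rewrite Cmod_opp, Hm, Cmod_R, Rabs_pos_eq by lra; auto. }
  assert (Cmod w <= Cmod w / eta * Cmod (RtoC x + s)%C).
  { replace (Cmod w) with (Cmod w / eta * eta) at 1 by (field; lra).
    apply Rmult_le_compat_l; [|exact Hi].
    apply Rmult_le_pos; [apply Cmod_ge_0|apply Rlt_le, Rinv_0_lt_compat, He]. }
  unfold k; lra. }
replace (1 - w * w / (RtoC x * RtoC x))%C
  with ((RtoC x + w) * (RtoC x + - w) / (RtoC x * RtoC x))%C
  by (field; apply RtoC_neq0; lra).
rewrite Cmod_div, !Cmod_mult, Cmod_R, Rabs_pos_eq.
- generalize (H1 w (or_introl eq_refl)) (H1 (- w)%C (or_intror eq_refl)); intros H2 H3.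
  apply Rmult_le_reg_r with ((k * k) * (x * x)); [repeat apply Rmult_lt_0_compat; lra|].
  replace (/ (k * k) * (k * k * (x * x))) with (x * x) by (field; lra).
  replace (_ / (x * x) * (k * k * (x * x)))
    with ((k * Cmod (RtoC x + w)%C) * (k * Cmod (RtoC x + - w)%C)) by (field; lra).
  apply Rmult_le_compat; lra.
- lra.
- apply Cmult_neq_0; apply RtoC_neq0; lra.
Qed.

(** The last product of [e2_product_folded]: the trigonometric counterpart of [sineB] on a grid of
    [M = 2 (H + 1)] points. *)
Definition sineA (w : C) (H : nat) : C :=
  let M := 2 * INR (S H) in
  let X := e2 (w / RtoC M) in
  Cprod (fun j => 1 + (X + / X - RtoC 2) / RtoC 4 /
                        RtoC (sin (PI * (INR (S j) / M)) ^ 2))%C H.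

(** An error of order [/ M ^ 2] per factor, uniform in [j], leaves a total error of order [/ M] over
    the [H < M] factors. *)
Lemma sineA_factor (w : C) : exists K, 0 <= K /\ forall H j, (j < H)%nat ->
  let M := 2 * INR (S H) in
  let X := e2 (w / RtoC M) in
  Cmod ((X + / X - RtoC 2) / RtoC 4 / RtoC (sin (PI * (INR (S j) / M)) ^ 2)
        + w * w / (RtoC (INR (S j)) * RtoC (INR (S j))))%C <= K / (M * M).
Proof.
set (Q := 2 * PI * Cmod w).
assert (HP := PI_RGT_0).
assert (HQ : 0 <= Q) by (apply Rmult_le_pos; [lra|apply Cmod_ge_0]).
assert (HE := exp_pos Q).
assert (HQ4 : 0 <= Q ^ 4 * exp Q) by (apply Rmult_le_pos; [apply pow_le|]; lra).
exists (3 * (Q ^ 2 + Q ^ 4 * exp Q) + Q ^ 4 * exp Q); split.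
{ assert (0 <= Q ^ 2) by (apply pow_le; lra); lra. }
intros H j Hj M X.
assert (HSH : 1 <= INR (S H)) by (apply (le_INR 1); lia).
assert (HM : 2 <= M) by (unfold M; lra).
set (x := INR (S j)).
assert (Hx : 1 <= x) by (apply (le_INR 1); lia).
assert (HxM : x <= M / 2).
{ unfold M, x; apply Rle_trans with (INR (S H)); [apply le_INR; lia|lra]. }
set (t := PI * (x / M)).
assert (Ht : 0 < t <= PI / 2).
{ unfold t; split.
  - apply Rmult_lt_0_compat; [lra|apply Rdiv_lt_0_compat; lra].
  - unfold Rdiv; apply Rmult_le_compat_l; [lra|].
    apply Rmult_le_reg_r with M; [lra|]; rewrite Rmult_assoc, Rinv_l by lra; lra. }
assert (Hsin : 0 < sin t) by (apply sin_gt_0; lra).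
assert (HMC : RtoC M <> RtoC 0) by (apply RtoC_neq0; lra).
set (xi := (RtoC (2 * PI) * Ci * (w / RtoC M))%C).
assert (Hxi : Cmod xi = Q / M).
{ unfold xi, Cdiv; rewrite !Cmod_mult, Cmod_Ci, Cmod_inv, !Cmod_R, !Rabs_pos_eq by (exact HMC || lra).
  unfold Q; field; lra. }
set (T := ((X + / X - RtoC 2) / RtoC 4)%C).
assert (HiM : 0 < / M <= 1).
{ split; [apply Rinv_0_lt_compat; lra|].
  apply Rmult_le_reg_r with M; [lra|]; rewrite Rinv_l by lra; lra. }
assert (HQM : Q / M <= Q).
{ unfold Rdiv; rewrite <- (Rmult_1_r Q) at 2; apply Rmult_le_compat_l; lra. }
assert (HT : Cmod (T - xi * xi / RtoC 4)%C <= Q ^ 4 * exp Q / (M * M * (M * M))).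
{ eapply Rle_trans; [apply (Cexp_even_taylor xi)|]; rewrite Hxi.
  replace (Q ^ 4 * exp Q / (M * M * (M * M))) with ((Q / M) ^ 4 * exp Q) by (field; lra).
  apply Rmult_le_compat_l; [apply pow_le, Rmult_le_pos; lra|].
  destruct HQM as [HQM| ->]; [left; apply exp_increasing, HQM|right; reflexivity]. }
assert (HMM : 1 <= M * M) by nra.
assert (HT' : Cmod T <= (Q ^ 2 + Q ^ 4 * exp Q) / (M * M)).
{ replace T with ((T - xi * xi / RtoC 4) + RtoC (/ 4) * (xi * xi))%C.
  2:{ rewrite RtoC_inv by lra; field; apply RtoC_neq0; lra. }
  eapply Rle_trans; [apply Cmod_triangle|].
  rewrite !Cmod_mult, Hxi, Cmod_R, Rabs_pos_eq by lra.
  replace ((Q ^ 2 + Q ^ 4 * exp Q) / (M * M))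
    with (Q ^ 4 * exp Q / (M * M) + Q / M * (Q / M)) by (field; lra).
  apply Rplus_le_compat.
  - eapply Rle_trans; [exact HT|]; unfold Rdiv; apply Rmult_le_compat_l; [exact HQ4|].
    apply Rinv_le_contravar; nra.
  - assert (0 <= Q / M * (Q / M)) by (apply Rle_0_sqr); lra. }
(* The factors match because [T] is close to [xi ^ 2 / 4] and [sin t ^ 2] is close to [t ^ 2]; the
   quotient of these two main terms is exactly [- w ^ 2 / x ^ 2]. *)
assert (Ht2 : (xi * xi / RtoC 4)%C = (- (w * w / (RtoC x * RtoC x)) * RtoC (t * t))%C).
{ unfold xi, t; rewrite !RtoC_mult, !RtoC_div by lra.
  replace (RtoC 2 * RtoC PI * Ci * (w / RtoC M) * (RtoC 2 * RtoC PI * Ci * (w / RtoC M)) / RtoC 4)%C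
   with ((Ci * Ci) * (RtoC PI * RtoC PI * (w * w) / (RtoC M * RtoC M)))%C.
  - replace (Ci * Ci)%C with (RtoC (-1)) by (apply injective_projections; simpl; ring).
    replace (RtoC (-1)) with (- (1))%C by (apply injective_projections; simpl; ring).
    field; repeat split; first [exact HMC|apply RtoC_neq0; lra].
  - field; repeat split; first [exact HMC|apply RtoC_neq0; lra]. }
assert (Hst : RtoC (sin t ^ 2) <> RtoC 0) by (apply RtoC_neq0, pow_nonzero; lra).
assert (Htt : RtoC (t * t) <> RtoC 0) by (apply RtoC_neq0; nra).
replace (T / RtoC (sin t ^ 2) + w * w / (RtoC x * RtoC x))%C
  with (T * RtoC (/ sin t ^ 2 - / t ^ 2) + (T - xi * xi / RtoC 4) * RtoC (/ (t * t)))%C.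
2:{ rewrite Ht2; replace (t ^ 2) with (t * t) by ring.
    rewrite RtoC_minus, !RtoC_inv by (try apply pow_nonzero; nra).
    field; repeat split; try assumption; apply RtoC_neq0; lra. }
eapply Rle_trans; [apply Cmod_triangle|]; rewrite !Cmod_mult, !Cmod_R.
unfold Rdiv; rewrite Rmult_plus_distr_r; apply Rplus_le_compat.
- replace (3 * (Q ^ 2 + Q ^ 4 * exp Q) * / (M * M)) with
    ((Q ^ 2 + Q ^ 4 * exp Q) / (M * M) * 3) by (unfold Rdiv; ring).
  apply Rmult_le_compat; [apply Cmod_ge_0|apply Rabs_pos|exact HT'|apply inv_sin_sq_bound, Ht].
- rewrite Rabs_pos_eq by (apply Rlt_le, Rinv_0_lt_compat; nra).
  replace (Q ^ 4 * exp Q * / (M * M))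
    with (Q ^ 4 * exp Q / (M * M * (M * M)) * (M * M)) by (field; lra).
  apply Rmult_le_compat; [apply Cmod_ge_0|apply Rlt_le, Rinv_0_lt_compat; nra|exact HT|].
  apply Rmult_le_reg_r with (t * t); [nra|]; rewrite Rinv_l by nra.
  assert (1 <= M * t).
  { unfold t; replace (M * (PI * (x / M))) with (PI * x) by (field; lra).
    assert (HP2 := PI2_1); nra. }
  nra.
Qed.

Lemma sineA_sineB (w : C) : Im w <> 0 ->
  Clim (fun H => (sineA w H / sineB w H)%C) (RtoC 1).
Proof.
intros Hw.
destruct (sine_factor_lower w Hw) as [c [Hc HB]].
destruct (sineA_factor w) as [K [HK HA]].
assert (HBn : forall j, (1 - w * w / (RtoC (INR (S j)) * RtoC (INR (S j))))%C <> RtoC 0).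
{ intros j; apply Cmod_gt_0, (Rlt_le_trans _ c); [exact Hc|apply HB]. }
apply Clim_squeeze with (fun H => exp (K / c * / INR (S H)) - 1).
- intros H; set (M := 2 * INR (S H)).
  assert (HSH : 0 < INR (S H)) by (apply lt_0_INR; lia).
  unfold sineA, sineB; rewrite <- Cprod_div by (intros; apply HBn).
  eapply Rle_trans; [apply Cprod_near_1 with (delta := K / c / (M * M))|].
  + intros j Hj; cbv beta zeta; specialize (HA H j Hj); cbv zeta in HA; fold M in HA |- *.
    set (T := ((e2 (w / RtoC M) + / e2 (w / RtoC M) - RtoC 2) / RtoC 4 /
             RtoC (sin (PI * (INR (S j) / M)) ^ 2))%C) in *.
    specialize (HB j); specialize (HBn j).
    set (b := (w * w / (RtoC (INR (S j)) * RtoC (INR (S j))))%C) in *.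
    replace ((1 + T) / (1 - b) - 1)%C with ((T + b) / (1 - b))%C by (field; exact HBn).
    rewrite Cmod_div by exact HBn.
    replace (K / c / (M * M)) with (K / (M * M) * / c) by (field; unfold M; lra).
    apply Rmult_le_compat; [apply Cmod_ge_0|apply Rlt_le, Rinv_0_lt_compat, Cmod_gt_0, HBn|exact HA|].
    apply Rinv_le_contravar; assumption.
  + apply Rmult_le_pos; [apply Rmult_le_pos; [exact HK|]|]; apply Rlt_le, Rinv_0_lt_compat; [exact Hc|].
    unfold M; nra.
  + apply Rplus_le_compat_r.
    assert (INR H * (K / c / (M * M)) <= K / c * / INR (S H)) as [H1| ->];
      [|left; apply exp_increasing, H1|right; reflexivity].
    replace (INR H * (K / c / (M * M))) with (K / c * (INR H / (M * M))) by (unfold Rdiv; ring).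
    apply Rmult_le_compat_l.
    * apply Rmult_le_pos; [exact HK|apply Rlt_le, Rinv_0_lt_compat, Hc].
    * apply Rmult_le_reg_r with (M * M); [unfold M; nra|].
      unfold Rdiv; rewrite Rmult_assoc, Rinv_l by (unfold M; nra).
      unfold M; replace (/ INR (S H) * (2 * INR (S H) * (2 * INR (S H)))) with (4 * INR (S H))
        by (field; lra).
      rewrite S_INR; generalize (pos_INR H); lra.
- apply is_lim_seq_eq with (exp 0 - 1); [|rewrite exp_0; ring].
  apply is_lim_seq_minus'; [|apply is_lim_seq_const].
  apply is_lim_seq_continuous; [apply derivable_continuous_pt, derivable_pt_exp|].
  apply is_lim_seq_eq with (K / c * 0); [|ring].
  apply (is_lim_seq_scal_l _ _ 0).
  apply (is_lim_seq_incr_1 (fun n => / INR n) 0).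
  apply (is_lim_seq_inv INR p_infty); [apply is_lim_seq_INR|discriminate].
Qed.

(** * One row of the double series: [exp (sum of cc over w + Z) = 1 - e2 w] *)

Lemma Cmod_e2 (w : C) : Cmod (e2 w) = exp (- (2 * PI * Im w)).
Proof.
unfold e2; rewrite Cmod_Cexp; f_equal.
simpl; unfold Im; ring.
Qed.

Lemma one_minus_e2_neq0 (w : C) : 0 < Im w -> (1 - e2 w)%C <> RtoC 0.
Proof.
intros H E.
assert (E1 : e2 w = RtoC 1) by (apply eq_sym, Ceq_minus, E).
apply (f_equal Cmod) in E1; rewrite Cmod_e2, Cmod_1 in E1.
assert (H0 : exp (- (2 * PI * Im w)) < exp 0).
{ apply exp_increasing; generalize PI_RGT_0; intros HP.
  assert (0 < PI * Im w) by (apply Rmult_lt_0_compat; lra).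
  lra. }
rewrite exp_0 in H0; lra.
Qed.

Lemma is_lim_seq_inv_INR (K : R) : is_lim_seq (fun n => K * / INR (S n)) 0.
Proof.
apply is_lim_seq_eq with (K * 0); [|ring].
apply (is_lim_seq_scal_l _ _ 0).
apply (is_lim_seq_incr_1 (fun n => / INR n) 0).
apply (is_lim_seq_inv INR p_infty); [apply is_lim_seq_INR|discriminate].
Qed.

Lemma Clim_inv_INR (c : C) : Clim (fun n => (c / RtoC (INR (S n)))%C) (RtoC 0).
Proof.
apply Clim_squeeze with (fun n => Cmod c * / INR (S n)); [|apply is_lim_seq_inv_INR].
intros n; replace (c / RtoC (INR (S n)) - RtoC 0)%C with (c / RtoC (INR (S n)))%C by ring.
rewrite Cmod_div, Cmod_R, Rabs_pos_eq by (apply RtoC_S_neq0 || apply pos_INR).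
apply Rle_refl.
Qed.

Lemma filterlim_pow2_pred : filterlim (fun n => (2 ^ n - 1)%nat) eventually eventually.
Proof.
intros P [N HN]; exists (S N); intros n Hn; apply HN.
generalize (Nat.pow_gt_lin_r 2 n ltac:(lia)); lia.
Qed.

Lemma S_pow2_pred (n : nat) : S (2 ^ n - 1) = (2 ^ n)%nat.
Proof. generalize (Nat.pow_nonzero 2 n ltac:(lia)); lia. Qed.

Lemma Clim_exp_slope (c : C) :
  Clim (fun H => ((Cexp (c / RtoC (2 * INR (S H))) - 1) * RtoC (2 * INR (S H)))%C) c.
Proof.
apply Clim_squeeze with (fun H => Cmod c ^ 2 * exp (Cmod c) * / INR (S H));
  [|apply is_lim_seq_inv_INR].
intros H; set (M := 2 * INR (S H)).
assert (HSH : 1 <= INR (S H)) by (apply (le_INR 1); lia).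
assert (HM : 2 <= M) by (unfold M; lra).
assert (HMC : RtoC M <> RtoC 0) by (apply RtoC_neq0; lra).
assert (HT := Cexp_taylor (c / RtoC M)%C 2).
replace (taylor (c / RtoC M)%C (fun _ => RtoC 1) 2) with (1 + c / RtoC M)%C in HT.
2:{ unfold taylor; simpl; field; repeat split; try exact HMC; apply C1_nz. }
replace ((Cexp (c / RtoC M) - 1) * RtoC M - c)%C
  with ((Cexp (c / RtoC M) - (1 + c / RtoC M)) * RtoC M)%C by (field; exact HMC).
assert (Hc : Cmod (c / RtoC M)%C = Cmod c / M).
{ rewrite Cmod_div, Cmod_R, Rabs_pos_eq by (exact HMC || lra); reflexivity. }
rewrite Hc in HT.
rewrite Cmod_mult, Cmod_R, (Rabs_pos_eq M) by lra.
assert (Hc0 := Cmod_ge_0 c).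
assert (HcM : Cmod c / M <= Cmod c).
{ apply Rle_div_l; nra. }
assert (HE : exp (Cmod c / M) <= exp (Cmod c)).
{ destruct HcM as [H1|H1]; [left; apply exp_increasing, H1|rewrite H1; right; reflexivity]. }
assert (Hp := exp_pos (Cmod c / M)).
replace (Cmod c ^ 2 * exp (Cmod c) * / INR (S H))
  with ((2 * (Cmod c / M)) ^ 2 * exp (Cmod c) / 2 * M) by (unfold M; field; lra).
apply Rmult_le_compat_r; [lra|].
eapply Rle_trans; [exact HT|]; simpl (INR (fact 2)).
replace (1 + 1) with 2 by ring; unfold Rdiv at 1 3.
apply Rmult_le_compat_r; [lra|]; apply Rmult_le_compat_l; [|exact HE].
apply pow_le; apply Rmult_le_pos; [lra|]; apply Rmult_le_pos; [lra|].
apply Rlt_le, Rinv_0_lt_compat; lra.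
Qed.

Lemma Cexp_pow_e2 (w : C) (H : nat) :
  (e2 (w / RtoC (2 * INR (S H))) ^ S H)%C = e2 (w / RtoC 2)%C.
Proof.
unfold e2; rewrite Cexp_pow; f_equal.
rewrite !RtoC_mult; field; repeat split; first [apply RtoC_S_neq0|apply RtoC_neq0; lra].
Qed.

Lemma sineA_neq0 (w : C) (n : nat) : 0 < Im w -> sineA w (2 ^ n - 1) <> RtoC 0.
Proof.
intros Hw E.
apply (one_minus_e2_neq0 w Hw).
rewrite (e2_product_folded w n (2 ^ n - 1) (S_pow2_pred n)).
unfold sineA in E; rewrite E; ring.
Qed.

(** With [X = e2 (w / M)], this is the factor [1 - X ^ 2] of the folded product times [M / X]: the
    origin of the linear factor [w] in the sine product. *)
Lemma one_minus_e2_slope (w : C) :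
  Clim (fun H => ((/ e2 (w / RtoC (2 * INR (S H))) - e2 (w / RtoC (2 * INR (S H))))
                  * RtoC (2 * INR (S H)))%C)
       (- (RtoC 4 * RtoC PI * Ci * w))%C.
Proof.
set (c := (RtoC (2 * PI) * Ci * w)%C).
replace (- (RtoC 4 * RtoC PI * Ci * w))%C with (- c - c)%C
  by (unfold c; rewrite RtoC_mult; ring).
eapply Clim_ext; [|apply Clim_minus; [apply (Clim_exp_slope (- c))|apply (Clim_exp_slope c)]].
intros H; cbv beta.
replace (- c / RtoC (2 * INR (S H)))%C with (- (c / RtoC (2 * INR (S H))))%C
  by (unfold Cdiv; ring).
rewrite Cexp_opp.
replace (e2 (w / RtoC (2 * INR (S H)))) with (Cexp (c / RtoC (2 * INR (S H)))).
- ring.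
- unfold e2, c; f_equal; unfold Cdiv; ring.
Qed.

(** In a ratio the product of the [4 sin ^ 2], which depends on the grid alone, cancels and need not
    be evaluated. The last exponential is what remains of the powers [X ^ S H]. *)
Lemma sineB_ratio (w w0 : C) : 0 < Im w -> 0 < Im w0 ->
  Clim (fun n => (sineB w (2 ^ n - 1) / sineB w0 (2 ^ n - 1))%C)
    (w0 / w * ((1 - e2 w) / (1 - e2 w0)) * e2 ((w0 - w) / RtoC 2))%C.
Proof.
intros Hw Hw0.
assert (Hne : forall z, 0 < Im z -> z <> RtoC 0).
{ intros z Hz E; rewrite E in Hz; simpl in Hz; lra. }
assert (Hz := Hne w Hw); assert (Hz0 := Hne w0 Hw0).
assert (He := one_minus_e2_neq0 w Hw); assert (He0 := one_minus_e2_neq0 w0 Hw0).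
assert (HP : RtoC PI <> RtoC 0) by (apply RtoC_neq0; generalize PI_RGT_0; lra).
set (D := fun (z : C) (H : nat) => ((/ e2 (z / RtoC (2 * INR (S H)))
   - e2 (z / RtoC (2 * INR (S H)))) * RtoC (2 * INR (S H)))%C).
assert (HDlim : forall z, Clim (fun n => D z (2 ^ n - 1)%nat) (- (RtoC 4 * RtoC PI * Ci * z))%C).
{ intros z; apply (Clim_subseq (D z)); [apply filterlim_pow2_pred|apply one_minus_e2_slope]. }
assert (HA : forall z n, (RtoC (2 * INR (S (2 ^ n - 1))) * (1 - e2 z))%C =
  (D z (2 ^ n - 1)%nat * e2 (z / RtoC 2) *
   Cprod (fun j => RtoC (4 * sin (PI * (INR (S j) / (2 * INR (S (2 ^ n - 1))))) ^ 2)) (2 ^ n - 1)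
   * sineA z (2 ^ n - 1))%C).
{ intros z n; rewrite (e2_product_folded z n (2 ^ n - 1) (S_pow2_pred n)) at 1.
  unfold D, sineA; rewrite <- (Cexp_pow_e2 z (2 ^ n - 1)), Cpow_S.
  field; apply e2_neq0. }
assert (HAB : forall z, 0 < Im z ->
  Clim (fun n => (sineA z (2 ^ n - 1) / sineB z (2 ^ n - 1))%C) (RtoC 1)).
{ intros z Hz1; apply (Clim_subseq (fun H => (sineA z H / sineB z H)%C));
    [apply filterlim_pow2_pred|apply sineA_sineB; lra]. }
apply Clim_ext with (fun n => ((1 - e2 w) / (1 - e2 w0) * e2 ((w0 - w) / RtoC 2) *
  (D w0 (2 ^ n - 1)%nat / D w (2 ^ n - 1)%nat) *
  ((sineA w0 (2 ^ n - 1) / sineB w0 (2 ^ n - 1)) / (sineA w (2 ^ n - 1) / sineB w (2 ^ n - 1))))%C).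
- intros n.
  assert (H1 := HA w n); assert (H2 := HA w0 n).
  set (M := RtoC (2 * INR (S (2 ^ n - 1)))) in *.
  set (q := Cprod _ _) in H1, H2.
  assert (HM : M <> RtoC 0).
  { apply RtoC_neq0, Rgt_not_eq, Rmult_lt_0_compat; [lra|apply lt_0_INR; lia]. }
  assert (HA1 := sineA_neq0 w n Hw); assert (HA2 := sineA_neq0 w0 n Hw0).
  assert (HB : forall z, 0 < Im z -> sineB z (2 ^ n - 1) <> RtoC 0).
  { intros z Hz1; apply Cprod_neq0; intros k _.
    destruct (sine_factor_lower z ltac:(lra)) as [c [Hc HB]].
    apply Cmod_gt_0, (Rlt_le_trans _ c); [exact Hc|apply HB]. }
  assert (HB1 := HB w Hw); assert (HB2 := HB w0 Hw0).
  assert (Hprod : (M * (1 - e2 w))%C <> RtoC 0) by (apply Cmult_neq_0; assumption).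
  assert (Hprod0 : (M * (1 - e2 w0))%C <> RtoC 0) by (apply Cmult_neq_0; assumption).
  assert (HD1 : D w (2 ^ n - 1)%nat <> RtoC 0).
  { intros E; apply Hprod; rewrite H1, E; ring. }
  assert (HD2 : D w0 (2 ^ n - 1)%nat <> RtoC 0).
  { intros E; apply Hprod0; rewrite H2, E; ring. }
  assert (Hq : q <> RtoC 0).
  { intros E; apply Hprod; rewrite H1, E; ring. }
  assert (Hrat : ((1 - e2 w) / (1 - e2 w0))%C = ((M * (1 - e2 w)) / (M * (1 - e2 w0)))%C)
    by (field; split; assumption).
  rewrite Hrat, H1, H2.
  replace ((w0 - w) / RtoC 2)%C with (w0 / RtoC 2 - w / RtoC 2)%C
    by (field; apply RtoC_neq0; lra).
  unfold e2 at 3; unfold Cminus at 1; rewrite Cmult_plus_distr_l.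
  replace (RtoC (2 * PI) * Ci * - (w / RtoC 2))%C with (- (RtoC (2 * PI) * Ci * (w / RtoC 2)))%C by ring.
  rewrite Cexp_plus, Cexp_opp; fold (e2 (w0 / RtoC 2)) (e2 (w / RtoC 2)).
  field; repeat split; try assumption; apply e2_neq0.
- eapply Clim_ext_loc; [exists 0%nat; reflexivity|].
  assert (H4 : forall z, z <> RtoC 0 -> (- (RtoC 4 * RtoC PI * Ci * z))%C <> RtoC 0).
  { intros z Hz1 E.
    assert (E2 : (RtoC 4 * RtoC PI * Ci * z)%C = RtoC 0).
    { replace (RtoC 4 * RtoC PI * Ci * z)%C with (- - (RtoC 4 * RtoC PI * Ci * z))%C by ring.
      rewrite E; ring. }
    revert E2; repeat apply Cmult_neq_0; try assumption; [apply RtoC_neq0; lra|apply Ci_nz]. }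
  replace (w0 / w * ((1 - e2 w) / (1 - e2 w0)) * e2 ((w0 - w) / RtoC 2))%C
    with ((1 - e2 w) / (1 - e2 w0) * e2 ((w0 - w) / RtoC 2)
      * ((- (RtoC 4 * RtoC PI * Ci * w0)) / (- (RtoC 4 * RtoC PI * Ci * w)))
      * (RtoC 1 / RtoC 1))%C.
  + apply Clim_mult; [apply Clim_mult; [apply Clim_const|]|].
    * apply Clim_div; [apply H4, Hz|apply HDlim|apply HDlim].
    * apply Clim_div; [apply C1_nz|apply HAB, Hw0|apply HAB, Hw].
  + field; repeat split; try assumption; try apply Ci_nz; apply RtoC_neq0; lra.
Qed.

(** * Asymptotics of the Euler-Maclaurin terms under shifts *)

Section Shift.

Variables (w ga : C) (rho : R).
Hypothesis (rho_pos : 0 < rho)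
  (segment : forall t, 0 <= t <= 1 ->
     slit (w + RtoC t * ga)%C /\ rho <= Cmod (w + RtoC t * ga)%C).

Let err := (1 + 2 * Cmod ga) ^ 3 / rho.

Lemma Cmod_LE3 (z : C) : slit z -> Cmod (LE 3 z) = / Cmod z.
Proof.
intros Hz; unfold LE; rewrite Cmod_mult, Cmod_R, Cpow_1_r, Cmod_inv by (apply slit_neq0, Hz).
replace ((-1) ^ 0 * INR (fact 0)) with 1 by (simpl; ring).
rewrite Rabs_R1; ring.
Qed.

Lemma shift_LE (j : nat) : (j <= 3)%nat ->
  Cmod (LE j (w + ga) - taylor ga (fun i => LE (j + i) w) (3 - j))%C <= err.
Proof.
intros Hj.
assert (Hg := Cmod_ge_0 ga).
eapply Rle_trans.
- apply (chain_taylor LE w (/ rho) ga j (3 - j)).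
  + intros i t Ht; apply Cder_LE, segment, Ht.
  + intros t Ht; replace (j + (3 - j))%nat with 3%nat by lia.
    rewrite Cmod_LE3 by apply segment, Ht.
    apply Rinv_le_contravar; [exact rho_pos|apply segment, Ht].
- unfold err, Rdiv; apply Rmult_le_compat_r; [apply Rlt_le, Rinv_0_lt_compat, rho_pos|].
  apply Rle_trans with ((1 + 2 * Cmod ga) ^ (3 - j)).
  + apply pow_incr; lra.
  + apply Rle_pow; [lra|lia].
Qed.

Lemma LE3_small : Cmod (LE 3 w) <= err.
Proof.
assert (H0 := segment 0 ltac:(lra)); replace (w + RtoC 0 * ga)%C with w in H0 by ring.
assert (Hg := Cmod_ge_0 ga).
rewrite Cmod_LE3 by apply H0.
apply Rle_trans with (1 * / rho).
- rewrite Rmult_1_l; apply Rinv_le_contravar; [exact rho_pos|apply H0].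
- unfold err, Rdiv; apply Rmult_le_compat_r; [apply Rlt_le, Rinv_0_lt_compat, rho_pos|].
  rewrite <- (pow1 3); apply pow_incr; lra.
Qed.

(** Expanding at [w] the terms based at [w + ga], the first hypothesis removes [LE 0] and the second
    fixes the coefficient of [LE 1]; everything from [LE 3] on is of order [/ rho]. *)
Lemma shift_combination (a b : nat -> C) (c : C) :
  (a 0%nat + b 0%nat = RtoC 0)%C ->
  (b 0%nat * ga + a 1%nat + b 1%nat)%C = c ->
  Cmod (Csum (fun j => a j * LE j w + b j * LE j (w + ga))%C 4
    - (c * LE 1 w + (b 0%nat * (ga * ga / RtoC 2) + b 1%nat * ga + a 2%nat + b 2%nat) * LE 2 w))%C
  <= (Rsum (fun j => Cmod (b j)) 4 + Cmod (a 3%nat)) * err.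
Proof.
intros H0 H1.
assert (S0 := shift_LE 0 ltac:(lia)); assert (S1 := shift_LE 1 ltac:(lia)).
assert (S2 := shift_LE 2 ltac:(lia)); assert (S3 := shift_LE 3 ltac:(lia)).
assert (S3' := LE3_small).
set (r := fun j => (LE j (w + ga) - taylor ga (fun i => LE (j + i) w) (3 - j))%C).
assert (Hr : forall j, (j <= 3)%nat -> Cmod (r j) <= err) by (intros j Hj; apply shift_LE, Hj).
replace (_ - _)%C with (Csum (fun j => b j * r j)%C 4 + a 3%nat * LE 3 w)%C.
- eapply Rle_trans; [apply Cmod_triangle|].
  rewrite Rmult_plus_distr_r; apply Rplus_le_compat.
  + rewrite (Rmult_comm _ err), <- Rsum_scal; apply Cmod_Csum_le; intros k Hk.
    rewrite Cmod_mult, Rmult_comm; apply Rmult_le_compat_r; [apply Cmod_ge_0|apply Hr; lia].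
  + rewrite Cmod_mult; apply Rmult_le_compat_l; [apply Cmod_ge_0|exact S3'].
- unfold r, taylor; cbn [Csum Nat.add Nat.sub Cpow].
  change (fact 0) with 1%nat; change (fact 1) with 1%nat; change (fact 2) with 2%nat.
  rewrite !INR_IZR_INZ; cbn [Z.of_nat Pos.of_succ_nat Pos.succ].
  set (l0 := LE 0 w); set (l1 := LE 1 w); set (l2 := LE 2 w); set (l3 := LE 3 w).
  set (m0 := LE 0 (w + ga)); set (m1 := LE 1 (w + ga)); set (m2 := LE 2 (w + ga)).
  set (m3 := LE 3 (w + ga)).
  assert (Ea : a 0%nat = (- b 0%nat)%C).
  { replace (a 0%nat) with ((a 0%nat + b 0%nat) - b 0%nat)%C by ring; rewrite H0; ring. }
  rewrite <- H1, Ea; field; repeat split; apply RtoC_neq0; lra.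
Qed.

End Shift.

(** Taking the difference in direction [tau] first leaves a one-dimensional corrector, through which
    [cc 1 tau] telescopes along a row. *)
Definition kap (tau w : C) : C := (hh 1 tau w - hh 1 tau (w + tau))%C.

Lemma cc_kap (tau w : C) : cc 1 tau w = (Clog w + kap tau w - kap tau (w + 1))%C.
Proof. unfold cc, DD, kap; ring. Qed.

(** The main terms [w log w - w - log w / 2] are those of Stirling's formula for [log Gamma(w)] and
    do not depend on [tau]. *)
Lemma kap_asymptotic (tau : C) : tau <> RtoC 0 -> exists K, 0 <= K /\
  forall w rho, 0 < rho ->
  (forall t, 0 <= t <= 1 ->
     slit (w + RtoC t * tau)%C /\ rho <= Cmod (w + RtoC t * tau)%C) ->
  Cmod (kap tau w - (LE 1 w - / RtoC 2 * LE 2 w))%C <= K / rho.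
Proof.
intros Ht.
exists ((Rsum (fun j => Cmod (acoef 1 tau j)) 4 + Cmod (- acoef 1 tau 3)%C) * (1 + 2 * Cmod tau) ^ 3).
assert (Hg := Cmod_ge_0 tau).
split.
{ apply Rmult_le_pos; [|apply pow_le; lra].
  apply Rplus_le_le_0_compat; [apply Rsum_pos; intros|]; apply Cmod_ge_0. }
intros w rho Hr Hs.
assert (H2 : RtoC 2 <> RtoC 0) by (apply RtoC_neq0; lra).
assert (H12 : RtoC 12 <> RtoC 0) by (apply RtoC_neq0; lra).
generalize (shift_combination w tau rho Hr Hs (fun j => - acoef 1 tau j)%C (acoef 1 tau) 1).
unfold Rdiv; rewrite <- Rmult_assoc; intros H.
replace (kap tau w - (LE 1 w - / RtoC 2 * LE 2 w))%C
  with (Csum (fun j => - acoef 1 tau j * LE j w + acoef 1 tau j * LE j (w + tau))%C 4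
    - (1 * LE 1 w + (acoef 1 tau 0 * (tau * tau / RtoC 2) + acoef 1 tau 1 * tau
       + - acoef 1 tau 2 + acoef 1 tau 2) * LE 2 w))%C.
- apply H.
  + ring.
  + unfold acoef; field; repeat split; assumption || apply C1_nz.
- unfold kap, hh; rewrite (Csum_plus (fun j => - acoef 1 tau j * LE j w)%C).
  rewrite (Csum_ext (fun j => - acoef 1 tau j * LE j w)%C (fun j => - (acoef 1 tau j * LE j w))%C)
    by (intros; ring).
  rewrite Csum_opp.
  replace (acoef 1 tau 0 * (tau * tau / RtoC 2) + acoef 1 tau 1 * tau
       + - acoef 1 tau 2 + acoef 1 tau 2)%C with (- / RtoC 2)%C.
  + ring.
  + unfold acoef; field; repeat split; assumption || apply C1_nz.
Qed.

(** The truncated form of [1 / (e ^ (- t) - 1) = - e ^ t / (e ^ t - 1)], the factor [e ^ t] being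
    the shift by 1. It lets the cones in directions [1] and [- 1] be joined into a half-plane. *)
Lemma hh_reflect (tau : C) : tau <> RtoC 0 -> exists K, 0 <= K /\
  forall w rho, 0 < rho ->
  (forall t, 0 <= t <= 1 ->
     slit (w + RtoC t * 1)%C /\ rho <= Cmod (w + RtoC t * 1)%C) ->
  Cmod (hh (- (1)) tau w + hh 1 tau (w + 1))%C <= K / rho.
Proof.
intros Ht.
exists ((Rsum (fun j => Cmod (- acoef 1 tau j)%C) 4 + Cmod (- acoef (- (1)) tau 3)%C) * (1 + 2 * Cmod 1) ^ 3).
assert (Hg := Cmod_ge_0 1).
split.
{ apply Rmult_le_pos; [|apply pow_le; lra].
  apply Rplus_le_le_0_compat; [apply Rsum_pos; intros|]; apply Cmod_ge_0. }
intros w rho Hr Hs.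
assert (H2 : RtoC 2 <> RtoC 0) by (apply RtoC_neq0; lra).
assert (H12 : RtoC 12 <> RtoC 0) by (apply RtoC_neq0; lra).
assert (Hm1 : (- (1))%C <> RtoC 0).
{ intros E; apply C1_nz; replace (RtoC 1) with (- - (1))%C by ring; rewrite E; ring. }
generalize (shift_combination w 1 rho Hr Hs (fun j => - acoef (- (1)) tau j)%C
  (fun j => - acoef 1 tau j)%C 0).
unfold Rdiv; rewrite <- Rmult_assoc; intros H.
replace (hh (- (1)) tau w + hh 1 tau (w + 1))%C
  with (Csum (fun j => - acoef (- (1)) tau j * LE j w + - acoef 1 tau j * LE j (w + 1))%C 4
    - (0 * LE 1 w + (- acoef 1 tau 0 * (1 * 1 / RtoC 2) + - acoef 1 tau 1 * 1
       + - acoef (- (1)) tau 2 + - acoef 1 tau 2) * LE 2 w))%C.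
- apply H.
  + unfold acoef; field; repeat split; assumption || apply C1_nz.
  + unfold acoef; field; repeat split; assumption || apply C1_nz.
- unfold hh; rewrite (Csum_plus (fun j => - acoef (- (1)) tau j * LE j w)%C).
  rewrite (Csum_ext (fun j => - acoef (- (1)) tau j * LE j w)%C
     (fun j => - (acoef (- (1)) tau j * LE j w))%C) by (intros; ring).
  rewrite (Csum_ext (fun j => - acoef 1 tau j * LE j (w + 1))%C
     (fun j => - (acoef 1 tau j * LE j (w + 1)))%C) by (intros; ring).
  rewrite !Csum_opp.
  replace (- acoef 1 tau 0 * (1 * 1 / RtoC 2) + - acoef 1 tau 1 * 1
       + - acoef (- (1)) tau 2 + - acoef 1 tau 2)%C with (RtoC 0).
  + ring.
  + unfold acoef; field; repeat split; assumption || apply C1_nz.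
Qed.

Lemma Clog_Im_nonpos (w : C) : slit w -> Im w <= 0 -> Im (Clog w) <= 0.
Proof.
unfold slit, Clog; intros H Hi; simpl.
assert (Im w / (Cmod w + Re w) <= 0) as [H1|E].
{ unfold Rdiv; assert (0 < / (Cmod w + Re w)) by apply Rinv_0_lt_compat, H; nra. }
- generalize (atan_increasing _ _ H1); rewrite atan_0; lra.
- rewrite E, atan_0; lra.
Qed.

Lemma Clog_neg (w : C) : 0 < Im w -> Clog w = (RtoC PI * Ci + Clog (- w))%C.
Proof.
intros Hw.
assert (Hs : slit (- w)%C) by (apply slit_Im; rewrite im_opp; lra).
apply Clog_unique.
- apply slit_Im; lra.
- rewrite Cexp_plus, Cexp_Clog by exact Hs.
  unfold Cexp at 1; simpl.
  replace (PI * 0 - 0 * 1) with 0 by ring; replace (PI * 1 + 0 * 0) with PI by ring.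
  rewrite exp_0, cos_PI, sin_PI; apply injective_projections; simpl; ring.
- rewrite im_plus; assert (H := Clog_Im_nonpos _ Hs ltac:(rewrite im_opp; lra)).
  generalize (Clog_Im_bounds (- w)%C); simpl (Im (RtoC PI * Ci)%C); lra.
Qed.

(** [PI i] comes from writing [v - N] as [- (N - v)]. The points [N - v] and [N + v] that remain are
    joined by a segment in the half-plane of real part at least [N / 2], where the logarithm varies
    slowly. *)
Lemma Clog_jump (v : C) (N R0 : R) : 0 < Im v -> Cmod v <= R0 -> 2 * R0 <= N -> 0 < R0 ->
  Cmod (Clog (v - RtoC N) - Clog (v + RtoC N) - RtoC PI * Ci)%C <= 8 * R0 / N.
Proof.
intros Hi HR HN HR0.
rewrite (Clog_neg (v - RtoC N)) by (unfold Cminus; rewrite im_plus, im_opp, im_RtoC; lra).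
replace (- (v - RtoC N))%C with (RtoC N - v)%C by ring.
replace (RtoC PI * Ci + Clog (RtoC N - v) - Clog (v + RtoC N) - RtoC PI * Ci)%C
  with (- (Clog (v + RtoC N) - Clog (RtoC N - v)))%C by ring.
rewrite Cmod_opp.
set (f := fun t => (Clog ((RtoC N - v) + RtoC t * (RtoC 2 * v)) - Clog (RtoC N - v))%C).
replace (Clog (v + RtoC N) - Clog (RtoC N - v))%C with (f 1).
2:{ unfold f; do 2 f_equal; ring. }
assert (Hre : forall t, 0 <= t <= 1 -> N / 2 <= Re ((RtoC N - v) + RtoC t * (RtoC 2 * v))%C).
{ intros t Ht; unfold Cminus; rewrite !re_plus, re_opp, re_scal_l, re_scal_l, re_RtoC.
  generalize (re_le_Cmod v); intros H; apply Rabs_le_between in H; nra. }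
eapply Rle_trans.
- apply (Cder_growth f (fun t => (RtoC 2 * v / ((RtoC N - v) + RtoC t * (RtoC 2 * v)))%C)
           (4 * R0 / N) 0); [| | |lra].
  + intros t Ht; eapply Cder_eq.
    * apply Cder_minus; [|apply Cder_const].
      apply Cder_Clog; [apply slit_Re; generalize (Hre t Ht); lra|apply Cder_line].
    * cbv beta; ring.
  + intros t Ht; rewrite pow_O, Rmult_1_r.
    assert (Hs : slit ((RtoC N - v) + RtoC t * (RtoC 2 * v))%C).
    { apply slit_Re; generalize (Hre t Ht); lra. }
    rewrite Cmod_div, Cmod_mult, Cmod_R, Rabs_pos_eq by (lra || apply slit_neq0, Hs).
    assert (HM : N / 2 <= Cmod ((RtoC N - v) + RtoC t * (RtoC 2 * v))%C).
    { eapply Rle_trans; [apply (Hre t Ht)|].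
      eapply Rle_trans; [apply Rle_abs|apply re_le_Cmod]. }
    apply Rle_trans with (2 * R0 / (N / 2)).
    * unfold Rdiv; apply Rmult_le_compat; [generalize (Cmod_ge_0 v); lra| |lra|].
      -- apply Rlt_le, Rinv_0_lt_compat; lra.
      -- apply Rinv_le_contravar; lra.
    * apply Req_le; field; lra.
  + unfold f; replace (RtoC N - v + RtoC 0 * (RtoC 2 * v))%C with (RtoC N - v)%C by ring; ring.
- rewrite pow1; simpl INR; apply Req_le; field; lra.
Qed.

Definition kap0 (w : C) : C := (LE 1 w - / RtoC 2 * LE 2 w)%C.

(** Subtracting the value at [w0] removes the part that diverges with [N]. Along the segment from
    [w0] to [w] the derivative of the rest is the jump [PI i] of the logarithm, up to an error of
    order [/ N]. *)
Lemma kap0_difference (w w0 : C) (R0 N : R) : 0 < Im w -> 0 < Im w0 ->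
  0 < R0 -> Cmod w + Cmod w0 <= R0 -> 2 * R0 <= N ->
  Cmod (kap0 (w - RtoC N) - kap0 (w + RtoC N) - (kap0 (w0 - RtoC N) - kap0 (w0 + RtoC N))
        - (w - w0) * (RtoC PI * Ci))%C <= 2 * (R0 * (8 * R0 + 2) / N).
Proof.
intros Hw Hw0 HR0 HR HN.
set (ga := (w - w0)%C).
set (f := fun t => (kap0 ((w0 - RtoC N) + RtoC t * ga) - kap0 ((w0 + RtoC N) + RtoC t * ga)
    - (kap0 (w0 - RtoC N) - kap0 (w0 + RtoC N)) - RtoC t * (ga * (RtoC PI * Ci)))%C).
replace (_ - _ * _)%C with (f 1).
2:{ unfold f, ga; replace (w0 - RtoC N + RtoC 1 * (w - w0))%C with (w - RtoC N)%C by ring.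
    replace (w0 + RtoC N + RtoC 1 * (w - w0))%C with (w + RtoC N)%C by ring; ring. }
assert (Hga : Cmod ga <= R0).
{ unfold ga; eapply Rle_trans; [apply Cmod_triangle|]; rewrite Cmod_opp; lra. }
assert (Hv : forall t, 0 <= t <= 1 -> 0 < Im (w0 + RtoC t * ga)%C /\ Cmod (w0 + RtoC t * ga)%C <= R0).
{ intros t Ht; split.
  - unfold ga, Cminus; rewrite im_plus, im_scal_l, im_plus, im_opp; nra.
  - replace (w0 + RtoC t * ga)%C with (RtoC (1 - t) * w0 + RtoC t * w)%C
      by (unfold ga; rewrite RtoC_minus; ring).
    eapply Rle_trans; [apply Cmod_triangle|].
    rewrite !Cmod_mult, !Cmod_R, !Rabs_pos_eq by lra.
    generalize (Cmod_ge_0 w) (Cmod_ge_0 w0); nra. }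
assert (Hsl : forall t s, 0 <= t <= 1 -> slit ((w0 + RtoC s) + RtoC t * ga)%C).
{ intros t s Ht; apply slit_Im.
  replace (w0 + RtoC s + RtoC t * ga)%C with ((w0 + RtoC t * ga) + RtoC s)%C by ring.
  rewrite im_plus, im_RtoC; generalize (proj1 (Hv t Ht)); lra. }
assert (Hsl' : forall t s, 0 <= t <= 1 -> slit ((w0 - RtoC s) + RtoC t * ga)%C).
{ intros t s Ht; generalize (Hsl t (- s) Ht); rewrite RtoC_opp; intros H; exact H. }
assert (Hm : forall t s, 0 <= t <= 1 -> (s = N \/ s = - N) -> N / 2 <= Cmod ((w0 + RtoC s) + RtoC t * ga)%C).
{ intros t s Ht Hs.
  replace (w0 + RtoC s + RtoC t * ga)%C with ((w0 + RtoC t * ga) + RtoC s)%C by ring.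
  generalize (Cmod_triangle ((w0 + RtoC t * ga) + RtoC s)%C (- (w0 + RtoC t * ga))%C).
  replace (w0 + RtoC t * ga + RtoC s + - (w0 + RtoC t * ga))%C with (RtoC s) by ring.
  rewrite Cmod_opp, Cmod_R.
  assert (Rabs s = N).
  { destruct Hs as [->| ->]; [|rewrite Rabs_Ropp]; apply Rabs_pos_eq; lra. }
  generalize (proj2 (Hv t Ht)); lra. }
set (df := fun t => (ga * ((LE 2 ((w0 - RtoC N) + RtoC t * ga) - LE 2 ((w0 + RtoC N) + RtoC t * ga)
   - RtoC PI * Ci) + / RtoC 2 * (LE 3 ((w0 + RtoC N) + RtoC t * ga) - LE 3 ((w0 - RtoC N) + RtoC t * ga))))%C).
eapply Rle_trans.
- apply (Cder_growth f df (R0 * (8 * R0 + 2) / N) 0); [| | |lra].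
  + intros t Ht; unfold f, df, kap0; eapply Cder_eq.
    * apply Cder_minus; [apply Cder_minus; [|apply Cder_const]|].
      -- apply Cder_minus; (apply Cder_minus; [apply Cder_LE|apply Cder_scal, Cder_LE]; auto).
      -- apply Cder_mult; [apply Cder_id|apply Cder_const].
    * cbv beta; ring.
  + intros t Ht; rewrite pow_O, Rmult_1_r; unfold df.
    rewrite Cmod_mult; unfold Rdiv; rewrite Rmult_assoc.
    apply Rmult_le_compat; try apply Cmod_ge_0; [exact Hga|].
    eapply Rle_trans; [apply Cmod_triangle|].
    rewrite Rmult_plus_distr_r; apply Rplus_le_compat.
    * replace (w0 - RtoC N + RtoC t * ga)%C with ((w0 + RtoC t * ga) - RtoC N)%C by ring.
      replace (w0 + RtoC N + RtoC t * ga)%C with ((w0 + RtoC t * ga) + RtoC N)%C by ring.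
      apply Clog_jump; try apply Hv; assumption.
    * rewrite Cmod_mult, <- RtoC_inv, Cmod_R, Rabs_pos_eq by lra.
      generalize (Cmod_triangle (LE 3 ((w0 + RtoC N) + RtoC t * ga))
        (- LE 3 ((w0 - RtoC N) + RtoC t * ga))%C); rewrite Cmod_opp.
      rewrite !Cmod_LE3 by auto.
      assert (H1 : / Cmod (w0 + RtoC N + RtoC t * ga)%C <= / (N / 2)).
      { apply Rinv_le_contravar; [lra|apply Hm; auto]. }
      assert (H2 : / Cmod (w0 - RtoC N + RtoC t * ga)%C <= / (N / 2)).
      { apply Rinv_le_contravar; [lra|].
        generalize (Hm t (- N) Ht (or_intror eq_refl)); rewrite RtoC_opp; intros H; exact H. }
      replace (/ (N / 2)) with (2 * / N) in H1, H2 by (field; lra).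
      unfold Cminus in *; lra.
  + unfold f; replace (w0 - RtoC N + RtoC 0 * ga)%C with (w0 - RtoC N)%C by ring.
    replace (w0 + RtoC N + RtoC 0 * ga)%C with (w0 + RtoC N)%C by ring; ring.
- rewrite pow1; simpl INR; apply Req_le; field; lra.
Qed.

(** * Rows of the lattice in the upper half-plane *)

Definition lat (z al be : C) (n m : nat) : C :=
  (z + RtoC (INR n) * al + RtoC (INR m) * be)%C.

(** The imaginary part bounds the modulus below by a multiple of [m + 1], the real part then by a
    multiple of [k + 1]; the geometric mean of both separates the variables. Allowing a real [nu]
    with [k <= |nu|] covers both halves of a row. *)
Lemma uhp_lower (tau : C) (r L : R) : 0 < Im tau -> 0 < r -> 0 <= L ->
  exists kappa, 0 < kappa /\
  forall (z : C) (nu : R) (k m : nat) (ga : C) (t : R),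
    r <= Im z -> Rabs (Re z) <= L -> INR k <= Rabs nu ->
    ga = 1%C \/ ga = tau \/ ga = (1 + tau)%C -> 0 <= t <= 1 ->
    slit (z + RtoC nu + RtoC (INR m) * tau + RtoC t * ga)%C /\
    kappa * (sqrt (INR (S k)) * sqrt (INR (S m)))
      <= Cmod (z + RtoC nu + RtoC (INR m) * tau + RtoC t * ga)%C.
Proof.
intros Ht Hr HL.
set (k1 := Rmin r (Im tau)).
assert (Hk1 : 0 < k1) by (apply Rmin_pos; assumption).
set (L1 := L + Rabs (Re tau) + 1).
assert (HL1 : 1 <= L1) by (unfold L1; generalize (Rabs_pos (Re tau)); lra).
set (k2 := / (1 + (L1 + 1) / k1)).
assert (Hq : 0 < (L1 + 1) / k1) by (apply Rdiv_lt_0_compat; lra).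
assert (Hk2 : 0 < k2) by (apply Rinv_0_lt_compat; lra).
exists (sqrt (k1 * k2)); split; [apply sqrt_lt_R0, Rmult_lt_0_compat; assumption|].
intros z nu k m ga t Hz HRe Hnu Hga Htt.
set (W := (z + RtoC nu + RtoC (INR m) * tau + RtoC t * ga)%C).
assert (Hm := pos_INR m); assert (Hkk := pos_INR k).
assert (Hga1 : 0 <= Im ga /\ Rabs (Re ga) <= 1 + Rabs (Re tau)).
{ destruct Hga as [->|[->| ->]].
  - rewrite im_RtoC, re_RtoC, Rabs_R1; generalize (Rabs_pos (Re tau)); lra.
  - lra.
  - rewrite im_plus, re_plus, im_RtoC, re_RtoC.
    generalize (Rabs_triang 1 (Re tau)); rewrite Rabs_R1; lra. }
assert (HIm : k1 * INR (S m) <= Im W).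
{ unfold W; rewrite !im_plus, im_RtoC, !im_scal_l, S_INR.
  assert (k1 <= r) by apply Rmin_l; assert (k1 <= Im tau) by apply Rmin_r.
  assert (k1 * INR m <= INR m * Im tau) by nra.
  assert (0 <= t * Im ga) by (apply Rmult_le_pos; lra).
  lra. }
assert (HSm : 0 < INR (S m)) by (apply lt_0_INR; lia).
assert (Hpos : 0 < Im W) by (apply Rlt_le_trans with (2 := HIm), Rmult_lt_0_compat; assumption).
split; [apply slit_Im; lra|].
assert (HW1 : k1 * INR (S m) <= Cmod W).
{ generalize (im_le_Cmod W) (Rle_abs (Im W)); lra. }
assert (HW2 : INR (S k) <= Cmod W + (L1 + 1) * INR (S m)).
{ generalize (re_le_Cmod W).
  assert (E : nu = Re W - (Re z + INR m * Re tau + t * Re ga)).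
  { unfold W; rewrite !re_plus, re_RtoC, !re_scal_l; ring. }
  assert (HN : Rabs nu <= Rabs (Re W) + (Rabs (Re z) + INR m * Rabs (Re tau) + Rabs (Re ga))).
  { rewrite E at 1; eapply Rle_trans; [apply Rabs_triang|]; rewrite Rabs_Ropp.
    apply Rplus_le_compat_l.
    eapply Rle_trans; [apply Rabs_triang|]; apply Rplus_le_compat.
    - eapply Rle_trans; [apply Rabs_triang|]; rewrite Rabs_mult, (Rabs_pos_eq (INR m)) by lra; lra.
    - rewrite Rabs_mult, (Rabs_pos_eq t) by lra; generalize (Rabs_pos (Re ga)); nra. }
  rewrite !S_INR; generalize (Rabs_pos (Re tau)); unfold L1 in *; nra. }
assert (HW3 : k2 * INR (S k) <= Cmod W).
{ apply Rmult_le_reg_l with (/ k2); [apply Rinv_0_lt_compat, Hk2|].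
  rewrite <- Rmult_assoc, Rinv_l, Rmult_1_l by lra.
  unfold k2; rewrite Rinv_inv.
  assert ((L1 + 1) * INR (S m) <= (L1 + 1) / k1 * Cmod W).
  { replace ((L1 + 1) * INR (S m)) with ((L1 + 1) / k1 * (k1 * INR (S m))) by (field; lra).
    apply Rmult_le_compat_l; lra. }
  lra. }
assert (HX := sqrt_S_sq k); assert (HY := sqrt_S_sq m).
assert (HXp := sqrt_S_pos k); assert (HYp := sqrt_S_pos m).
assert (Hkp : 0 < k1 * k2) by (apply Rmult_lt_0_compat; assumption).
assert (HS := sqrt_sqrt (k1 * k2) (Rlt_le _ _ Hkp)); assert (HSp := sqrt_lt_R0 _ Hkp).
apply Rsqr_incr_0_var; [|apply Cmod_ge_0].
unfold Rsqr.
replace (sqrt (k1 * k2) * (sqrt (INR (S k)) * sqrt (INR (S m))) *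
  (sqrt (k1 * k2) * (sqrt (INR (S k)) * sqrt (INR (S m)))))
  with ((sqrt (k1 * k2) * sqrt (k1 * k2)) * sqrt (INR (S k)) ^ 2 * sqrt (INR (S m)) ^ 2) by ring.
rewrite HS, HX, HY.
replace (k1 * k2 * INR (S k) * INR (S m)) with ((k2 * INR (S k)) * (k1 * INR (S m))) by ring.
assert (HSk : 0 < INR (S k)) by (apply lt_0_INR; lia).
apply Rmult_le_compat; try assumption; apply Rmult_le_pos; lra.
Qed.

Lemma sqrt_S_ge_1 (n : nat) : 1 <= sqrt (INR (S n)).
Proof. rewrite <- sqrt_1 at 1; apply sqrt_le_1_alt; apply (le_INR 1); lia. Qed.

Lemma cc_bound_pw (al be w : C) (kappa : R) (k m : nat) :
  al <> RtoC 0 -> be <> RtoC 0 -> 0 < kappa ->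
  (forall ga t, ga = al \/ ga = be \/ ga = (al + be)%C -> 0 <= t <= 1 ->
     slit (w + RtoC t * ga)%C /\
     kappa * (sqrt (INR (S k)) * sqrt (INR (S m))) <= Cmod (w + RtoC t * ga)%C) ->
  Cmod (cc al be w) <= ccst al be * (6 / kappa ^ 4) * pw k * pw m.
Proof.
intros Ha Hb Hk H.
set (X := sqrt (INR (S k))) in *; set (Y := sqrt (INR (S m))) in *.
assert (HX : 1 <= X) by apply sqrt_S_ge_1; assert (HY : 1 <= Y) by apply sqrt_S_ge_1.
assert (HXY : 0 < X * Y) by nra.
eapply Rle_trans; [apply (cc_bound al be w (kappa * (X * Y))); auto|].
- apply Rmult_lt_0_compat; assumption.
- rewrite !Rmult_assoc; apply Rmult_le_compat_l; [apply ccst_pos|].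
  unfold pw; fold X Y.
  replace (6 / kappa ^ 4 * (/ X ^ 3 * / Y ^ 3)) with (6 / kappa ^ 4 / (X ^ 3 * Y ^ 3))
    by (field; repeat split; lra).
  replace (6 / (kappa * (X * Y)) ^ 4) with (6 / kappa ^ 4 / (X ^ 3 * Y ^ 3) * / (X * Y))
    by (field; repeat split; lra).
  rewrite <- (Rmult_1_r (6 / kappa ^ 4 / (X ^ 3 * Y ^ 3))) at 2.
  apply Rmult_le_compat_l.
  + apply Rmult_le_pos; [apply Rmult_le_pos; [lra|]|]; apply Rlt_le, Rinv_0_lt_compat.
    * apply pow_lt, Hk.
    * apply Rmult_lt_0_compat; apply pow_lt; lra.
  + rewrite <- Rinv_1; apply Rinv_le_contravar; nra.
Qed.

Lemma Im_neq0 (z : C) : 0 < Im z -> z <> RtoC 0.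
Proof. intros H E; rewrite E in H; simpl in H; lra. Qed.

Lemma pw_0 : pw 0 = 1.
Proof. unfold pw; simpl INR; rewrite sqrt_1; field. Qed.

(** The indices [n] and [- 1 - n] together run once through all integers. *)
Definition row (tau w : C) (n : nat) : C :=
  (cc 1 tau (w + RtoC (INR n)) + cc 1 tau (w - 1 - RtoC (INR n)))%C.

Lemma uhp_cc_bound (tau : C) (r L : R) : 0 < Im tau -> 0 < r -> 0 <= L ->
  exists K, 0 <= K /\ forall (z : C) (k m : nat), r <= Im z -> Rabs (Re z) <= L ->
    Cmod (cc 1 tau (z + RtoC (INR m) * tau + RtoC (INR k))%C) <= K * pw k * pw m /\
    Cmod (cc 1 tau (z + RtoC (INR m) * tau - 1 - RtoC (INR k))%C) <= K * pw k * pw m.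
Proof.
intros Ht Hr HL.
destruct (uhp_lower tau r L Ht Hr HL) as [kappa [Hk H]].
exists (ccst 1 tau * (6 / kappa ^ 4)); split.
{ apply Rmult_le_pos; [apply ccst_pos|].
  apply Rmult_le_pos; [lra|apply Rlt_le, Rinv_0_lt_compat, pow_lt, Hk]. }
intros z k m Hz HRe; split; (apply cc_bound_pw; [apply C1_nz|apply Im_neq0, Ht|exact Hk|]);
  intros ga t Hga Htt.
- replace (z + RtoC (INR m) * tau + RtoC (INR k))%C
    with (z + RtoC (INR k) + RtoC (INR m) * tau)%C by ring.
  apply H; auto; apply Rle_abs.
- replace (z + RtoC (INR m) * tau - 1 - RtoC (INR k))%C
    with (z + RtoC (- (1 + INR k)) + RtoC (INR m) * tau)%C by (rewrite RtoC_opp, RtoC_plus; ring).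
  apply H; auto; rewrite Rabs_Ropp, Rabs_pos_eq; generalize (pos_INR k); lra.
Qed.

Lemma row_bound (tau : C) (r L : R) : 0 < Im tau -> 0 < r -> 0 <= L ->
  exists K, 0 <= K /\ forall (z : C) (n : nat), r <= Im z -> Rabs (Re z) <= L ->
    Cmod (row tau z n) <= K * pw n.
Proof.
intros Ht Hr HL.
destruct (uhp_cc_bound tau r L Ht Hr HL) as [K [HK H]].
exists (2 * K); split; [lra|].
intros z n Hz HRe; destruct (H z n 0%nat Hz HRe) as [H1 H2].
rewrite pw_0 in H1, H2.
unfold row; eapply Rle_trans; [apply Cmod_triangle|].
replace (z + RtoC (INR 0) * tau)%C with z in H1, H2 by (simpl; ring); lra.
Qed.

(** Both halves of the row telescope, and their inner ends [kap tau w] cancel. *)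
Lemma row_exp (tau w : C) (N : nat) : 0 < Im w ->
  Cexp (Csum (row tau w) N) =
  (Cprod (fun n => (w + RtoC (INR n)) * (w - 1 - RtoC (INR n))) N *
   Cexp (kap tau (w - RtoC (INR N)) - kap tau (w + RtoC (INR N))))%C.
Proof.
intros Hw.
assert (E : Csum (row tau w) N =
  (Csum (fun n => Clog (w + RtoC (INR n)) + Clog (w - 1 - RtoC (INR n))) N +
   (kap tau (w - RtoC (INR N)) - kap tau (w + RtoC (INR N))))%C).
{ induction N as [|N IH].
  - simpl; replace (w - 0)%C with w by ring; replace (w + 0)%C with w by ring; ring.
  - rewrite !Csum_S, IH; unfold row; rewrite !cc_kap, S_INR, RtoC_plus.
    replace (w - 1 - RtoC (INR N) + 1)%C with (w - RtoC (INR N))%C by ring.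
    replace (w - (RtoC (INR N) + RtoC 1))%C with (w - 1 - RtoC (INR N))%C by ring.
    replace (w + (RtoC (INR N) + RtoC 1))%C with (w + RtoC (INR N) + 1)%C by ring.
    ring. }
rewrite E, Cexp_plus, Cexp_Csum; f_equal.
apply Cprod_ext; intros n _; rewrite Cexp_plus, !Cexp_Clog; [reflexivity| |];
  apply slit_Im; unfold Cminus; rewrite ?im_plus, ?im_opp, ?im_RtoC; lra.
Qed.

(** The two halves of the row are offset by one, so [w] and [w - (H + 1)] stay unpaired. As [q] does
    not depend on [w], it cancels in the ratio of two rows. *)
Lemma linear_product (H : nat) : exists q : C, q <> RtoC 0 /\ forall w,
  Cprod (fun n => (w + RtoC (INR n)) * (w - 1 - RtoC (INR n)))%C (S H) =
  (w * (w - RtoC (INR (S H))) * q * sineB w H)%C.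
Proof.
induction H as [|H [q [Hq IH]]].
- exists (RtoC 1); split; [apply C1_nz|]; intros w; unfold sineB; simpl; ring.
- exists (- (q * RtoC (INR (S H)) * RtoC (INR (S H))))%C; split.
  + intros E; assert (E2 : (q * RtoC (INR (S H)) * RtoC (INR (S H)))%C = RtoC 0).
    { replace (q * RtoC (INR (S H)) * RtoC (INR (S H)))%C
        with (- - (q * RtoC (INR (S H)) * RtoC (INR (S H))))%C by ring; rewrite E; ring. }
    revert E2; repeat apply Cmult_neq_0; try exact Hq; apply RtoC_S_neq0.
  + intros w; rewrite Cprod_S, IH; unfold sineB; rewrite (Cprod_S _ H).
    rewrite (S_INR (S H)), RtoC_plus; field; apply RtoC_S_neq0.
Qed.

Lemma e2_half_diff (w w0 : C) :
  Cexp ((w - w0) * (RtoC PI * Ci))%C = (/ e2 ((w0 - w) / RtoC 2))%C.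
Proof.
unfold e2; rewrite <- Cexp_opp; f_equal.
rewrite RtoC_mult; field; apply RtoC_neq0; lra.
Qed.

Lemma kap_jump (tau w w0 : C) : 0 < Im tau -> 0 < Im w -> 0 < Im w0 ->
  Clim (fun N => (kap tau (w - RtoC (INR N)) - kap tau (w + RtoC (INR N))
     - (kap tau (w0 - RtoC (INR N)) - kap tau (w0 + RtoC (INR N))))%C)
   ((w - w0) * (RtoC PI * Ci))%C.
Proof.
intros Ht Hw Hw0.
destruct (kap_asymptotic tau (Im_neq0 _ Ht)) as [K [HK HKa]].
set (R0 := Cmod w + Cmod w0 + Cmod tau + 1).
assert (Hcw := Cmod_ge_0 w); assert (Hcw0 := Cmod_ge_0 w0); assert (Hct := Cmod_ge_0 tau).
destruct (nfloor_ex (2 * R0) ltac:(unfold R0; lra)) as [N0 HN0].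
apply Clim_incr_n with (N := S N0).
assert (HN : forall n, 2 * R0 <= INR (n + S N0)).
{ intros n; rewrite plus_INR, S_INR; generalize (pos_INR n); lra. }
apply Clim_squeeze with (fun n => (8 * K + 2 * (R0 * (8 * R0 + 2))) * / INR (S n)).
2: apply is_lim_seq_inv_INR.
intros n; set (N := INR (n + S N0)); specialize (HN n); fold N in HN.
assert (HR : 1 <= R0) by (unfold R0; lra).
assert (HNn : INR (S n) <= N) by (apply le_INR; lia).
assert (HSn : 0 < INR (S n)) by (apply lt_0_INR; lia).
assert (Hb : forall v s, 0 < Im v -> Cmod v + Cmod tau <= R0 -> (s = N \/ s = - N) ->
  Cmod (kap tau (v + RtoC s) - kap0 (v + RtoC s))%C <= 2 * K / N).
{ intros v s Hv Hvt Hs.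
  replace (2 * K / N) with (K / (N / 2)) by (field; lra).
  apply HKa; [lra|].
  intros t Htt; split.
  - apply slit_Im; rewrite !im_plus, im_RtoC, im_scal_l.
    assert (0 <= t * Im tau) by (apply Rmult_le_pos; lra); lra.
  - assert (Rabs s = N).
    { destruct Hs as [->| ->]; [|rewrite Rabs_Ropp]; apply Rabs_pos_eq; lra. }
    generalize (Cmod_triangle (v + RtoC s + RtoC t * tau)%C (- (v + RtoC t * tau))%C).
    replace (v + RtoC s + RtoC t * tau + - (v + RtoC t * tau))%C with (RtoC s) by ring.
    rewrite Cmod_opp, Cmod_R.
    generalize (Cmod_triangle v (RtoC t * tau)%C); rewrite Cmod_mult, Cmod_R, (Rabs_pos_eq t) by lra.
    nra. }
assert (B1 := Hb w N Hw ltac:(unfold R0; lra) (or_introl eq_refl)).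
assert (B2 := Hb w (- N) Hw ltac:(unfold R0; lra) (or_intror eq_refl)).
assert (B3 := Hb w0 N Hw0 ltac:(unfold R0; lra) (or_introl eq_refl)).
assert (B4 := Hb w0 (- N) Hw0 ltac:(unfold R0; lra) (or_intror eq_refl)).
rewrite RtoC_opp in B2, B4.
change (w + - RtoC N)%C with (w - RtoC N)%C in B2.
change (w0 + - RtoC N)%C with (w0 - RtoC N)%C in B4.
assert (B0 := kap0_difference w w0 R0 N Hw Hw0 ltac:(lra) ltac:(unfold R0; lra) HN).
set (d0 := (_ - _ * _)%C) in B0.
set (d1 := (kap tau (w + _) - _)%C) in B1; set (d2 := (kap tau (w - _) - _)%C) in B2.
set (d3 := (kap tau (w0 + _) - _)%C) in B3; set (d4 := (kap tau (w0 - _) - _)%C) in B4.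
replace (_ - _ * _)%C with (d0 + ((d2 + - d1) + (d3 + - d4)))%C.
2:{ unfold d0, d1, d2, d3, d4; ring. }
apply Rle_trans with ((8 * K + 2 * (R0 * (8 * R0 + 2))) * / N).
- generalize (Cmod_triangle d0 ((d2 + - d1) + (d3 + - d4))%C)
    (Cmod_triangle (d2 + - d1)%C (d3 + - d4)%C) (Cmod_triangle d2 (- d1)%C) (Cmod_triangle d3 (- d4)%C).
  rewrite !Cmod_opp; unfold Rdiv in *; lra.
- apply Rmult_le_compat_l; [nra|]; apply Rinv_le_contravar; assumption.
Qed.

(** Comparing two rows avoids every normalising constant; the contribution [(w - w0) PI i] of
    [kap_jump] cancels the exponential factor of [sineB_ratio]. The limit runs through [N = 2 ^ n],
    the lengths for which the sine product is available. *)
Lemma row_exp_ratio (tau w w0 : C) : 0 < Im tau -> 0 < Im w -> 0 < Im w0 ->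
  (Cexp (CSer (row tau w)) * (1 - e2 w0) = Cexp (CSer (row tau w0)) * (1 - e2 w))%C.
Proof.
intros Ht Hw Hw0.
assert (Hlim : forall z, 0 < Im z ->
  Clim (fun n => Cexp (Csum (row tau z) (2 ^ n))) (Cexp (CSer (row tau z)))).
{ intros z Hz.
  destruct (row_bound tau (Im z) (Rabs (Re z)) Ht Hz (Rabs_pos _)) as [K [HK Hb]].
  destruct pw_summable as [U HU].
  apply Clim_Cexp.
  apply (Clim_subseq (Csum (row tau z)) _ (fun n => 2 ^ n)%nat).
  - intros P [N HN]; exists N; intros n Hn; apply HN.
    generalize (Nat.pow_gt_lin_r 2 n ltac:(lia)); lia.
  - apply (CSer_correct _ (fun n => K * pw n) (K * U)).
    + intros n; apply Hb; [apply Rle_refl|apply Rle_refl].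
    + apply summable_scal; assumption. }
assert (Hz := Im_neq0 _ Hw); assert (Hz0 := Im_neq0 _ Hw0).
assert (He := one_minus_e2_neq0 w Hw); assert (He0 := one_minus_e2_neq0 w0 Hw0).
assert (H1 : Clim (fun n => (Cexp (Csum (row tau w) (2 ^ n)) / Cexp (Csum (row tau w0) (2 ^ n)))%C)
   (Cexp (CSer (row tau w)) / Cexp (CSer (row tau w0)))%C).
{ apply Clim_div; [apply Cexp_neq0|apply Hlim, Hw|apply Hlim, Hw0]. }
assert (H2 : Clim (fun n => (Cexp (Csum (row tau w) (2 ^ n)) / Cexp (Csum (row tau w0) (2 ^ n)))%C)
   ((1 - e2 w) / (1 - e2 w0))%C).
{ apply Clim_ext with (fun n => ((w / w0) *
    ((w / RtoC (INR (S (2 ^ n - 1))) - 1) / (w0 / RtoC (INR (S (2 ^ n - 1))) - 1)) *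
    (sineB w (2 ^ n - 1) / sineB w0 (2 ^ n - 1)) *
    Cexp (kap tau (w - RtoC (INR (2 ^ n))) - kap tau (w + RtoC (INR (2 ^ n)))
     - (kap tau (w0 - RtoC (INR (2 ^ n))) - kap tau (w0 + RtoC (INR (2 ^ n))))))%C).
  - intros n; rewrite !row_exp by assumption.
    destruct (linear_product (2 ^ n - 1)) as [q [Hq Hl]].
    rewrite <- (S_pow2_pred n), !Hl, Cexp_minus.
    rewrite !S_pow2_pred.
    set (N := RtoC (INR (2 ^ n))).
    assert (HN : N <> RtoC 0).
    { unfold N; rewrite <- S_pow2_pred; apply RtoC_S_neq0. }
    assert (HwN : (w0 - N)%C <> RtoC 0).
    { apply Im_neq0; unfold N, Cminus; rewrite im_plus, im_opp, im_RtoC; lra. }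
    assert (HB : sineB w0 (2 ^ n - 1) <> RtoC 0).
    { apply Cprod_neq0; intros k _.
      destruct (sine_factor_lower w0 ltac:(lra)) as [c [Hc HB]].
      apply Cmod_gt_0, (Rlt_le_trans _ c); [exact Hc|apply HB]. }
    assert (Hw0N : (w0 / N - 1)%C <> RtoC 0).
    { replace (w0 / N - 1)%C with ((w0 - N) / N)%C by (field; exact HN).
      intros E; apply HwN; replace (w0 - N)%C with ((w0 - N) / N * N)%C by (field; exact HN).
      rewrite E; ring. }
    assert (HE := Cexp_neq0 (kap tau (w0 - N) - kap tau (w0 + N))).
    replace ((w / N - 1) / (w0 / N - 1))%C with ((w - N) / (w0 - N))%C.
    2:{ field; repeat split; try assumption. }
    unfold Cdiv; field; repeat split; assumption.
  - replace ((1 - e2 w) / (1 - e2 w0))%C with ((w / w0) * ((0 - 1) / (0 - 1)) *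
      (w0 / w * ((1 - e2 w) / (1 - e2 w0)) * e2 ((w0 - w) / RtoC 2)) * (/ e2 ((w0 - w) / RtoC 2)))%C.
    + apply Clim_mult; [apply Clim_mult; [apply Clim_mult; [apply Clim_const|]|]|].
      * apply (Clim_subseq (fun H => ((w / RtoC (INR (S H)) - 1) / (w0 / RtoC (INR (S H)) - 1))%C)
          _ (fun n => 2 ^ n - 1)%nat); [apply filterlim_pow2_pred|].
        apply Clim_div.
        -- intros E; apply C1_nz; replace (RtoC 1) with (- (0 - 1))%C by ring; rewrite E; ring.
        -- apply Clim_minus; [apply Clim_inv_INR|apply Clim_const].
        -- apply Clim_minus; [apply Clim_inv_INR|apply Clim_const].
      * apply sineB_ratio; assumption.
      * rewrite <- e2_half_diff; apply Clim_Cexp.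
        apply (Clim_subseq (fun N => (kap tau (w - RtoC (INR N)) - kap tau (w + RtoC (INR N))
          - (kap tau (w0 - RtoC (INR N)) - kap tau (w0 + RtoC (INR N))))%C) _ (fun n => 2 ^ n)%nat).
        -- intros P [N HN]; exists N; intros n Hn; apply HN.
           generalize (Nat.pow_gt_lin_r 2 n ltac:(lia)); lia.
        -- apply kap_jump; assumption.
    + field; repeat split; try assumption; apply e2_neq0. }
assert (E := Clim_unique _ _ _ H1 H2).
replace (Cexp (CSer (row tau w))) with
  (Cexp (CSer (row tau w)) / Cexp (CSer (row tau w0)) * Cexp (CSer (row tau w0)))%C
  by (field; apply Cexp_neq0).
rewrite E; field; exact He0.
Qed.

(** High up in the half-plane every term of the row tends to 0. This fixes the constant that
    [row_exp_ratio] leaves open, since [e2] tends to 0 there as well. *)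
Lemma row_at_infinity (tau : C) : 0 < Im tau ->
  Clim (fun i => CSer (row tau (RtoC (INR (S i)) * Ci)%C)) (RtoC 0).
Proof.
intros Ht.
destruct (row_bound tau 1 0 Ht Rlt_0_1 (Rle_refl 0)) as [K [HK Hb]].
destruct pw_summable as [U HU].
assert (HIm : forall i, Im (RtoC (INR (S i)) * Ci)%C = INR (S i)) by (intros; simpl; ring).
assert (HRe : forall i, Re (RtoC (INR (S i)) * Ci)%C = 0) by (intros; simpl; ring).
replace (RtoC 0) with (CSer (fun _ => RtoC 0)).
2:{ unfold CSer; apply Clim_C_lim_seq.
    apply Clim_ext with (fun _ => RtoC 0); [|apply Clim_const].
    intros n; symmetry; apply Csum_zero; reflexivity. }
apply (CSer_dominated _ _ (fun n => K * pw n) (K * U)).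
- intros i n; apply Hb; [rewrite HIm; apply (le_INR 1); lia|rewrite HRe, Rabs_R0; lra].
- apply summable_scal; assumption.
- intros n.
  assert (Hone : forall nu : R,
    Clim (fun i => cc 1 tau (RtoC (INR (S i)) * Ci + RtoC nu)%C) (RtoC 0)).
  { intros nu; apply Clim_squeeze with (fun i => ccst 1 tau * 6 * / INR (S i)); [|apply is_lim_seq_inv_INR].
    intros i; set (Y := INR (S i)).
    assert (HY : 1 <= Y) by (apply (le_INR 1); lia).
    replace (cc 1 tau (RtoC Y * Ci + RtoC nu) - RtoC 0)%C with (cc 1 tau (RtoC Y * Ci + RtoC nu)) by ring.
    eapply Rle_trans; [apply (cc_bound 1 tau _ Y); [apply C1_nz|apply Im_neq0, Ht|lra|]|].
    - intros ga t Hga Htt.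
      assert (HI : Y <= Im (RtoC Y * Ci + RtoC nu + RtoC t * ga)%C).
      { unfold Y at 2; rewrite !im_plus, im_RtoC, (HIm i), im_scal_l.
        assert (0 <= Im ga) by (destruct Hga as [->|[->| ->]]; rewrite ?im_plus, ?im_RtoC; lra).
        fold Y; assert (0 <= t * Im ga) by (apply Rmult_le_pos; lra); lra. }
      split; [apply slit_Im; lra|].
      generalize (im_le_Cmod (RtoC Y * Ci + RtoC nu + RtoC t * ga)%C)
        (Rle_abs (Im (RtoC Y * Ci + RtoC nu + RtoC t * ga)%C)); lra.
    - rewrite Rmult_assoc; apply Rmult_le_compat_l; [apply ccst_pos|].
      unfold Rdiv; apply Rmult_le_compat_l; [lra|]; apply Rinv_le_contravar; [lra|].
      rewrite <- (pow_1 Y) at 1; apply Rle_pow; [exact HY|lia]. }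
  unfold row; replace (RtoC 0) with (0 + 0)%C by ring.
  apply Clim_plus; [apply Hone|].
  eapply Clim_ext; [|apply (Hone (- (1 + INR n)))].
  intros i; cbv beta; f_equal; rewrite RtoC_opp, RtoC_plus; ring.
Qed.

Lemma row_exp_eq (tau w : C) : 0 < Im tau -> 0 < Im w ->
  Cexp (CSer (row tau w)) = (1 - e2 w)%C.
Proof.
intros Ht Hw.
assert (HIm : forall i, Im (RtoC (INR (S i)) * Ci)%C = INR (S i)) by (intros; simpl; ring).
assert (He : Clim (fun i => e2 (RtoC (INR (S i)) * Ci)) (RtoC 0)).
{ apply Clim_squeeze with (fun i => 1 * / INR (S i)); [|apply is_lim_seq_inv_INR].
  intros i; set (Y := INR (S i)).
  assert (HY : 1 <= Y) by (apply (le_INR 1); lia).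
  replace (e2 (RtoC Y * Ci) - RtoC 0)%C with (e2 (RtoC Y * Ci)) by ring.
  rewrite Cmod_e2; unfold Y; rewrite (HIm i); fold Y; rewrite exp_Ropp, Rmult_1_l.
  apply Rinv_le_contravar; [lra|].
  generalize (exp_ineq1_le (2 * PI * Y)) PI2_1; intros; nra. }
assert (H1 := Clim_mult _ _ _ _ (Clim_const (Cexp (CSer (row tau w))))
   (Clim_minus _ _ _ _ (Clim_const (RtoC 1)) He)).
assert (H2 := Clim_mult _ _ _ _ (Clim_Cexp _ _ (row_at_infinity tau Ht)) (Clim_const (1 - e2 w)%C)).
rewrite Cexp_0 in H2.
replace (Cexp (CSer (row tau w))) with (Cexp (CSer (row tau w)) * (RtoC 1 - RtoC 0))%C by ring.
replace (1 - e2 w)%C with (1 * (1 - e2 w))%C by ring.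
eapply Clim_unique; [exact H1|].
eapply Clim_ext; [|exact H2].
intros i; cbv beta; symmetry; apply row_exp_ratio; try assumption.
rewrite HIm; apply lt_0_INR; lia.
Qed.

(** * The modular relation of the q-Pochhammer symbol *)

(** Regularised logarithm of the product of the lattice points in a box. *)
Definition Lam (al be z : C) (N : nat) : C :=
  (Csum (fun n => Csum (fun m => Clog (lat z al be n m)) N) N
   - hh al be (z + RtoC (INR N) * al) - hh al be (z + RtoC (INR N) * be)
   + hh al be (z + RtoC (INR N) * al + RtoC (INR N) * be))%C.

Lemma DD_row (h : C -> C) (al be z : C) (n M : nat) :
  Csum (fun m => DD h al be (lat z al be n m)) M =
  ((h (lat z al be n 0) - h (lat z al be (S n) 0))
   - (h (lat z al be n M) - h (lat z al be (S n) M)))%C.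
Proof.
rewrite (Csum_ext _ (fun m => ((h (lat z al be n m) - h (lat z al be (S n) m))
   - (h (lat z al be n (S m)) - h (lat z al be (S n) (S m))))%C) M).
- rewrite (Csum_telescope (fun m => (h (lat z al be n m) - h (lat z al be (S n) m))%C)); ring.
- intros m _; unfold DD, lat; rewrite !S_INR, !RtoC_plus.
  replace (z + RtoC (INR n) * al + RtoC (INR m) * be + al + be)%C
    with (z + (RtoC (INR n) + RtoC 1) * al + (RtoC (INR m) + RtoC 1) * be)%C by ring.
  replace (z + RtoC (INR n) * al + RtoC (INR m) * be + al)%C
    with (z + (RtoC (INR n) + RtoC 1) * al + RtoC (INR m) * be)%C by ring.
  replace (z + RtoC (INR n) * al + RtoC (INR m) * be + be)%C
    with (z + RtoC (INR n) * al + (RtoC (INR m) + RtoC 1) * be)%C by ring.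
  ring.
Qed.

Lemma DD_box (h : C -> C) (al be z : C) (N M : nat) :
  Csum (fun n => Csum (fun m => DD h al be (lat z al be n m)) M) N =
  (h z - h (z + RtoC (INR N) * al) - h (z + RtoC (INR M) * be)
   + h (z + RtoC (INR N) * al + RtoC (INR M) * be))%C.
Proof.
rewrite (Csum_ext _ (fun n => ((h (lat z al be n 0) - h (lat z al be n M))
   - (h (lat z al be (S n) 0) - h (lat z al be (S n) M)))%C) N).
- rewrite (Csum_telescope (fun n => (h (lat z al be n 0) - h (lat z al be n M))%C)).
  unfold lat; simpl (INR 0).
  replace (z + RtoC 0 * al + RtoC 0 * be)%C with z by ring.
  replace (z + RtoC 0 * al + RtoC (INR M) * be)%C with (z + RtoC (INR M) * be)%C by ring.
  replace (z + RtoC (INR N) * al + RtoC 0 * be)%C with (z + RtoC (INR N) * al)%C by ring.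
  ring.
- intros n _; rewrite DD_row; ring.
Qed.

Lemma Lam_cc (al be z : C) (N : nat) :
  Csum (fun n => Csum (fun m => cc al be (lat z al be n m)) N) N =
  (Lam al be z N + hh al be z)%C.
Proof.
unfold cc; rewrite (Csum_ext _ (fun n => (Csum (fun m => Clog (lat z al be n m)) N
  + Csum (fun m => DD (hh al be) al be (lat z al be n m)) N)%C)).
- rewrite Csum_plus, DD_box; unfold Lam; ring.
- intros n _; apply Csum_plus.
Qed.

Lemma acoef_sym (al be : C) (j : nat) : acoef al be j = acoef be al j.
Proof.
destruct j as [|[|[|[|j]]]]; simpl; unfold Cdiv; try reflexivity.
- f_equal; ring.
- replace (RtoC 2 * al * be)%C with (RtoC 2 * be * al)%C by ring; ring.
- replace (RtoC 12 * al * be)%C with (RtoC 12 * be * al)%C by ring; ring.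
- ring.
Qed.

Lemma hh_sym (al be w : C) : hh al be w = hh be al w.
Proof.
unfold hh; f_equal; apply Csum_ext; intros j _; rewrite acoef_sym; reflexivity.
Qed.

Lemma lat_sym (z al be : C) (n m : nat) : lat z al be n m = lat z be al m n.
Proof. unfold lat; ring. Qed.

Lemma Lam_sym (al be z : C) (N : nat) : Lam al be z N = Lam be al z N.
Proof.
unfold Lam; rewrite Csum_swap.
rewrite (Csum_ext _ (fun j => Csum (fun i => Clog (lat z be al j i)) N)).
- rewrite !(hh_sym al be).
  replace (z + RtoC (INR N) * al + RtoC (INR N) * be)%C
    with (z + RtoC (INR N) * be + RtoC (INR N) * al)%C by ring.
  ring.
- intros j _; apply Csum_ext; intros i _; rewrite lat_sym; reflexivity.
Qed.

(** Half of the Bernoulli polynomial [B_{2,2}(w | al, be)]. *)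
Definition bern (al be w : C) : C :=
  (acoef al be 0 * (w * w / RtoC 2) + acoef al be 1 * w + acoef al be 2)%C.

(** [acoef] has degree [j - 2] and [LE j] degree [2 - j], except for the logarithm in [LE 0], [LE 1]
    and [LE 2]; those three terms produce [bern]. *)
Lemma hh_scale (l al be w : C) : l <> RtoC 0 -> al <> RtoC 0 -> be <> RtoC 0 -> w <> RtoC 0 ->
  Clog (l * w)%C = (Clog l + Clog w)%C ->
  hh (l * al) (l * be) (l * w)%C = (hh al be w - Clog l * bern al be w)%C.
Proof.
intros Hl Ha Hb Hw H.
assert (H2 : RtoC 2 <> RtoC 0) by (apply RtoC_neq0; lra).
assert (H12 : RtoC 12 <> RtoC 0) by (apply RtoC_neq0; lra).
assert (H24 : RtoC 24 <> RtoC 0) by (apply RtoC_neq0; lra).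
unfold hh, bern; cbn [Csum LE acoef]; rewrite H; cbn [Cpow].
replace (RtoC ((-1) ^ 0 * INR (fact 0))) with (RtoC 1) by (simpl; f_equal; ring).
field; repeat split; assumption.
Qed.

(** [bern] is quadratic with constant mixed difference 1, so its alternating corner sum over the box
    is the number of points. *)
Lemma bern_box (al be z : C) (N : nat) : al <> RtoC 0 -> be <> RtoC 0 ->
  (RtoC (INR N) * RtoC (INR N) + bern al be (z + RtoC (INR N) * al)
   + bern al be (z + RtoC (INR N) * be)
   - bern al be (z + RtoC (INR N) * al + RtoC (INR N) * be) = bern al be z)%C.
Proof.
intros Ha Hb.
assert (H2 : RtoC 2 <> RtoC 0) by (apply RtoC_neq0; lra).
assert (H12 : RtoC 12 <> RtoC 0) by (apply RtoC_neq0; lra).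
unfold bern, acoef; field; repeat split; assumption.
Qed.

(** The [N ^ 2] copies of [Clog l] and the corner terms combine by [bern_box] to a quantity
    independent of [N]. The hypothesis excludes a [2 PI i] jump at each point. *)
Lemma Lam_scale (l al be z : C) (N : nat) : l <> RtoC 0 -> al <> RtoC 0 -> be <> RtoC 0 ->
  (forall n m, lat z al be n m <> RtoC 0 /\
     Clog (l * lat z al be n m)%C = (Clog l + Clog (lat z al be n m))%C) ->
  Lam (l * al) (l * be) (l * z) N = (Lam al be z N + Clog l * bern al be z)%C.
Proof.
intros Hl Ha Hb H.
assert (Hlat : forall n m, lat (l * z) (l * al) (l * be) n m = (l * lat z al be n m)%C)
  by (intros; unfold lat; ring).
unfold Lam.
rewrite (Csum_ext _ (fun n => (RtoC (INR N) * Clog l + Csum (fun m => Clog (lat z al be n m)) N)%C)).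
2:{ intros n _.
    rewrite (Csum_ext _ (fun m => (Clog l + Clog (lat z al be n m))%C)).
    - rewrite Csum_plus, Csum_const; reflexivity.
    - intros m _; rewrite Hlat; apply H. }
rewrite Csum_plus, Csum_const.
set (x := RtoC (INR N)).
assert (E1 : (l * z + x * (l * al))%C = (l * (z + x * al))%C) by ring.
assert (E2 : (l * z + x * (l * be))%C = (l * (z + x * be))%C) by ring.
assert (E3 : (l * z + x * (l * al) + x * (l * be))%C = (l * (z + x * al + x * be))%C) by ring.
rewrite E3, E1, E2.
assert (L1 : lat z al be N 0 = (z + x * al)%C) by (unfold lat, x; simpl (INR 0); ring).
assert (L2 : lat z al be 0 N = (z + x * be)%C) by (unfold lat, x; simpl (INR 0); ring).
assert (L3 : lat z al be N N = (z + x * al + x * be)%C) by reflexivity.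
destruct (H N 0%nat) as [N1 C1]; destruct (H 0%nat N) as [N2 C2]; destruct (H N N) as [N3 C3].
rewrite L1 in N1, C1; rewrite L2 in N2, C2; rewrite L3 in N3, C3.
rewrite !hh_scale by assumption.
rewrite <- (bern_box al be z N Ha Hb); fold x; ring.
Qed.

(** A logarithm of the q-Pochhammer product, as [qpoch_product] shows; its branch is fixed by the
    lattice sum. *)
Definition qsum (tau z : C) : C :=
  CSer (fun m => CSer (row tau (z + RtoC (INR m) * tau))).

Lemma uhp_row_sum_bound (tau z : C) : 0 < Im tau -> 0 < Im z ->
  exists K U, summable pw U /\ 0 <= K /\
  (forall m n, Cmod (row tau (z + RtoC (INR m) * tau) n) <= pw m * (K * pw n)).
Proof.
intros Ht Hz.
destruct (uhp_cc_bound tau (Im z) (Rabs (Re z)) Ht Hz (Rabs_pos _)) as [K [HK Hb]].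
destruct pw_summable as [U HU].
exists (2 * K), U; split; [exact HU|split; [lra|]].
intros m n; unfold row; eapply Rle_trans; [apply Cmod_triangle|].
destruct (Hb z n m (Rle_refl _) (Rle_refl _)) as [H1 H2]; lra.
Qed.

Lemma qpoch_product (tau z : C) : 0 < Im tau -> 0 < Im z ->
  Clim (Cprod (fun m => 1 - e2 (z + RtoC (INR m) * tau))%C) (Cexp (qsum tau z)).
Proof.
intros Ht Hz.
destruct (uhp_row_sum_bound tau z Ht Hz) as [K [U [HU [HK Hb]]]].
apply Clim_ext with (fun M => Cexp (Csum (fun m => CSer (row tau (z + RtoC (INR m) * tau))) M)).
- intros M; rewrite Cexp_Csum; apply Cprod_ext; intros m _.
  apply row_exp_eq; [exact Ht|].
  rewrite im_plus, im_scal_l; generalize (pos_INR m); nra.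
- apply Clim_Cexp.
  assert (HKU : summable (fun n => K * pw n) (K * U)) by (apply summable_scal; assumption).
  apply (CSer_correct _ (fun m => (K * U) * pw m) (K * U * U)).
  + intros m; rewrite Rmult_comm.
    apply (CSer_bound _ (fun n => pw m * (K * pw n))); [apply Hb|].
    apply summable_scal; [apply HU|exact HKU].
  + apply summable_scal; [apply (summable_pos _ _ HKU)|exact HU].
Qed.

(** The half-plane lattice is the disjoint union of the cone at [z] in directions [1], [tau] and the
    cone at [z - 1] in directions [- 1], [tau]. *)
Lemma Lam_qsum (tau z : C) : 0 < Im tau -> 0 < Im z ->
  Clim (fun N => (Lam 1 tau z N + Lam (- (1)) tau (z - 1) N)%C) (qsum tau z).
Proof.
intros Ht Hz.
assert (Ht0 := Im_neq0 _ Ht).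
destruct (uhp_row_sum_bound tau z Ht Hz) as [K [U [HU [HK Hb]]]].
assert (HKU : summable (fun n => K * pw n) (K * U)) by (apply summable_scal; assumption).
assert (Hbox := CSer_box (fun m n => row tau (z + RtoC (INR m) * tau) n) _ _ _ _ HU HKU Hb).
change (CSer (fun m => CSer _)) with (qsum tau z) in Hbox.
destruct (hh_reflect tau Ht0) as [K' [HK' He]].
set (ee := fun w => (hh (- (1)) tau w + hh 1 tau (w + 1))%C).
assert (He' : forall w rho, 0 < rho ->
  (forall t, 0 <= t <= 1 -> slit (w + RtoC t * 1)%C /\ rho <= Cmod (w + RtoC t * 1)%C) ->
  Cmod (ee w) <= K' / rho) by exact He.
clear He.
(* At the three far corners of the left cone the rows carry corrections by [hh 1 tau], whereas [Lam]
   carries [hh (- (1)) tau]; [hh_reflect] makes the discrepancy vanish in the limit. *)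
set (err := fun N => (ee (z - 1 - RtoC (INR N)) + ee (z - 1 + RtoC (INR N) * tau)
   - ee (z - 1 - RtoC (INR N) + RtoC (INR N) * tau))%C).
assert (Herr : Clim err (RtoC 0)).
{ assert (Hk : exists k, 0 < k /\ forall w N, 0 < Im w -> Im z <= Im w -> (1 <= N)%nat ->
     (w = z - 1 - RtoC (INR N) \/ w = z - 1 + RtoC (INR N) * tau \/
      w = z - 1 - RtoC (INR N) + RtoC (INR N) * tau)%C -> Cmod (ee w) <= K' / k * / sqrt (INR (S N))).
  { destruct (uhp_lower tau (Im z) (Rabs (Re z)) Ht Hz (Rabs_pos _)) as [k [Hk Hl]].
    exists k; split; [exact Hk|].
    intros w N Hw Hzw HN Hcase.
    assert (HS := sqrt_S_pos N).
    replace (K' / k * / sqrt (INR (S N))) with (K' / (k * sqrt (INR (S N)))) by (field; lra).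
    apply (He' w (k * sqrt (INR (S N)))); [apply Rmult_lt_0_compat; assumption|].
    intros t Htt.
    assert (Hge : forall p, 1 <= sqrt (INR (S p))) by apply sqrt_S_ge_1.
    destruct Hcase as [->|[->| ->]].
    - destruct (Hl z (- (1 + INR N)) N 0%nat 1%C t (Rle_refl _) (Rle_refl _)) as [H1 H2]; auto.
      { rewrite Rabs_Ropp, Rabs_pos_eq; generalize (pos_INR N); lra. }
      replace (z + RtoC (- (1 + INR N)) + RtoC (INR 0) * tau + RtoC t * 1)%C
        with (z - 1 - RtoC (INR N) + RtoC t * 1)%C in H1, H2 by (rewrite RtoC_opp, RtoC_plus; simpl (INR 0); ring).
      split; [exact H1|]; eapply Rle_trans; [|exact H2].
      apply Rmult_le_compat_l; [lra|]; generalize (Hge 0%nat); nra.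
    - destruct (Hl z (- 1) 0%nat N 1%C t (Rle_refl _) (Rle_refl _)) as [H1 H2]; auto.
      { simpl; apply Rabs_pos. }
      replace (z + RtoC (-1) + RtoC (INR N) * tau + RtoC t * 1)%C
        with (z - 1 + RtoC (INR N) * tau + RtoC t * 1)%C in H1, H2
        by (replace (-1) with (- (1)) by ring; rewrite RtoC_opp; ring).
      split; [exact H1|]; eapply Rle_trans; [|exact H2].
      apply Rmult_le_compat_l; [lra|]; generalize (Hge 0%nat); nra.
    - destruct (Hl z (- (1 + INR N)) N N 1%C t (Rle_refl _) (Rle_refl _)) as [H1 H2]; auto.
      { rewrite Rabs_Ropp, Rabs_pos_eq; generalize (pos_INR N); lra. }
      replace (z + RtoC (- (1 + INR N)) + RtoC (INR N) * tau + RtoC t * 1)%C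
        with (z - 1 - RtoC (INR N) + RtoC (INR N) * tau + RtoC t * 1)%C in H1, H2
        by (rewrite RtoC_opp, RtoC_plus; ring).
      split; [exact H1|]; eapply Rle_trans; [|exact H2].
      apply Rmult_le_compat_l; [lra|]; generalize (Hge N); nra. }
  destruct Hk as [k [Hk Hl]].
  apply Clim_incr_n with (N := 1%nat).
  apply Clim_squeeze with (fun N => 3 * (K' / k) * / sqrt (INR (S (N + 1)))).
  - intros N; unfold err.
    replace (_ - RtoC 0)%C with (ee (z - 1 - RtoC (INR (N + 1))) + (ee (z - 1 + RtoC (INR (N + 1)) * tau)
       + - ee (z - 1 - RtoC (INR (N + 1)) + RtoC (INR (N + 1)) * tau)))%C by ring.
    assert (HIN : 0 <= INR (N + 1) * Im tau) by (apply Rmult_le_pos; [apply pos_INR|lra]).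
    assert (Hle : forall w, (w = z - 1 - RtoC (INR (N + 1)) \/ w = z - 1 + RtoC (INR (N + 1)) * tau \/
      w = z - 1 - RtoC (INR (N + 1)) + RtoC (INR (N + 1)) * tau)%C ->
      Cmod (ee w) <= K' / k * / sqrt (INR (S (N + 1)))).
    { intros w Hw.
      assert (Im z <= Im w).
      { destruct Hw as [->|[->| ->]]; unfold Cminus;
          rewrite ?im_plus, ?im_opp, ?im_plus, ?im_opp, ?im_RtoC, ?im_scal_l; lra. }
      apply Hl; [lra|assumption|lia|exact Hw]. }
    eapply Rle_trans; [apply Cmod_triangle|].
    generalize (Cmod_triangle (ee (z - 1 + RtoC (INR (N + 1)) * tau)%C)
      (- ee (z - 1 - RtoC (INR (N + 1)) + RtoC (INR (N + 1)) * tau))%C); rewrite Cmod_opp.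
    assert (L1 := Hle (z - 1 - RtoC (INR (N + 1)))%C ltac:(auto)).
    assert (L2 := Hle (z - 1 + RtoC (INR (N + 1)) * tau)%C ltac:(auto)).
    assert (L3 := Hle (z - 1 - RtoC (INR (N + 1)) + RtoC (INR (N + 1)) * tau)%C ltac:(auto)).
    lra.
  - apply is_lim_seq_eq with (3 * (K' / k) * 0); [|ring].
    apply (is_lim_seq_scal_l _ _ 0).
    apply (is_lim_seq_incr_n (fun n => / sqrt (INR (S n))) 1 0).
    apply (is_lim_seq_incr_1 (fun n => / sqrt (INR n)) 0).
    apply (is_lim_seq_inv (fun n => sqrt (INR n)) p_infty); [|discriminate].
    eapply filterlim_comp; [apply is_lim_seq_INR|apply filterlim_sqrt_p]. }
replace (qsum tau z) with (qsum tau z - RtoC 0)%C by ring.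
eapply Clim_ext; [|apply Clim_minus; [exact Hbox|exact Herr]].
intros N; cbv beta.
assert (E1 : Csum (fun m => Csum (fun n => row tau (z + RtoC (INR m) * tau) n) N) N =
  (Csum (fun n => Csum (fun m => cc 1 tau (lat z 1 tau n m)) N) N
   + Csum (fun n => Csum (fun m => cc 1 tau (lat (z - 1) (- (1)) tau n m)) N) N)%C).
{ rewrite (Csum_swap (fun n m => cc 1 tau (lat z 1 tau n m))).
  rewrite (Csum_swap (fun n m => cc 1 tau (lat (z - 1) (- (1)) tau n m))).
  rewrite <- Csum_plus; apply Csum_ext; intros m _.
  rewrite <- Csum_plus; apply Csum_ext; intros n _.
  unfold row, lat; f_equal; f_equal; ring. }
rewrite E1, Lam_cc.
assert (E2 : Csum (fun n => Csum (fun m => cc 1 tau (lat (z - 1) (- (1)) tau n m)) N) N =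
  (Csum (fun n => Csum (fun m => Clog (lat (z - 1) (- (1)) tau n m)) N) N
   - hh 1 tau z + hh 1 tau (z - RtoC (INR N)) + hh 1 tau (z + RtoC (INR N) * tau)
   - hh 1 tau (z - RtoC (INR N) + RtoC (INR N) * tau))%C).
(* The same mixed difference read from right to left: the shift by 1 and the sign turn a difference
   in direction [1] into one in direction [- 1]. *)
{ rewrite (Csum_ext _ (fun n => (Csum (fun m => Clog (lat (z - 1) (- (1)) tau n m)) N
     + Csum (fun m => DD (fun w => - hh 1 tau (w + 1))%C (- (1)) tau (lat (z - 1) (- (1)) tau n m)) N)%C)).
  - rewrite Csum_plus, DD_box.
    replace (z - 1 + 1)%C with z by ring.
    replace (z - 1 + RtoC (INR N) * - (1) + 1)%C with (z - RtoC (INR N))%C by ring.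
    replace (z - 1 + RtoC (INR N) * tau + 1)%C with (z + RtoC (INR N) * tau)%C by ring.
    replace (z - 1 + RtoC (INR N) * - (1) + RtoC (INR N) * tau + 1)%C
      with (z - RtoC (INR N) + RtoC (INR N) * tau)%C by ring.
    ring.
  - intros n _; rewrite <- Csum_plus; apply Csum_ext; intros m _.
    unfold cc, DD.
    set (w := lat (z - 1) (- (1)) tau n m).
    replace (w + - (1) + 1)%C with w by ring.
    replace (w + - (1) + tau + 1)%C with (w + tau)%C by ring.
    replace (w + tau + 1)%C with (w + 1 + tau)%C by ring.
    ring. }
rewrite E2; unfold Lam, err, ee.
replace (z - 1 + RtoC (INR N) * - (1))%C with (z - 1 - RtoC (INR N))%C by ring.
replace (z - 1 - RtoC (INR N) + 1)%C with (z - RtoC (INR N))%C by ring.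
replace (z - 1 + RtoC (INR N) * tau + 1)%C with (z + RtoC (INR N) * tau)%C by ring.
replace (z - 1 - RtoC (INR N) + RtoC (INR N) * tau + 1)%C
  with (z - RtoC (INR N) + RtoC (INR N) * tau)%C by ring.
ring.
Qed.

Lemma Im_inv_opp (tau : C) : 0 < Im tau -> 0 < Im (- / tau)%C.
Proof.
intros H; rewrite im_opp; unfold Cinv; simpl.
assert (0 < fst tau * (fst tau * 1) + snd tau * (snd tau * 1)).
{ unfold Im in H; nra. }
unfold Rdiv; rewrite Ropp_mult_distr_l, Ropp_involutive.
apply Rmult_lt_0_compat; [exact H|apply Rinv_0_lt_compat; assumption].
Qed.

Lemma Clog_inv_opp (tau : C) : 0 < Im tau -> Clog (- / tau)%C = (RtoC PI * Ci - Clog tau)%C.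
Proof.
intros H; assert (Hs : slit tau) by (apply slit_Im; lra).
apply Clog_unique.
- apply slit_Im; generalize (Im_inv_opp _ H); lra.
- rewrite Cexp_minus, Cexp_Clog by exact Hs.
  replace (Cexp (RtoC PI * Ci)) with (- (1))%C.
  + field; apply slit_neq0, Hs.
  + unfold Cexp; simpl.
    replace (PI * 0 - 0 * 1) with 0 by ring; replace (PI * 1 + 0 * 0) with PI by ring.
    rewrite exp_0, cos_PI, sin_PI; apply injective_projections; simpl; ring.
- unfold Cminus; rewrite im_plus, im_opp; simpl (Im (RtoC PI * Ci)%C).
  generalize (Clog_Im_pos _ H) (Clog_Im_bounds tau); lra.
Qed.

(** Each [qsum] splits into two cones. The left cone for [tau] is, up to rotation, the right cone
    for [- / tau] and cancels; the other two are those at [z] and [1 + tau - z]. The terms in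
    [Clog tau] cancel too, leaving [PI i] times [bern]. *)
Lemma modular_relation (tau : C) (x y : R) : 0 < Im tau -> 0 < x <= 1 -> 0 <= y < 1 ->
  let z := (RtoC x * tau + RtoC y)%C in
  Clim (fun N => (Lam 1 tau z N - Lam 1 tau (1 + tau - z) N)%C)
   (qsum tau z - qsum (- / tau) ((z - 1) / tau) + RtoC PI * Ci * bern 1 tau z)%C.
Proof.
intros Ht Hx Hy z.
assert (Ht0 := Im_neq0 _ Ht).
set (tau' := (- / tau)%C); set (z' := ((z - 1) / tau)%C).
assert (Ht' : 0 < Im tau') by apply Im_inv_opp, Ht.
assert (Ht0' := Im_neq0 _ Ht').
assert (Hz : 0 < Im z).
{ unfold z; rewrite im_plus, im_scal_l, im_RtoC; nra. }
assert (Ez' : z' = (RtoC x + RtoC (1 - y) * tau')%C).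
{ unfold z', z, tau'; rewrite RtoC_minus; field; exact Ht0. }
assert (Hz' : 0 < Im z').
{ rewrite Ez', im_plus, im_scal_l, im_RtoC; nra. }
assert (H2 : RtoC 2 <> RtoC 0) by (apply RtoC_neq0; lra).
assert (H12 : RtoC 12 <> RtoC 0) by (apply RtoC_neq0; lra).
assert (HQ1 := Lam_qsum tau z Ht Hz); assert (HQ2 := Lam_qsum tau' z' Ht' Hz').
(* Multiplication by [tau] sends the directions [tau'], [1] to [- 1], [tau] and the vertex [z'] to
   [z - 1]. *)
assert (HS1 : forall N, Lam (- (1)) tau (z - 1) N = (Lam 1 tau' z' N - Clog tau * bern 1 tau z)%C).
{ intros N.
  replace (Lam (- (1)) tau (z - 1) N) with (Lam (tau * tau') (tau * 1) (tau * z') N).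
  2:{ unfold tau', z'; f_equal; field; exact Ht0. }
  rewrite Lam_scale; try assumption; [|apply C1_nz|].
  - rewrite Lam_sym; replace (bern tau' 1 z') with (- bern 1 tau z)%C; [ring|].
    unfold bern, acoef, tau', z'; field; repeat split; first [assumption|apply C1_nz].
  - intros n m.
    assert (Hl : 0 < Im (lat z' tau' 1 n m)).
    { unfold lat; rewrite !im_plus, !im_scal_l, im_RtoC; generalize (pos_INR n) (pos_INR m); nra. }
    assert (El : (tau * lat z' tau' 1 n m)%C = (z - 1 - RtoC (INR n) + RtoC (INR m) * tau)%C).
    { unfold lat, z', tau'; field; exact Ht0. }
    assert (Hl' : 0 < Im (tau * lat z' tau' 1 n m)%C).
    { rewrite El; unfold Cminus; rewrite !im_plus, !im_opp, !im_scal_l, !im_RtoC.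
      generalize (pos_INR m); nra. }
    split; [apply Im_neq0, Hl|].
    apply Clog_mult; try lra; apply slit_Im; lra. }
(* Multiplication by [tau'] sends the directions [tau], [1] to [- 1], [tau'] and the reflected
   vertex [1 + tau - z] to [z' - 1]. *)
assert (HS2 : forall N, Lam (- (1)) tau' (z' - 1) N =
  (Lam 1 tau (1 + tau - z) N + (RtoC PI * Ci - Clog tau) * bern 1 tau z)%C).
{ intros N.
  replace (Lam (- (1)) tau' (z' - 1) N) with (Lam (tau' * tau) (tau' * 1) (tau' * (1 + tau - z)) N).
  2:{ unfold tau', z'; f_equal; field; exact Ht0. }
  rewrite Lam_scale; try assumption; [|apply C1_nz|].
  - rewrite Lam_sym; unfold tau' at 1; rewrite Clog_inv_opp by exact Ht.
    replace (bern tau 1 (1 + tau - z)) with (bern 1 tau z); [ring|].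
    unfold bern, acoef; field; repeat split; try assumption; apply C1_nz.
  - intros n m.
    assert (Elat : lat (1 + tau - z) tau 1 n m =
      (RtoC (1 - x + INR n) * tau + RtoC (1 - y + INR m))%C).
    { unfold lat, z; rewrite !RtoC_plus, !RtoC_minus; ring. }
    assert (Hn := pos_INR n); assert (Hm := pos_INR m).
    assert (Hl : 0 <= Im (lat (1 + tau - z) tau 1 n m)).
    { rewrite Elat, im_plus, im_scal_l, im_RtoC; nra. }
    (* For [x = 1] and [n = 0] these points are real; [y < 1] makes them positive, so they avoid the
       cut. *)
    assert (Hs : slit (lat (1 + tau - z) tau 1 n m)).
    { destruct Hl as [Hl|Hl]; [apply slit_Im; lra|].
      apply slit_Re; rewrite Elat, im_plus, im_scal_l, im_RtoC in Hl.
      rewrite Elat, re_plus, re_scal_l, re_RtoC.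
      assert (1 - x + INR n = 0) by nra.
      rewrite H; lra. }
    assert (El : (tau' * lat (1 + tau - z) tau 1 n m)%C =
      (RtoC (1 - y + INR m) * tau' + RtoC (- (1 - x + INR n)))%C).
    { rewrite Elat, RtoC_opp; unfold tau'; field; exact Ht0. }
    assert (Hl' : 0 < Im (tau' * lat (1 + tau - z) tau 1 n m)%C).
    { rewrite El, im_plus, im_scal_l, im_RtoC; nra. }
    split; [apply slit_neq0, Hs|].
    apply Clog_mult; try lra; try assumption; apply slit_Im; lra. }
eapply Clim_ext; [|apply Clim_plus; [apply Clim_minus; [exact HQ1|exact HQ2]|apply Clim_const]].
intros N; cbv beta; rewrite HS1, HS2; ring.
Qed.

(** * The limit at real parameters *)

(** The logarithm of a double gamma function: [- zeta_2'(0, z, tau)] for real [tau, z > 0]. *)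
Definition Gam (tau z : C) : C :=
  (CSer (fun n => CSer (fun m => cc 1 tau (lat z 1 tau n m))) - hh 1 tau z)%C.

Lemma right_lat_Re (delta : R) (tau z : C) (n m : nat) (ga : C) (t : R) :
  0 < delta <= 1 -> delta <= Re tau -> delta <= Re z ->
  ga = 1%C \/ ga = tau \/ ga = (1 + tau)%C -> 0 <= t <= 1 ->
  delta * (1 + INR n + INR m) <= Re (lat z 1 tau n m + RtoC t * ga)%C.
Proof.
intros Hd Ht Hz Hga Htt.
assert (Hg : 0 <= Re ga) by (destruct Hga as [->|[->| ->]]; rewrite ?re_plus, ?re_RtoC; lra).
assert (Hn := pos_INR n); assert (Hm := pos_INR m).
unfold lat; rewrite !re_plus, !re_scal_l, re_RtoC.
assert (0 <= t * Re ga) by (apply Rmult_le_pos; lra); nra.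
Qed.

Lemma sqrt_S_prod (n m : nat) :
  sqrt (INR (S n)) * sqrt (INR (S m)) <= 1 + INR n + INR m.
Proof.
assert (Hn := pos_INR n); assert (Hm := pos_INR m).
assert (HX := sqrt_S_sq n); assert (HY := sqrt_S_sq m).
rewrite S_INR in HX at 2; rewrite S_INR in HY at 2.
assert (HX1 := sqrt_S_ge_1 n); assert (HY1 := sqrt_S_ge_1 m).
assert (H1 : (sqrt (INR (S n)) * sqrt (INR (S m))) ^ 2 <= (1 + INR n + INR m) ^ 2).
{ replace ((sqrt (INR (S n)) * sqrt (INR (S m))) ^ 2)
    with (sqrt (INR (S n)) ^ 2 * sqrt (INR (S m)) ^ 2) by ring.
  rewrite HX, HY; nra. }
apply Rsqr_incr_0_var; [rewrite !Rsqr_pow2; exact H1|lra].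
Qed.

Lemma right_lat_bound (delta : R) (tau z : C) (n m : nat) (ga : C) (t : R) :
  0 < delta <= 1 -> delta <= Re tau -> delta <= Re z ->
  ga = 1%C \/ ga = tau \/ ga = (1 + tau)%C -> 0 <= t <= 1 ->
  slit (lat z 1 tau n m + RtoC t * ga)%C /\
  delta * (sqrt (INR (S n)) * sqrt (INR (S m))) <= Cmod (lat z 1 tau n m + RtoC t * ga)%C.
Proof.
intros Hd Ht Hz Hga Htt.
assert (HR := right_lat_Re delta tau z n m ga t Hd Ht Hz Hga Htt).
assert (Hs := sqrt_S_prod n m).
assert (HX1 := sqrt_S_ge_1 n); assert (HY1 := sqrt_S_ge_1 m).
assert (0 < delta * (1 + INR n + INR m)).
{ apply Rmult_lt_0_compat; [lra|]; generalize (pos_INR n) (pos_INR m); lra. }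
split; [apply slit_Re; lra|].
apply Rle_trans with (delta * (1 + INR n + INR m)); [apply Rmult_le_compat_l; lra|].
eapply Rle_trans; [exact HR|].
eapply Rle_trans; [apply Rle_abs|apply re_le_Cmod].
Qed.

Lemma Re_neq0 (z : C) : 0 < Re z -> z <> RtoC 0.
Proof. intros H E; rewrite E in H; simpl in H; lra. Qed.

Lemma right_cc_bound (delta : R) (tau z : C) (n m : nat) :
  0 < delta <= 1 -> delta <= Re tau -> delta <= Re z ->
  Cmod (cc 1 tau (lat z 1 tau n m)) <= (ccst 1 tau * (6 / delta ^ 4) * pw n) * pw m.
Proof.
intros Hd Ht Hz.
apply cc_bound_pw; [apply C1_nz|apply Re_neq0; lra|lra|].
intros ga t Hga Htt; apply right_lat_bound; assumption.
Qed.

Lemma Gam_lim (tau z : C) : 0 < Re tau -> 0 < Re z -> Clim (Lam 1 tau z) (Gam tau z).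
Proof.
intros Ht Hz.
set (delta := Rmin 1 (Rmin (Re tau) (Re z))).
assert (Hd : 0 < delta <= 1).
{ split; [repeat apply Rmin_pos; lra|apply Rmin_l]. }
assert (Hd1 : delta <= Re tau) by (eapply Rle_trans; [apply Rmin_r|apply Rmin_l]).
assert (Hd2 : delta <= Re z) by (eapply Rle_trans; [apply Rmin_r|apply Rmin_r]).
destruct pw_summable as [U HU].
assert (HK : 0 <= ccst 1 tau * (6 / delta ^ 4)).
{ apply Rmult_le_pos; [apply ccst_pos|].
  apply Rmult_le_pos; [lra|apply Rlt_le, Rinv_0_lt_compat, pow_lt, Hd]. }
unfold Gam.
eapply Clim_ext; [|apply Clim_minus; [apply (CSer_box (fun n m => cc 1 tau (lat z 1 tau n m))
   (fun n => ccst 1 tau * (6 / delta ^ 4) * pw n) pw (ccst 1 tau * (6 / delta ^ 4) * U) U)|apply Clim_const]].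
- intros N; cbv beta; rewrite Lam_cc; ring.
- apply summable_scal; assumption.
- exact HU.
- intros n m; apply right_cc_bound; assumption.
Qed.

(** * Continuity of the double gamma logarithm in its parameters *)

Lemma Clim_pow (u : nat -> C) (l : C) (k : nat) :
  Clim u l -> Clim (fun n => (u n ^ k)%C) (l ^ k)%C.
Proof.
intros H; induction k as [|k IH]; [apply (Clim_const (RtoC 1))|].
apply Clim_ext with (fun n => (u n * u n ^ k)%C); [intros; rewrite Cpow_S; reflexivity|].
rewrite Cpow_S; apply Clim_mult; assumption.
Qed.

Lemma Clim_Csum (a : nat -> nat -> C) (l : nat -> C) (N : nat) :
  (forall j, Clim (fun i => a i j) (l j)) -> Clim (fun i => Csum (a i) N) (Csum l N).
Proof.
intros H; induction N as [|N IH]; simpl; [apply Clim_const|apply Clim_plus; auto].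
Qed.

Lemma Clim_LE (u : nat -> C) (l : C) (j : nat) :
  slit l -> Clim u l -> Clim (fun n => LE j (u n)) (LE j l).
Proof.
intros Hs H; assert (Hl := Clim_Clog u l Hs H); assert (H0 := slit_neq0 _ Hs).
destruct j as [|[|[|k]]]; unfold LE.
- apply Clim_minus; [apply Clim_mult; [|exact Hl]|apply Clim_scal, Clim_mult; exact H].
  apply Clim_div; [apply RtoC_neq0; lra|apply Clim_mult; exact H|apply Clim_const].
- apply Clim_minus; [apply Clim_mult|]; assumption.
- exact Hl.
- apply Clim_scal, Clim_pow, Clim_inv; assumption.
Qed.

Lemma Clim_acoef (u : nat -> C) (l : C) (j : nat) :
  l <> RtoC 0 -> Clim u l -> Clim (fun n => acoef 1 (u n) j) (acoef 1 l j).
Proof.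
intros Hl H.
assert (H1l : (1 * l)%C <> RtoC 0) by (apply Cmult_neq_0; [apply C1_nz|exact Hl]).
assert (H2 : RtoC 2 <> RtoC 0) by (apply RtoC_neq0; lra).
assert (H12 : RtoC 12 <> RtoC 0) by (apply RtoC_neq0; lra).
assert (H24 : RtoC 24 <> RtoC 0) by (apply RtoC_neq0; lra).
destruct j as [|[|[|[|j]]]]; unfold acoef.
- apply Clim_inv; [exact H1l|apply Clim_scal, H].
- apply Clim_div.
  + repeat apply Cmult_neq_0; try assumption; apply C1_nz.
  + apply Clim_opp, Clim_plus; [apply Clim_const|exact H].
  + apply Clim_scal, H.
- apply Clim_div.
  + repeat apply Cmult_neq_0; try assumption; apply C1_nz.
  + apply Clim_plus; [apply Clim_plus; [apply Clim_const|apply Clim_mult; exact H]|].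
    apply Clim_scal, H.
  + apply Clim_scal, H.
- apply Clim_div; [exact H24| |apply Clim_const].
  apply Clim_opp, Clim_plus; [apply Clim_const|exact H].
- apply Clim_const.
Qed.

Lemma Clim_hh (u v : nat -> C) (tau w : C) :
  tau <> RtoC 0 -> slit w -> Clim u tau -> Clim v w ->
  Clim (fun n => hh 1 (u n) (v n)) (hh 1 tau w).
Proof.
intros Ht Hw Hu Hv; unfold hh.
apply Clim_opp.
apply (Clim_Csum (fun i j => (acoef 1 (u i) j * LE j (v i))%C) (fun j => (acoef 1 tau j * LE j w)%C)).
intros j; apply Clim_mult; [apply Clim_acoef|apply Clim_LE]; assumption.
Qed.

Lemma Clim_cc (u v : nat -> C) (tau w : C) :
  tau <> RtoC 0 -> slit w -> slit (w + 1)%C -> slit (w + tau)%C -> slit (w + 1 + tau)%C ->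
  Clim u tau -> Clim v w -> Clim (fun n => cc 1 (u n) (v n)) (cc 1 tau w).
Proof.
intros Ht H0 H1 H2 H3 Hu Hv; unfold cc, DD.
apply Clim_plus; [apply Clim_Clog; assumption|].
assert (Hv1 : Clim (fun n => (v n + 1)%C) (w + 1)%C) by (apply Clim_plus; [exact Hv|apply Clim_const]).
apply Clim_plus; [apply Clim_minus; [apply Clim_minus|]|]; apply Clim_hh; try assumption;
  apply Clim_plus; assumption.
Qed.

Lemma is_lim_seq_pow (u : nat -> R) (l : R) (k : nat) :
  is_lim_seq u l -> is_lim_seq (fun n => u n ^ k) (l ^ k).
Proof.
intros H; induction k as [|k IH]; [apply (is_lim_seq_const 1)|].
apply is_lim_seq_mult'; assumption.
Qed.

Lemma ccst_lim (u : nat -> C) (tau : C) : tau <> RtoC 0 -> Clim u tau ->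
  is_lim_seq (fun n => ccst 1 (u n)) (ccst 1 tau).
Proof.
intros Ht H.
assert (Hd : forall K, is_lim_seq (fun n => dbound 1 (u n) K) (dbound 1 tau K)).
{ intros K; unfold dbound.
  assert (H2 : forall (v : nat -> C) l, Clim v l ->
    is_lim_seq (fun n => (2 * Cmod (v n)) ^ K) ((2 * Cmod l) ^ K)).
  { intros v l Hv; apply is_lim_seq_pow.
    apply (is_lim_seq_scal_l _ 2 (Cmod l)), Clim_Cmod, Hv. }
  apply is_lim_seq_plus'; [apply is_lim_seq_plus'|].
  - apply (H2 (fun _ => RtoC 1)), Clim_const.
  - apply H2, H.
  - apply (H2 (fun n => (1 + u n)%C)), Clim_plus; [apply Clim_const|exact H]. }
unfold ccst; cbn [Rsum].
repeat (apply is_lim_seq_plus'; [|apply is_lim_seq_mult'; [apply Clim_Cmod, Clim_acoef; assumption|apply Hd]]).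
apply is_lim_seq_const.
Qed.

Lemma lim_bounded (u : nat -> R) (l : R) : is_lim_seq u l -> exists M, forall n, u n <= M.
Proof.
intros H.
destruct (filterlim_bounded (K := R_AbsRing) (V := R_NormedModule) u) as [M HM].
- exists l; exact H.
- exists M; intros n; eapply Rle_trans; [apply Rle_abs|apply HM].
Qed.

(** A common lower bound on the real parts and a bound on the convergent constants [ccst] give one
    majorant for the whole sequence of double sums. *)
Lemma Gam_cont (u v : nat -> C) (tau z : C) (delta : R) : 0 < delta <= 1 ->
  (forall n, delta <= Re (u n)) -> (forall n, delta <= Re (v n)) ->
  Clim u tau -> Clim v z -> Clim (fun n => Gam (u n) (v n)) (Gam tau z).
Proof.
intros Hd Hu Hv Hlu Hlv.
assert (Ht : delta <= Re tau).
{ apply Clim_components in Hlu.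
  apply (is_lim_seq_le _ _ _ _ Hu (is_lim_seq_const delta) (proj1 Hlu)). }
assert (Hz : delta <= Re z).
{ apply Clim_components in Hlv.
  apply (is_lim_seq_le _ _ _ _ Hv (is_lim_seq_const delta) (proj1 Hlv)). }
assert (Ht0 : tau <> RtoC 0) by (apply Re_neq0; lra).
destruct (lim_bounded _ _ (ccst_lim u tau Ht0 Hlu)) as [M HM].
destruct pw_summable as [U HU].
assert (Hd6 : 0 <= 6 / delta ^ 4).
{ apply Rmult_le_pos; [lra|apply Rlt_le, Rinv_0_lt_compat, pow_lt, Hd]. }
assert (HM0 : 0 <= M) by (eapply Rle_trans; [apply ccst_pos|apply (HM 0%nat)]).
apply Clim_minus; [|apply Clim_hh; try assumption; apply slit_Re; lra].
apply (CSer_double_dominated (fun i n m => cc 1 (u i) (lat (v i) 1 (u i) n m)) _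
  (fun n => M * (6 / delta ^ 4) * pw n) pw (M * (6 / delta ^ 4) * U) U).
- apply summable_scal; [apply Rmult_le_pos; assumption|exact HU].
- exact HU.
- intros i n m; eapply Rle_trans; [apply (right_cc_bound delta); auto|].
  apply Rmult_le_compat_r; [apply HU|].
  apply Rmult_le_compat_r; [apply HU|].
  apply Rmult_le_compat_r; [exact Hd6|apply HM].
- intros n m.
  assert (Hl : 0 < Re (lat z 1 tau n m)).
  { unfold lat; rewrite !re_plus, !re_scal_l, re_RtoC.
    generalize (pos_INR n) (pos_INR m); nra. }
  apply Clim_cc; try assumption; try (apply slit_Re; rewrite ?re_plus, ?re_RtoC; lra).
  unfold lat; apply Clim_plus; [apply Clim_plus; [exact Hlv|apply Clim_const]|].
  apply Clim_scal, Hlu.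
Qed.

Lemma Im0_plus (u v : C) : Im u = 0 -> Im v = 0 -> Im (u + v)%C = 0.
Proof. intros H1 H2; rewrite im_plus, H1, H2; ring. Qed.

Lemma Im0_opp (u : C) : Im u = 0 -> Im (- u)%C = 0.
Proof. intros H; rewrite im_opp, H; ring. Qed.

Lemma Im0_mult (u v : C) : Im u = 0 -> Im v = 0 -> Im (u * v)%C = 0.
Proof. intros H1 H2; rewrite im_mult, H1, H2; ring. Qed.

Lemma Im0_inv (u : C) : Im u = 0 -> Im (/ u)%C = 0.
Proof. unfold Im, Cinv; simpl; intros ->; unfold Rdiv; ring. Qed.

Lemma Im_bern (x y om : R) : Im (bern 1 (RtoC om) (RtoC x * RtoC om + RtoC y)) = 0.
Proof.
unfold bern, acoef, Cdiv.
repeat first [apply Im0_plus|apply Im0_mult|apply Im0_inv|apply Im0_opp|apply im_RtoC].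
Qed.

Lemma eventually_Re (u : nat -> C) (l : C) : Clim u l -> 0 < Re l ->
  exists N, forall n, (N <= n)%nat -> Re l / 2 <= Re (u n).
Proof.
intros [H _]%Clim_components Hl.
apply is_lim_seq_spec in H.
assert (Hp : 0 < Re l / 2) by lra.
destruct (H (mkposreal _ Hp)) as [N HN]; exists N; intros n Hn.
specialize (HN n Hn); simpl in HN; apply Rabs_lt_between in HN; lra.
Qed.

(** Once [tau n] has positive real part, the ranges of [x] and [y] keep [z] and [1 + tau - z] in the
    right half-plane. Both sequences of [modular_relation] then converge separately, to [Gam], whose
    continuity gives the limit. *)
Lemma qratio_limit (tau : nat -> C) (om x y : R) : 0 < om -> 0 < x <= 1 -> 0 <= y < 1 ->
  (forall n, 0 < Im (tau n)) -> Clim tau (RtoC om) ->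
  is_lim_seq (fun n =>
    Cmod (Cexp (qsum (tau n) (RtoC x * tau n + RtoC y))
          / Cexp (qsum (- / tau n) ((RtoC x * tau n + RtoC y - 1) / tau n)))%C)
   (exp (Re (Gam (RtoC om) (RtoC (x * om + y))
             - Gam (RtoC om) (RtoC (1 + om - (x * om + y))))%C)).
Proof.
intros Hom Hx Hy HIm Hlim.
destruct (eventually_Re tau (RtoC om) Hlim Hom) as [N0 HN0]; rewrite re_RtoC in HN0.
apply is_lim_seq_incr_n with N0.
set (sig := fun n => tau (n + N0)%nat).
assert (Hsig : forall n, om / 2 <= Re (sig n)) by (intros n; apply HN0; lia).
assert (HsIm : forall n, 0 < Im (sig n)) by (intros n; apply HIm).
assert (Hslim : Clim sig (RtoC om)) by (apply -> Clim_incr_n; exact Hlim).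
set (z := fun n => (RtoC x * sig n + RtoC y)%C).
assert (HzR : forall n, x * (om / 2) <= Re (z n)).
{ intros n; unfold z; rewrite re_plus, re_scal_l, re_RtoC; generalize (Hsig n); nra. }
assert (HzR' : forall n, 1 - y <= Re (1 + sig n - z n)%C).
{ intros n; unfold z, Cminus; rewrite !re_plus, re_opp, re_plus, re_scal_l, !re_RtoC.
  generalize (Hsig n); nra. }
set (delta := Rmin 1 (Rmin (om / 2) (Rmin (x * (om / 2)) (1 - y)))).
assert (Hxo : 0 < x * (om / 2)) by (apply Rmult_lt_0_compat; lra).
assert (Hd : 0 < delta <= 1).
{ split; [repeat apply Rmin_pos; lra|apply Rmin_l]. }
assert (Hd1 : delta <= om / 2) by (eapply Rle_trans; [apply Rmin_r|apply Rmin_l]).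
assert (Hd2 : delta <= x * (om / 2)).
{ eapply Rle_trans; [apply Rmin_r|]; eapply Rle_trans; [apply Rmin_r|apply Rmin_l]. }
assert (Hd3 : delta <= 1 - y).
{ eapply Rle_trans; [apply Rmin_r|]; eapply Rle_trans; [apply Rmin_r|apply Rmin_r]. }
assert (Hzlim : Clim z (RtoC (x * om + y))).
{ rewrite RtoC_plus, RtoC_mult; apply Clim_plus; [apply Clim_scal, Hslim|apply Clim_const]. }
assert (Hzlim' : Clim (fun n => (1 + sig n - z n)%C) (RtoC (1 + om - (x * om + y)))).
{ rewrite RtoC_minus, RtoC_plus; apply Clim_minus; [|exact Hzlim].
  apply Clim_plus; [apply Clim_const|exact Hslim]. }
assert (Hbern : Clim (fun n => (RtoC PI * Ci * bern 1 (sig n) (z n))%C)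
   (RtoC PI * Ci * bern 1 (RtoC om) (RtoC x * RtoC om + RtoC y))%C).
{ apply Clim_scal; unfold bern.
  assert (Hom0 : RtoC om <> RtoC 0) by (apply RtoC_neq0; lra).
  rewrite RtoC_plus, RtoC_mult in Hzlim.
  apply Clim_plus; [apply Clim_plus|]; try (apply Clim_acoef; assumption);
    apply Clim_mult; try (apply Clim_acoef; assumption); try assumption.
  apply Clim_div; [apply RtoC_neq0; lra|apply Clim_mult; assumption|apply Clim_const]. }
assert (HG : Clim (fun n => (Gam (sig n) (z n) - Gam (sig n) (1 + sig n - z n)
    - RtoC PI * Ci * bern 1 (sig n) (z n))%C)
  (Gam (RtoC om) (RtoC (x * om + y)) - Gam (RtoC om) (RtoC (1 + om - (x * om + y)))
    - RtoC PI * Ci * bern 1 (RtoC om) (RtoC x * RtoC om + RtoC y))%C).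
{ apply Clim_minus; [apply Clim_minus|exact Hbern].
  - apply (Gam_cont sig z _ _ delta); try assumption; intros n.
    + generalize (Hsig n); lra.
    + generalize (HzR n); lra.
  - apply (Gam_cont sig (fun n => (1 + sig n - z n)%C) _ _ delta); try assumption; intros n.
    + generalize (Hsig n); lra.
    + generalize (HzR' n); lra. }
assert (Hre : is_lim_seq (fun n => exp (Re (Gam (sig n) (z n) - Gam (sig n) (1 + sig n - z n)
    - RtoC PI * Ci * bern 1 (sig n) (z n))%C))
  (exp (Re (Gam (RtoC om) (RtoC (x * om + y))
             - Gam (RtoC om) (RtoC (1 + om - (x * om + y))))%C))).
{ apply Clim_components in HG; destruct HG as [HG _].
  apply is_lim_seq_continuous; [apply derivable_continuous_pt, derivable_pt_exp|].
  eapply is_lim_seq_eq; [exact HG|].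
  unfold Cminus at 1; rewrite re_plus, re_opp.
  (* The Bernoulli term is purely imaginary because [om] is real. *)
  replace (Re (RtoC PI * Ci * bern 1 (RtoC om) (RtoC x * RtoC om + RtoC y))%C) with 0; [ring|].
  rewrite re_mult, Im_bern; simpl; ring. }
eapply is_lim_seq_ext; [|exact Hre].
intros n; cbv beta; fold (sig n); fold (z n).
rewrite <- Cexp_minus, Cmod_Cexp; do 2 f_equal.
assert (HM := modular_relation (sig n) x y (HsIm n) Hx Hy); cbv zeta in HM; fold (z n) in HM.
assert (HL : Clim (fun N => (Lam 1 (sig n) (z n) N - Lam 1 (sig n) (1 + sig n - z n) N)%C)
  (Gam (sig n) (z n) - Gam (sig n) (1 + sig n - z n))%C).
{ apply Clim_minus; apply Gam_lim; generalize (Hsig n) (HzR n) (HzR' n); lra. }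
rewrite (Clim_unique _ _ _ HL HM).
change (z n - 1)%C with (RtoC x * sig n + RtoC y - 1)%C; ring.
Qed.

(** * Complex power series *)

Lemma filterlim_Clim (u : nat -> C) (l : C) :
  filterlim u eventually (locally (T := C_UniformSpace) l) <-> Clim u l.
Proof.
split.
- intros H; apply Clim_components; split.
  + apply (filterlim_comp _ _ _ u fst eventually (locally (T := C_UniformSpace) l)); [exact H|].
    apply (continuous_fst (U := R_UniformSpace) (V := R_UniformSpace) (fst l) (snd l)).
  + apply (filterlim_comp _ _ _ u snd eventually (locally (T := C_UniformSpace) l)); [exact H|].
    apply (continuous_snd (U := R_UniformSpace) (V := R_UniformSpace) (fst l) (snd l)).
- intros H; apply filterlim_locally; intros eps.
  apply is_lim_seq_spec in H; destruct (H eps) as [N HN]; exists N; intros n Hn.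
  apply (C_NormedModule_mixin_compat1 l (u n) eps).
  specialize (HN n Hn); rewrite Rminus_0_r, Rabs_pos_eq in HN by apply Cmod_ge_0.
  exact HN.
Qed.

Lemma sum_n_Csum (a : nat -> C) (n : nat) :
  sum_n (G := C_AbelianMonoid) a n = Csum a (S n).
Proof.
induction n as [|n IH].
- rewrite sum_O; simpl; ring.
- rewrite sum_Sn, IH; reflexivity.
Qed.

Lemma is_series_Clim (a : nat -> C) (l : C) :
  is_series (K := C_AbsRing) (V := C_NormedModule) a l <-> Clim (Csum a) l.
Proof.
unfold is_series.
rewrite (Clim_incr_n (Csum a) 1 l), <- filterlim_Clim.
split; apply filterlim_ext; intros n; rewrite Nat.add_1_r, <- sum_n_Csum; reflexivity.
Qed.

Lemma is_pseries_Clim (c : nat -> C) (x l : C) :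
  is_pseries (K := C_AbsRing) (V := C_NormedModule) c x l <->
  Clim (Csum (fun k => (c k * x ^ k)%C)) l.
Proof.
unfold is_pseries; rewrite is_series_Clim.
assert (E : forall k, scal (V := C_NormedModule) (pow_n (K := C_AbsRing) x k) (c k) = (c k * x ^ k)%C).
{ intros k; change (scal (V := C_NormedModule) (pow_n (K := C_AbsRing) x k) (c k))
    with (pow_n (K := C_AbsRing) x k * c k)%C.
  apply Cmult_comm. }
split; apply Clim_ext; intros n; apply Csum_ext; intros k _; rewrite E; reflexivity.
Qed.

Lemma Clim_eq (u : nat -> C) (l l' : C) : Clim u l -> l = l' -> Clim u l'.
Proof. intros H <-; exact H. Qed.

(** Analyticity with radius and coefficients made explicit, so that infinitely many functions can be
    expanded on one common disc. *)
Definition AN (f : C -> C) (s0 : C) (rho : R) (c : nat -> C) : Prop :=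
  forall s, Cmod (s - s0)%C < rho -> Clim (Csum (fun k => (c k * (s - s0) ^ k)%C)) (f s).

Lemma AN_analytic (f : C -> C) (s0 : C) (rho : R) (c : nat -> C) :
  0 < rho -> AN f s0 rho c -> analytic_at f s0.
Proof.
intros Hr H; exists c, rho; split; [exact Hr|].
intros s Hs; apply is_pseries_Clim, H, Hs.
Qed.

Lemma analytic_AN (f : C -> C) (s0 : C) :
  analytic_at f s0 -> exists rho c, 0 < rho /\ AN f s0 rho c.
Proof.
intros [c [rho [Hr H]]]; exists rho, c; split; [exact Hr|].
intros s Hs; apply is_pseries_Clim, H, Hs.
Qed.

Lemma AN_mono (f : C -> C) (s0 : C) (rho rho' : R) (c : nat -> C) :
  rho' <= rho -> AN f s0 rho c -> AN f s0 rho' c.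
Proof. intros Hr H s Hs; apply H; lra. Qed.

Lemma AN_ext (f g : C -> C) (s0 : C) (rho : R) (c : nat -> C) :
  (forall s, Cmod (s - s0)%C < rho -> f s = g s) -> AN f s0 rho c -> AN g s0 rho c.
Proof. intros E H s Hs; rewrite <- E by exact Hs; apply H, Hs. Qed.

Lemma geom_summable (q : R) : 0 <= q < 1 -> summable (pow q) (/ (1 - q)).
Proof.
intros Hq; split; [intros n; apply pow_le; lra|].
apply is_lim_seq_ext with (fun n => / (1 - q) - / (1 - q) * q ^ n).
- intros n; induction n as [|n IH]; simpl; [field; lra|rewrite <- IH; field; lra].
- apply is_lim_seq_eq with (/ (1 - q) - / (1 - q) * 0); [|ring].
  apply is_lim_seq_minus'; [apply is_lim_seq_const|].
  apply (is_lim_seq_scal_l _ _ 0), is_lim_seq_geom; rewrite Rabs_pos_eq; lra.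
Qed.

Lemma summable_dominated (a b : nat -> R) (B : R) :
  (forall n, 0 <= a n <= b n) -> summable b B -> exists A, summable a A.
Proof.
intros Ha Hb.
destruct (Rsum_abs_conv a b B) as [A HA]; [|exact Hb|].
- intros n; rewrite Rabs_pos_eq; apply Ha.
- exists A; split; [intros n; apply Ha|exact HA].
Qed.

Lemma AN_summable (f : C -> C) (s0 : C) (rho : R) (c : nat -> C) (r : R) :
  AN f s0 rho c -> 0 <= r < rho -> exists B, summable (fun k => Cmod (c k) * r ^ k) B.
Proof.
intros H Hr.
(* Convergence at an intermediate radius bounds the terms there; the ratio [r / r1 < 1] then
   supplies a geometric majorant. *)
set (r1 := (r + rho) / 2).
assert (Hr1 : r < r1 < rho) by (unfold r1; lra).
assert (Hc : exists K, forall k, Cmod (c k) * r1 ^ k <= K).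
{ assert (Hs : Cmod ((s0 + RtoC r1) - s0)%C < rho).
  { replace (s0 + RtoC r1 - s0)%C with (RtoC r1) by ring.
    rewrite Cmod_R, Rabs_pos_eq; lra. }
  specialize (H _ Hs); replace (s0 + RtoC r1 - s0)%C with (RtoC r1) in H by ring.
  assert (H0 : Clim (fun k => (c k * RtoC r1 ^ k)%C) (RtoC 0)).
  { replace (RtoC 0) with (f (s0 + RtoC r1)%C - f (s0 + RtoC r1)%C)%C by ring.
    eapply Clim_ext; [|apply Clim_minus; [apply (proj1 (Clim_incr_n _ 1 _) H)|exact H]].
    intros n; cbv beta; rewrite Nat.add_1_r, Csum_S; ring. }
  assert (H1 : exists M, forall n, Cmod (c n * RtoC r1 ^ n)%C <= M).
  { apply Clim_Cmod in H0.
    destruct (filterlim_bounded (K := R_AbsRing) (V := R_NormedModule)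
      (fun n => Cmod (c n * RtoC r1 ^ n)%C)) as [M HM]; [eexists; exact H0|].
    exists M; intros n; eapply Rle_trans; [apply Rle_abs|apply HM]. }
  destruct H1 as [x H1]; exists x; intros k; generalize (H1 k).
  rewrite Cmod_mult, Cmod_pow, Cmod_R, Rabs_pos_eq by lra; auto. }
destruct Hc as [K HK].
apply (summable_dominated _ (fun k => K * (r / r1) ^ k) (K * / (1 - r / r1))).
- intros k; split; [apply Rmult_le_pos; [apply Cmod_ge_0|apply pow_le; lra]|].
  replace (Cmod (c k) * r ^ k) with (Cmod (c k) * r1 ^ k * (r / r1) ^ k).
  + apply Rmult_le_compat_r; [|apply HK].
    apply pow_le, Rmult_le_pos; [lra|apply Rlt_le, Rinv_0_lt_compat; lra].
  + unfold Rdiv; rewrite Rpow_mult_distr, pow_inv; field; apply pow_nonzero; lra.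
- apply summable_scal.
  + apply Rle_trans with (2 := HK 0%nat); simpl; rewrite Rmult_1_r; apply Cmod_ge_0.
  + apply geom_summable; split.
    * apply Rmult_le_pos; [lra|apply Rlt_le, Rinv_0_lt_compat; lra].
    * apply Rmult_lt_reg_r with r1; [lra|]; unfold Rdiv; rewrite Rmult_assoc, Rinv_l; lra.
Qed.

Lemma CSer_finite (f : nat -> C) (N : nat) :
  (forall n, (N <= n)%nat -> f n = RtoC 0) -> CSer f = Csum f N.
Proof.
intros H; apply Clim_C_lim_seq.
apply Clim_incr_n with (N := N).
apply Clim_ext with (fun _ => Csum f N); [|apply Clim_const].
intros n; rewrite Nat.add_comm, Csum_split, (Csum_zero (fun k => f (N + k)%nat)); [ring|].
intros k _; apply H; lia.
Qed.

Lemma CSer_scal (c : C) (a : nat -> C) (b : nat -> R) (B : R) :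
  (forall n, Cmod (a n) <= b n) -> summable b B ->
  CSer (fun n => (c * a n)%C) = (c * CSer a)%C.
Proof.
intros Ha Hb; apply Clim_C_lim_seq.
apply Clim_ext with (fun n => (c * Csum a n)%C); [intros; symmetry; apply Csum_scal|].
apply Clim_scal, (CSer_correct a b B); assumption.
Qed.

(** A triangular partial sum is the sum over [j] of [a j] times a partial sum of [b] of length
    [N - j], to which dominated convergence applies. *)
Lemma cauchy_product (a b : nat -> C) (u v : nat -> R) (U V : R) (la lb : C) :
  (forall n, Cmod (a n) <= u n) -> summable u U ->
  (forall n, Cmod (b n) <= v n) -> summable v V ->
  Clim (Csum a) la -> Clim (Csum b) lb ->
  Clim (Csum (fun l => Csum (fun j => a j * b (l - j)%nat)%C (S l))) (la * lb)%C.
Proof.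
intros Ha Hu Hb Hv Hla Hlb.
apply Clim_ext with (fun N => CSer (fun j => (a j * Csum b (N - j))%C)).
- intros N.
  rewrite (CSer_finite _ N).
  + rewrite <- (Csum_triangle (fun j i => (a j * b i)%C)).
    apply Csum_ext; intros j _; symmetry; apply Csum_scal.
  + intros n Hn; replace (N - n)%nat with 0%nat by lia; simpl; ring.
- replace (la * lb)%C with (CSer (fun j => (a j * lb)%C)).
  + apply (CSer_dominated _ _ (fun j => V * u j) (V * U)).
    * intros i n; rewrite Cmod_mult, Rmult_comm.
      apply Rmult_le_compat; try apply Cmod_ge_0; [|apply Ha].
      eapply Rle_trans; [apply (Cmod_Csum_le _ v); intros; apply Hb|apply summable_le, Hv].
    * apply summable_scal; [apply (summable_pos v), Hv|exact Hu].
    * intros n; apply Clim_scal.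
      apply Clim_incr_n with (N := n).
      apply Clim_ext with (Csum b); [|exact Hlb].
      intros k; f_equal; lia.
  + apply Clim_C_lim_seq.
    apply Clim_ext with (fun N => (lb * Csum a N)%C).
    * intros N; rewrite <- Csum_scal; apply Csum_ext; intros; ring.
    * rewrite (Cmult_comm la lb); apply Clim_scal, Hla.
Qed.

Lemma AN_const (k : C) (s0 : C) (rho : R) : exists c, AN (fun _ => k) s0 rho c.
Proof.
exists (fun n => match n with O => k | S _ => RtoC 0 end).
intros s _; apply Clim_incr_n with (N := 1%nat).
apply Clim_ext with (fun _ => k); [|apply Clim_const].
intros n; rewrite Nat.add_1_r, Csum_shift, Csum_zero; [simpl; ring|].
intros; ring.
Qed.

Lemma AN_id (s0 : C) (rho : R) : exists c, AN (fun s => s) s0 rho c.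
Proof.
exists (fun n => match n with O => s0 | S O => RtoC 1 | _ => RtoC 0 end).
intros s _; apply Clim_incr_n with (N := 2%nat).
apply Clim_ext with (fun _ => s); [|apply Clim_const].
intros n; replace (n + 2)%nat with (S (S n)) by lia.
rewrite !Csum_shift, Csum_zero; [simpl; ring|].
intros; ring.
Qed.

Lemma AN_plus (f g : C -> C) (s0 : C) (rho : R) (c d : nat -> C) :
  AN f s0 rho c -> AN g s0 rho d ->
  AN (fun s => (f s + g s)%C) s0 rho (fun k => (c k + d k)%C).
Proof.
intros Hf Hg s Hs.
eapply Clim_ext; [|apply Clim_plus; [apply Hf, Hs|apply Hg, Hs]].
intros n; cbv beta; rewrite <- Csum_plus; apply Csum_ext; intros; ring.
Qed.

Lemma AN_scal (k : C) (f : C -> C) (s0 : C) (rho : R) (c : nat -> C) :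
  AN f s0 rho c -> AN (fun s => (k * f s)%C) s0 rho (fun n => (k * c n)%C).
Proof.
intros Hf s Hs.
eapply Clim_ext; [|apply Clim_scal, Hf, Hs].
intros n; cbv beta; rewrite <- Csum_scal; apply Csum_ext; intros; ring.
Qed.

Lemma AN_mult (f g : C -> C) (s0 : C) (rho : R) (c d : nat -> C) :
  AN f s0 rho c -> AN g s0 rho d ->
  AN (fun s => (f s * g s)%C) s0 rho (fun l => Csum (fun j => c j * d (l - j)%nat)%C (S l)).
Proof.
intros Hf Hg s Hs.
destruct (AN_summable f s0 rho c (Cmod (s - s0)) Hf (conj (Cmod_ge_0 _) Hs)) as [U HU].
destruct (AN_summable g s0 rho d (Cmod (s - s0)) Hg (conj (Cmod_ge_0 _) Hs)) as [V HV].
eapply Clim_ext; [|apply (cauchy_product (fun k => (c k * (s - s0) ^ k)%C)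
   (fun k => (d k * (s - s0) ^ k)%C) (fun k => Cmod (c k) * Cmod (s - s0) ^ k)
   (fun k => Cmod (d k) * Cmod (s - s0) ^ k) U V); [|exact HU| |exact HV|apply Hf, Hs|apply Hg, Hs]].
- intros n; apply Csum_ext; intros l _.
  rewrite Cmult_comm, <- Csum_scal; apply Csum_ext; intros j Hj.
  replace ((s - s0) ^ l)%C with ((s - s0) ^ j * (s - s0) ^ (l - j))%C.
  + ring.
  + rewrite <- Cpow_add_r; f_equal; lia.
- intros n; cbv beta; rewrite Cmod_mult, Cmod_pow; apply Rle_refl.
- intros n; cbv beta; rewrite Cmod_mult, Cmod_pow; apply Rle_refl.
Qed.

Lemma AN_exp (a b : C) (s0 : C) (rho : R) : exists c, AN (fun s => Cexp (a + b * s)%C) s0 rho c.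
Proof.
exists (fun k => (Cexp (a + b * s0) * (/ RtoC (INR (fact k)) * b ^ k))%C).
intros s _.
replace (Cexp (a + b * s)) with (Cexp (a + b * s0) * Cexp (b * (s - s0)))%C
  by (rewrite <- Cexp_plus; f_equal; ring).
eapply Clim_ext; [|apply Clim_scal, Cexp_series].
intros n; cbv beta; rewrite <- Csum_scal; apply Csum_ext; intros k _.
rewrite Cpow_mult_l; ring.
Qed.

Lemma AN_inv (p s0 : C) (rho : R) : 0 < rho -> rho <= Cmod (p - s0)%C ->
  exists c, AN (fun s => (/ (p - s))%C) s0 rho c.
Proof.
intros Hr Hp.
assert (Hne : (p - s0)%C <> RtoC 0) by (apply Cmod_gt_0; lra).
exists (fun k => (/ (p - s0) * (/ (p - s0)) ^ k)%C).
intros s Hs.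
set (x := ((s - s0) / (p - s0))%C).
assert (Hx : Cmod x < 1).
{ unfold x; rewrite Cmod_div by exact Hne.
  apply Rmult_lt_reg_r with (Cmod (p - s0)%C); [lra|].
  unfold Rdiv; rewrite Rmult_assoc, Rinv_l; lra. }
assert (Hps : (p - s)%C <> RtoC 0).
{ intros E; replace (s - s0)%C with ((p - s0) - (p - s))%C in Hs by ring.
  rewrite E in Hs; replace (p - s0 - 0)%C with (p - s0)%C in Hs by ring; lra. }
assert (Hx1 : (1 - x)%C <> RtoC 0).
{ unfold x; replace (1 - (s - s0) / (p - s0))%C with ((p - s) / (p - s0))%C by (field; exact Hne).
  apply Cmult_neq_0; [exact Hps|]; apply Cmod_gt_0; rewrite Cmod_inv by exact Hne.
  apply Rinv_0_lt_compat; lra. }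
apply Clim_ext with (fun n => (/ (p - s) * (1 - x ^ n))%C).
- intros n; induction n as [|n IH]; [simpl; ring|].
  rewrite Csum_S, <- IH.
  replace ((/ (p - s0)) ^ n * (s - s0) ^ n)%C with (x ^ n)%C
    by (unfold x, Cdiv; rewrite Cpow_mult_l; ring).
  rewrite <- Cmult_assoc.
  replace ((/ (p - s0)) ^ n * (s - s0) ^ n)%C with (x ^ n)%C
    by (unfold x, Cdiv; rewrite Cpow_mult_l; ring).
  rewrite Cpow_S; generalize (x ^ n)%C; intros X; unfold x; field; split; assumption.
- apply Clim_eq with (/ (p - s) * (1 - 0))%C; [|ring].
  apply Clim_scal, Clim_minus; [apply Clim_const|].
  apply Clim_squeeze with (fun n => Cmod x ^ n).
  + intros n; replace (x ^ n - 0)%C with (x ^ n)%C by ring; rewrite Cmod_pow; apply Rle_refl.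
  + apply is_lim_seq_geom; rewrite Rabs_pos_eq; [exact Hx|apply Cmod_ge_0].
Qed.

Lemma e2_Cmod_real (x : R) : Cmod (e2 (RtoC x)) = 1.
Proof. rewrite Cmod_e2, im_RtoC, Rmult_0_r, Ropp_0, exp_0; reflexivity. Qed.

Lemma e2_pow (w : C) (n : nat) : (e2 w ^ n)%C = e2 (RtoC (INR n) * w)%C.
Proof. unfold e2; rewrite Cexp_pow; f_equal; ring. Qed.

Lemma root_orthogonality (n k l : nat) : (k < n)%nat -> (l < n)%nat -> k <> l ->
  Csum (fun j => e2 (RtoC (INR j * (INR l - INR k) / INR n))) n = RtoC 0.
Proof.
intros Hk Hl Hkl.
assert (Hn : 0 < INR n) by (apply lt_0_INR; lia).
set (q := e2 (RtoC ((INR l - INR k) / INR n))).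
assert (E : forall j, e2 (RtoC (INR j * (INR l - INR k) / INR n)) = (q ^ j)%C).
{ intros j; unfold q; rewrite e2_pow, <- RtoC_mult; do 2 f_equal; field; lra. }
rewrite (Csum_ext _ (pow_n (K := C_AbsRing) q)) by (intros; apply E).
assert (Hqn : (q ^ n)%C = RtoC 1).
{ unfold q; rewrite e2_pow, <- RtoC_mult.
  replace (INR n * ((INR l - INR k) / INR n)) with (IZR (Z.of_nat l - Z.of_nat k)).
  - apply e2_Z.
  - rewrite minus_IZR, <- !INR_IZR_INZ; field; lra. }
assert (Hq1 : q <> RtoC 1).
{ intros H; unfold q, e2 in H; apply Cexp_eq_1 in H.
  - apply (f_equal Im) in H; simpl in H.
    assert (H1 : 2 * PI * ((INR l - INR k) / INR n) = 0) by lra.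
    assert (HP := PI_RGT_0).
    assert (H2 : (INR l - INR k) / INR n = 0) by nra.
    assert (H3 : INR l - INR k = 0).
    { replace (INR l - INR k) with ((INR l - INR k) / INR n * INR n) by (field; lra); rewrite H2; ring. }
    apply Hkl, INR_eq; lra.
  - simpl.
    assert (Hb : -1 < (INR l - INR k) / INR n < 1).
    { assert (INR k < INR n) by (apply lt_INR, Hk); assert (INR l < INR n) by (apply lt_INR, Hl).
      generalize (pos_INR k) (pos_INR l); intros.
      split; apply Rmult_lt_reg_r with (INR n); try exact Hn;
        unfold Rdiv; rewrite Rmult_assoc, Rinv_l; lra. }
    assert (HP := PI_RGT_0); nra. }
assert (Hs : ((q - 1) * Csum (pow_n (K := C_AbsRing) q) n = q ^ n - 1)%C).
{ generalize q; clear; intros q; induction n as [|n IH].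
  - change ((q - 1) * RtoC 0 = RtoC 1 - RtoC 1)%C; ring.
  - rewrite Csum_S, Cmult_plus_distr_l, IH, Cpow_S.
    change (pow_n (K := C_AbsRing) q n) with (q ^ n)%C; ring. }
rewrite Hqn in Hs.
assert (Hq2 : (q - 1)%C <> RtoC 0) by (apply Cminus_eq_contra, Hq1).
replace (Csum _ n) with (/ (q - 1) * ((q - 1) * Csum (pow_n (K := C_AbsRing) q) n))%C.
- rewrite Hs; ring.
- field; exact Hq2.
Qed.

(** By averaging over the [n]-th roots of unity. *)
Lemma cauchy_estimate (f : C -> C) (s0 : C) (rho r M : R) (c : nat -> C) :
  AN f s0 rho c -> 0 <= r < rho ->
  (forall s, Cmod (s - s0)%C <= r -> Cmod (f s) <= M) ->
  forall k, Cmod (c k) * r ^ k <= M.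
Proof.
intros Hf Hr HM k.
destruct (AN_summable f s0 rho c r Hf Hr) as [B HB].
set (b := fun k => Cmod (c k) * r ^ k) in HB.
assert (H : forall n, (k < n)%nat -> b k <= M + (B - Rsum b n)).
{ intros n Hkn.
  assert (Hn : 0 < INR n) by (apply lt_0_INR; lia).
  assert (Hnn : RtoC (INR n) <> RtoC 0) by (apply RtoC_neq0; lra).
  set (h := fun j => (RtoC r * e2 (RtoC (INR j / INR n)))%C).
  assert (Hh : forall j, Cmod (h j) = r).
  { intros j; unfold h; rewrite Cmod_mult, e2_Cmod_real, Cmod_R, Rabs_pos_eq; lra. }
  assert (Hsh : forall j, (s0 + h j - s0)%C = h j) by (intros; ring).
  set (P := fun j => Csum (fun l => (c l * h j ^ l)%C) n).
  assert (Hb : forall j l, Cmod (c l * h j ^ l)%C <= b l).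
  { intros j l; rewrite Cmod_mult, Cmod_pow, Hh; apply Rle_refl. }
  assert (HP : forall j, Cmod (P j) <= M + (B - Rsum b n)).
  { intros j.
    assert (Hser : Clim (Csum (fun l => (c l * h j ^ l)%C)) (f (s0 + h j)%C)).
    { generalize (Hf (s0 + h j)%C); rewrite Hsh, Hh; intros H; apply H; lra. }
    assert (E := Clim_C_lim_seq _ _ Hser); change (C_lim_seq _) with (CSer (fun l => (c l * h j ^ l)%C)) in E.
    assert (Ht := CSer_tail (fun l => (c l * h j ^ l)%C) b B n (Hb j) HB).
    rewrite E in Ht; fold (P j) in Ht.
    assert (HMj : Cmod (f (s0 + h j)%C) <= M) by (apply HM; rewrite Hsh, Hh; lra).
    replace (P j) with (f (s0 + h j)%C + - (f (s0 + h j)%C - P j))%C by ring.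
    eapply Rle_trans; [apply Cmod_triangle|]; rewrite Cmod_opp; lra. }
  assert (HS : Csum (fun j => (P j * e2 (RtoC (- (INR j * INR k / INR n))))%C) n
    = (RtoC (INR n) * (c k * RtoC r ^ k))%C).
  { transitivity (Csum (fun l => (c l * RtoC r ^ l) *
      Csum (fun j => e2 (RtoC (INR j * (INR l - INR k) / INR n))) n)%C n).
    - unfold P.
      rewrite (Csum_ext _ (fun j => Csum (fun l => ((c l * RtoC r ^ l) *
         e2 (RtoC (INR j * (INR l - INR k) / INR n)))%C) n)).
      + rewrite Csum_swap; apply Csum_ext; intros l _; apply Csum_scal.
      + intros j _; rewrite Cmult_comm, <- Csum_scal; apply Csum_ext; intros l _.
        unfold h; rewrite Cpow_mult_l, e2_pow, <- RtoC_mult.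
        replace (INR j * (INR l - INR k) / INR n)
          with (INR l * (INR j / INR n) + - (INR j * INR k / INR n)) by (field; lra).
        rewrite RtoC_plus, e2_plus; ring.
    - rewrite (Csum_single _ n k Hkn).
      + rewrite (Csum_ext _ (fun _ => RtoC 1)).
        * rewrite Csum_const; ring.
        * intros j _; replace (INR j * (INR k - INR k) / INR n) with (INR 0) by (simpl; field; lra).
          apply e2_nat.
      + intros l Hl Hlk; rewrite root_orthogonality by (try assumption; auto); ring. }
  apply (f_equal Cmod) in HS.
  rewrite !Cmod_mult, Cmod_pow, !Cmod_R, !Rabs_pos_eq in HS by lra.
  fold (b k) in HS.
  apply Rmult_le_reg_l with (INR n); [exact Hn|]; rewrite <- HS.
  rewrite <- Rsum_const; apply Cmod_Csum_le; intros j _.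
  rewrite Cmod_mult, e2_Cmod_real, Rmult_1_r; apply HP. }
apply (is_lim_seq_le_loc (fun _ => b k) (fun n => M + (B - Rsum b n)) (b k) M).
- exists (S k); intros n Hn; apply H; lia.
- apply is_lim_seq_const.
- apply is_lim_seq_eq with (M + 0); [|ring].
  apply is_lim_seq_plus'; [apply is_lim_seq_const|apply summable_tail, HB].
Qed.

(** Weierstrass's theorem. Cauchy's estimate turns the bound on the values into
    [Cmod (c n k) * r ^ k <= b n], which justifies exchanging the sums inside radius [r]; hence the
    loss of radius. *)
Lemma AN_sum (f : nat -> C -> C) (s0 : C) (rho r : R) (c : nat -> nat -> C) (b : nat -> R) (B : R) :
  (forall n, AN (f n) s0 rho (c n)) -> 0 < r < rho -> summable b B ->
  (forall n s, Cmod (s - s0)%C <= r -> Cmod (f n s) <= b n) ->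
  AN (fun s => CSer (fun n => f n s)) s0 r (fun k => CSer (fun n => c n k)).
Proof.
intros Hf Hr Hb Hfb s Hs.
set (h := (s - s0)%C) in *; set (q := Cmod h / r).
assert (Hq : 0 <= q < 1).
{ unfold q; split.
  - apply Rmult_le_pos; [apply Cmod_ge_0|apply Rlt_le, Rinv_0_lt_compat; lra].
  - apply Rmult_lt_reg_r with r; [lra|]; unfold Rdiv; rewrite Rmult_assoc, Rinv_l; lra. }
assert (Hc : forall n k, Cmod (c n k) * r ^ k <= b n).
{ intros n k; apply (cauchy_estimate (f n) s0 rho r (b n) (c n)); [apply Hf|lra|apply Hfb]. }
assert (Ha : forall n k, Cmod (c n k * h ^ k)%C <= b n * q ^ k).
{ intros n k; rewrite Cmod_mult, Cmod_pow.
  replace (Cmod (c n k) * Cmod h ^ k) with (Cmod (c n k) * r ^ k * q ^ k).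
  - apply Rmult_le_compat_r; [apply pow_le; lra|apply Hc].
  - unfold q, Rdiv; rewrite Rpow_mult_distr, pow_inv; field; apply pow_nonzero; lra. }
assert (Hg := geom_summable q Hq).
assert (Hcb : forall k, Cmod (CSer (fun n => c n k)) * r ^ k <= B).
{ intros k.
  assert (Hrk : 0 < r ^ k) by (apply pow_lt; lra).
  assert (Hck : forall n, Cmod (c n k) <= / r ^ k * b n).
  { intros n; apply Rmult_le_reg_l with (r ^ k); [exact Hrk|].
    rewrite <- Rmult_assoc, Rinv_r, Rmult_1_l by lra; rewrite Rmult_comm; apply Hc. }
  assert (H1 := CSer_bound (fun n => c n k) _ _ Hck
    (summable_scal (/ r ^ k) b B (Rlt_le _ _ (Rinv_0_lt_compat _ Hrk)) Hb)).
  apply Rmult_le_reg_l with (/ r ^ k); [apply Rinv_0_lt_compat, Hrk|].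
  replace (/ r ^ k * (Cmod (CSer (fun n => c n k)) * r ^ k)) with (Cmod (CSer (fun n => c n k)))
    by (field; lra).
  exact H1. }
assert (E1 : CSer (fun n => f n s) = CSer (fun n => CSer (fun k => (c n k * h ^ k)%C))).
{ apply CSer_ext; intros n; symmetry; apply Clim_C_lim_seq, (Hf n); fold h; lra. }
assert (E2 : forall k, (CSer (fun n => c n k) * h ^ k)%C = CSer (fun n => (c n k * h ^ k)%C)).
{ intros k; rewrite Cmult_comm.
  assert (Hrk : 0 < r ^ k) by (apply pow_lt; lra).
  rewrite <- (CSer_scal _ _ (fun n => / r ^ k * b n) (/ r ^ k * B)).
  - apply CSer_ext; intros; apply Cmult_comm.
  - intros n; apply Rmult_le_reg_l with (r ^ k); [exact Hrk|].
    rewrite <- Rmult_assoc, Rinv_r, Rmult_1_l by lra; rewrite Rmult_comm; apply Hc.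
  - apply summable_scal; [apply Rlt_le, Rinv_0_lt_compat, Hrk|exact Hb]. }
rewrite E1, (CSer_swap _ b (pow q) B (/ (1 - q)) Hb Hg Ha).
apply Clim_ext with (Csum (fun k => CSer (fun n => (c n k * h ^ k)%C))).
- intros N; apply Csum_ext; intros k _; symmetry; apply E2.
- apply (CSer_correct _ (fun k => B * q ^ k) (B * / (1 - q))).
  + intros k; apply (CSer_bound _ (fun n => q ^ k * b n)).
    * intros n; rewrite Rmult_comm; apply Ha.
    * rewrite Rmult_comm; apply summable_scal; [apply pow_le; lra|exact Hb].
  + apply summable_scal; [apply (summable_pos b), Hb|exact Hg].
Qed.

(** Both the complex derivative and the derivative along the real axis are read off from this
    quadratic error. *)
Lemma AN_second_order (f : C -> C) (s0 : C) (rho : R) (c : nat -> C) :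
  0 < rho -> AN f s0 rho c -> exists K, 0 <= K /\
  forall h, Cmod h <= rho / 2 ->
    f s0 = c 0%nat /\ Cmod (f (s0 + h) - f s0 - c 1%nat * h)%C <= K * (Cmod h * Cmod h).
Proof.
intros Hr H.
set (r := rho / 2); assert (Hrr : 0 < r) by (unfold r; lra).
destruct (AN_summable f s0 rho c r H ltac:(unfold r; lra)) as [B HB].
assert (HB0 := summable_pos _ _ HB).
exists (B / (r * r)); split.
{ apply Rmult_le_pos; [exact HB0|apply Rlt_le, Rinv_0_lt_compat, Rmult_lt_0_compat; exact Hrr]. }
assert (E0 : f s0 = c 0%nat).
{ apply (Clim_unique (Csum (fun k => (c k * (s0 - s0) ^ k)%C))).
  - apply H; replace (s0 - s0)%C with (RtoC 0) by ring; rewrite Cmod_0; exact Hr.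
  - apply Clim_incr_n with (N := 1%nat).
    apply Clim_ext with (fun _ => c 0%nat); [|apply Clim_const].
    intros n; rewrite Nat.add_1_r, Csum_shift, Csum_zero; [simpl; ring|].
    intros k _; rewrite Cpow_S; ring. }
intros h Hh; split; [exact E0|]; rewrite E0.
assert (Hs := H (s0 + h)%C); replace (s0 + h - s0)%C with h in Hs by ring.
specialize (Hs ltac:(unfold r in *; lra)).
apply (Clim_bound (fun n => (Csum (fun k => c k * h ^ k) (n + 2) - c 0%nat - c 1%nat * h)%C)).
- apply Clim_minus; [apply Clim_minus|]; try apply Clim_const.
  apply (proj1 (Clim_incr_n _ 2 _) Hs).
- intros n; replace (n + 2)%nat with (S (S n)) by lia; rewrite !Csum_shift.
  replace (_ - c 0%nat - c 1%nat * h)%C with (Csum (fun k => c (S (S k)) * h ^ S (S k))%C n)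
    by (simpl Cpow; ring).
  apply Rle_trans with (Rsum (fun k => Cmod h * Cmod h * / (r * r) * (Cmod (c (S (S k))) * r ^ S (S k))) n).
  + apply Cmod_Csum_le; intros k _; rewrite Cmod_mult, Cmod_pow.
    replace (Cmod h * Cmod h * / (r * r) * (Cmod (c (S (S k))) * r ^ S (S k)))
      with (Cmod (c (S (S k))) * (Cmod h * Cmod h * r ^ k)) by (simpl pow; field; lra).
    apply Rmult_le_compat_l; [apply Cmod_ge_0|].
    simpl pow; rewrite <- Rmult_assoc; apply Rmult_le_compat_l.
    * apply Rmult_le_pos; apply Cmod_ge_0.
    * apply pow_incr; split; [apply Cmod_ge_0|exact Hh].
  + rewrite Rsum_scal.
    assert (Hle : Rsum (fun k => Cmod (c (S (S k))) * r ^ S (S k)) n <= B).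
    { eapply Rle_trans; [|apply (summable_le _ _ (2 + n) HB)].
      assert (Hsp : forall g m, Rsum g (2 + m) = Rsum g 2 + Rsum (fun k => g (S (S k))) m).
      { intros g m; induction m as [|m IH]; [simpl; ring|].
        change (2 + S m)%nat with (S (2 + m)).
        change (Rsum g (S (2 + m))) with (Rsum g (2 + m) + g (2 + m)%nat).
        rewrite IH; simpl; ring. }
      rewrite Hsp.
      assert (0 <= Rsum (fun k => Cmod (c k) * r ^ k) 2) by (apply Rsum_pos, HB); lra. }
    unfold Rdiv.
    replace (B * / (r * r) * (Cmod h * Cmod h)) with (Cmod h * Cmod h * / (r * r) * B) by ring.
    apply Rmult_le_compat_l; [|exact Hle].
    apply Rmult_le_pos; [apply Rmult_le_pos; apply Cmod_ge_0|].
    apply Rlt_le, Rinv_0_lt_compat, Rmult_lt_0_compat; exact Hrr.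
Qed.

Lemma AN_C_derive (f : C -> C) (s0 : C) (rho : R) (c : nat -> C) :
  0 < rho -> AN f s0 rho c -> C_derive f s0 = c 1%nat.
Proof.
intros Hr H.
destruct (AN_second_order f s0 rho c Hr H) as [K [HK Hb]].
apply is_C_derive_unique.
split; [apply is_linear_scal_l|].
intros x Hx.
apply (is_filter_lim_locally_unique (K := C_AbsRing) (V := AbsRing_NormedModule C_AbsRing)) in Hx.
subst x; intros eps.
set (d := Rmin (rho / 2) (eps / (K + 1))).
assert (Hd : 0 < d).
{ apply Rmin_pos; [lra|apply Rdiv_lt_0_compat; [apply cond_pos|lra]]. }
assert (G : forall y : C, Cmod (y - s0)%C < d ->
  Cmod ((f y - f s0) - (y - s0) * c 1%nat)%C <= eps * Cmod (y - s0)%C).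
2:{ exists (mkposreal d Hd); intros y Hy; apply (G y Hy). }
intros y Hy.
assert (Hd1 : d <= rho / 2) by apply Rmin_l.
assert (Hd2 : d <= eps / (K + 1)) by apply Rmin_r.
destruct (Hb (y - s0)%C ltac:(lra)) as [_ Hy2].
replace (s0 + (y - s0))%C with y in Hy2 by ring.
replace (f y - f s0 - (y - s0) * c 1%nat)%C with (f y - f s0 - c 1%nat * (y - s0))%C by ring.
eapply Rle_trans; [exact Hy2|].
rewrite <- Rmult_assoc; apply Rmult_le_compat_r; [apply Cmod_ge_0|].
assert (H1 : (K + 1) * Cmod (y - s0)%C <= eps).
{ apply Rle_trans with ((K + 1) * (eps / (K + 1))).
  - apply Rmult_le_compat_l; lra.
  - apply Req_le; field; lra. }
generalize (Cmod_ge_0 (y - s0)%C); nra.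
Qed.

Lemma is_derive_unique_eq (f : R -> R) (t l m : R) :
  is_derive f t l -> is_derive f t m -> l = m.
Proof. intros H1 H2; rewrite <- (is_derive_unique _ _ _ H1); apply is_derive_unique, H2. Qed.

(** Allows a Taylor coefficient in [s] to be found by differentiating for real [s], where the rules
    for [Cder] apply. *)
Lemma AN_Cder (f : C -> C) (rho : R) (c : nat -> C) (l : C) :
  0 < rho -> AN f (RtoC 0) rho c -> Cder (fun t => f (RtoC t)) 0 l -> c 1%nat = l.
Proof.
intros Hr H Hd.
destruct (AN_second_order f (RtoC 0) rho c Hr H) as [K [HK Hb]].
assert (Hc : forall p : C -> R, (forall z, Rabs (p z) <= Cmod z) ->
  (forall z w, p (z - w)%C = p z - p w) -> (forall t : R, p (c 1%nat * RtoC t)%C = t * p (c 1%nat)) ->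
  is_derive (fun t => p (f (RtoC t))) 0 (p (c 1%nat))).
{ intros p Hp1 Hp2 Hp3.
  apply is_derive_Reals; intros eps Heps.
  set (d := Rmin (rho / 2) (eps / (K + 1))).
  assert (Hdp : 0 < d) by (apply Rmin_pos; [lra|apply Rdiv_lt_0_compat; lra]).
  exists (mkposreal d Hdp); intros h Hh0 Hh; simpl in Hh.
  assert (Hd1 : d <= rho / 2) by apply Rmin_l.
  assert (Hd2 : d <= eps / (K + 1)) by apply Rmin_r.
  destruct (Hb (RtoC h)) as [_ Hb2]; [rewrite Cmod_R; lra|].
  replace (RtoC 0 + RtoC h)%C with (RtoC h) in Hb2 by ring; rewrite Cmod_R in Hb2.
  rewrite Rplus_0_l.
  replace ((p (f (RtoC h)) - p (f (RtoC 0))) / h - p (c 1%nat))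
    with (p (f (RtoC h) - f (RtoC 0) - c 1%nat * RtoC h)%C / h).
  2:{ rewrite !Hp2, Hp3; field; exact Hh0. }
  assert (Hah : 0 < Rabs h) by apply Rabs_pos_lt, Hh0.
  unfold Rdiv; rewrite Rabs_mult, Rabs_inv.
  apply Rmult_lt_reg_r with (Rabs h); [exact Hah|].
  rewrite Rmult_assoc, Rinv_l, Rmult_1_r by lra.
  eapply Rle_lt_trans; [apply Hp1|]; eapply Rle_lt_trans; [exact Hb2|].
  rewrite <- Rmult_assoc; apply Rmult_lt_compat_r; [exact Hah|].
  assert (H1 : (K + 1) * Rabs h < eps).
  { apply Rlt_le_trans with ((K + 1) * (eps / (K + 1))).
    - apply Rmult_lt_compat_l; lra.
    - apply Req_le; field; lra. }
  lra. }
destruct Hd as [D1 D2].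
apply injective_projections.
- apply (is_derive_unique_eq (fun t => Re (f (RtoC t))) 0); [|exact D1].
  apply (Hc Re); [apply re_le_Cmod| |].
  + intros z w; unfold Cminus; rewrite re_plus, re_opp; ring.
  + intros t; rewrite re_scal_r; ring.
- apply (is_derive_unique_eq (fun t => Im (f (RtoC t))) 0); [|exact D2].
  apply (Hc Im); [apply im_le_Cmod| |].
  + intros z w; unfold Cminus; rewrite im_plus, im_opp; ring.
  + intros t; rewrite im_scal_r; ring.
Qed.

(** * Analytic continuation of the double zeta function *)

(** The case 0 comes from integrating [w ^ (- s)] twice, which is where the poles at 1 and 2
    originate; each differentiation then multiplies by the current exponent. *)
Fixpoint qz (j : nat) (s : C) : C :=
  match j with
  | O => (/ ((1 - s) * (RtoC 2 - s)))%C
  | S i => (qz i s * (RtoC 2 - RtoC (INR i) - s))%C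
  end.

(** [ZE s j] is the [(j - 2)]-nd derivative of [w ^ (- s)], on the positive real axis. *)
Definition ZE (s : C) (j : nat) (w : C) : C :=
  (qz j s * Rcpow (Re w) (RtoC 2 - RtoC (INR j) - s))%C.

Lemma Cmod_Rcpow (r : R) (s : C) : Cmod (Rcpow r s) = exp (Re s * ln r).
Proof. unfold Rcpow; rewrite Cmod_Cexp, re_scal_r; reflexivity. Qed.

Lemma Rcpow_pred (r : R) (s : C) : 0 < r -> Rcpow r (s - 1) = (Rcpow r s / RtoC r)%C.
Proof.
intros Hr; unfold Rcpow.
replace ((s - 1) * RtoC (ln r))%C with (s * RtoC (ln r) - RtoC (ln r))%C by ring.
rewrite Cexp_minus, (Cexp_RtoC (ln r)), exp_ln by exact Hr; reflexivity.
Qed.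

Lemma Cder_RtoC (f : R -> R) (t l : R) : is_derive f t l -> Cder (fun s => RtoC (f s)) t (RtoC l).
Proof.
intros H; split; [exact H|].
apply (is_derive_const (K := R_AbsRing) (V := R_NormedModule) 0).
Qed.

Lemma Cder_ZE (s : C) (j : nat) (w ga : C) (t : R) : Im ga = 0 -> 0 < Re (w + RtoC t * ga)%C ->
  Cder (fun u => ZE s j (w + RtoC u * ga)) t (ga * ZE s (S j) (w + RtoC t * ga))%C.
Proof.
intros Hga Hp; unfold ZE, Rcpow.
set (sg := (RtoC 2 - RtoC (INR j) - s)%C).
assert (Hd : Cder (fun u => RtoC (ln (Re (w + RtoC u * ga)%C))) t
  (RtoC (Re ga / Re (w + RtoC t * ga)%C))).
{ apply Cder_RtoC.
  apply is_derive_ext with (fun u => ln (Re w + u * Re ga)).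
  { intros u; rewrite re_plus, re_scal_l; reflexivity. }
  rewrite re_plus, re_scal_l in Hp |- *.
  auto_derive; [exact Hp|]; field; lra. }
eapply Cder_eq.
- apply Cder_scal, Cder_Cexp, Cder_scal, Hd.
- cbv beta; fold (Rcpow (Re (w + RtoC t * ga)%C) sg).
  replace (RtoC 2 - RtoC (INR (S j)) - s)%C with (sg - 1)%C
    by (unfold sg; rewrite S_INR, RtoC_plus; ring).
  fold (Rcpow (Re (w + RtoC t * ga)%C) (sg - 1)).
  rewrite Rcpow_pred by exact Hp.
  replace ga with (RtoC (Re ga)) at 4 by (apply injective_projections; simpl; auto).
  change (qz (S j) s) with (qz j s * sg)%C.
  rewrite RtoC_div by lra; field; apply RtoC_neq0; lra.
Qed.

Lemma qz_2 (s : C) : s <> RtoC 1 -> s <> RtoC 2 -> qz 2 s = RtoC 1.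
Proof.
intros H1 H2; simpl.
assert (E1 : (1 - s)%C <> RtoC 0) by (apply Cminus_eq_contra; auto).
assert (E2 : (RtoC 2 - s)%C <> RtoC 0) by (apply Cminus_eq_contra; auto).
replace (RtoC 2 - 0 - s)%C with (RtoC 2 - s)%C by ring.
replace (RtoC 2 - 1 - s)%C with (1 - s)%C.
- field; split; assumption.
- replace (RtoC 2) with (RtoC 1 + RtoC 1)%C by (rewrite <- RtoC_plus; f_equal; ring); ring.
Qed.

Lemma qz_bound (s : C) (P : R) (j : nat) : s <> RtoC 1 -> s <> RtoC 2 -> Cmod s <= P ->
  (2 <= j)%nat -> Cmod (qz j s) <= (INR j + P + 2) ^ j.
Proof.
intros H1 H2 HP Hj.
assert (HP0 : 0 <= P) by (eapply Rle_trans; [apply Cmod_ge_0|exact HP]).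
induction Hj as [|j Hj IH].
- rewrite qz_2, Cmod_1 by assumption; simpl; nra.
- change (qz (S j) s) with (qz j s * (RtoC 2 - RtoC (INR j) - s))%C.
  assert (Hj0 := pos_INR j).
  rewrite Cmod_mult, S_INR.
  apply Rle_trans with ((INR j + P + 2) ^ j * (INR j + P + 2)).
  + apply Rmult_le_compat; try apply Cmod_ge_0; [exact IH|].
    eapply Rle_trans; [apply Cmod_triangle|]; rewrite Cmod_opp.
    eapply Rle_trans; [apply Rplus_le_compat_r, Cmod_triangle|].
    rewrite Cmod_opp, !Cmod_R, !Rabs_pos_eq by lra; lra.
  + rewrite Rmult_comm; change ((INR j + P + 2) * (INR j + P + 2) ^ j) with ((INR j + P + 2) ^ S j).
    apply pow_incr; lra.
Qed.

(** Coefficients of the inverse power series. Stage [n] is a table correct up to index [n], so that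
    the recursion, which uses all earlier coefficients, stays structural; the coefficients
    themselves are on the diagonal. *)
Fixpoint conv_inv (e : nat -> C) (n : nat) : nat -> C :=
  match n with
  | O => fun _ => (/ e O)%C
  | S m => fun j => if Nat.leb j m then conv_inv e m j
      else (- Csum (fun i => conv_inv e m i * e (S m - i)%nat)%C (S m) / e O)%C
  end.

Lemma conv_inv_stable (e : nat -> C) (n j : nat) : (j <= n)%nat ->
  conv_inv e n j = conv_inv e j j.
Proof.
intros H; induction H as [|n H IH]; [reflexivity|].
simpl; rewrite (proj2 (Nat.leb_le j n) H); exact IH.
Qed.

Lemma conv_inv_spec (e : nat -> C) (l : nat) : e O <> RtoC 0 ->
  Csum (fun j => conv_inv e j j * e (l - j)%nat)%C (S l) =
  if Nat.eqb l 0 then RtoC 1 else RtoC 0.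
Proof.
intros He; destruct l as [|m]; [simpl; field; exact He|].
rewrite Csum_S, Nat.sub_diag.
rewrite (Csum_ext _ (fun i => conv_inv e m i * e (S m - i)%nat)%C).
- assert (E : conv_inv e (S m) (S m) =
    (- Csum (fun i => conv_inv e m i * e (S m - i)%nat)%C (S m) / e O)%C).
  { cbn [conv_inv]; rewrite (proj2 (Nat.leb_gt (S m) m) (Nat.lt_succ_diag_r m)); reflexivity. }
  rewrite E; cbn [Nat.eqb]; field; exact He.
- intros i Hi; rewrite (conv_inv_stable e m i) by lia; reflexivity.
Qed.

Lemma conv_unique (e a b : nat -> C) (L : nat) : e O <> RtoC 0 ->
  (forall l, (l <= L)%nat -> Csum (fun j => a j * e (l - j)%nat)%C (S l) =
                             Csum (fun j => b j * e (l - j)%nat)%C (S l)) ->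
  forall j, (j <= L)%nat -> a j = b j.
Proof.
intros He H j; induction j as [j IH] using lt_wf_ind; intros Hj.
specialize (H j Hj); rewrite !Csum_S, Nat.sub_diag in H.
rewrite (Csum_ext _ (fun j0 => b j0 * e (j - j0)%nat)%C) in H by (intros k Hk; rewrite IH by lia; reflexivity).
assert (E : (a j * e O)%C = (b j * e O)%C).
{ set (X := Csum _ j) in H.
  replace (a j * e O)%C with ((X + a j * e O) - X)%C by ring; rewrite H; ring. }
replace (a j) with (a j * e O / e O)%C by (field; exact He).
rewrite E; field; exact He.
Qed.

(** * A continuation by Euler-Maclaurin terms of variable order *)

Section Zeta.

Variables (z om : R).
Hypotheses (z_pos : 0 < z) (om_pos : 0 < om).

Let e (i : nat) : C := dcoef 1 (RtoC om) (S (S i)).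

(** The Taylor coefficients of [t ^ 2 / ((e ^ t - 1) (e ^ (om t) - 1))]. *)
Definition za (j : nat) : C := conv_inv e j j.

Lemma om_neq0 : RtoC om <> RtoC 0.
Proof. apply RtoC_neq0; lra. Qed.

Lemma e0_neq0 : e O <> RtoC 0.
Proof.
unfold e, dcoef; cbn [Cpow]; change (fact 2) with 2%nat.
replace (((1 + RtoC om) * ((1 + RtoC om) * 1) - 1 * (1 * 1) - RtoC om * (RtoC om * 1)
  + RtoC 0 * (RtoC 0 * 1)) / RtoC (INR 2))%C with (RtoC om).
- apply om_neq0.
- replace (INR 2) with 2 by (simpl; ring).
  replace (RtoC 2) with (RtoC 1 + RtoC 1)%C by (rewrite <- RtoC_plus; f_equal; ring).
  field; rewrite <- RtoC_plus; apply RtoC_neq0; lra.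
Qed.

Lemma za_spec (l : nat) : Csum (fun j => za j * dcoef 1 (RtoC om) (S (S (l - j))))%C (S l) =
  if Nat.eqb l 0 then RtoC 1 else RtoC 0.
Proof. apply (conv_inv_spec e l e0_neq0). Qed.

(** Inverse power series are unique. This identifies the correction terms of the zeta function, of
    arbitrary order, with the four of the logarithm. *)
Lemma za_acoef (j : nat) : (j <= 3)%nat -> za j = acoef 1 (RtoC om) j.
Proof.
apply (conv_unique e za (acoef 1 (RtoC om)) 3 e0_neq0).
intros l Hl; transitivity (if Nat.eqb l 0 then RtoC 1 else RtoC 0).
- apply za_spec.
- symmetry; apply acoef_spec; [apply C1_nz|apply om_neq0|exact Hl].
Qed.

(** The counterpart of [cc] for [w ^ (- s)]. Its size is that of [ZE s (N + 3)], a power of exponent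
    [- (N + 1) - Re s], which is at most [- 3] when [2 <= N + Re s]. *)
Definition rN (N : nat) (s w : C) : C :=
  (ZE s 2 w - Csum (fun j => za j * DD (ZE s j) 1 (RtoC om) w)%C (S N))%C.

Definition zlat (n m : nat) : C := lat (RtoC z) 1 (RtoC om) n m.

(** Where the original series converges, telescoping the corrections leaves only the vertex [z]. The
    right-hand side still makes sense for [2 <= N + Re s]. *)
Definition FN (N : nat) (s : C) : C :=
  (Csum (fun j => za j * ZE s j (RtoC z))%C (S N)
   + CSer (fun n => CSer (fun m => rN N s (zlat n m))))%C.

Let delta := Rmin 1 (Rmin om z).

Lemma delta_pos : 0 < delta <= 1.
Proof. split; [repeat apply Rmin_pos; lra|apply Rmin_l]. Qed.

Lemma delta_om : delta <= om.
Proof. unfold delta; eapply Rle_trans; [apply Rmin_r|apply Rmin_l]. Qed.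

Lemma delta_z : delta <= z.
Proof. unfold delta; eapply Rle_trans; [apply Rmin_r|apply Rmin_r]. Qed.

Lemma zlat_Re (n m : nat) (ga : C) (t : R) :
  ga = 1%C \/ ga = RtoC om \/ ga = (1 + RtoC om)%C -> 0 <= t <= 1 ->
  delta * (1 + INR n + INR m) <= Re (zlat n m + RtoC t * ga)%C.
Proof.
intros Hga Ht; apply right_lat_Re; try assumption.
- apply delta_pos.
- apply delta_om.
- apply delta_z.
Qed.

Lemma rN_bound (N : nat) (P : R) : exists K, 0 <= K /\
  forall s, s <> RtoC 1 -> s <> RtoC 2 -> 2 <= INR N + Re s -> Cmod s <= P ->
  forall n m, Cmod (rN N s (zlat n m)) <= (K * pw n) * pw m.
Proof.
assert (Hd := delta_pos).
set (Q := (INR (N + 3) + Rabs P + 2) ^ (N + 3)).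
(* Bounds the surplus power [w ^ (2 - N - Re s)] for all [w >= delta], uniformly in [s]; as
   [delta <= 1], the exponent may be enlarged. *)
set (D := exp ((INR N + 1 + Rabs P) * - ln delta)).
set (A := Rsum (fun j => Cmod (za j) * dbound 1 (RtoC om) (N + 3 - j)) (S N)).
assert (HQ : 0 <= Q).
{ apply pow_le; generalize (pos_INR (N + 3)) (Rabs_pos P); lra. }
assert (HD : 0 < D) by apply exp_pos.
assert (HA : 0 <= A).
{ apply Rsum_pos; intros; apply Rmult_le_pos; [apply Cmod_ge_0|apply dbound_pos]. }
assert (Hd3 : 0 < / delta ^ 3) by (apply Rinv_0_lt_compat, pow_lt; lra).
exists (A * (Q * (D * / delta ^ 3))); split.
{ repeat apply Rmult_le_pos; lra. }
intros s H1 H2 HN HP n m.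
assert (HPP : Cmod s <= Rabs P) by (eapply Rle_trans; [exact HP|apply Rle_abs]).
assert (Hln : ln delta <= 0).
{ destruct (proj2 Hd) as [H| ->]; [|rewrite ln_1; lra].
  rewrite <- ln_1; left; apply ln_increasing; lra. }
assert (HB : forall ga : C, ga = RtoC 1 \/ ga = RtoC om \/ ga = (1 + RtoC om)%C ->
  bounded_on (ZE s) (zlat n m) (Q * (D * / delta ^ 3 * pw n * pw m)) (N + 3) ga).
{ intros ga Hga t Ht; unfold ZE; rewrite Cmod_mult.
  assert (Hw := zlat_Re n m ga t Hga Ht).
  set (w := Re (zlat n m + RtoC t * ga)%C) in *.
  assert (Hs := sqrt_S_prod n m).
  assert (HX := sqrt_S_ge_1 n); assert (HY := sqrt_S_ge_1 m).
  set (X := sqrt (INR (S n))) in *; set (Y := sqrt (INR (S m))) in *.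
  assert (HXY : 1 <= X * Y) by nra.
  assert (Hw2 : delta * (X * Y) <= w) by (eapply Rle_trans; [|exact Hw]; apply Rmult_le_compat_l; lra).
  assert (Hdw : delta <= w) by nra.
  apply Rmult_le_compat; try apply Cmod_ge_0.
  - apply qz_bound; try assumption; lia.
  - rewrite Cmod_Rcpow.
    assert (Hlw : ln delta <= ln w).
    { destruct Hdw as [H| ->]; [left; apply ln_increasing; lra|lra]. }
    assert (E : Re (RtoC 2 - RtoC (INR (N + 3)) - s)%C = - 3 - (INR N + Re s - 2)).
    { unfold Cminus; rewrite !re_plus, !re_opp, !re_RtoC, plus_INR; simpl (INR 3); ring. }
    rewrite E.
    replace ((- 3 - (INR N + Re s - 2)) * ln w)
      with ((INR N + Re s - 2) * - ln w + - (3 * ln w)) by ring.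
    rewrite exp_plus, !Rmult_assoc; apply Rmult_le_compat; try (left; apply exp_pos).
    + assert (Hre : Re s <= Rabs P).
      { generalize (re_le_Cmod s) (Rle_abs (Re s)); lra. }
      assert (Hle : (INR N + Re s - 2) * - ln w <= (INR N + 1 + Rabs P) * - ln delta).
      { apply Rle_trans with ((INR N + Re s - 2) * - ln delta).
        - apply Rmult_le_compat_l; lra.
        - apply Rmult_le_compat_r; lra. }
      unfold D; destruct Hle as [H| ->]; [left; apply exp_increasing, H|lra].
    + assert (Hw0 : 0 < w) by lra.
      replace (exp (- (3 * ln w))) with (/ w ^ 3).
      2:{ rewrite exp_Ropp; f_equal.
          replace (3 * ln w) with (ln w + (ln w + ln w)) by ring.
          rewrite !exp_plus, exp_ln by exact Hw0; ring. }
      unfold pw; fold X Y.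
      replace (/ delta ^ 3 * (/ X ^ 3 * / Y ^ 3)) with (/ (delta * (X * Y)) ^ 3)
        by (field; repeat split; lra).
      apply Rinv_le_contravar.
      * apply pow_lt, Rmult_lt_0_compat; lra.
      * apply pow_incr; split; [apply Rmult_le_pos; lra|exact Hw2]. }
assert (HC : forall ga : C, ga = RtoC 1 \/ ga = RtoC om \/ ga = (1 + RtoC om)%C ->
  chain_on (ZE s) (zlat n m) ga).
{ intros ga Hga i t Ht; apply Cder_ZE.
  - destruct Hga as [->|[->| ->]]; rewrite ?im_plus, ?im_RtoC; ring.
  - eapply Rlt_le_trans; [|apply zlat_Re; assumption].
    apply Rmult_lt_0_compat; [lra|]; generalize (pos_INR n) (pos_INR m); lra. }
eapply Rle_trans.
- apply (euler_maclaurin (ZE s) 1 (RtoC om) (zlat n m) (Q * (D * / delta ^ 3 * pw n * pw m))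
    (HC _ (or_introl eq_refl)) (HC _ (or_intror (or_introl eq_refl)))
    (HC _ (or_intror (or_intror eq_refl))) za N); auto.
  intros l _; apply za_spec.
- fold A; apply Req_le; ring.
Qed.

Lemma ZE_vanish (s : C) (j : nat) (w : nat -> C) : 2 - INR j - Re s < 0 ->
  (forall k, delta * INR (S k) <= Re (w k)) -> Clim (fun k => ZE s j (w k)) (RtoC 0).
Proof.
intros Hp Hw; assert (Hd := delta_pos).
set (p := 2 - INR j - Re s) in *.
apply Clim_squeeze with (fun k => Cmod (qz j s) * exp (p * ln (delta * INR (S k)))).
- intros k; replace (ZE s j (w k) - RtoC 0)%C with (ZE s j (w k)) by ring.
  unfold ZE; rewrite Cmod_mult, Cmod_Rcpow; apply Rmult_le_compat_l; [apply Cmod_ge_0|].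
  replace (Re (RtoC 2 - RtoC (INR j) - s)%C) with p
    by (unfold p, Cminus; rewrite !re_plus, !re_opp, !re_RtoC; ring).
  assert (Hk : 0 < delta * INR (S k)) by (apply Rmult_lt_0_compat; [lra|apply lt_0_INR; lia]).
  assert (Hl : ln (delta * INR (S k)) <= ln (Re (w k))).
  { destruct (Hw k) as [H| ->]; [left; apply ln_increasing; assumption|lra]. }
  assert (Hle : p * ln (Re (w k)) <= p * ln (delta * INR (S k))) by nra.
  destruct Hle as [H| ->]; [left; apply exp_increasing, H|lra].
- apply is_lim_seq_eq with (Cmod (qz j s) * 0); [|ring].
  apply (is_lim_seq_scal_l _ _ 0).
  apply (is_lim_seq_incr_1 (fun k => exp (p * ln (delta * INR k))) 0).
  apply (is_lim_comp_seq exp _ m_infty 0 is_lim_exp_m).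
  + exists 0%nat; intros n _; discriminate.
  + replace m_infty with (Rbar_mult p p_infty).
    2:{ simpl; destruct (Rle_dec 0 p) as [H|H]; [exfalso; lra|reflexivity]. }
    apply is_lim_seq_scal_l.
    apply (is_lim_comp_seq ln _ p_infty p_infty is_lim_ln_p).
    * exists 0%nat; intros n _; discriminate.
    * replace p_infty with (Rbar_mult delta p_infty).
      2:{ simpl; destruct (Rle_dec 0 delta) as [H|H]; [|exfalso; lra].
          destruct (Rle_lt_or_eq_dec 0 delta H) as [H'|H']; [reflexivity|exfalso; lra]. }
      apply is_lim_seq_scal_l, is_lim_seq_INR.
Qed.

Lemma zlat_Re0 (n m : nat) : delta * (1 + INR n + INR m) <= Re (zlat n m).
Proof.
assert (H := zlat_Re n m 1%C 0 (or_introl eq_refl) ltac:(lra)).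
replace (zlat n m + RtoC 0 * 1)%C with (zlat n m) in H by ring; exact H.
Qed.

Lemma ZE_zlat_vanish_r (s : C) (j n : nat) : 2 - INR j - Re s < 0 ->
  Clim (fun m => ZE s j (zlat n m)) (RtoC 0).
Proof.
intros Hp; apply ZE_vanish; [exact Hp|].
intros k; eapply Rle_trans; [|apply zlat_Re0].
apply Rmult_le_compat_l; [generalize delta_pos; lra|].
rewrite S_INR; generalize (pos_INR n); lra.
Qed.

Lemma ZE_zlat_vanish_l (s : C) (j : nat) (m : nat -> nat) : 2 - INR j - Re s < 0 ->
  Clim (fun n => ZE s j (zlat n (m n))) (RtoC 0).
Proof.
intros Hp; apply ZE_vanish; [exact Hp|].
intros k; eapply Rle_trans; [|apply zlat_Re0].
apply Rmult_le_compat_l; [generalize delta_pos; lra|].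
rewrite S_INR; generalize (pos_INR (m k)); lra.
Qed.

Lemma rN_box (N : nat) (s : C) : s <> RtoC 1 -> s <> RtoC 2 -> 2 <= INR N + Re s ->
  Clim (fun M => Csum (fun n => Csum (fun m => rN N s (zlat n m)) M) M)
       (CSer (fun n => CSer (fun m => rN N s (zlat n m)))).
Proof.
intros H1 H2 HN.
destruct (rN_bound N (Cmod s)) as [K [HK Hb]].
destruct pw_summable as [U HU].
apply (CSer_box _ (fun n => K * pw n) pw (K * U) U); [apply summable_scal; assumption|exact HU|].
intros n m; apply Hb; try assumption; apply Rle_refl.
Qed.

(** The additional mixed difference telescopes over a box. Its far corners vanish in the limit, and
    the near one is the additional term at [z]. *)
Lemma FN_step (N : nat) (s : C) : s <> RtoC 1 -> s <> RtoC 2 -> 2 <= INR N + Re s ->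
  FN N s = FN (S N) s.
Proof.
intros H1 H2 HN.
assert (HSN : 2 <= INR (S N) + Re s) by (rewrite S_INR; lra).
assert (B1 := rN_box N s H1 H2 HN); assert (B2 := rN_box (S N) s H1 H2 HSN).
assert (Hp : 2 - INR (S N) - Re s < 0) by (rewrite S_INR; lra).
assert (E : (CSer (fun n => CSer (fun m => rN N s (zlat n m)))
   - CSer (fun n => CSer (fun m => rN (S N) s (zlat n m))))%C = (za (S N) * ZE s (S N) (RtoC z))%C).
{ eapply Clim_unique; [apply Clim_minus; [exact B1|exact B2]|].
  apply Clim_ext with (fun M => (za (S N) * (ZE s (S N) (RtoC z) - ZE s (S N) (zlat M 0)
     - ZE s (S N) (zlat 0 M) + ZE s (S N) (zlat M M)))%C).
  - intros M; symmetry.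
    transitivity (Csum (fun n => Csum (fun m => za (S N) * DD (ZE s (S N)) 1 (RtoC om) (zlat n m)) M)%C M).
    + rewrite <- Csum_minus; apply Csum_ext; intros n _.
      rewrite <- Csum_minus; apply Csum_ext; intros m _.
      unfold rN; rewrite (Csum_S _ (S N)); ring.
    + rewrite (Csum_ext _ (fun n => (za (S N) * Csum (fun m => DD (ZE s (S N)) 1 (RtoC om) (zlat n m)) M)%C))
        by (intros; apply Csum_scal).
      rewrite Csum_scal; unfold zlat; rewrite DD_box.
      unfold lat; simpl (INR 0).
      replace (RtoC z + RtoC (INR M) * 1 + RtoC 0 * RtoC om)%C with (RtoC z + RtoC (INR M) * 1)%C by ring.
      replace (RtoC z + RtoC 0 * 1 + RtoC (INR M) * RtoC om)%C with (RtoC z + RtoC (INR M) * RtoC om)%C by ring.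
      reflexivity.
  - apply Clim_eq with (za (S N) * (ZE s (S N) (RtoC z) - RtoC 0 - RtoC 0 + RtoC 0))%C; [|ring].
    apply Clim_scal, Clim_plus; [apply Clim_minus; [apply Clim_minus; [apply Clim_const|]|]|].
    + apply (ZE_zlat_vanish_l s (S N) (fun _ => 0%nat) Hp).
    + apply (ZE_zlat_vanish_r s (S N) 0 Hp).
    + apply (ZE_zlat_vanish_l s (S N) (fun n => n) Hp). }
unfold FN; rewrite (Csum_S _ (S N)).
set (S1 := CSer _) in E |- *; set (S2 := CSer _) in E |- *.
replace S1 with ((S1 - S2) + S2)%C by ring; rewrite E; ring.
Qed.

Lemma FN_eq (N N' : nat) (s : C) : s <> RtoC 1 -> s <> RtoC 2 ->
  2 <= INR N + Re s -> (N <= N')%nat -> FN N s = FN N' s.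
Proof.
intros H1 H2 HN HNN; induction HNN as [|N' HNN IH]; [reflexivity|].
rewrite IH; apply FN_step; try assumption.
apply le_INR in HNN; lra.
Qed.

Definition nN (s : C) : nat := (Z.to_nat (up (Rabs (Re s))) + 3)%nat.

(** The order varies with [s], but by [zeta2_FN] the value does not depend on it, so near any point
    a fixed order may be used. *)
Definition zeta2 (s : C) : C := FN (nN s) s.

Lemma nN_large (s : C) : 2 <= INR (nN s) + Re s.
Proof.
unfold nN; rewrite plus_INR.
destruct (archimed (Rabs (Re s))) as [H _].
assert (H0 : (0 <= up (Rabs (Re s)))%Z).
{ apply le_IZR; generalize (Rabs_pos (Re s)); lra. }
rewrite INR_IZR_INZ, Z2Nat.id by exact H0.
simpl (INR 3); generalize (Rle_abs (- Re s)); rewrite Rabs_Ropp; lra.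
Qed.

Lemma zeta2_FN (N : nat) (s : C) : s <> RtoC 1 -> s <> RtoC 2 -> 2 <= INR N + Re s ->
  zeta2 s = FN N s.
Proof.
intros H1 H2 HN; unfold zeta2; assert (HL := nN_large s).
destruct (Nat.le_ge_cases (nN s) N) as [H|H].
- apply FN_eq; assumption.
- symmetry; apply FN_eq; assumption.
Qed.

Lemma zlat_re (n m : nat) : Re (zlat n m) = INR n + INR m * om + z.
Proof. unfold zlat, lat; rewrite !re_plus, !re_scal_l, !re_RtoC; ring. Qed.

Lemma zeta2_series (s : C) : 2 < Re s -> double_series s z om (zeta2 s).
Proof.
intros Hs.
assert (H1 : s <> RtoC 1) by (intros E; rewrite E, re_RtoC in Hs; lra).
assert (H2 : s <> RtoC 2) by (intros E; rewrite E, re_RtoC in Hs; lra).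
rewrite (zeta2_FN 3 s H1 H2) by (simpl (INR 3); lra).
assert (Hp : forall j, 2 - INR j - Re s < 0) by (intros j; generalize (pos_INR j); lra).
destruct (rN_bound 3 (Cmod s)) as [K [HK Hb0]].
assert (Hb : forall n m, Cmod (rN 3 s (zlat n m)) <= K * pw n * pw m).
{ apply Hb0; try assumption; [simpl (INR 3); lra|apply Rle_refl]. }
destruct pw_summable as [U HU].
assert (Hrow : forall n, summable (fun m => K * pw n * pw m) (K * pw n * U)).
{ intros n; apply summable_scal; [|exact HU]; apply Rmult_le_pos; [exact HK|apply HU]. }
(* The corrections at the start of row [n]. Summed over rows, the differences of [G] telescope to
   [G 0], as every exponent [2 - j - Re s] is negative. *)
set (G := fun n => Csum (fun j => za j * ZE s j (zlat n 0))%C 4).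
exists (fun n => (CSer (fun m => rN 3 s (zlat n m)) + (G n - G (S n)))%C); split.
- intros n; apply is_series_Clim.
  apply Clim_ext with (fun M => (Csum (fun m => rN 3 s (zlat n m)) M +
     Csum (fun j => za j * ((ZE s j (zlat n 0) - ZE s j (zlat (S n) 0))
        - (ZE s j (zlat n M) - ZE s j (zlat (S n) M))))%C 4)%C).
  + intros M.
    rewrite (Csum_ext (fun j => za j * _)%C
      (fun j => Csum (fun m => za j * DD (ZE s j) 1 (RtoC om) (zlat n m))%C M)).
    * rewrite Csum_swap, <- Csum_plus; apply Csum_ext; intros m _.
      unfold rN; replace (Rcpow (INR n + INR m * om + z) (- s)) with (ZE s 2 (zlat n m)); [ring|].
      unfold ZE; rewrite qz_2, zlat_re by assumption.
      replace (RtoC 2 - RtoC (INR 2) - s)%C with (- s)%C; [ring|].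
      replace (INR 2) with 2 by (simpl; ring); ring.
    * intros j _; rewrite Csum_scal; unfold zlat; rewrite DD_row; reflexivity.
  + apply Clim_plus.
    * apply (CSer_correct _ _ _ (Hb n) (Hrow n)).
    * apply Clim_eq with (Csum (fun j => za j * ((ZE s j (zlat n 0) - ZE s j (zlat (S n) 0))
         - (RtoC 0 - RtoC 0)))%C 4).
      -- apply (Clim_Csum (fun M j => za j * ((ZE s j (zlat n 0) - ZE s j (zlat (S n) 0))
            - (ZE s j (zlat n M) - ZE s j (zlat (S n) M))))%C
           (fun j => za j * ((ZE s j (zlat n 0) - ZE s j (zlat (S n) 0)) - (RtoC 0 - RtoC 0)))%C).
         intros j; apply Clim_scal, Clim_minus; [apply Clim_const|].
         apply Clim_minus; apply ZE_zlat_vanish_r, Hp.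
      -- unfold G; rewrite <- Csum_minus; apply Csum_ext; intros; ring.
- apply is_series_Clim; unfold FN.
  rewrite Cplus_comm.
  apply Clim_ext with (fun M => (Csum (fun n => CSer (fun m => rN 3 s (zlat n m))) M + (G 0%nat - G M))%C).
  + intros M; rewrite Csum_plus, Csum_telescope; reflexivity.
  + apply Clim_plus.
    * apply (CSer_correct _ (fun n => (K * U) * pw n) (K * U * U)).
      -- intros n; replace (K * U * pw n) with (K * pw n * U) by ring.
         apply (CSer_bound _ _ _ (Hb n) (Hrow n)).
      -- apply summable_scal; [|exact HU]; apply Rmult_le_pos; [exact HK|apply (summable_pos pw), HU].
    * apply Clim_eq with (G 0%nat - Csum (fun j => za j * RtoC 0)%C 4)%C.
      -- apply Clim_minus; [apply Clim_const|].
         apply (Clim_Csum (fun M j => za j * ZE s j (zlat M 0))%C (fun j => za j * RtoC 0)%C).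
         intros j; apply Clim_scal, (ZE_zlat_vanish_l s j (fun _ => 0%nat)), Hp.
      -- rewrite (Csum_zero (fun j => za j * RtoC 0)%C) by (intros; ring).
         unfold G, zlat, lat; simpl (INR 0).
         replace (RtoC z + RtoC 0 * 1 + RtoC 0 * RtoC om)%C with (RtoC z) by ring; ring.
Qed.

(** * Analyticity of the continuation *)

Lemma qz_AN (j : nat) (s0 : C) (rho : R) : 0 < rho -> rho <= Cmod (1 - s0)%C ->
  rho <= Cmod (RtoC 2 - s0)%C -> exists c, AN (qz j) s0 rho c.
Proof.
intros Hr H1 H2; induction j as [|j [c Hc]].
- destruct (AN_inv 1 s0 rho Hr H1) as [c1 Hc1]; destruct (AN_inv (RtoC 2) s0 rho Hr H2) as [c2 Hc2].
  eexists; eapply AN_ext; [|apply (AN_mult _ _ _ _ _ _ Hc1 Hc2)].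
  intros s Hs; simpl.
  assert (Hne : forall p, rho <= Cmod (p - s0)%C -> (p - s)%C <> RtoC 0).
  { intros p Hp E; replace (s - s0)%C with ((p - s0) - (p - s))%C in Hs by ring.
    rewrite E in Hs; replace (p - s0 - 0)%C with (p - s0)%C in Hs by ring; lra. }
  field; split; [apply (Hne (RtoC 2))|apply (Hne (RtoC 1))]; assumption.
- destruct (AN_const (RtoC 2 - RtoC (INR j))%C s0 rho) as [c1 Hc1].
  destruct (AN_id s0 rho) as [c2 Hc2].
  eexists; eapply AN_ext;
    [|apply (AN_mult _ _ _ _ _ _ Hc (AN_plus _ _ _ _ _ _ Hc1 (AN_scal (- (1))%C _ _ _ _ Hc2)))].
  intros s _; simpl; ring.
Qed.

Lemma AN_Csum (f : nat -> C -> C) (s0 : C) (rho : R) (N : nat) :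
  (forall j, exists c, AN (f j) s0 rho c) -> exists c, AN (fun s => Csum (fun j => f j s) N) s0 rho c.
Proof.
intros H; induction N as [|N [c Hc]]; [apply (AN_const (RtoC 0))|].
destruct (H N) as [d Hd]; eexists; apply (AN_plus _ _ _ _ _ _ Hc Hd).
Qed.

Lemma ZE_AN (j : nat) (w s0 : C) (rho : R) : 0 < rho -> rho <= Cmod (1 - s0)%C ->
  rho <= Cmod (RtoC 2 - s0)%C -> exists c, AN (fun s => ZE s j w) s0 rho c.
Proof.
intros Hr H1 H2.
destruct (qz_AN j s0 rho Hr H1 H2) as [c1 Hc1].
destruct (AN_exp ((RtoC 2 - RtoC (INR j)) * RtoC (ln (Re w)))%C (- RtoC (ln (Re w)))%C s0 rho) as [c2 Hc2].
eexists; eapply AN_ext; [|apply (AN_mult _ _ _ _ _ _ Hc1 Hc2)].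
intros s _; unfold ZE, Rcpow; f_equal; f_equal; ring.
Qed.

Lemma AN_scal_ex (k : C) (f : C -> C) (s0 : C) (rho : R) :
  (exists c, AN f s0 rho c) -> exists c, AN (fun s => (k * f s)%C) s0 rho c.
Proof. intros [c Hc]; eexists; apply (AN_scal _ _ _ _ _ Hc). Qed.

Lemma AN_plus_ex (f g : C -> C) (s0 : C) (rho : R) :
  (exists c, AN f s0 rho c) -> (exists c, AN g s0 rho c) ->
  exists c, AN (fun s => (f s + g s)%C) s0 rho c.
Proof. intros [c Hc] [d Hd]; eexists; apply (AN_plus _ _ _ _ _ _ Hc Hd). Qed.

Lemma AN_minus_ex (f g : C -> C) (s0 : C) (rho : R) :
  (exists c, AN f s0 rho c) -> (exists c, AN g s0 rho c) ->
  exists c, AN (fun s => (f s - g s)%C) s0 rho c.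
Proof.
intros Hf Hg; destruct (AN_plus_ex f (fun s => - (1) * g s)%C s0 rho Hf (AN_scal_ex _ _ _ _ Hg)) as [c Hc].
exists c; eapply AN_ext; [|exact Hc]; intros s _; cbv beta; ring.
Qed.

Lemma rN_AN (N : nat) (w s0 : C) (rho : R) : 0 < rho -> rho <= Cmod (1 - s0)%C ->
  rho <= Cmod (RtoC 2 - s0)%C -> exists c, AN (fun s => rN N s w) s0 rho c.
Proof.
intros Hr H1 H2; unfold rN.
assert (HZ : forall j v, exists c, AN (fun s => ZE s j v) s0 rho c) by (intros; apply ZE_AN; assumption).
apply AN_minus_ex; [apply HZ|].
apply AN_Csum; intros j; apply AN_scal_ex; unfold DD.
apply AN_plus_ex; [apply AN_minus_ex; [apply AN_minus_ex|]|]; apply HZ.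
Qed.

(** A choice of coefficients as a function of [f]: summing over the lattice needs a whole family of
    them, not their mere existence at each point. *)
Definition coef (f : C -> C) (s0 : C) (rho : R) : nat -> C :=
  epsilon (inhabits (fun _ => RtoC 0)) (AN f s0 rho).

Lemma coef_spec (f : C -> C) (s0 : C) (rho : R) :
  (exists c, AN f s0 rho c) -> AN f s0 rho (coef f s0 rho).
Proof. apply epsilon_spec. Qed.

(** The inner and the outer sum each halve the radius. Asking for 3 instead of 2 on the left of
    [INR N + Re s0] leaves room for a disc of radius at most 1. *)
Lemma FN_AN (N : nat) (s0 : C) (rho : R) : 0 < rho <= 1 -> rho <= Cmod (1 - s0)%C ->
  rho <= Cmod (RtoC 2 - s0)%C -> 3 <= INR N + Re s0 ->
  exists c0, AN (fun s => Csum (fun j => za j * ZE s j (RtoC z))%C (S N)) s0 rho c0 /\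
  AN (FN N) s0 (rho / 4) (fun k => (c0 k +
    CSer (fun n => CSer (fun m => coef (fun s => rN N s (zlat n m)) s0 rho k)))%C).
Proof.
intros Hr H1 H2 HN.
assert (HZ : exists c0, AN (fun s => Csum (fun j => za j * ZE s j (RtoC z))%C (S N)) s0 rho c0).
{ apply (AN_Csum (fun j s => za j * ZE s j (RtoC z))%C); intros j; apply AN_scal_ex, ZE_AN; lra. }
destruct HZ as [c0 Hc0]; exists c0; split; [exact Hc0|].
assert (Hc : forall n m, AN (fun s => rN N s (zlat n m)) s0 rho
   (coef (fun s => rN N s (zlat n m)) s0 rho)).
{ intros n m; apply coef_spec, rN_AN; lra. }
destruct (rN_bound N (Cmod s0 + 1)) as [K [HK Hb]].
destruct pw_summable as [U HU].
assert (Hbs : forall s n m, Cmod (s - s0)%C <= rho / 2 ->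
  Cmod (rN N s (zlat n m)) <= K * pw n * pw m).
{ intros s n m Hs.
  assert (Hne : forall p, rho <= Cmod (p - s0)%C -> s <> p).
  { intros p Hp E; rewrite E in Hs; lra. }
  apply Hb.
  - apply (Hne (RtoC 1)), H1.
  - apply (Hne (RtoC 2)), H2.
  - generalize (re_le_Cmod (s - s0)%C); unfold Cminus; rewrite re_plus, re_opp; intros H.
    apply Rabs_le_between in H; unfold Cminus in Hs; lra.
  - replace s with (s0 + (s - s0))%C by ring.
    eapply Rle_trans; [apply Cmod_triangle|]; lra. }
assert (Hrow : forall n, summable (fun m => K * pw n * pw m) (K * pw n * U)).
{ intros n; apply summable_scal; [|exact HU]; apply Rmult_le_pos; [exact HK|apply HU]. }
apply AN_plus; [apply (AN_mono _ _ rho); [lra|exact Hc0]|].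
apply (AN_sum (fun n s => CSer (fun m => rN N s (zlat n m))) s0 (rho / 2) (rho / 4)
   (fun n k => CSer (fun m => coef (fun s => rN N s (zlat n m)) s0 rho k))
   (fun n => (K * U) * pw n) (K * U * U)).
- intros n.
  apply (AN_sum (fun m s => rN N s (zlat n m)) s0 rho (rho / 2)
    (fun m k => coef (fun s => rN N s (zlat n m)) s0 rho k) (fun m => K * pw n * pw m) (K * pw n * U)).
  + intros m; apply Hc.
  + lra.
  + apply Hrow.
  + intros m s Hs; apply Hbs, Hs.
- lra.
- apply summable_scal; [|exact HU]; apply Rmult_le_pos; [exact HK|apply (summable_pos pw), HU].
- intros n s Hs; replace (K * U * pw n) with (K * pw n * U) by ring.
  apply (CSer_bound _ (fun m => K * pw n * pw m)); [intros m; apply Hbs; lra|apply Hrow].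
Qed.

Lemma zeta2_FN_near (N : nat) (s0 : C) (rho : R) : 0 < rho <= 1 -> rho <= Cmod (1 - s0)%C ->
  rho <= Cmod (RtoC 2 - s0)%C -> 3 <= INR N + Re s0 ->
  forall s, Cmod (s - s0)%C < rho / 4 -> FN N s = zeta2 s.
Proof.
intros Hr H1 H2 HN s Hs; symmetry; apply zeta2_FN.
- intros E; rewrite E in Hs; lra.
- intros E; rewrite E in Hs; lra.
- generalize (re_le_Cmod (s - s0)%C); unfold Cminus; rewrite re_plus, re_opp; intros H.
  apply Rabs_le_between in H; unfold Cminus in Hs; lra.
Qed.

Lemma zeta2_analytic (s0 : C) : s0 <> RtoC 1 -> s0 <> RtoC 2 -> analytic_at zeta2 s0.
Proof.
intros H1 H2.
set (rho := Rmin 1 (Rmin (Cmod (1 - s0)%C) (Cmod (RtoC 2 - s0)%C))).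
assert (P1 : 0 < Cmod (1 - s0)%C) by (apply (proj1 (Cmod_gt_0 _)), Cminus_eq_contra; auto).
assert (P2 : 0 < Cmod (RtoC 2 - s0)%C) by (apply (proj1 (Cmod_gt_0 _)), Cminus_eq_contra; auto).
assert (Hr : 0 < rho <= 1) by (split; [repeat apply Rmin_pos; lra|apply Rmin_l]).
assert (Hr1 : rho <= Cmod (1 - s0)%C) by (eapply Rle_trans; [apply Rmin_r|apply Rmin_l]).
assert (Hr2 : rho <= Cmod (RtoC 2 - s0)%C) by (eapply Rle_trans; [apply Rmin_r|apply Rmin_r]).
assert (HN : 3 <= INR (S (nN s0)) + Re s0) by (rewrite S_INR; generalize (nN_large s0); lra).
destruct (FN_AN (S (nN s0)) s0 rho Hr Hr1 Hr2 HN) as [c0 [_ Hc]].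
eapply AN_analytic; [|eapply AN_ext; [|exact Hc]]; [lra|].
apply zeta2_FN_near; assumption.
Qed.

Lemma zeta2_is_double_zeta : is_double_zeta z om zeta2.
Proof. split; [apply zeta2_analytic|apply zeta2_series]. Qed.

(** * The derivative of the continuation at 0 *)

Lemma Cder_qz_0 : Cder (fun t => qz 0 (RtoC t)) 0 (RtoC (3 / 4)).
Proof.
(* The value [1 / 2] times the logarithmic derivative [1 + 1 / 2]; this is the constant [3 / 4] in
   [LE 0]. *)
simpl; eapply Cder_eq.
- apply Cder_inv.
  + replace ((1 - RtoC 0) * (RtoC 2 - RtoC 0))%C with (RtoC 2) by ring; apply RtoC_neq0; lra.
  + apply Cder_mult; (apply Cder_minus; [apply Cder_const|apply Cder_id]).
- cbv beta; rewrite RtoC_div by lra.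
  replace (RtoC 3) with (RtoC 2 + 1)%C by (rewrite <- RtoC_plus; f_equal; ring).
  replace (RtoC 4) with (RtoC 2 * RtoC 2)%C by (rewrite <- RtoC_mult; f_equal; ring).
  field; repeat split; try apply C1_nz; try (apply RtoC_neq0; lra).
  all: replace (RtoC 2 - 0)%C with (RtoC 2) by ring; apply RtoC_neq0; lra.
Qed.

Lemma Cder_qz_S (j : nat) (l : C) : Cder (fun t => qz j (RtoC t)) 0 l ->
  Cder (fun t => qz (S j) (RtoC t)) 0 (l * (RtoC 2 - RtoC (INR j)) - qz j (RtoC 0))%C.
Proof.
intros H; cbn [qz]; eapply Cder_eq.
- apply Cder_mult; [exact H|].
  apply Cder_minus; [apply Cder_const|apply Cder_id].
- cbv beta; ring.
Qed.

Lemma Cder_ZE_s (j : nat) (x : R) (l : C) : Cder (fun t => qz j (RtoC t)) 0 l ->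
  Cder (fun t => ZE (RtoC t) j (RtoC x)) 0
    ((l - qz j (RtoC 0) * RtoC (ln x)) * Rcpow x (RtoC 2 - RtoC (INR j)))%C.
Proof.
intros H; unfold ZE, Rcpow; rewrite re_RtoC; eapply Cder_eq.
- apply Cder_mult; [exact H|].
  apply Cder_Cexp, Cder_mult; [|apply Cder_const].
  apply Cder_minus; [apply Cder_const|apply Cder_id].
- cbv beta; replace (RtoC 2 - RtoC (INR j) - RtoC 0)%C with (RtoC 2 - RtoC (INR j))%C by ring; ring.
Qed.

(** At [s = 0] the derivative of [w ^ (- s)] in [s] is [- log w]. The integration constants in [LE]
    are those for which this persists along the chain. *)
Lemma Cder_ZE_LE (j : nat) (x : R) : (j <= 3)%nat -> 0 < x ->
  Cder (fun t => ZE (RtoC t) j (RtoC x)) 0 (- LE j (RtoC x))%C.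
Proof.
intros Hj Hx.
assert (Hxc : RtoC x <> RtoC 0) by (apply RtoC_neq0; lra).
assert (H2c : RtoC 2 <> RtoC 0) by (apply RtoC_neq0; lra).
assert (E2 : RtoC 2 = (1 + 1)%C) by (rewrite <- RtoC_plus; f_equal; ring).
assert (R0 : Rcpow x 0 = RtoC 1).
{ unfold Rcpow; replace (0 * RtoC (ln x))%C with (RtoC 0) by ring; apply Cexp_0. }
assert (Rm1 : Rcpow x (- (1)) = (/ RtoC x)%C).
{ replace (- (1))%C with (0 - 1)%C by ring; rewrite Rcpow_pred, R0 by exact Hx; field; exact Hxc. }
assert (R1 : Rcpow x 1 = RtoC x).
{ replace (Rcpow x 1) with (Rcpow x 1 / RtoC x * RtoC x)%C by (field; exact Hxc).
  rewrite <- Rcpow_pred by exact Hx; replace (1 - 1)%C with (RtoC 0) by ring; rewrite R0; ring. }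
assert (R2 : Rcpow x (RtoC 2) = (RtoC x * RtoC x)%C).
{ replace (Rcpow x (RtoC 2)) with (Rcpow x (RtoC 2) / RtoC x * RtoC x)%C by (field; exact Hxc).
  rewrite <- Rcpow_pred by exact Hx; rewrite E2; replace (1 + 1 - 1)%C with (RtoC 1) by ring.
  rewrite R1; ring. }
assert (Q0 : qz 0 (RtoC 0) = (/ RtoC 2)%C) by (simpl; f_equal; ring).
assert (Q1 : qz 1 (RtoC 0) = RtoC 1).
{ change (qz 1 (RtoC 0)) with (qz 0 (RtoC 0) * (RtoC 2 - RtoC (INR 0) - RtoC 0))%C.
  rewrite Q0; simpl (INR 0); field; exact H2c. }
assert (Q2 : qz 2 (RtoC 0) = RtoC 1).
{ apply qz_2; intros E; apply RtoC_inj in E; lra. }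
assert (Q3 : qz 3 (RtoC 0) = RtoC 0).
{ change (qz 3 (RtoC 0)) with (qz 2 (RtoC 0) * (RtoC 2 - RtoC (INR 2) - RtoC 0))%C.
  replace (INR 2) with 2 by (simpl; ring); ring. }
assert (D0 := Cder_qz_0).
assert (D1 := Cder_qz_S 0 _ D0); rewrite Q0 in D1.
assert (D2 := Cder_qz_S 1 _ D1); rewrite Q1 in D2.
assert (D3 := Cder_qz_S 2 _ D2); rewrite Q2 in D3.
assert (T34 : (RtoC (3 / 4) * RtoC 2 - / RtoC 2)%C = RtoC 1).
{ rewrite RtoC_div by lra.
  replace (RtoC 3) with (RtoC 2 + 1)%C by (rewrite <- RtoC_plus; f_equal; ring).
  replace (RtoC 4) with (RtoC 2 * RtoC 2)%C by (rewrite <- RtoC_mult; f_equal; ring).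
  rewrite E2; field; rewrite <- E2; exact H2c. }
assert (N2 : INR 2 = 2) by (simpl; ring); assert (N3 : INR 3 = 3) by (simpl; ring).
simpl (INR 0) in *; simpl (INR 1) in *; rewrite N2 in D3.
destruct j as [|[|[|[|j]]]]; [| | | |lia].
- eapply Cder_eq; [apply (Cder_ZE_s 0 x _ D0)|].
  rewrite Q0; simpl (INR 0); replace (RtoC 2 - 0)%C with (RtoC 2) by ring; rewrite R2.
  unfold LE; rewrite Clog_RtoC by exact Hx; field; exact H2c.
- eapply Cder_eq; [apply (Cder_ZE_s 1 x _ D1)|].
  rewrite Q1; simpl (INR 1); replace (RtoC 2 - 1)%C with (RtoC 1) by (rewrite E2; ring); rewrite R1.
  unfold LE; rewrite Clog_RtoC by exact Hx.
  replace (RtoC 2 - 0)%C with (RtoC 2) by ring; rewrite T34; ring.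
- eapply Cder_eq; [apply (Cder_ZE_s 2 x _ D2)|].
  rewrite Q2, N2; replace (RtoC 2 - RtoC 2)%C with (RtoC 0) by ring; rewrite R0.
  unfold LE; rewrite Clog_RtoC by exact Hx.
  replace (RtoC 2 - 0)%C with (RtoC 2) by ring; rewrite T34, E2; ring.
- eapply Cder_eq; [apply (Cder_ZE_s 3 x _ D3)|].
  rewrite Q3, N3.
  replace (RtoC 2 - RtoC 3)%C with (- (1))%C
    by (replace (RtoC 3) with (RtoC 2 + 1)%C by (rewrite <- RtoC_plus; f_equal; ring); ring).
  rewrite Rm1; unfold LE; rewrite Cpow_1_r.
  replace (RtoC ((-1) ^ 0 * INR (fact 0))) with (RtoC 1) by (simpl; f_equal; ring).
  replace (RtoC 2 - 0)%C with (RtoC 2) by ring; rewrite T34; ring.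
Qed.

Lemma Cder_Csum (f : nat -> R -> C) (l : nat -> C) (t : R) (N : nat) :
  (forall j, (j < N)%nat -> Cder (f j) t (l j)) ->
  Cder (fun u => Csum (fun j => f j u) N) t (Csum l N).
Proof.
induction N as [|N IH]; intros H; [apply (Cder_const (RtoC 0))|].
apply (Cder_plus (fun u => Csum (fun j => f j u) N) (f N)); [apply IH; intros|]; apply H; lia.
Qed.

Lemma zlat_real (n m : nat) : zlat n m = RtoC (z + INR n + INR m * om).
Proof. unfold zlat, lat; rewrite !RtoC_plus, RtoC_mult; ring. Qed.

Lemma Cder_rN (n m : nat) :
  Cder (fun t => rN 3 (RtoC t) (zlat n m)) 0 (- cc 1 (RtoC om) (zlat n m))%C.
Proof.
rewrite zlat_real; set (x := z + INR n + INR m * om).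
assert (Hx : 0 < x).
{ unfold x; generalize (pos_INR n); intros; assert (0 <= INR m * om) by (apply Rmult_le_pos; [apply pos_INR|lra]); lra. }
unfold rN; eapply Cder_eq.
- apply Cder_minus; [apply (Cder_ZE_LE 2); [lia|exact Hx]|].
  apply (Cder_Csum (fun j t => za j * DD (ZE (RtoC t) j) 1 (RtoC om) (RtoC x))%C
     (fun j => za j * DD (fun w => - LE j w) 1 (RtoC om) (RtoC x))%C).
  intros j Hj; apply Cder_scal; unfold DD; rewrite <- !RtoC_plus.
  apply Cder_plus; [apply Cder_minus; [apply Cder_minus|]|]; apply Cder_ZE_LE; lia || lra.
- rewrite (Csum_ext _ (fun j => - (acoef 1 (RtoC om) j * DD (LE j) 1 (RtoC om) (RtoC x)))%C 4).
  + rewrite Csum_opp; unfold cc, hh, DD; simpl Csum; change (LE 2 (RtoC x)) with (Clog (RtoC x)); ring.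
  + intros j Hj; rewrite za_acoef by lia; unfold DD; ring.
Qed.

(** Order 3 suffices at 0, and the first Taylor coefficient is found term by term: the vertex gives
    [hh], each lattice point gives [- cc]. *)
Lemma zeta2_derive_0 : exists rho c, 0 < rho /\ AN zeta2 (RtoC 0) rho c /\
  c 1%nat = (- Gam (RtoC om) (RtoC z))%C.
Proof.
assert (H1 : 1 <= Cmod (1 - RtoC 0)%C).
{ replace (1 - RtoC 0)%C with (RtoC 1) by ring; rewrite Cmod_1; lra. }
assert (H2 : 1 <= Cmod (RtoC 2 - RtoC 0)%C).
{ replace (RtoC 2 - RtoC 0)%C with (RtoC 2) by ring; rewrite Cmod_R, Rabs_pos_eq; lra. }
assert (HN : 3 <= INR 3 + Re (RtoC 0)) by (rewrite re_RtoC; simpl; lra).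
destruct (FN_AN 3 (RtoC 0) 1 ltac:(lra) H1 H2 HN) as [c0 [Hc0 Hc]].
eexists; eexists; split; [|split; [eapply AN_ext; [|exact Hc]; apply zeta2_FN_near; try assumption; lra|]]; [lra|].
cbv beta.
assert (E0 : c0 1%nat = hh 1 (RtoC om) (RtoC z)).
{ apply (AN_Cder _ 1 _ _ Rlt_0_1 Hc0).
  eapply Cder_eq.
  - apply (Cder_Csum (fun j t => za j * ZE (RtoC t) j (RtoC z))%C (fun j => za j * - LE j (RtoC z))%C).
    intros j Hj; apply Cder_scal, Cder_ZE_LE; [lia|exact z_pos].
  - unfold hh; rewrite <- Csum_opp; apply Csum_ext; intros j Hj.
    rewrite za_acoef by lia; ring. }
assert (E1 : forall n m, coef (fun s => rN 3 s (zlat n m)) (RtoC 0) 1 1%nat = (- cc 1 (RtoC om) (zlat n m))%C).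
{ intros n m; apply (AN_Cder (fun s => rN 3 s (zlat n m)) 1); [lra| |apply Cder_rN].
  apply coef_spec, rN_AN; assumption || lra. }
rewrite E0; unfold Gam.
assert (E2 : CSer (fun n => CSer (fun m => coef (fun s => rN 3 s (zlat n m)) (RtoC 0) 1 1%nat)) =
  (- CSer (fun n => CSer (fun m => cc 1 (RtoC om) (zlat n m))))%C).
{ destruct pw_summable as [U HU].
  assert (Hb : forall n m, Cmod (cc 1 (RtoC om) (zlat n m)) <= ccst 1 (RtoC om) * (6 / delta ^ 4) * pw n * pw m).
  { intros n m; apply right_cc_bound; [apply delta_pos|apply delta_om|apply delta_z]. }
  set (K := ccst 1 (RtoC om) * (6 / delta ^ 4)) in Hb.
  assert (HK : 0 <= K).
  { apply Rmult_le_pos; [apply ccst_pos|].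
    apply Rmult_le_pos; [lra|apply Rlt_le, Rinv_0_lt_compat, pow_lt, delta_pos]. }
  assert (Hrow : forall n, summable (fun m => K * pw n * pw m) (K * pw n * U)).
  { intros n; apply summable_scal; [|exact HU]; apply Rmult_le_pos; [exact HK|apply HU]. }
  rewrite (CSer_ext _ (fun n => (- (1) * CSer (fun m => cc 1 (RtoC om) (zlat n m)))%C)).
  - rewrite (CSer_scal _ _ (fun n => (K * U) * pw n) (K * U * U)).
    + ring.
    + intros n; replace (K * U * pw n) with (K * pw n * U) by ring.
      apply (CSer_bound _ _ _ (Hb n) (Hrow n)).
    + apply summable_scal; [|exact HU]; apply Rmult_le_pos; [exact HK|apply (summable_pos pw), HU].
  - intros n; rewrite <- (CSer_scal _ _ _ _ (Hb n) (Hrow n)).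
    apply CSer_ext; intros m; rewrite E1; ring. }
rewrite E2; unfold zlat; ring.
Qed.

End Zeta.

(** * Uniqueness of the continuation and the double sine function *)

(** If the earlier coefficients vanish, dividing [f = 0] by the [k]-th power of the distance along
    the ray leaves [c k] plus an error proportional to [h]. *)
Lemma AN_zero_ray (f : C -> C) (s0 eta : C) (rho d : R) (c : nat -> C) :
  0 < rho -> AN f s0 rho c -> eta <> RtoC 0 -> 0 < d ->
  (forall h, 0 < h < d -> f (s0 + RtoC h * eta)%C = RtoC 0) -> forall k, c k = RtoC 0.
Proof.
intros Hr Hf Heta Hd Hz k; induction k as [k IH] using lt_wf_ind.
set (r := rho / 2); assert (Hrr : 0 < r) by (unfold r; lra).
destruct (AN_summable f s0 rho c r Hf ltac:(unfold r; lra)) as [B HB].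
assert (HB0 := summable_pos _ _ HB).
assert (He : 0 < Cmod eta) by (apply Cmod_gt_0, Heta).
assert (Hx : forall h, 0 < h < d -> h * Cmod eta <= r ->
  Cmod (c k) <= h * (Cmod eta * B / r ^ S k)).
{ intros h Hh Hhr.
  set (x := (RtoC h * eta)%C).
  assert (Hxm : Cmod x = h * Cmod eta) by (unfold x; rewrite Cmod_mult, Cmod_R, Rabs_pos_eq; lra).
  assert (Hx0 : 0 < Cmod x) by (rewrite Hxm; apply Rmult_lt_0_compat; lra).
  assert (Hser := Hf (s0 + x)%C); replace (s0 + x - s0)%C with x in Hser by ring.
  specialize (Hser ltac:(unfold r in Hhr; lra)); unfold x at 2 in Hser; rewrite Hz in Hser by exact Hh.
  set (q := Cmod x / r).
  assert (Hq : 0 <= q <= 1).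
  { unfold q; split; [apply Rmult_le_pos; [lra|apply Rlt_le, Rinv_0_lt_compat, Hrr]|].
    apply Rle_div_l; lra. }
  (* The series without its [k]-th term: by induction it starts at degree [k + 1], whence the factor
     [q ^ S k]. *)
  set (c' := fun l => if Nat.eqb l k then RtoC 0 else c l).
  assert (Hsplit : forall n, (k < n)%nat -> (c k * x ^ k)%C =
    (Csum (fun l => c l * x ^ l)%C n - Csum (fun l => c' l * x ^ l)%C n)%C).
  { intros n Hn; rewrite <- Csum_minus, (Csum_single _ n k Hn).
    - unfold c'; rewrite Nat.eqb_refl; ring.
    - intros l _ Hl; unfold c'; rewrite (proj2 (Nat.eqb_neq l k) Hl); ring. }
  assert (Hc' : forall n, Cmod (Csum (fun l => c' l * x ^ l)%C n) <= q ^ S k * B).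
  { intros n; apply Rle_trans with (Rsum (fun l => q ^ S k * (Cmod (c l) * r ^ l)) n).
    - apply Cmod_Csum_le; intros l _; unfold c'.
      assert (Hpos : 0 <= q ^ S k * (Cmod (c l) * r ^ l)).
      { apply Rmult_le_pos; [apply pow_le; lra|].
        apply Rmult_le_pos; [apply Cmod_ge_0|apply pow_le; lra]. }
      destruct (Nat.eqb_spec l k) as [->|Hlk].
      + replace (0 * x ^ k)%C with (RtoC 0) by ring; rewrite Cmod_0; exact Hpos.
      + destruct (Nat.lt_ge_cases l k) as [Hl|Hl].
        * rewrite (IH l Hl); replace (0 * x ^ l)%C with (RtoC 0) by ring; rewrite Cmod_0.
          rewrite (IH l Hl), Cmod_0 in Hpos; exact Hpos.
        * rewrite Cmod_mult, Cmod_pow.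
          replace (Cmod x ^ l) with (q ^ l * r ^ l).
          2:{ unfold q, Rdiv; rewrite Rpow_mult_distr, pow_inv; field; apply pow_nonzero; lra. }
          replace (Cmod (c l) * (q ^ l * r ^ l)) with (q ^ l * (Cmod (c l) * r ^ l)) by ring.
          apply Rmult_le_compat_r.
          -- apply Rmult_le_pos; [apply Cmod_ge_0|apply pow_le; lra].
          -- replace l with (S k + (l - S k))%nat by lia; rewrite pow_add.
             rewrite <- (Rmult_1_r (q ^ S k)) at 2; apply Rmult_le_compat_l; [apply pow_le; lra|].
             rewrite <- (pow1 (l - S k)); apply pow_incr; lra.
    - rewrite Rsum_scal; apply Rmult_le_compat_l; [apply pow_le; lra|apply summable_le, HB]. }
  assert (Hck : Cmod (c k * x ^ k)%C <= q ^ S k * B).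
  { apply (is_lim_seq_le_loc (fun _ => Cmod (c k * x ^ k)%C)
      (fun n => Cmod (Csum (fun l => c l * x ^ l)%C n) + q ^ S k * B)
      (Cmod (c k * x ^ k)%C) (q ^ S k * B)).
    - exists (S k); intros n Hn; rewrite (Hsplit n) by lia.
      eapply Rle_trans; [apply Cmod_triangle|]; rewrite Cmod_opp.
      apply Rplus_le_compat_l, Hc'.
    - apply is_lim_seq_const.
    - apply is_lim_seq_eq with (Cmod (RtoC 0) + q ^ S k * B); [|rewrite Cmod_0; ring].
      apply is_lim_seq_plus'; [apply Clim_Cmod, Hser|apply is_lim_seq_const]. }
  rewrite Cmod_mult, Cmod_pow in Hck.
  apply Rmult_le_reg_r with (Cmod x ^ k); [apply pow_lt, Hx0|].
  eapply Rle_trans; [exact Hck|].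
  apply Req_le; unfold q, Rdiv; rewrite Rpow_mult_distr, pow_inv, Hxm.
  change ((h * Cmod eta) ^ S k) with (h * Cmod eta * (h * Cmod eta) ^ k).
  field; apply pow_nonzero; lra. }
apply Cmod_eq_0; apply Rle_antisym; [|apply Cmod_ge_0].
set (K := Cmod eta * B / r ^ S k) in Hx.
assert (HK : 0 <= K).
{ apply Rmult_le_pos; [apply Rmult_le_pos; lra|apply Rlt_le, Rinv_0_lt_compat, pow_lt, Hrr]. }
apply le_epsilon; intros eps Heps; rewrite Rplus_0_l.
set (h := Rmin (d / 2) (Rmin (r / Cmod eta) (eps / (K + 1)))).
assert (Hre : 0 < r / Cmod eta) by (apply Rdiv_lt_0_compat; assumption).
assert (HeK : 0 < eps / (K + 1)) by (apply Rdiv_lt_0_compat; lra).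
assert (Hh : 0 < h) by (repeat apply Rmin_pos; lra).
assert (Hh1 : h <= d / 2) by apply Rmin_l.
assert (Hh2 : h <= r / Cmod eta) by (eapply Rle_trans; [apply Rmin_r|apply Rmin_l]).
assert (Hh3 : h <= eps / (K + 1)) by (eapply Rle_trans; [apply Rmin_r|apply Rmin_r]).
eapply Rle_trans; [apply (Hx h)|].
- lra.
- apply Rle_trans with (r / Cmod eta * Cmod eta); [apply Rmult_le_compat_r; lra|].
  apply Req_le; field; lra.
- apply Rle_trans with (eps / (K + 1) * (K + 1)).
  + apply Rmult_le_compat; lra.
  + apply Req_le; field; lra.
Qed.

Lemma AN_zero (f : C -> C) (s0 : C) (rho : R) (c : nat -> C) :
  AN f s0 rho c -> (forall k, c k = RtoC 0) -> forall s, Cmod (s - s0)%C < rho -> f s = RtoC 0.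
Proof.
intros Hf Hc s Hs.
apply (Clim_unique _ _ _ (Hf s Hs)).
apply Clim_ext with (fun _ => RtoC 0); [|apply Clim_const].
intros n; symmetry; apply Csum_zero; intros k _; rewrite Hc; ring.
Qed.

(** The identity theorem along the segment from [3 (1 + i)] to [0], which avoids
    the poles. *)
Lemma identity_on_ray (D : C -> C) :
  let L := fun t => (RtoC t * (1 + Ci))%C in
  (forall t, 0 <= t <= 3 -> exists rho c, 0 < rho /\ AN D (L t) rho c) ->
  (forall t, 2 < t -> D (L t) = RtoC 0) ->
  exists rho, 0 < rho /\ forall s, Cmod s < rho -> D s = RtoC 0.
Proof.
intros L HA H2.
assert (Heta : (1 + Ci)%C <> RtoC 0).
{ intros E; apply (f_equal Im) in E; simpl in E; lra. }
assert (HL : forall t h, (L t + RtoC h * (1 + Ci))%C = L (t + h)).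
{ intros t h; unfold L; rewrite RtoC_plus; ring. }
assert (Hm : Cmod (1 + Ci)%C <= 2).
{ eapply Rle_trans; [apply Cmod_triangle|]; rewrite Cmod_1, Cmod_Ci; lra. }
set (E := fun t => 0 <= t <= 3 /\ D (L t) <> RtoC 0).
assert (HE : forall t, 0 <= t -> D (L t) = RtoC 0).
{ intros t0 Ht0; destruct (Classical_Prop.classic (D (L t0) = RtoC 0)) as [H|Hne]; [exact H|exfalso].
  assert (Et0 : E t0).
  { split; [|exact Hne]; split; [exact Ht0|].
    destruct (Rle_or_lt t0 3) as [H|H]; [exact H|exfalso; apply Hne, H2; lra]. }
  assert (Hbd : forall t, E t -> t <= 2).
  { intros t [_ Ht]; destruct (Rle_or_lt t 2) as [H|H]; [exact H|exfalso; apply Ht, H2, H]. }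
  destruct (completeness E) as [m [Hm1 Hm2]].
  - exists 2; intros t Ht; apply Hbd, Ht.
  - exists t0; exact Et0.
  - assert (Hmr : 0 <= m <= 2).
    { split; [apply Rle_trans with t0; [exact Ht0|apply Hm1, Et0]|apply Hm2; intros t Ht; apply Hbd, Ht]. }
    destruct (HA m ltac:(lra)) as [rho [c [Hr Hc]]].
    (* To the right of the supremum [m] of the nonzero parameters [D] vanishes, so its expansion at
       [m] is zero. Then [D] vanishes to the left of [m] as well, contradicting the supremum. *)
    assert (Hz : forall k, c k = RtoC 0).
    { apply (AN_zero_ray D (L m) (1 + Ci) rho 1 c Hr Hc Heta Rlt_0_1).
      intros h Hh; rewrite HL.
      destruct (Classical_Prop.classic (D (L (m + h)) = RtoC 0)) as [H|H]; [exact H|exfalso].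
      assert (m + h <= m); [|lra].
      apply Hm1; split; [lra|exact H]. }
    assert (Hm' : m <= m - rho / 4).
    { apply Hm2; intros t Ht.
      destruct (Rle_or_lt t (m - rho / 4)) as [H|H]; [exact H|exfalso].
      apply (proj2 Ht); apply (AN_zero D (L m) rho c Hc Hz).
      replace (L t - L m)%C with (RtoC (t - m) * (1 + Ci))%C by (unfold L; rewrite RtoC_minus; ring).
      rewrite Cmod_mult, Cmod_R.
      assert (Htm : t <= m) by (apply Hm1, Ht).
      rewrite Rabs_left1 by lra.
      apply Rle_lt_trans with (- (t - m) * 2); [apply Rmult_le_compat_l; lra|lra]. }
    lra. }
destruct (HA 0 ltac:(lra)) as [rho [c [Hr Hc]]].
exists rho; split; [exact Hr|].
assert (HL0 : L 0 = RtoC 0) by (unfold L; ring).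
rewrite HL0 in Hc.
intros s Hs; apply (AN_zero D (RtoC 0) rho c Hc).
- apply (AN_zero_ray D (RtoC 0) (1 + Ci) rho 1 c Hr Hc Heta Rlt_0_1).
  intros h Hh; replace (RtoC 0 + RtoC h * (1 + Ci))%C with (L h) by (unfold L; ring).
  apply HE; lra.
- replace (s - RtoC 0)%C with s by ring; exact Hs.
Qed.

Lemma double_series_unique (s : C) (z w : R) (l l' : C) :
  double_series s z w l -> double_series s z w l' -> l = l'.
Proof.
intros [r [Hr Hl]] [r' [Hr' Hl']].
apply is_series_Clim in Hl; apply is_series_Clim in Hl'.
apply (Clim_unique (Csum r)); [exact Hl|].
eapply Clim_ext; [|exact Hl'].
intros n; apply Csum_ext; intros k _.
apply (Clim_unique (Csum (fun n2 => Rcpow (INR k + INR n2 * w + z) (- s)%C)));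
  apply is_series_Clim; [apply Hr'|apply Hr].
Qed.

(** [double_zeta] is an [epsilon] choice and known only through such uniqueness; agreement on a disc
    about 0 determines the derivative there. *)
Lemma double_zeta_unique (z w : R) (F G : C -> C) :
  is_double_zeta z w F -> is_double_zeta z w G ->
  exists rho, 0 < rho /\ forall s, Cmod s < rho -> F s = G s.
Proof.
intros [HF1 HF2] [HG1 HG2].
destruct (identity_on_ray (fun s => (F s - G s)%C)) as [rho [Hr H]].
- intros t Ht.
  assert (Hne : forall p : R, p <> 0 -> (RtoC t * (1 + Ci))%C <> RtoC p).
  { intros p Hp E; assert (E1 := f_equal Re E); assert (E2 := f_equal Im E); simpl in E1, E2.
    apply Hp; lra. }
  destruct (analytic_AN F _ (HF1 _ (Hne 1 ltac:(lra)) (Hne 2 ltac:(lra)))) as [r1 [c1 [Hr1 Hc1]]].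
  destruct (analytic_AN G _ (HG1 _ (Hne 1 ltac:(lra)) (Hne 2 ltac:(lra)))) as [r2 [c2 [Hr2 Hc2]]].
  assert (A1 := AN_mono _ _ r1 (Rmin r1 r2) c1 (Rmin_l _ _) Hc1).
  assert (A2 := AN_mono _ _ r2 (Rmin r1 r2) c2 (Rmin_r _ _) Hc2).
  exists (Rmin r1 r2); eexists; split; [apply Rmin_pos; assumption|].
  eapply AN_ext; [|apply (AN_plus _ _ _ _ _ _ A1 (AN_scal (- (1))%C _ _ _ _ A2))].
  intros s _; cbv beta; ring.
- intros t Ht.
  assert (Hre : 2 < Re (RtoC t * (1 + Ci))%C) by (simpl; lra).
  rewrite (double_series_unique _ _ _ _ _ (HF2 _ Hre) (HG2 _ Hre)); ring.
- exists rho; split; [exact Hr|]; intros s Hs.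
  replace (F s) with ((F s - G s) + G s)%C by ring; rewrite H by exact Hs; ring.
Qed.

Lemma double_zeta'_0 (z om : R) : 0 < z -> 0 < om ->
  double_zeta' (RtoC 0) z om = (- Gam (RtoC om) (RtoC z))%C.
Proof.
intros Hz Hom; unfold double_zeta'.
assert (HF : is_double_zeta z om (fun s => double_zeta s z om)).
{ unfold double_zeta; apply (epsilon_spec (inhabits (fun _ : C => RtoC 0)) (is_double_zeta z om)).
  exists (zeta2 z om); apply zeta2_is_double_zeta; assumption. }
destruct (double_zeta_unique z om _ _ HF (zeta2_is_double_zeta z om Hz Hom)) as [r1 [Hr1 HE]].
destruct (zeta2_derive_0 z om Hz Hom) as [r2 [c [Hr2 [Hc Hc1]]]].
rewrite <- Hc1; apply (AN_C_derive _ _ (Rmin r1 r2)); [apply Rmin_pos; assumption|].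
eapply AN_ext; [|apply (AN_mono _ _ r2 _ _ (Rmin_r _ _) Hc)].
intros s Hs; symmetry; apply HE.
replace (s - RtoC 0)%C with s in Hs by ring.
eapply Rlt_le_trans; [exact Hs|apply Rmin_l].
Qed.

Lemma Im_Csum_0 (a : nat -> C) (n : nat) :
  (forall k, (k < n)%nat -> Im (a k) = 0) -> Im (Csum a n) = 0.
Proof.
induction n as [|n IH]; intros H; [reflexivity|].
rewrite Csum_S, im_plus, IH, H by (try lia; intros; apply H; lia); ring.
Qed.

Lemma Im_CSer_0 (a : nat -> C) : (forall n, Im (a n) = 0) -> Im (CSer a) = 0.
Proof.
intros H; unfold CSer, C_lim_seq; simpl.
rewrite (Lim_seq_ext _ (fun _ => 0)); [rewrite Lim_seq_const; reflexivity|].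
intros n; apply Im_Csum_0; auto.
Qed.

Lemma Im_hh (om x : R) : 0 < om -> 0 < x -> Im (hh 1 (RtoC om) (RtoC x)) = 0.
Proof.
intros Hom Hx; unfold hh; apply Im0_opp, Im_Csum_0; intros j Hj.
apply Im0_mult.
- destruct j as [|[|[|[|j]]]]; unfold acoef, Cdiv;
    repeat first [apply Im0_plus|apply Im0_mult|apply Im0_inv|apply Im0_opp|apply im_RtoC].
- destruct j as [|[|[|[|j]]]]; unfold LE, Cdiv, Cminus; rewrite ?Clog_RtoC by exact Hx; [| | | |lia];
    cbn [Cpow];
    repeat first [apply Im0_plus|apply Im0_mult|apply Im0_inv|apply Im0_opp|apply im_RtoC].
Qed.

(** All terms are rational expressions in positive reals and their logarithms. The limits in view
    are moduli, so the double sine has to be a positive real. *)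
Lemma Im_Gam (om z : R) : 0 < om -> 0 < z -> Im (Gam (RtoC om) (RtoC z)) = 0.
Proof.
intros Hom Hz; unfold Gam, Cminus; apply Im0_plus; [|apply Im0_opp, Im_hh; assumption].
apply Im_CSer_0; intros n; apply Im_CSer_0; intros m.
assert (Hx : 0 < z + INR n + INR m * om).
{ generalize (pos_INR n); intros; assert (0 <= INR m * om) by (apply Rmult_le_pos; [apply pos_INR|lra]); lra. }
replace (lat (RtoC z) 1 (RtoC om) n m) with (RtoC (z + INR n + INR m * om))
  by (unfold lat; rewrite !RtoC_plus, RtoC_mult; ring).
unfold cc, DD, Cminus; rewrite Clog_RtoC by exact Hx; rewrite <- !RtoC_plus.
repeat first [apply Im_hh; lra|apply im_RtoC|apply Im0_plus|apply Im0_opp].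
Qed.

Lemma double_sine_Gam (om z : R) : 0 < om -> 0 < z < 1 + om ->
  double_sine om z =
  RtoC (exp (Re (Gam (RtoC om) (RtoC z) - Gam (RtoC om) (RtoC (1 + om - z)))%C)).
Proof.
intros Hom Hz; unfold double_sine.
rewrite !double_zeta'_0 by lra.
rewrite <- Cexp_RtoC; f_equal.
assert (H1 := Im_Gam om z Hom ltac:(lra)).
assert (H2 := Im_Gam om (1 + om - z) Hom ltac:(lra)).
set (G1 := Gam (RtoC om) (RtoC z)) in *; set (G2 := Gam (RtoC om) (RtoC (1 + om - z))) in *.
replace (- G2 - - G1)%C with (G1 - G2)%C by ring.
assert (H : Im (G1 - G2)%C = 0) by (unfold Cminus; rewrite im_plus, im_opp; lra).
apply injective_projections; [reflexivity|exact H].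
Qed.

(** * Units and decomposition data *)

Lemma Q2R_inject_Z (n : Z) : Q2R (inject_Z n) = IZR n.
Proof. unfold Q2R; simpl; field. Qed.

Lemma Q2R_half (n : Z) : Q2R (n # 2) = IZR n / 2.
Proof. unfold Q2R; simpl; reflexivity. Qed.

Lemma irrational_independent (r : R) : (~ exists q : Q, r = Q2R q) ->
  forall p q : Q, Q2R p + Q2R q * r = 0 -> Q2R p = 0 /\ Q2R q = 0.
Proof.
intros Hr p q H.
destruct (Qeq_dec q 0) as [Hq|Hq].
- apply Qeq_eqR in Hq; rewrite RMicromega.Q2R_0 in Hq; rewrite Hq in H |- *; lra.
- exfalso; apply Hr; exists (- p / q)%Q.
  assert (Hq' : Q2R q <> 0).
  { intros E; apply Hq, eqR_Qeq; rewrite E, RMicromega.Q2R_0; reflexivity. }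
  rewrite Q2R_div, Q2R_opp by exact Hq.
  replace r with ((- Q2R p + (Q2R p + Q2R q * r)) / Q2R q) by (field; exact Hq').
  rewrite H; field; exact Hq'.
Qed.

Section Field.

Variables (d : Z) (a b : nat) (eps : R).
Hypotheses (d_pos : (0 < d)%Z)
  (K_quadratic : ~ exists q : Q, sqrt (IZR d) = Q2R q)
  (eps_eq : eps = (INR a + INR b * sqrt (IZR d)) / 2)
  (eps_fundamental : generates eps (tot_pos_unit d))
  (OK_basis : forall x : R, OK d x <-> exists m n : Z, x = IZR m + IZR n * eps).

Lemma sqrt_in_OK : OK d (sqrt (IZR d)).
Proof.
assert (Hd : 0 < IZR d) by (apply IZR_lt, d_pos).
split.
- exists 0%Q, 1%Q; rewrite RMicromega.Q2R_0, RMicromega.Q2R_1; ring.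
- exists 1%nat, (fun i => match i with O => (- d)%Z | _ => 0%Z end).
  simpl; rewrite opp_IZR, Rmult_1_r, sqrt_sqrt by lra; ring.
Qed.

Lemma eps_irrational : ~ exists q : Q, eps = Q2R q.
Proof.
intros [q Hq].
destruct (proj1 (OK_basis _) sqrt_in_OK) as [m [n E]].
apply K_quadratic; exists (inject_Z m + inject_Z n * q)%Q.
rewrite E, Hq, Q2R_plus, Q2R_mult, !Q2R_inject_Z; reflexivity.
Qed.

Lemma eps_independent (p q : Q) : Q2R p + Q2R q * eps = 0 -> Q2R p = 0 /\ Q2R q = 0.
Proof. apply irrational_independent, eps_irrational. Qed.

Lemma eps_independent_Z (m n : Z) : IZR m + IZR n * eps = 0 -> m = 0%Z /\ n = 0%Z.
Proof.
intros H; destruct (eps_independent (inject_Z m) (inject_Z n)) as [H1 H2].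
- rewrite !Q2R_inject_Z; exact H.
- rewrite Q2R_inject_Z in H1, H2; split; apply eq_IZR; assumption.
Qed.

(** Total positivity only provides some rational coordinates of [eps]; irrationality of [sqrt d]
    identifies them with [a / 2] and [b / 2]. *)
Lemma conj_pos : 0 < INR a - INR b * sqrt (IZR d).
Proof.
assert (H : tot_pos_unit d eps).
{ apply eps_fundamental; exists 1%Z; simpl; ring. }
destruct H as [_ [_ [_ [p [q [E [_ Hp]]]]]]].
destruct (irrational_independent _ K_quadratic ((Z.of_nat a # 2) - p) ((Z.of_nat b # 2) - q)) as [H1 H2].
- rewrite !Q2R_minus, !Q2R_half, <- !INR_IZR_INZ; lra.
- rewrite Q2R_minus, Q2R_half, <- INR_IZR_INZ in H1, H2.
  replace (INR b) with (2 * Q2R q) by lra; replace (INR a) with (2 * Q2R p) by lra; lra.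
Qed.

Lemma eps_pos : 0 < eps.
Proof.
assert (H1 := conj_pos).
assert (0 <= INR b * sqrt (IZR d)) by (apply Rmult_le_pos; [apply pos_INR|apply sqrt_pos]).
lra.
Qed.

(** The powers of [eps] are integral, which forces the norm to be an integer. *)
Lemma eps_norm : eps * ((INR a - INR b * sqrt (IZR d)) / 2) = 1.
Proof.
assert (He := eps_pos); assert (Hc := conj_pos).
set (c := (INR a - INR b * sqrt (IZR d)) / 2).
assert (Hs : eps + c = INR a) by (unfold c; lra).
set (N := eps * c).
assert (Hd : 0 < IZR d) by (apply IZR_lt, d_pos).
assert (HNq : N = (INR a * INR a - INR b * INR b * IZR d) / 4).
{ unfold N, c; rewrite eps_eq.
  replace (IZR d) with (sqrt (IZR d) * sqrt (IZR d)) at 3 by (apply sqrt_sqrt; lra); field. }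
assert (Hsq : eps * eps = INR a * eps - N) by (unfold N; nra).
assert (H2 : tot_pos_unit d (eps ^ 2)).
{ apply eps_fundamental; exists 2%Z; reflexivity. }
destruct H2 as [_ [H2 _]]; destruct (proj1 (OK_basis _) H2) as [m [n E2]].
set (A := Z.of_nat a); set (B := Z.of_nat b).
assert (HA : INR a = IZR A) by apply INR_IZR_INZ; assert (HB : INR b = IZR B) by apply INR_IZR_INZ.
assert (HN : N = - IZR m).
(* Two expressions for [eps ^ 2] are compared; the factor 4 clears the denominator of [N]. *)
{ destruct (eps_independent_Z (4 * m + (A * A - B * B * d)) (4 * (n - A))) as [H3 H4].
  - rewrite plus_IZR, minus_IZR, !mult_IZR, minus_IZR, <- HA, <- HB.
    replace (eps ^ 2) with (eps * eps) in E2 by ring.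
    clearbody N; lra.
  - assert (H5 := f_equal IZR H3); rewrite plus_IZR, minus_IZR, !mult_IZR, <- HA, <- HB in H5.
    rewrite HNq; lra. }
assert (H1 : tot_pos_unit d eps).
{ apply eps_fundamental; exists 1%Z; simpl; ring. }
destruct H1 as [_ [_ [H1 _]]]; destruct (proj1 (OK_basis _) H1) as [m' [n' E1]].
(* Multiplying the coordinates of [/ eps] by [eps] yields [n' * m = 1]; since [N = - m] is positive,
   [m = - 1]. *)
assert (E3 : 1 = IZR m' * eps + IZR n' * (INR a * eps - N)).
{ rewrite <- Hsq; replace 1 with (eps * / eps) by (field; lra); rewrite E1; ring. }
destruct (eps_independent_Z (n' * m - 1) (m' + n' * A)) as [H3 _].
{ rewrite minus_IZR, plus_IZR, !mult_IZR, <- HA; 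
  rewrite HN in E3; lra. }
assert (HNp : 0 < N) by (apply Rmult_lt_0_compat; unfold c; lra).
assert (Hm : (m < 0)%Z) by (apply lt_IZR; lra).
assert (Hm1 : m = (-1)%Z) by
  (destruct (Z.divide_1_r m); [exists n'; lia|lia|assumption]).
rewrite HN, Hm1; simpl; lra.
Qed.

Lemma eps_inv : / eps = (INR a - INR b * sqrt (IZR d)) / 2.
Proof.
assert (He := eps_pos); assert (H := eps_norm).
apply Rmult_eq_reg_l with eps; [|lra]; rewrite H; field; lra.
Qed.

Lemma eps_trace : INR a = eps + / eps.
Proof. rewrite eps_inv; lra. Qed.

Lemma eps_disc : INR b * sqrt (IZR d) = eps - / eps.
Proof. rewrite eps_inv; lra. Qed.

Lemma eps_gt_1 : 1 < eps.
Proof.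
assert (He := eps_pos).
assert (Hb : 0 <= INR b * sqrt (IZR d)) by (apply Rmult_le_pos; [apply pos_INR|apply sqrt_pos]).
assert (Hi : 0 < / eps) by (apply Rinv_0_lt_compat, He).
assert (Hle : / eps <= eps) by (generalize eps_disc; lra).
assert (Hm : eps * / eps = 1) by (field; lra).
destruct (Rtotal_order eps 1) as [H|[H|H]]; [|exfalso|exact H].
- exfalso; nra.
- apply eps_irrational; exists 1%Q; rewrite RMicromega.Q2R_1; exact H.
Qed.

(** * The decomposition data modulo the ring of integers *)

Definition lattice (x : R) : Prop := exists m n : Z, x = IZR m + IZR n * eps.

Lemma lattice_plus (x y : R) : lattice x -> lattice y -> lattice (x + y).
Proof.
intros [m [n ->]] [m' [n' ->]]; exists (m + m')%Z, (n + n')%Z; rewrite !plus_IZR; ring.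
Qed.

Lemma lattice_opp (x : R) : lattice x -> lattice (- x).
Proof. intros [m [n ->]]; exists (- m)%Z, (- n)%Z; rewrite !opp_IZR; ring. Qed.

Lemma eps_sq : eps * eps = INR a * eps - 1.
Proof.
assert (He := eps_pos); rewrite eps_trace.
replace ((eps + / eps) * eps) with (eps * eps + eps * / eps) by ring.
rewrite Rinv_r; lra.
Qed.

Lemma lattice_mult_eps (x : R) : lattice x -> lattice (x * eps).
Proof.
intros [m [n ->]]; exists (- n)%Z, (m + n * Z.of_nat a)%Z.
rewrite plus_IZR, mult_IZR, opp_IZR, <- INR_IZR_INZ.
replace ((IZR m + IZR n * eps) * eps) with (IZR m * eps + IZR n * (eps * eps)) by ring.
rewrite eps_sq; ring.
Qed.

Lemma lattice_div_eps (x : R) : lattice x -> lattice (x * / eps).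
Proof.
intros [m [n ->]]; exists (m * Z.of_nat a + n)%Z, (- m)%Z.
rewrite plus_IZR, mult_IZR, opp_IZR, <- INR_IZR_INZ.
assert (He := eps_pos); rewrite eps_trace; field; lra.
Qed.

Lemma lattice_powerRZ (x : R) (k : Z) : lattice x -> lattice (x * powerRZ eps k).
Proof.
intros H.
assert (Hp : forall n, lattice (x * eps ^ n)).
{ induction n as [|n IH]; [simpl; rewrite Rmult_1_r; exact H|].
  replace (x * eps ^ S n) with (x * eps ^ n * eps) by (simpl; ring); apply lattice_mult_eps, IH. }
assert (Hn : forall n, lattice (x * / eps ^ n)).
{ induction n as [|n IH]; [simpl; rewrite Rinv_1, Rmult_1_r; exact H|].
  replace (x * / eps ^ S n) with (x * / eps ^ n * / eps).
  - apply lattice_div_eps, IH.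
  - simpl; field; split; [apply pow_nonzero|]; generalize eps_pos; lra. }
destruct k as [|k|k]; simpl; [rewrite Rmult_1_r; exact H|apply Hp|apply Hn].
Qed.

Variables (phi : R) (g : nat) (x y : Z -> Q).
Hypotheses (phi_neq0 : phi <> 0) (g_spec : is_g d eps phi g)
  (xy_spec : forall k : Z, is_decomposition d eps (/ phi) k (x k) (y k)).

Lemma x_range (k : Z) : 0 < Q2R (x k) <= 1.
Proof.
destruct (xy_spec k) as [[H1 H2] _].
apply Qlt_Rlt in H1; apply Qle_Rle in H2.
rewrite RMicromega.Q2R_0 in H1; rewrite RMicromega.Q2R_1 in H2; lra.
Qed.

Lemma y_range (k : Z) : 0 <= Q2R (y k) < 1.
Proof.
destruct (xy_spec k) as [_ [[H1 H2] _]].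
apply Qle_Rle in H1; apply Qlt_Rlt in H2.
rewrite RMicromega.Q2R_0 in H1; rewrite RMicromega.Q2R_1 in H2; lra.
Qed.

(** After multiplication by the unit [eps ^ k], the data are the coordinates of [eps ^ k / phi] in
    the basis [eps], [1] modulo integers; a step in [k] becomes multiplication by [eps]. *)
Lemma decomposition_lattice (k : Z) :
  lattice (Q2R (x k) * eps + Q2R (y k) - powerRZ eps k / phi).
Proof.
destruct (xy_spec k) as [_ [_ H]].
apply OK_basis, (lattice_powerRZ _ k) in H.
assert (He := eps_pos).
replace (Q2R (x k) * eps + Q2R (y k) - powerRZ eps k / phi)
  with ((Q2R (x k) * powerRZ eps (1 - k) + Q2R (y k) * powerRZ eps (- k) - / phi) * powerRZ eps k);
  [exact H|].
assert (E1 : powerRZ eps (1 - k) * powerRZ eps k = eps).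
{ rewrite <- powerRZ_add by lra; replace (1 - k + k)%Z with 1%Z by lia; simpl; ring. }
assert (E2 : powerRZ eps (- k) * powerRZ eps k = 1).
{ rewrite <- powerRZ_add by lra; replace (- k + k)%Z with 0%Z by lia; reflexivity. }
transitivity (Q2R (x k) * (powerRZ eps (1 - k) * powerRZ eps k)
  + Q2R (y k) * (powerRZ eps (- k) * powerRZ eps k) - powerRZ eps k / phi).
- unfold Rdiv; ring.
- rewrite E1, E2; ring.
Qed.

Lemma lattice_rational (p q : Q) : lattice (Q2R p * eps + Q2R q) ->
  exists m n : Z, Q2R p = IZR m /\ Q2R q = IZR n.
Proof.
intros [m [n E]]; exists n, m.
destruct (eps_independent (q - inject_Z m) (p - inject_Z n)) as [H1 H2].
- rewrite !Q2R_minus, !Q2R_inject_Z; lra.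
- rewrite Q2R_minus, Q2R_inject_Z in H1, H2; split; lra.
Qed.

Lemma decomposition_pred (k : Z) : Q2R (x (k - 1)) = 1 - Q2R (y k) /\
  exists M : Z, Q2R (y (k - 1)) + (1 - Q2R (y k)) * INR a - Q2R (x k) = IZR M.
Proof.
assert (He := eps_pos).
assert (H1 := decomposition_lattice k); assert (H2 := decomposition_lattice (k - 1)).
apply lattice_mult_eps in H2.
assert (Ek : powerRZ eps (k - 1) * eps = powerRZ eps k).
{ replace k with (k - 1 + 1)%Z at 2 by lia; rewrite powerRZ_add by lra; simpl; ring. }
(* [p] and [q] are the coordinates of [eps] times the relation at [k - 1] minus the relation at [k],
   reduced by [eps ^ 2 = a eps - 1]. *)
set (p := (inject_Z (Z.of_nat a) * x (k - 1) + y (k - 1) - x k)%Q).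
set (q := (- x (k - 1) - y k)%Q).
destruct (lattice_rational p q) as [m [n [Em En]]].
- replace (Q2R p * eps + Q2R q) with
    ((Q2R (x (k - 1)) * eps + Q2R (y (k - 1)) - powerRZ eps (k - 1) / phi) * eps
     + - (Q2R (x k) * eps + Q2R (y k) - powerRZ eps k / phi)).
  + apply lattice_plus; [exact H2|apply lattice_opp, H1].
  + unfold p, q; rewrite !Q2R_minus, Q2R_plus, Q2R_mult, Q2R_opp, Q2R_inject_Z, <- INR_IZR_INZ, <- Ek.
    replace ((Q2R (x (k - 1)) * eps + Q2R (y (k - 1)) - powerRZ eps (k - 1) / phi) * eps)
      with (Q2R (x (k - 1)) * (eps * eps) + Q2R (y (k - 1)) * eps - powerRZ eps (k - 1) * eps / phi)
      by (field; exact phi_neq0).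
    rewrite eps_sq; field; exact phi_neq0.
- unfold p in Em; unfold q in En.
  rewrite Q2R_minus, Q2R_plus, Q2R_mult, Q2R_inject_Z, <- INR_IZR_INZ in Em.
  rewrite Q2R_minus, Q2R_opp in En.
  assert (Hx := x_range (k - 1)); assert (Hy := y_range k).
  (* The half-open ranges place the integer [x (k - 1) + y k] strictly between 0 and 2. *)
  assert (Hn : n = (-1)%Z).
  { assert (-2 < n < 0)%Z by (split; apply lt_IZR; lra); lia. }
  rewrite Hn in En; simpl in En.
  assert (Ex : Q2R (x (k - 1)) = 1 - Q2R (y k)) by lra.
  split; [exact Ex|]; exists m; rewrite <- Em, Ex; ring.
Qed.

(** Since [eps ^ g - 1] lies in the ideal of [phi], the numbers [eps ^ k / phi] and
    [eps ^ (k - g) / phi] differ by an integer of the field, and coordinates in these ranges are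
    unique. *)
Lemma decomposition_period (k : Z) :
  Q2R (x (k - Z.of_nat g)) = Q2R (x k) /\ Q2R (y (k - Z.of_nat g)) = Q2R (y k).
Proof.
assert (He := eps_pos).
destruct g_spec as [_ [Hg _]].
assert (Hu : ray_units d phi (eps ^ g)).
{ apply Hg; exists 1%Z; simpl; ring. }
destruct Hu as [_ [w [Hw Ew]]].
apply OK_basis, (lattice_powerRZ _ (k - Z.of_nat g)) in Hw.
assert (H1 := decomposition_lattice k); assert (H2 := decomposition_lattice (k - Z.of_nat g)).
assert (Ek : powerRZ eps k = powerRZ eps (k - Z.of_nat g) * eps ^ g).
{ rewrite pow_powerRZ, <- powerRZ_add by lra; f_equal; lia. }
destruct (lattice_rational (x (k - Z.of_nat g) - x k) (y (k - Z.of_nat g) - y k)) as [m [n [Em En]]].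
- rewrite !Q2R_minus.
  replace ((Q2R (x (k - Z.of_nat g)) - Q2R (x k)) * eps + (Q2R (y (k - Z.of_nat g)) - Q2R (y k)))
    with ((Q2R (x (k - Z.of_nat g)) * eps + Q2R (y (k - Z.of_nat g)) - powerRZ eps (k - Z.of_nat g) / phi)
     + - (Q2R (x k) * eps + Q2R (y k) - powerRZ eps k / phi)
     + - (w * powerRZ eps (k - Z.of_nat g))).
  + apply lattice_plus; [apply lattice_plus; [exact H2|apply lattice_opp, H1]|apply lattice_opp, Hw].
  + rewrite Ek; replace w with ((eps ^ g - 1) / phi) by (rewrite Ew; field; exact phi_neq0).
    field; exact phi_neq0.
- rewrite Q2R_minus in Em, En.
  assert (Hx := x_range k); assert (Hx' := x_range (k - Z.of_nat g)).
  assert (Hy := y_range k); assert (Hy' := y_range (k - Z.of_nat g)).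
  assert (Hm : m = 0%Z) by (assert (-1 < m < 1)%Z by (split; apply lt_IZR; lra); lia).
  assert (Hn : n = 0%Z) by (assert (-1 < n < 1)%Z by (split; apply lt_IZR; lra); lia).
  rewrite Hm in Em; rewrite Hn in En; simpl in Em, En; split; lra.
Qed.

End Field.

(** * Convergence along the Chebyshev points *)

Lemma qpoch_qsum (x y : R) (t : C) : 0 < Im t -> 0 < x ->
  qpoch x y t = Cexp (qsum t (RtoC x * t + RtoC y)).
Proof.
intros Ht Hx; apply Clim_C_lim_seq.
apply Clim_ext with (2 := qpoch_product t (RtoC x * t + RtoC y)%C Ht ltac:(rewrite im_plus, im_scal_l, im_RtoC; nra)).
intros n; apply Cprod_ext; intros j _; unfold e2.
do 3 f_equal; ring.
Qed.

Lemma qpoch_inversion (x y x' y' : R) (A M : Z) (t : C) : 0 < Im t -> y < 1 ->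
  x' = 1 - y -> y' + (1 - y) * IZR A - x = IZR M ->
  qpoch x' y' (RtoC (IZR A) - / t)%C =
  Cexp (qsum (- / t) ((RtoC x * t + RtoC y - 1) / t)).
Proof.
intros Ht Hy -> HM.
assert (Ht0 := Im_neq0 t Ht); assert (Hs := Im_inv_opp t Ht).
assert (Ez : ((RtoC x * t + RtoC y - 1) / t = RtoC (1 - y) * (- / t) + RtoC x)%C).
{ rewrite RtoC_minus; field; exact Ht0. }
rewrite Ez; apply Clim_C_lim_seq.
apply Clim_ext with (2 := qpoch_product (- / t)%C (RtoC (1 - y) * (- / t) + RtoC x)%C Hs ltac:(rewrite im_plus, im_scal_l, im_RtoC; nra)).
intros n; apply Cprod_ext; intros j _; apply (f_equal (Cminus 1)).
assert (Ey : y' = x + IZR M - (1 - y) * IZR A) by lra.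
(* Translating [- / t] by [A] changes the exponent of the [j]-th factor by integers only, once [y']
   is expressed through [x] and [M]; they are invisible to [e2]. *)
transitivity (e2 (RtoC (1 - y) * (- / t) + RtoC x + RtoC (INR j) * (- / t)
  + RtoC (IZR (M + Z.of_nat j * A)))%C).
- rewrite (e2_plus _ (RtoC (IZR _))), e2_Z; ring.
- unfold e2; f_equal; f_equal.
  rewrite Ey, plus_IZR, mult_IZR, <- INR_IZR_INZ.
  rewrite !RtoC_minus, !RtoC_plus, !RtoC_mult, !RtoC_minus; ring.
Qed.

Section Chebyshev.

Variable e : R.
Hypothesis e_gt_1 : 1 < e.

Definition cheb_value (m : Z) : R := powerRZ e m + powerRZ e (- m).

(** The point [tau d a b m] written in terms of the unit alone, as [tau_cheb_point] shows. *)
Definition cheb_point (m : Z) : C :=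
  (cheb_value (m + 1) / cheb_value m, (e - / e) / cheb_value m).

Lemma powerRZ_e_pos (m : Z) : 0 < powerRZ e m.
Proof. apply powerRZ_lt; lra. Qed.

Lemma powerRZ_e_opp (m : Z) : powerRZ e (- m) = / powerRZ e m.
Proof. apply powerRZ_neg'. Qed.

Lemma cheb_value_pos (m : Z) : 0 < cheb_value m.
Proof. generalize (powerRZ_e_pos m) (powerRZ_e_pos (- m)); unfold cheb_value; lra. Qed.

Lemma cheb_point_Im (m : Z) : 0 < Im (cheb_point m).
Proof.
apply Rdiv_lt_0_compat; [|apply cheb_value_pos].
assert (/ e < 1) by (rewrite <- Rinv_1; apply Rinv_lt_contravar; lra); lra.
Qed.

Lemma cheb_value_succ (m : Z) : cheb_value (m + 1) = powerRZ e m * e + / (powerRZ e m * e).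
Proof.
unfold cheb_value; rewrite powerRZ_e_opp, powerRZ_add by lra; simpl; rewrite Rmult_1_r; reflexivity.
Qed.

(** Besides the three-term recursion this rests on the quadratic identity [T_(m+1) ^ 2 + (e - / e) ^
    2 = T_m T_(m+2)], which evaluates the squared modulus of the point. *)
Lemma cheb_point_step (m : Z) :
  cheb_point (m + 2) = (RtoC (e + / e) - / cheb_point m)%C.
Proof.
assert (Hp := powerRZ_e_pos m).
set (t := cheb_point m); set (A := RtoC (e + / e)).
assert (Ht0 : t <> RtoC 0) by apply Im_neq0, cheb_point_Im.
assert (H : (t * (A - cheb_point (m + 2)) = RtoC 1)%C).
{ unfold t, A, cheb_point.
  assert (H0 := cheb_value_pos m); assert (H2 := cheb_value_pos (m + 2)).
  assert (E2 : cheb_value (m + 2) = powerRZ e m * (e * e) + / (powerRZ e m * (e * e))).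
  { replace (m + 2)%Z with (m + 1 + 1)%Z by lia.
    rewrite cheb_value_succ, powerRZ_add by lra; simpl; rewrite Rmult_1_r, Rmult_assoc; reflexivity. }
  assert (E1 := cheb_value_succ m).
  assert (E0 : cheb_value m = powerRZ e m + / powerRZ e m)
    by (unfold cheb_value; rewrite powerRZ_e_opp; reflexivity).
  assert (E3 : cheb_value (m + 2 + 1) = (e + / e) * cheb_value (m + 2) - cheb_value (m + 1)).
  { rewrite cheb_value_succ, E2, E1, (powerRZ_add e m 2) by lra; simpl.
    field; repeat split; lra. }
  assert (Q : cheb_value (m + 1) * cheb_value (m + 1) + (e - / e) * (e - / e)
              = cheb_value m * cheb_value (m + 2)).
  { rewrite E0, E1, E2; field; repeat split; lra. }
  unfold Cmult, Cminus, Cplus, Copp, RtoC; simpl fst; simpl snd; f_equal.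
  - rewrite E3.
    transitivity ((cheb_value (m + 1) * cheb_value (m + 1) + (e - / e) * (e - / e))
       / (cheb_value m * cheb_value (m + 2))).
    + field; repeat split; lra.
    + rewrite Q; field; split; lra.
  - rewrite E3; field; repeat split; lra. }
replace (/ t)%C with (t * (A - cheb_point (m + 2)) / t)%C.
- field; exact Ht0.
- rewrite H; field; exact Ht0.
Qed.

(** The shape of the points after division by the dominant power of [e]: [v] is [e ^ (- m)] at one
    end and [e ^ m] at the other, with [e] and [/ e] exchanged as [c] and [c']. *)
Lemma cheb_point_form (c c' : R) (v : nat -> R) : is_lim_seq v 0 ->
  Clim (fun n => ((c + c' * (v n * v n)) / (1 + v n * v n),
                  (e - / e) * v n / (1 + v n * v n))) (RtoC c).
Proof.
intros Hv.
assert (Hvv : is_lim_seq (fun n => v n * v n) 0).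
{ eapply is_lim_seq_eq; [apply (is_lim_seq_mult' _ _ _ _ Hv Hv)|ring]. }
assert (Hd : is_lim_seq (fun n => 1 + v n * v n) 1).
{ eapply is_lim_seq_eq; [apply (is_lim_seq_plus' _ _ _ _ (is_lim_seq_const 1) Hvv)|ring]. }
apply Clim_components; split; simpl Re; simpl Im.
- eapply is_lim_seq_eq.
  + apply is_lim_seq_div'; [|exact Hd|lra].
    apply is_lim_seq_plus'; [apply is_lim_seq_const|].
    apply is_lim_seq_mult'; [apply is_lim_seq_const|exact Hvv].
  + simpl; field.
- eapply is_lim_seq_eq.
  + apply is_lim_seq_div'; [|exact Hd|lra].
    apply is_lim_seq_mult'; [apply is_lim_seq_const|exact Hv].
  + simpl; field; lra.
Qed.

Lemma cheb_point_lim (m : nat -> Z) :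
  is_lim_seq (fun n => powerRZ e (- m n)) 0 -> Clim (fun n => cheb_point (m n)) (RtoC e).
Proof.
intros H; apply Clim_ext with (2 := cheb_point_form e (/ e) _ H).
intros n; assert (Hp := powerRZ_e_pos (m n)); unfold cheb_point.
rewrite cheb_value_succ; unfold cheb_value; rewrite powerRZ_e_opp.
assert (0 < powerRZ e (m n) * powerRZ e (m n)) by (apply Rmult_lt_0_compat; exact Hp).
f_equal; field; repeat split; lra.
Qed.

Lemma cheb_point_lim_inv (m : nat -> Z) :
  is_lim_seq (fun n => powerRZ e (m n)) 0 -> Clim (fun n => cheb_point (m n)) (RtoC (/ e)).
Proof.
intros H; apply Clim_ext with (2 := cheb_point_form (/ e) e _ H).
intros n; assert (Hp := powerRZ_e_pos (m n)); unfold cheb_point.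
rewrite cheb_value_succ; unfold cheb_value; rewrite powerRZ_e_opp.
assert (0 < powerRZ e (m n) * powerRZ e (m n)) by (apply Rmult_lt_0_compat; exact Hp).
f_equal; field; repeat split; lra.
Qed.

Lemma powerRZ_lim_shift (m : nat -> Z) (c : Z) :
  is_lim_seq (fun n => powerRZ e (m n)) 0 -> is_lim_seq (fun n => powerRZ e (m n + c)) 0.
Proof.
intros H; apply is_lim_seq_ext with (fun n => powerRZ e (m n) * powerRZ e c).
- intros n; rewrite powerRZ_add by lra; reflexivity.
- eapply is_lim_seq_eq; [apply (is_lim_seq_mult' _ _ _ _ H (is_lim_seq_const (powerRZ e c)))|ring].
Qed.

Lemma powerRZ_lim : is_lim_seq (fun n => powerRZ e (- Z.of_nat n)) 0.
Proof.
apply is_lim_seq_ext with (fun n => (/ e) ^ n).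
- intros n; rewrite powerRZ_e_opp, <- pow_powerRZ, pow_inv; reflexivity.
- apply is_lim_seq_geom; rewrite Rabs_pos_eq.
  + rewrite <- Rinv_1; apply Rinv_lt_contravar; lra.
  + apply Rlt_le, Rinv_0_lt_compat; lra.
Qed.

End Chebyshev.

(** * Telescoping over one period *)

Lemma Rsum_shift (f : nat -> R) (n : nat) : Rsum f (S n) = f O + Rsum (fun k => f (S k)) n.
Proof. induction n as [|n IH]; [simpl; ring|simpl in *; rewrite IH; ring]. Qed.

Lemma Rsum_ext (f g : nat -> R) (n : nat) :
  (forall k, (k < n)%nat -> f k = g k) -> Rsum f n = Rsum g n.
Proof.
intros H; induction n as [|n IH]; [reflexivity|simpl; rewrite IH, (H n); auto].
Qed.

(** Telescoping runs downwards from [k], the invariant upwards from 1; periodicity makes the sums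
    equal and the limit independent of [k]. *)
Lemma Rsum_periodic (f : Z -> R) (g : nat) :
  (forall k, f (k - Z.of_nat g)%Z = f k) ->
  forall k : nat, Rsum (fun i => f (Z.of_nat k - Z.of_nat i)%Z) g =
    Rsum (fun j => f (Z.of_nat (S j))) g.
Proof.
intros Hf.
assert (Hrev : forall n, Rsum (fun i => f (Z.of_nat n - Z.of_nat i)%Z) n = Rsum (fun j => f (Z.of_nat (S j))) n).
{ induction n as [|n IH]; [reflexivity|].
  rewrite Rsum_shift.
  change (Rsum (fun j => f (Z.of_nat (S j))) (S n))
    with (Rsum (fun j => f (Z.of_nat (S j))) n + f (Z.of_nat (S n))).
  rewrite <- IH, Rplus_comm; f_equal.
  apply Rsum_ext; intros i _; f_equal; lia. }
assert (Hs : forall k, Rsum (fun i => f (k + 1 - Z.of_nat i)%Z) g = Rsum (fun i => f (k - Z.of_nat i)%Z) g).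
{ intros k.
  assert (H : Rsum (fun i => f (k + 1 - Z.of_nat i)%Z) (S g)
    = f (k + 1)%Z + Rsum (fun i => f (k - Z.of_nat i)%Z) g).
  { rewrite Rsum_shift; f_equal; [f_equal; lia|].
    apply Rsum_ext; intros i _; f_equal; lia. }
  simpl in H; rewrite Hf in H; lra. }
assert (H0 : forall k : nat, Rsum (fun i => f (Z.of_nat k - Z.of_nat i)%Z) g
  = Rsum (fun i => f (0 - Z.of_nat i)%Z) g).
{ induction k as [|k IH]; [reflexivity|].
  rewrite <- IH, <- (Hs (Z.of_nat k)); apply Rsum_ext; intros i _; f_equal; lia. }
intros k; rewrite H0, <- (H0 g); apply Hrev.
Qed.

(** [good] is a class of index sequences stable under the shift by 2 that each step makes, so one
    induction serves both ends of the integers. *)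
Lemma ratio_telescope (f : Z -> Z -> R) (s : Z -> R) (good : (nat -> Z) -> Prop) :
  (forall k m, f k m <> 0) ->
  (forall m, good m -> good (fun n => m n + 2)%Z) ->
  (forall k m, good m ->
     is_lim_seq (fun n => f k (m n) / f (k - 1)%Z (m n + 2)%Z) (exp (s k))) ->
  forall (g : nat) k m, good m ->
    is_lim_seq (fun n => f k (m n) / f (k - Z.of_nat g)%Z (m n + 2 * Z.of_nat g)%Z)
      (exp (Rsum (fun i => s (k - Z.of_nat i)%Z) g)).
Proof.
intros Hf Hgood Hs g; induction g as [|g IH]; intros k m Hm.
- apply is_lim_seq_ext with (fun _ => 1).
  + intros n; replace (k - Z.of_nat 0)%Z with k by lia.
    replace (m n + 2 * Z.of_nat 0)%Z with (m n) by lia; field; apply Hf.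
  + simpl; rewrite exp_0; apply is_lim_seq_const.
- assert (H := is_lim_seq_mult' _ _ _ _ (Hs k m Hm) (IH (k - 1)%Z _ (Hgood m Hm))).
  eapply is_lim_seq_eq.
  + eapply is_lim_seq_ext; [|exact H].
    intros n; cbv beta.
    replace (k - 1 - Z.of_nat g)%Z with (k - Z.of_nat (S g))%Z by lia.
    replace (m n + 2 + 2 * Z.of_nat g)%Z with (m n + 2 * Z.of_nat (S g))%Z by lia.
    field; split; apply Hf.
  + rewrite <- exp_plus, Rsum_shift; do 2 f_equal; [f_equal; lia|].
    apply Rsum_ext; intros i _; f_equal; lia.
Qed.

Definition log_sine (om : R) (x y : Q) : R :=
  let z := Q2R x * om + Q2R y in
  Re (Gam (RtoC om) (RtoC z) - Gam (RtoC om) (RtoC (1 + om - z)))%C.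

Lemma shintani_factor_real (om : R) (g : nat) (x y : Z -> Q) : 0 < om ->
  (forall k, 0 < Q2R (x k) <= 1) -> (forall k, 0 <= Q2R (y k) < 1) ->
  shintani_factor om g x y =
  RtoC (exp (Rsum (fun j => log_sine om (x (Z.of_nat (S j))) (y (Z.of_nat (S j)))) g)).
Proof.
intros Hom Hx Hy; unfold shintani_factor; cbv zeta.
induction g as [|g IH]; [simpl; rewrite exp_0; reflexivity|].
rewrite Cprod_S, IH; change (Rsum ?f (S g)) with (Rsum f g + f g); rewrite exp_plus, RtoC_mult.
f_equal; apply double_sine_Gam; [exact Hom|].
specialize (Hx (Z.of_nat (S g))); specialize (Hy (Z.of_nat (S g))); nra.
Qed.

Section Limit.

Variables (d : Z) (a b : nat) (eps phi : R) (g : nat) (x y : Z -> Q).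
Hypotheses (d_pos : (0 < d)%Z)
  (K_quadratic : ~ exists q : Q, sqrt (IZR d) = Q2R q)
  (eps_eq : eps = (INR a + INR b * sqrt (IZR d)) / 2)
  (eps_fundamental : generates eps (tot_pos_unit d))
  (OK_basis : forall x : R, OK d x <-> exists m n : Z, x = IZR m + IZR n * eps)
  (phi_neq0 : phi <> 0) (g_spec : is_g d eps phi g)
  (xy_spec : forall k : Z, is_decomposition d eps (/ phi) k (x k) (y k)).

Let e_gt_1 : 1 < eps := eps_gt_1 d a b eps d_pos K_quadratic eps_eq eps_fundamental OK_basis.
Let trace : INR a = eps + / eps :=
  eps_trace d a b eps d_pos K_quadratic eps_eq eps_fundamental OK_basis.

Lemma tau_cheb_point (m : Z) : tau d a b m = cheb_point eps m.
Proof.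
unfold tau, cheb_point.
rewrite (eps_disc d a b eps) by assumption.
rewrite trace, !chebT_spec by lra.
fold (cheb_value eps (m + 1)); fold (cheb_value eps m).
assert (H := cheb_value_pos eps e_gt_1 m).
unfold Cdiv; rewrite <- RtoC_inv by lra.
unfold Cmult, Cplus, Ci, RtoC; simpl; f_equal; field; lra.
Qed.

Let P (k m : Z) : C := qpoch (Q2R (x k)) (Q2R (y k)) (tau d a b m).

Lemma qpoch_tau_exp (k m : Z) :
  P k m = Cexp (qsum (cheb_point eps m)
    (RtoC (Q2R (x k)) * cheb_point eps m + RtoC (Q2R (y k)))%C).
Proof.
unfold P; rewrite tau_cheb_point; apply qpoch_qsum; [apply cheb_point_Im, e_gt_1|].
eapply x_range; eassumption.
Qed.

Lemma qpoch_tau_inversion (k m : Z) :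
  P (k - 1) (m + 2) = Cexp (qsum (- / cheb_point eps m)
    ((RtoC (Q2R (x k)) * cheb_point eps m + RtoC (Q2R (y k)) - 1) / cheb_point eps m))%C.
Proof.
unfold P; rewrite tau_cheb_point, (cheb_point_step _ e_gt_1), <- trace, INR_IZR_INZ.
destruct (decomposition_pred d a b eps) with (phi := phi) (x := x) (y := y) (k := k)
  as [Hx [M HM]]; try assumption.
eapply qpoch_inversion with (M := M).
- apply cheb_point_Im, e_gt_1.
- eapply y_range; eassumption.
- exact Hx.
- rewrite <- INR_IZR_INZ; exact HM.
Qed.

Lemma qpoch_tau_neq0 (k m : Z) : Cmod (P k m) <> 0.
Proof.
rewrite qpoch_tau_exp; apply Rgt_not_eq, Cmod_gt_0, Cexp_neq0.
Qed.

(** Telescoping [g] steps lowers [k] by [g] and raises the index of [tau] by [2 g]; the period [g]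
    of the data brings [k] back. *)
Lemma qpoch_tau_limit (om : R) (good : (nat -> Z) -> Prop) (k : nat) (m : nat -> Z) :
  0 < om -> (forall m, good m -> Clim (fun n => cheb_point eps (m n)) (RtoC om)) ->
  (forall m, good m -> good (fun n => m n + 2)%Z) -> good m ->
  is_lim_seq (fun n => Cmod (P (Z.of_nat k) (m n)) / Cmod (P (Z.of_nat k) (m n + 2 * Z.of_nat g)%Z))
    (exp (Rsum (fun j => log_sine om (x (Z.of_nat (S j))) (y (Z.of_nat (S j)))) g)).
Proof.
intros Hom Hlim Hgood Hm.
assert (Hper : forall k, Q2R (x (k - Z.of_nat g)) = Q2R (x k) /\ Q2R (y (k - Z.of_nat g)) = Q2R (y k))
  by (intros k'; eapply decomposition_period with (phi := phi); eassumption).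
assert (H := ratio_telescope (fun k m => Cmod (P k m)) (fun k => log_sine om (x k) (y k)) good
  qpoch_tau_neq0 Hgood).
rewrite <- (Rsum_periodic (fun i => log_sine om (x i) (y i)) g) with (k := k).
- eapply is_lim_seq_ext; [|apply H; [|exact Hm]].
  + intros n; cbv beta; do 2 f_equal; unfold P.
    destruct (Hper (Z.of_nat k)) as [-> ->]; reflexivity.
  + intros k' m' Hm'.
    eapply is_lim_seq_ext; [|apply (qratio_limit (fun n => cheb_point eps (m' n)) om (Q2R (x k')) (Q2R (y k')) Hom)].
    * intros n; cbv beta; rewrite qpoch_tau_exp, qpoch_tau_inversion, Cmod_div by apply Cexp_neq0.
      reflexivity.
    * eapply x_range; eassumption.
    * eapply y_range; eassumption.
    * intros n; apply cheb_point_Im, e_gt_1.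
    * apply Hlim, Hm'.
- intros k'; destruct (Hper k') as [E1 E2]; unfold log_sine; rewrite E1, E2; reflexivity.
Qed.

(** The sequence [m] approaches [eps] and yields [X_1], the sequence [m'] approaches [/ eps] and
    yields [X_2]. General sequences make both quotients of the theorem instances. *)
Lemma shintani_limit (k : nat) (m m' : nat -> Z) :
  is_lim_seq (fun n => powerRZ eps (- m n)) 0 -> is_lim_seq (fun n => powerRZ eps (m' n)) 0 ->
  let Pk := fun m => P (Z.of_nat k) m in let G := Z.of_nat g in
  filterlim
    (fun n : nat => RtoC (Cmod ((Pk (m n) * Pk (m' n))
                     / (Pk (m n + 2 * G)%Z * Pk (m' n + 2 * G)%Z))%C))
    eventually (locally (T := C_UniformSpace) (shintani_X eps g x y)).
Proof.
intros Hm Hm' Pk G; apply filterlim_Clim.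
assert (Hi : 0 < / eps) by (apply Rinv_0_lt_compat; lra).
unfold shintani_X; rewrite !shintani_factor_real;
  try lra; try (intros k'; eapply x_range; eassumption); try (intros k'; eapply y_range; eassumption).
rewrite <- RtoC_mult; apply Clim_RtoC.
eapply is_lim_seq_ext; [|apply is_lim_seq_mult'].
2: { apply (qpoch_tau_limit eps (fun m => is_lim_seq (fun n => powerRZ eps (- m n)) 0) k m); [lra| | |exact Hm].
  - intros m1 H1; apply cheb_point_lim; assumption.
  - intros m1 H1; eapply is_lim_seq_ext; [|apply (powerRZ_lim_shift eps e_gt_1 _ (- 2) H1)].
    intros n; cbv beta; f_equal; lia. }
2: { apply (qpoch_tau_limit (/ eps) (fun m => is_lim_seq (fun n => powerRZ eps (m n)) 0) k m'); [lra| | |exact Hm'].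
  - intros m1 H1; apply cheb_point_lim_inv; assumption.
  - intros m1 H1; apply (powerRZ_lim_shift eps e_gt_1 _ 2 H1). }
intros n; cbv beta; unfold Pk, G.
assert (Hn : forall k m, P k m <> RtoC 0).
{ intros k1 m1 E; apply (qpoch_tau_neq0 k1 m1); rewrite E; apply Cmod_0. }
rewrite Cmod_div by (apply Cmult_neq_0; apply Hn); rewrite !Cmod_mult.
field; split; apply qpoch_tau_neq0.
Qed.

End Limit.

Theorem corollary3p1
  (d : Z) (d_pos : (0 < d)%Z) (d_squarefree : squarefree d)
  (K_quadratic : ~ exists q : Q, sqrt (IZR d) = Q2R q)
  (a b : nat) (eps : R)
  (eps_eq : eps = (INR a + INR b * sqrt (IZR d)) / 2)
  (eps_fundamental : generates eps (tot_pos_unit d))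
  (OK_basis : forall x : R, OK d x <-> exists m n : Z, x = IZR m + IZR n * eps)
  (u v : Q) (phi : R)
  (phi_eq : phi = Q2R u + Q2R v * sqrt (IZR d))
  (phi_integral : OK d phi) (phi_neq0 : phi <> 0)
  (g : nat) (g_spec : is_g d eps phi g)
  (x y : Z -> Q)
  (xy_spec : forall k : Z, is_decomposition d eps (/ phi) k (x k) (y k))
  (k : nat) (k_lt_g : (k < g)%nat) :
  let P := fun m : Z =>
    qpoch (Q2R (x (Z.of_nat k))) (Q2R (y (Z.of_nat k))) (tau d a b m) in
  let G := Z.of_nat g in
  filterlim
    (fun n : nat => let N := Z.of_nat n in
       RtoC (Cmod ((P N * P (- N)%Z)
                     / (P (N + 2 * G)%Z * P (- N + 2 * G)%Z))%C))
    eventually (locally (shintani_X eps g x y)) /\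
  filterlim
    (fun n : nat => let N := Z.of_nat n in
       RtoC (Cmod ((P (N - G)%Z * P (- N - G)%Z)
                     / (P (N + G)%Z * P (- N + G)%Z))%C))
    eventually (locally (shintani_X eps g x y)).
Proof.
intros P G.
assert (He : 1 < eps) by (eapply eps_gt_1; eassumption).
assert (H := powerRZ_lim eps He).
split.
- apply (shintani_limit d a b eps phi g x y d_pos K_quadratic eps_eq eps_fundamental OK_basis
    phi_neq0 g_spec xy_spec k (fun n => Z.of_nat n) (fun n => (- Z.of_nat n)%Z) H H).
(* The second quotient is the first with all indices lowered by [G]. *)
- eapply filterlim_ext; [|apply (shintani_limit d a b eps phi g x y d_pos K_quadratic eps_eq
    eps_fundamental OK_basis phi_neq0 g_spec xy_spec k
    (fun n => (Z.of_nat n - G)%Z) (fun n => (- Z.of_nat n - G)%Z))].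
  + intros n; cbv beta zeta; fold G.
    replace (Z.of_nat n - G + 2 * G)%Z with (Z.of_nat n + G)%Z by lia.
    replace (- Z.of_nat n - G + 2 * G)%Z with (- Z.of_nat n + G)%Z by lia; reflexivity.
  + eapply is_lim_seq_ext; [|apply (powerRZ_lim_shift eps He _ G H)].
    intros n; cbv beta; f_equal; lia.
  + apply (powerRZ_lim_shift eps He _ (- G) H).
Qed.
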